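(* Fix $t\in[0,T]$. There exists a bounded linear operator $\mathcal N^K_{2-2s}$ from $V(\mathcal B^{s,t}_\Omega,\Omega)$ to $(B^{2,2}_\alpha(\partial\Omega))'$ such that the following generalized Green formula holds for every $u\in V(\mathcal B^{s,t}_\Omega,\Omega)$ and every $v\in H^s(\Omega)$: $$C_s\big\langle\mathcal N^K_{2-2s}u,v|_{\partial\Omega}\big\rangle_{(B^{2,2}_\alpha(\partial\Omega))',B^{2,2}_\alpha(\partial\Omega)}=-\int_\Omega\mathcal B^{s,t}_\Omega u\,v\,d\mathcal L_N+\frac{C_{N,s}}2\iint_{\Omega\times\Omega}K(t,x,y)\frac{(u(x)-u(y))(v(x)-v(y))}{|x-y|^{N+2s}}\,d\mathcal L_N(x)\,d\mathcal L_N(y).$$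
   Context: Setting. $\Omega\subset\mathbb R^N$ is a bounded $(\varepsilon,\delta)$ domain, i.e. $\Omega$ is open and connected and, with $d(x)=\inf_{y\notin\Omega}|x-y|$, whenever $x,y\in\Omega$ and $|x-y|<\delta$ there is a rectifiable arc $\gamma\subset\Omega$ joining $x$ to $y$ with length $\ell(\gamma)\le\frac1\varepsilon|x-y|$ and $d(z)\ge\frac{\varepsilon|x-z||y-z|}{|x-y|}$ for all $z\in\gamma$. The boundary $\partial\Omega$ is a $d$-set, $0<d\le N$: there are a Borel measure $\mu$ with $\operatorname{supp}\mu=\partial\Omega$ and constants $c_1,c_2>0$ with $c_1r^d\le\mu(B(x,r)\cap\partial\Omega)\le c_2r^d$ for every $x\in\partial\Omega$ and $0<r\le1$. Moreover $\Omega=\bigcup_n\Omega_n$ with $\Omega_n$ bounded Lipschitz domains and $\Omega_n\subseteq\Omega_{n+1}$. The number $s$ satisfies $\frac{N-d}2<s<1$, $\alpha:=s-\frac{N-d}2\in(0,1)$, and $T>0$ is fixed. $\mathcal L_N$ is Lebesgue measure. $H^s(\Omega)$ has norm $\|u\|_{H^s(\Omega)}^2=\|u\|_{L^2(\Omega)}^2+\iint_{\Omega\times\Omega}\frac{(u(x)-u(y))^2}{|x-y|^{N+2s}}\,d\mathcal L_N(x)\,d\mathcal L_N(y)$. The trace is $u|_{\partial\Omega}(x)=\lim_{r\to0}\frac1{|B(x,r)\cap\Omega|}\int_{B(x,r)\cap\Omega}u\,d\mathcal L_N$ ($\mu$-a.e.). $B^{2,2}_\alpha(\partial\Omega)$ is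 the Besov space with norm $\|u\|^2=\|u\|_{L^2(\partial\Omega,\mu)}^2+\iint_{|x-y|<1}\frac{|u(x)-u(y)|^2}{|x-y|^{d+2\alpha}}\,d\mu(x)\,d\mu(y)$; it is the trace space of $H^s(\Omega)$ (the trace is bounded $H^s(\Omega)\to B^{2,2}_\alpha(\partial\Omega)$ with a bounded linear right inverse). Primes denote duals. $K:[0,T]\times\Omega\times\Omega\to\mathbb R$ is measurable, $K(t,\cdot,\cdot)$ is symmetric for every $t$, and $k_1\le K\le k_2$ a.e. for constants $0<k_1<k_2$. $C_{N,s}=\frac{s2^{2s}\Gamma(\frac{N+2s}2)}{\pi^{N/2}\Gamma(1-s)}$, and $$C_s=\frac{C_{1,s}}{2s(2s-1)}\int_0^\infty\frac{|z-1|^{1-2s}-(z\vee1)^{1-2s}}{z^{2-2s}}\,dz$$ (for $s=\frac12$ understood as the limit $s\to\frac12$). The operator is $\mathcal B^{s,t}_\Omega u(x)=C_{N,s}\lim_{\epsilon\to0^+}\int_{\{y\in\Omega:|x-y|>\epsilon\}}K(t,x,y)\frac{u(x)-u(y)}{|x-y|^{N+2s}}\,d\mathcal L_N(y)$, understood in the sense of distributions: for $u\in H^s(\Omega)$ and $\varphi\in C_c^\infty(\Omega)$, $\langle\mathcal B^{s,t}_\Omega u,\varphi\rangle=\frac{C_{N,s}}2\iint_{\Omega\times\Omega}K(t,x,y)\frac{(u(x)-u(y))(\varphi(x)-\varphi(y))}{|x-y|^{N+2s}}\,d\mathcal L_N(x)\,d\mathcal L_N(y)$. Finally $V(\mathcal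 B^{s,t}_\Omega,\Omega)=\{u\in H^s(\Omega):\mathcal B^{s,t}_\Omega u\in L^2(\Omega)\text{ in the sense of distributions}\}$, with norm $\|u\|^2=\|u\|_{H^s(\Omega)}^2+\|\mathcal B^{s,t}_\Omega u\|_{L^2(\Omega)}^2$. *)

(* Defs.v *)
From HB Require Import structures.
From mathcomp Require Import all_boot all_order all_algebra.
From mathcomp Require Import all_classical all_reals all_analysis measurable_realfun.

Set Implicit Arguments.
Unset Strict Implicit.
Unset Printing Implicit Defensive.

Import Order.TTheory GRing.Theory Num.Theory.
Import numFieldNormedType.Exports.

Local Open Scope classical_set_scope.
Local Open Scope ring_scope.

(* The library provides no measurable structure on row vectors: the Borel
   sigma-algebra is installed here. *)
Section borel_rV.
Variables (R : realType) (n : nat).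

Definition rV_display : measure_display := sigma_display (@open 'rV[R]_n).

Let borel0 : <<s @open 'rV[R]_n >> set0.
Proof. exact: sigma_algebra0. Qed.

Let borelC A : <<s @open 'rV[R]_n >> A -> <<s @open 'rV[R]_n >> (~` A).
Proof. exact: sigma_algebraC. Qed.

Let borel_bigcup (F : (set 'rV[R]_n)^nat) :
  (forall i, <<s @open 'rV[R]_n >> (F i)) ->
  <<s @open 'rV[R]_n >> (\bigcup_i (F i)).
Proof. exact: sigma_algebra_bigcup. Qed.

HB.instance Definition _ := @isMeasurable.Build rV_display
  'rV[R]_n (<<s @open 'rV[R]_n >>) borel0 borelC borel_bigcup.


Lemma measurable_coord_rV (i : 'I_n) :
  measurable_fun [set: 'rV[R]_n] (fun v => v ord0 i : measurableTypeR R).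
Proof.
apply: (measurability _ (RGenOInfty.measurableE R)) => _ [_ [a ->] <-].
rewrite setTI; apply: sub_sigma_algebra.
by apply: (@open_comp 'rV[R]_n R); [move=> v _; exact: coord_continuous|exact: interval_open].
Qed.

Lemma measurable_to_rV d (T : measurableType d) (f : T -> 'rV[R]_n) :
  (forall i, measurable_fun [set: T] (fun x => f x ord0 i : measurableTypeR R)) ->
  measurable_fun [set: T] f.
Proof.
move=> mf; apply: (measurability (@open 'rV[R]_n)) => // _ [U oU <-].
pose rball (qk : 'rV[rat]_n * nat) : set 'rV[R]_n :=
  ball (map_mx ratr qk.1 : 'rV[R]_n) qk.2.+1%:R^-1.
have -> : U = \bigcup_(qk in [set qk | rball qk `<=` U]) rball qk.
  apply/seteqP; split=> [x Ux|x [qk /= +]]; last exact.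
  have /nbhs_ballP[e/= e0 xeU] : nbhs x U by exact: open_nbhs_nbhs.
  pose k := Num.truncn (2 / e).
  have k_e : k.+1%:R^-1 < e / 2.
    by rewrite -[ltRHS]invrK ltf_pV2 ?posrE ?invr_gt0 ?divr_gt0// invf_div truncnS_gt.
  have k0 : 0 < k.+1%:R^-1 :> R by rewrite invr_gt0.
  have /(_ _)/cid-/all_sig[q qP] : forall j : 'I_n, exists q : rat,
      ball (ratr q : R) k.+1%:R^-1 (x ord0 j).
    move=> j.
    have /rat_in_itvoo[q] : x ord0 j - k.+1%:R^-1 < x ord0 j + k.+1%:R^-1.
      by rewrite ltrBlDr -addrA ltrDl addr_gt0.
    by rewrite in_itv/= -ltr_distl => qx; exists q; rewrite /ball/=.
  exists (\row_j q j, k) => /=.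
    move=> y [_ qy]; apply: xeU; split => // i j.
    rewrite (splitr e); apply: (@ball_triangle _ _ (ratr (q j) : R)).
      by apply: ball_sym; rewrite ord1; apply: le_ball (qP j); exact: ltW.
    by have := qy i j; rewrite !mxE; apply: le_ball; exact: ltW.
  by split => // i j; rewrite ord1 !mxE.
rewrite setTI preimage_bigcup bigcup_mkcond.
apply: countable_bigcupT_measurable => [|qk]; first exact: countableP.
case: ifPn => // _.
have -> : f @^-1` rball qk = \bigcap_(i in [set: 'I_n])
    [set x | ball (ratr (qk.1 ord0 i) : R) qk.2.+1%:R^-1 (f x ord0 i)].
  apply/seteqP; split=> [x [_ xq] i _|x xq].
    by have := xq ord0 i; rewrite mxE.
  split; first by rewrite invr_gt0.
  by move=> i j; rewrite ord1 mxE; exact: xq.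
apply: fin_bigcap_measurable => // i _.
rewrite -[X in measurable X]setTI.
apply: (mf i) => //.
by apply: open_measurable; exact: ball_open.
Qed.

End borel_rV.

Lemma sigma_finite_product d1 d2 (T1 : measurableType d1)
    (T2 : measurableType d2) (R : realType)
    (m1 : {sigma_finite_measure set T1 -> \bar R})
    (m2 : {sigma_finite_measure set T2 -> \bar R}) :
  sigma_finite [set: T1 * T2] (m1 \x m2)%E.
Proof.
have /sigma_finiteP[F [TF ndF Foo]] := sigma_finiteT m1.
have /sigma_finiteP[G [TG ndG Goo]] := sigma_finiteT m2.
exists (fun n => F n `*` G n).
  rewrite -setXTT TF TG predeqE => -[x y]; split.
    move=> [/= [n _ Fnx] [k _ Gky]]; exists (maxn n k) => //; split.
    - by move: x Fnx; exact/subsetPset/ndF/leq_maxl.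
    - by move: y Gky; exact/subsetPset/ndG/leq_maxr.
  by move=> [n _ []/= ? ?]; split; exists n.
move=> k; have [? ?] := Foo k; have [? ?] := Goo k.
split; first exact: measurableX.
by rewrite product_measure1E// lte_mul_pinfty// ge0_fin_numE.
Qed.

(* Lebesgue measure on R^n, as the n-fold product of the one-dimensional one;
   R^(n+1) is identified with R * R^n. *)
Section lebesgue_rV.
Variable R : realType.

Definition cons_rV n (p : measurableTypeR R * 'rV[R]_n) : 'rV[R]_n.+1 :=
  row_mx (p.1%:M : 'M[R]_1) p.2.

Definition uncons_rV n (v : 'rV[R]_n.+1) : measurableTypeR R * 'rV[R]_n :=
  (v ord0 ord0, \row_j v ord0 (lift ord0 j)).

Lemma cons_rVK n : cancel (@cons_rV n) (@uncons_rV n).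
Proof.
move=> [a v]; rewrite /uncons_rV; congr pair.
  have -> : ord0 = lshift n (ord0 : 'I_1) :> 'I_(1 + n) by exact: val_inj.
  by rewrite (row_mxEl (a%:M : 'M[R]_1) v) !mxE.
apply/rowP => j; rewrite mxE.
have -> : lift ord0 j = rshift 1 j :> 'I_(1 + n) by exact: val_inj.
by rewrite (row_mxEr (a%:M : 'M[R]_1) v).
Qed.

Lemma measurable_cons_rV n : measurable_fun [set: measurableTypeR R * 'rV[R]_n] (@cons_rV n).
Proof.
apply: measurable_to_rV => i.
case: (@split_ordP 1 n i) => j -> {i}.
  rewrite (_ : (fun _ => _) = fst); first exact: measurable_fst.
  apply/funext => p; rewrite /cons_rV.
  by rewrite (row_mxEl (p.1%:M : 'M[R]_1)) mxE (ord1 j) mulr1n.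
rewrite (_ : (fun _ => _) = (fun v : 'rV[R]_n => v ord0 j) \o snd).
  by apply: measurableT_comp; [exact: measurable_coord_rV|exact: measurable_snd].
by apply/funext => p /=; rewrite /cons_rV (row_mxEr (p.1%:M : 'M[R]_1)).
Qed.

Lemma measurable_uncons_rV n : measurable_fun [set: 'rV[R]_n.+1] (@uncons_rV n).
Proof.
apply: measurable_fun_pair; first exact: measurable_coord_rV.
apply: measurable_to_rV => i.
rewrite (_ : (fun _ => _) = fun v : 'rV[R]_n.+1 => v ord0 (lift ord0 i)).
  exact: measurable_coord_rV.
by apply/funext => v /=; rewrite mxE.
Qed.

HB.instance Definition _ n := @isMeasurableFun.Build _ _ _ _
  (@cons_rV n) (@measurable_cons_rV n).

Section lebesgue_cons.
Variables (n : nat) (m : {sigma_finite_measure set 'rV[R]_n -> \bar R}).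

Definition lebesgue_cons : set 'rV[R]_n.+1 -> \bar R :=
  pushforward (lebesgue_measure \x m)%E (@cons_rV n).

Let lebesgue_cons0 : lebesgue_cons set0 = 0%E.
Proof. exact: measure0. Qed.

Let lebesgue_cons_ge0 A : (0 <= lebesgue_cons A)%E.
Proof. exact: measure_ge0. Qed.

Let lebesgue_cons_sigma_additive : semi_sigma_additive lebesgue_cons.
Proof. exact: measure_semi_sigma_additive. Qed.

HB.instance Definition _ := isMeasure.Build _ _ _ lebesgue_cons
  lebesgue_cons0 lebesgue_cons_ge0 lebesgue_cons_sigma_additive.

Let lebesgue_cons_sigma_finite : sigma_finite [set: 'rV[R]_n.+1] lebesgue_cons.
Proof.
have [F FT Foo] := sigma_finite_product (@lebesgue_measure R) m.
exists (fun k => @uncons_rV n @^-1` F k).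
  by rewrite -preimage_bigcup -FT.
move=> k; have [mF Fk] := Foo k; split.
  by rewrite -[X in measurable X]setTI; exact: measurable_uncons_rV.
rewrite /lebesgue_cons /pushforward -comp_preimage.
rewrite (_ : _ \o _ = id) ?preimage_id//.
by apply/funext => p; exact: cons_rVK.
Qed.

HB.instance Definition _ := @Measure_isSigmaFinite.Build _ _ _
  lebesgue_cons lebesgue_cons_sigma_finite.

End lebesgue_cons.

Fixpoint lebesgue_rV (n : nat) : {sigma_finite_measure set 'rV[R]_n -> \bar R} :=
  match n with
  | 0 => dirac (0 : 'rV[R]_0)
  | n'.+1 => lebesgue_cons (lebesgue_rV n')
  end.

End lebesgue_rV.

Section constants.
Variable R : realType.
Implicit Types s x : R.

Definition Gamma x : R :=
  \int[lebesgue_measure]_(z in `]0, +oo[) (z `^ (x - 1) * expR (- z)).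

Definition C_frac (N : nat) s : R :=
  s * 2 `^ (2 * s) * Gamma ((N%:R + 2 * s) / 2) /
  (pi `^ (N%:R / 2) * Gamma (1 - s)).

Definition C_green_generic s : R :=
  C_frac 1 s / (2 * s * (2 * s - 1)) *
  \int[lebesgue_measure]_(z in `]0, +oo[)
    ((`|z - 1| `^ (1 - 2 * s) - Num.max z 1 `^ (1 - 2 * s)) /
     z `^ (2 - 2 * s)).

Definition C_green s : R :=
  if s == 2^-1 then lim (C_green_generic x @[x --> (2^-1 : R)^'])
  else C_green_generic s.

End constants.

Section geometry.
Variables (R : realType) (N : nat).
Local Notation E := 'rV[R]_N.
Implicit Types (A Om F : set E) (x y z : E) (r : R).

(* `|x| is the sup norm on row vectors, hence these Euclidean notions; both
   norms induce the same topology. *)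
Definition dotr x y : R := \sum_(i < N) x ord0 i * y ord0 i.

Definition enorm x : R := Num.sqrt (dotr x x).

Definition eball x r : set E := [set y | enorm (y - x) < r].

Definition boundary A : set E := closure A `\` A^°.

Definition dist_compl A x : R := inf [set enorm (x - y) | y in ~` A].

Definition curve_variation (g : R -> E) (a b : R) (l : seq R) : R :=
  let G := g \o nth b (a :: l) in
  \sum_(0 <= i < size l) enorm (G i.+1 - G i).

Definition curve_length (g : R -> E) (a b : R) : \bar R :=
  ereal_sup [set (curve_variation g a b l)%:E | l in itv_partition a b].

Definition eps_delta_domain Om (eps delta : R) : Prop :=
  [/\ open Om, connected Om, 0 < eps, 0 < delta &
    forall x y, Om x -> Om y -> enorm (x - y) < delta ->
      exists g : R -> E,
        [/\ {within `[0, 1], continuous g} /\ g @` `[0, 1] `<=` Om,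
            g 0 = x, g 1 = y,
            (curve_length g 0 1 <= (eps^-1 * enorm (x - y))%:E)%E &
            forall z, (g @` `[0, 1]) z ->
              eps * enorm (x - z) * enorm (y - z) / enorm (x - y)
                <= dist_compl Om z]].

Definition measure_support (mu : {measure set E -> \bar R}) : set E :=
  [set x | forall U, open U -> U x -> (0 < mu U)%E].

Definition d_set_measure F (d : R) (mu : {measure set E -> \bar R}) : Prop :=
  [/\ 0 < d, d <= N%:R, measure_support mu = F &
    exists c1 c2 : R, [/\ 0 < c1, 0 < c2 &
      forall x r, F x -> 0 < r -> r <= 1 ->
        ((c1 * r `^ d)%:E <= mu (eball x r `&` F))%E /\
        (mu (eball x r `&` F) <= (c2 * r `^ d)%:E)%E]].

(* Near each boundary point A lies above the graph of a Lipschitz function phi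
   in rotated coordinates: the unit vector e is the last axis, and
   y - (y . e) e stands for the remaining N - 1 coordinates of y. *)
Definition lipschitz_domain A : Prop :=
  [/\ open A, connected A & forall x, boundary A x ->
    exists (e : E) (phi : E -> R) (L r : R),
      [/\ enorm e = 1, 0 < r,
          forall y z, `|phi y - phi z| <= L * enorm (y - z) &
          forall y, eball x r y ->
            (A y <-> phi (y - dotr y e *: e) < dotr y e)]].

(* C_c^infty(Om): all iterated directional derivatives are differentiable. *)
Definition smooth (phi : E -> R) : Prop :=
  forall (vs : seq E) x,
    differentiable (foldr (fun v (f : E -> R) => 'D_v f) phi vs) x.

Definition test_function Om (phi : E -> R) : Prop :=
  let supp := closure [set x | phi x != 0] in
  [/\ smooth phi, compact supp & supp `<=` Om].

End geometry.

(* Spaces of functions are subsets S of E -> R with a seminorm nm; functions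
   that agree almost everywhere are not identified but have distance 0. *)
Section duality.
Variables (R : realType) (E : Type).
Implicit Types (S V : set (E -> R)) (nm : (E -> R) -> R).

Definition dual_norm S nm (l : (E -> R) -> R) : \bar R :=
  ereal_sup [set `|l f|%:E | f in [set f | S f /\ nm f <= 1]].

Definition dual S nm : set ((E -> R) -> R) :=
  [set l | (forall (a : R) f g, S f -> S g ->
              l (fun x => a * f x + g x) = a * l f + l g) /\
           (dual_norm S nm l < +oo)%E].

Definition bounded_linear_to_dual V nmV S nmS
    (Phi : (E -> R) -> (E -> R) -> R) : Prop :=
  [/\ forall u, V u -> dual S nmS (Phi u),
      forall (a : R) u w f, V u -> V w -> S f ->
        Phi (fun x => a * u x + w x) f = a * Phi u f + Phi w f &
      exists C : R, forall u, V u ->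
        (dual_norm S nmS (Phi u) <= (C * nmV u)%:E)%E].

End duality.

Section spaces.
Variables (R : realType) (N : nat).
Local Notation E := 'rV[R]_N.
Local Notation leb := (lebesgue_rV R N).
Implicit Types (Om F : set E) (u v g phi f : E -> R) (x y : E).

Definition L2_normsq Om u : \bar R := \int[leb]_(x in Om) (u x ^+ 2)%:E.

Definition L2 Om : set (E -> R) :=
  [set u | measurable_fun Om u /\ (L2_normsq Om u < +oo)%E].

Definition Hs_normsq Om (s : R) u : \bar R :=
  (L2_normsq Om u +
   \int[leb \x leb]_(p in Om `*` Om)
     ((u p.1 - u p.2) ^+ 2 / enorm (p.1 - p.2) `^ (N%:R + 2 * s))%:E)%E.

Definition Hs Om (s : R) : set (E -> R) :=
  [set u | measurable_fun Om u /\ (Hs_normsq Om s u < +oo)%E].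

Definition trace Om u x : R :=
  lim ((\int[leb]_(y in eball x r `&` Om) u y) /
       fine (leb (eball x r `&` Om)) @[r --> (0:R)^'+]).

Definition besov_normsq (mu : {measure set E -> \bar R}) F (d alpha : R) f
    : \bar R :=
  (\int[mu]_(x in F) (f x ^+ 2)%:E +
   \int[mu]_(x in F) \int[mu]_(y in F `&` eball x 1)
     (`|f x - f y| ^+ 2 / enorm (x - y) `^ (d + 2 * alpha))%:E)%E.

Definition besov mu F (d alpha : R) : set (E -> R) :=
  [set f | measurable_fun F f /\ (besov_normsq mu F d alpha f < +oo)%E].

Definition besov_norm mu F (d alpha : R) f : R :=
  Num.sqrt (fine (besov_normsq mu F d alpha f)).

(* The bounds hold at every time t, for almost every (x, y). *)
Definition admissible_kernel Om (T k1 k2 : R) (K : R -> E -> E -> R) : Prop :=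
  [/\ measurable_fun (`[0, T] `*` (Om `*` Om))
        (fun p : measurableTypeR R * (E * E) => K p.1 p.2.1 p.2.2),
      forall t x y, t \in `[0, T] -> Om x -> Om y -> K t x y = K t y x,
      0 < k1, k1 < k2 &
      forall t, t \in `[0, T] -> {ae (leb \x leb)%E, forall p,
        Om p.1 -> Om p.2 -> k1 <= K t p.1 p.2 <= k2}].

Section regional_operator.
Variables (Om : set E) (s : R) (k : E -> E -> R).

Definition energy_form u v : R :=
  C_frac N s / 2 *
  \int[(leb \x leb)%E]_(p in Om `*` Om)
    (k p.1 p.2 * ((u p.1 - u p.2) * (v p.1 - v p.2)) /
     enorm (p.1 - p.2) `^ (N%:R + 2 * s)).

Definition weak_B u g : Prop :=
  L2 Om g /\
  forall phi, test_function Om phi ->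
    energy_form u phi = \int[leb]_(x in Om) (g x * phi x).

(* A representative, unique almost everywhere on Om. *)
Definition B_op u : E -> R := xget (cst 0) [set g | weak_B u g].

Definition V_B : set (E -> R) :=
  [set u | Hs Om s u /\ exists g, weak_B u g].

Definition V_norm u : R :=
  Num.sqrt (fine (Hs_normsq Om s u + L2_normsq Om (B_op u))%E).

End regional_operator.
End spaces.

(* Main.v *)
(* Put Phi_u(v) = - int B u v + energy(u, v). The functional N u is defined on a
   function f of the boundary by N u f = Phi_u(v) / C_s for any v in H^s(Om) with
   trace f; three facts make this work.
   - C_s > 0: the integrand has the sign of 2 s - 1, and at s = 1/2 the limit is
     obtained by dominated convergence.
   - Phi_u(v) = 0 if v has trace 0. The averages of v over balls at dyadic scales
     around a boundary point telescope, so the integral of v^2 over the layer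
     {dist < h} is O(h^(2 s)). Then v, cut off to {dist > h} and averaged against
     a smooth partition of unity of mesh comparable to h, gives test functions
     that converge to v in L2 with bounded energy. They converge weakly, which is
     enough because Phi_u vanishes on test functions.
   - Every f in the Besov space is a trace with control of the norm: averaging f
     over the part of the boundary at distance comparable to dist(x) from x
     defines an extension whose energy is bounded by Schur's test.
   The interior arcs of the (eps, delta) condition are only used to see that
   Om meets every small ball centred at its boundary in a definite proportion. *)

Require Import Defs.
From mathcomp Require Import all_boot all_order all_algebra.
From mathcomp Require Import all_classical all_reals all_analysis measurable_realfun.
From mathcomp Require Import ring lra.

Set Implicit Arguments.
Unset Strict Implicit.
Unset Printing Implicit Defensive.

Import Order.TTheory GRing.Theory Num.Theory.
Import numFieldNormedType.Exports.

Local Open Scope classical_set_scope.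
Local Open Scope ring_scope.

(** * Euclidean balls and integration *)

Section euclidean.
Variables (R : realType) (N : nat).
Local Notation E := 'rV[R]_N.
Implicit Types (x y z : E) (a r : R).

Lemma dotr_ge0 x : 0 <= dotr x x.
Proof. by apply: sumr_ge0 => i _; rewrite -expr2 sqr_ge0. Qed.

Lemma enorm_ge0 x : 0 <= enorm x.
Proof. exact: sqrtr_ge0. Qed.

Lemma enorm_sq x : enorm x ^+ 2 = dotr x x.
Proof. by rewrite sqr_sqrtr// dotr_ge0. Qed.

Lemma dotrC x y : dotr x y = dotr y x.
Proof. by apply: eq_bigr => i _; rewrite mulrC. Qed.

Lemma dotrDl x y z : dotr (x + y) z = dotr x z + dotr y z.
Proof. by rewrite -big_split; apply: eq_bigr => i _; rewrite mxE mulrDl. Qed.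

Lemma dotrZl a x z : dotr (a *: x) z = a * dotr x z.
Proof. by rewrite mulr_sumr; apply: eq_bigr => i _; rewrite mxE mulrA. Qed.

Lemma dotr_cauchy_schwarz x y : dotr x y <= enorm x * enorm y.
Proof.
have [y0|y0] := eqVneq (enorm y) 0.
  have dy : dotr y y = 0 by rewrite -enorm_sq y0 expr0n.
  have yi i : y ord0 i = 0.
    have := dy; rewrite /dotr => /psumr_eq0P /(_ i isT).
    by move=> /(_ (fun j _ => sqr_ge0 (y ord0 j)))/eqP; rewrite mulf_eq0 orbb => /eqP.
  by rewrite y0 mulr0 /dotr big1// => i _; rewrite yi mulr0.
have yp : 0 < enorm y by rewrite lt_neqAle eq_sym y0 enorm_ge0.
have [//|h] := leP (dotr x y) (enorm x * enorm y).
have := dotr_ge0 (enorm y ^+ 2 *: x - dotr x y *: y).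
rewrite -scaleNr dotrDl !dotrZl ![dotr _ (_ + _)]dotrC !dotrDl !dotrZl -!enorm_sq (dotrC y x) => h2.
have : 0 <= enorm y ^+ 2 * ((enorm x * enorm y) ^+ 2 - dotr x y ^+ 2).
  by apply: le_trans h2 _; rewrite le_eqVlt; apply/orP; left; apply/eqP; ring.
rewrite pmulr_rge0 ?exprn_gt0// subr_ge0 ler_sqr ?nnegrE//.
- by move/(lt_le_trans h); rewrite ltxx.
- by apply: ltW; apply: le_lt_trans h; rewrite mulr_ge0 ?enorm_ge0.
- by rewrite mulr_ge0 ?enorm_ge0.
Qed.

Lemma enormD x y : enorm (x + y) <= enorm x + enorm y.
Proof.
rewrite -ler_sqr ?nnegrE ?addr_ge0 ?enorm_ge0// enorm_sq sqrrD dotrDl ![dotr _ (_ + _)]dotrC !dotrDl.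
rewrite !enorm_sq (dotrC y x).
have := dotr_cauchy_schwarz x y; lra.
Qed.

Lemma enormZ a x : enorm (a *: x) = `|a| * enorm x.
Proof.
apply/eqP; rewrite -(eqrXn2 (n:=2))// ?mulr_ge0 ?enorm_ge0// exprMn !enorm_sq.
by rewrite dotrZl dotrC dotrZl mulrA -expr2 real_normK// num_real.
Qed.

Lemma enormN x : enorm (- x) = enorm x.
Proof. by rewrite -scaleN1r enormZ normrN1 mul1r. Qed.

Lemma enorm0 : enorm (0 : E) = 0.
Proof. by rewrite -(scale0r (0 : E)) enormZ normr0 mul0r. Qed.

Lemma enormB x y : enorm (x - y) = enorm (y - x).
Proof. by rewrite -enormN opprB. Qed.

Lemma enorm_triangle z x y : enorm (x - y) <= enorm (x - z) + enorm (z - y).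
Proof. by rewrite (le_trans _ (enormD _ _))// addrA subrK. Qed.

Lemma enorm_coord x i : `|x ord0 i| <= enorm x.
Proof.
rewrite -ler_sqr ?nnegrE ?enorm_ge0// enorm_sq real_normK ?num_real//.
rewrite /dotr (bigD1 i)//= -expr2 lerDl sumr_ge0// => j _; by rewrite -expr2 sqr_ge0.
Qed.

Lemma enorm_le_coord x r : 0 <= r -> (forall i, `|x ord0 i| <= r) ->
  enorm x <= N%:R * r.
Proof.
move=> r0 xr; rewrite -ler_sqr ?nnegrE ?mulr_ge0 ?enorm_ge0// enorm_sq.
apply: (@le_trans _ _ (\sum_(i < N) r ^+ 2)).
  by apply: ler_sum => i _; rewrite -expr2 -real_normK ?num_real// ler_sqr ?nnegrE.
rewrite sumr_const card_ord exprMn -[r ^+ 2 *+ N]mulr_natl; apply: ler_wpM2r; first exact: sqr_ge0.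
by rewrite -natrX ler_nat expnS expn1; case: (N) => // n; rewrite leq_pmulr.
Qed.

Lemma norm_le_enorm x : `|x| <= enorm x.
Proof.
rewrite /Num.norm/= mx_normrE; apply/bigmax_leP; split; first exact: enorm_ge0.
by move=> [i j] _; rewrite /= ord1 enorm_coord.
Qed.

Lemma enorm_le_norm x : enorm x <= N%:R * `|x|.
Proof.
apply: enorm_le_coord => // i.
rewrite [leRHS]/Num.norm/= mx_normrE.
exact: (le_bigmax (0 : R) (fun ij : _ * _ => `|x ij.1 ij.2|) (ord0, i)).
Qed.

Lemma enorm_eq0 x : (enorm x == 0) = (x == 0).
Proof.
apply/eqP/eqP => [x0|->]; last exact: enorm0.
apply/eqP; rewrite -normr_eq0 eq_le normr_ge0 andbT -x0; exact: norm_le_enorm.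
Qed.

Lemma nbhs_eball x (A : set E) :
  nbhs x A <-> exists2 r, 0 < r & eball x r `<=` A.
Proof.
split.
  move=> /nbhs_ballP[e /= e0 xA]; exists e => // y; rewrite /eball/= => xy.
  by apply: xA; rewrite -ball_normE/=; apply: le_lt_trans (norm_le_enorm _) _; rewrite enormB.
move=> [r r0 xA]; apply/nbhs_ballP; exists (r / N.+1%:R) => /=; first by rewrite divr_gt0.
move=> y; rewrite -ball_normE/= => xy; apply: xA; rewrite /eball/=.
rewrite enormB; apply: le_lt_trans (enorm_le_norm _) _.
have : N%:R * `|x - y| <= N.+1%:R * `|x - y| by rewrite ler_wpM2r// ler_nat.
by move=> /le_lt_trans; apply; rewrite mulrC -ltr_pdivlMr.
Qed.

Lemma eball_open x r : open (eball x r).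
Proof.
rewrite openE => y; rewrite /eball/= => xy; apply/nbhs_eball.
exists (r - enorm (y - x)); first by rewrite subr_gt0.
move=> z; rewrite /eball/= ltrBrDr; apply: le_lt_trans; exact: enorm_triangle.
Qed.

Lemma enorm_dist x y : `|enorm x - enorm y| <= enorm (x - y).
Proof.
have := enormD (x - y) y; have := enormD (y - x) x; rewrite !subrK (enormB y).
by move=> h1 h2; rewrite ler_norml; apply/andP; split; lra.
Qed.

Lemma enorm_continuous : continuous (@enorm R N).
Proof.
move=> x; apply/(@cvgrPdist_lt _ _ _ (nbhs x) (nbhs_filter x)) => e e0; apply/nbhs_eball.
exists e => // y; rewrite /eball/= => xy.
by apply: le_lt_trans xy; rewrite enormB; exact: enorm_dist.
Qed.

End euclidean.

Section integral_tools.
Local Open Scope ereal_scope.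
Context d (T : measurableType d) (R : realType).
Variable m : {measure set T -> \bar R}.

Lemma ge0_le_int (D : set T) (f g : T -> \bar R) :
  (forall x, D x -> 0 <= f x) -> (forall x, D x -> f x <= g x) ->
  \int[m]_(x in D) f x <= \int[m]_(x in D) g x.
Proof.
move=> f0 fg.
have g0 x : D x -> 0 <= g x by move=> Dx; exact: le_trans (f0 _ Dx) (fg _ Dx).
rewrite (ge0_integralE _ f0) (ge0_integralE _ g0).
apply: ge_ereal_sup => _ [h /= hf <-]; apply: ereal_sup_ubound; exists h => //= x.
apply: (le_trans (hf x)); rewrite /patch; case: ifPn => //; rewrite inE => Dx.
exact: fg.
Qed.

Lemma int_ge0 (D : set T) (f : T -> \bar R) :
  (forall x, 0 <= f x) -> 0 <= \int[m]_(x in D) f x.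
Proof. by move=> f0; apply: integral_ge0 => x _. Qed.

Lemma int_le_series_indic (f : T -> \bar R) (c : nat -> R) (B : nat -> set T) :
  (forall x, 0 <= f x) -> (forall k, (0 <= c k)%R) ->
  (forall k, measurable (B k)) ->
  (forall x, f x <= 0 \/ exists k, B k x /\ f x <= (c k)%:E) ->
  \int[m]_x f x <= \sum_(k <oo) ((c k)%:E * m (B k)).
Proof.
move=> f0 c0 mB fB.
apply: (@le_trans _ _ (\int[m]_x \sum_(k <oo) ((c k)%:E * (\1_(B k) x)%:E))).
  apply: ge0_le_int => // x _.
  have s0 k : true -> 0 <= (c k)%:E * (\1_(B k) x)%:E.
    by move=> _; rewrite -EFinM lee_fin mulr_ge0.
  case: (fB x) => [fx|[k [Bkx fk]]].
    by apply: le_trans fx _; apply: nneseries_ge0 => k _ _; exact: s0.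
  apply: le_trans fk _; apply: le_trans (nneseries_lim_ge k.+1 _); last by move=> n ? _; apply: s0.
  rewrite big_nat_recr//= indicE mem_set// mule1 leeDr//.
  by apply: sume_ge0 => i _; exact: s0.
rewrite integral_nneseries//.
- apply: lee_nneseries => [k _ _|k _].
    by apply: integral_ge0 => x _; rewrite -EFinM lee_fin mulr_ge0.
  rewrite ge0_integralZl//.
  + by rewrite integral_indic// setIT.
  + by apply/measurable_EFinP; exact: measurable_indic.
  + by rewrite lee_fin.
- move=> k; under eq_fun do rewrite -EFinM.
  apply/measurable_EFinP; apply: measurable_funM => //.
- by move=> k x _; rewrite -EFinM lee_fin mulr_ge0.
Qed.

Lemma nneseries_geometric_le (a q : R) : (0 <= a)%R -> (0 <= q)%R -> (q < 1)%R ->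
  \sum_(k <oo) (a * q ^+ k)%:E <= (a / (1 - q))%:E.
Proof.
move=> a0 q0 q1; apply: lime_le.
  by apply: is_cvg_nneseries => k _ _; rewrite lee_fin mulr_ge0// exprn_ge0.
near=> n; rewrite sumEFin lee_fin -mulr_sumr ler_wpM2l//.
rewrite -[leRHS]mul1r ler_pdivlMr ?subr_gt0// big_mkord.
have := subrX1 q n; rewrite mulrC => h.
have -> : ((\sum_(i < n) q ^+ i) * (1 - q) = 1 - q ^+ n)%R.
  by rewrite -opprB mulrN -h opprB.
by rewrite lerBlDr lerDl exprn_ge0.
Unshelve. all: by end_near. Qed.

End integral_tools.

Section cauchy.
Context d (T : measurableType d) (R : realType).
Variable m : {measure set T -> \bar R}.
Implicit Types (f g : T -> R) (A : set T).

Lemma integrable_mul f g A : measurable A ->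
  measurable_fun A f -> measurable_fun A g ->
  (\int[m]_(x in A) (f x ^+ 2)%:E < +oo)%E ->
  (\int[m]_(x in A) (g x ^+ 2)%:E < +oo)%E ->
  m.-integrable A (EFin \o (fun x => f x * g x)).
Proof.
move=> mA mf mg f2 g2; apply/integrableP; split.
  by apply/measurable_EFinP; exact: measurable_funM.
apply: (@le_lt_trans _ _ (\int[m]_(x in A) ((f x ^+ 2)%:E + (g x ^+ 2)%:E))%E).
  apply: ge0_le_int => x _ //=; rewrite -EFinD lee_fin normrM.
  rewrite -(real_normK (num_real (f x))) -(real_normK (num_real (g x))).
  have := sqr_ge0 (`|f x| - `|g x|); rewrite sqrrB.
  have := sqr_ge0 (`|f x|); have := sqr_ge0 (`|g x|); lra.
rewrite ge0_integralD//; first exact: lte_add_pinfty.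
- by move=> x _; rewrite lee_fin sqr_ge0.
- by apply/measurable_EFinP; exact: measurable_funX.
- by move=> x _; rewrite lee_fin sqr_ge0.
- by apply/measurable_EFinP; exact: measurable_funX.
Qed.

Lemma integrable_sq f A : measurable A -> measurable_fun A f ->
  (\int[m]_(x in A) (f x ^+ 2)%:E < +oo)%E ->
  m.-integrable A (EFin \o (fun x => f x ^+ 2)).
Proof. by move=> mA mf f2; apply: (@integrable_mul f f A). Qed.

Lemma cauchy_int f g A : measurable A ->
  measurable_fun A f -> measurable_fun A g ->
  (\int[m]_(x in A) (f x ^+ 2)%:E < +oo)%E ->
  (\int[m]_(x in A) (g x ^+ 2)%:E < +oo)%E ->
  (\int[m]_(x in A) (f x * g x)) ^+ 2 <=
    (\int[m]_(x in A) (f x ^+ 2)) * (\int[m]_(x in A) (g x ^+ 2)).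
Proof.
move=> mA mf mg f2 g2.
set a := \int[m]_(x in A) (f x ^+ 2); set b := \int[m]_(x in A) (g x ^+ 2).
set c := \int[m]_(x in A) (f x * g x).
have a0 : 0 <= a by apply: Rintegral_ge0 => x _; exact: sqr_ge0.
have h t : 0 <= a * t ^+ 2 + 2 * c * t + b.
  have -> : a * t ^+ 2 + 2 * c * t + b = \int[m]_(x in A) ((t * f x + g x) ^+ 2).
    rewrite [RHS](_ : _ = \int[m]_(x in A)
      (t ^+ 2 * f x ^+ 2 + (2 * t * (f x * g x) + g x ^+ 2))); last first.
      by apply: eq_Rintegral => x _; ring.
    have i1 := integrable_sq mA mf f2; have i2 := integrable_sq mA mg g2.
    have i3 := integrable_mul mA mf mg f2 g2.
    have j1 : m.-integrable A (EFin \o (fun x => t ^+ 2 * f x ^+ 2)).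
      exact: (integrableZl mA (t ^+ 2) i1).
    have j3 : m.-integrable A (EFin \o (fun x => 2 * t * (f x * g x))).
      exact: (integrableZl mA (2 * t) i3).
    rewrite RintegralD//; last first.
      exact: (integrableD mA j3 i2).
    rewrite RintegralD// !RintegralZl//; rewrite -/a -/b -/c; ring.
  by apply: Rintegral_ge0 => x _; exact: sqr_ge0.
have b0 : 0 <= b by have := h 0; rewrite expr0n /= !mulr0 !add0r.
have [az|az] := eqVneq a 0.
  rewrite az mul0r; have [->|c0] := eqVneq c 0; first by rewrite expr0n.
  have := h (- (b + 1) / (2 * c)); rewrite az mul0r add0r.
  rewrite mulrCA divff ?mulf_neq0// mulr1; lra.
have a1 : 0 < a by rewrite lt_neqAle eq_sym az.
have := h (- c / a).
have -> : a * (- c / a) ^+ 2 + 2 * c * (- c / a) + b = b - c ^+ 2 / a.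
  by field.
by rewrite subr_ge0 ler_pdivrMr// mulrC.
Qed.

Lemma cauchy_bounded f g A (M V : R) : measurable A ->
  measurable_fun A f -> measurable_fun A g ->
  (\int[m]_(x in A) (f x ^+ 2)%:E < +oo)%E ->
  (m A <= V%:E)%E -> 0 <= M -> (forall x, A x -> `|g x| <= M) ->
  (((\int[m]_(x in A) (f x * g x)) ^+ 2)%:E <=
    (M ^+ 2 * V)%:E * \int[m]_(x in A) (f x ^+ 2)%:E)%E.
Proof.
move=> mA mf mg f2 mV M0 gM.
have g2 : (\int[m]_(x in A) (g x ^+ 2)%:E <= (M ^+ 2 * V)%:E)%E.
  apply: (@le_trans _ _ (\int[m]_(x in A) (M ^+ 2)%:E)%E).
    apply: ge0_le_int => x Ax; rewrite lee_fin ?sqr_ge0//.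
    by rewrite -real_normK ?num_real// lerXn2r ?nnegrE ?gM.
  by rewrite (integral_cst m mA (M ^+ 2)%:E) [leRHS]EFinM lee_wpmul2l// lee_fin sqr_ge0.
have g2' := le_lt_trans g2 (ltry _).
have h := cauchy_int mA mf mg f2 g2'.
have fin (u : T -> R) : (\int[m]_(x in A) (u x ^+ 2)%:E < +oo)%E ->
    ((\int[m]_(x in A) (u x ^+ 2))%:E = \int[m]_(x in A) (u x ^+ 2)%:E)%E.
  move=> u2; rewrite /Rintegral fineK// ge0_fin_numE//.
  by apply: integral_ge0 => x _; rewrite lee_fin sqr_ge0.
rewrite -(fin f f2) -EFinM lee_fin; apply: le_trans h _.
rewrite mulrC ler_wpM2r//; last by rewrite -lee_fin fin.
by apply: Rintegral_ge0 => x _; exact: sqr_ge0.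
Qed.

End cauchy.

Section tonelli.
Local Open Scope ereal_scope.
Context d1 d2 (T1 : measurableType d1) (T2 : measurableType d2) (R : realType).
Variables (m1 : {sigma_finite_measure set T1 -> \bar R})
  (m2 : {sigma_finite_measure set T2 -> \bar R}).

Lemma tonelli_swap (f : T1 -> T2 -> \bar R) :
  measurable_fun setT (fun p : T1 * T2 => f p.1 p.2) ->
  (forall x y, 0 <= f x y) ->
  \int[m1]_x \int[m2]_y f x y = \int[m2]_y \int[m1]_x f x y.
Proof.
by move=> mf f0; apply: (fubini_tonelli (fun p : T1 * T2 => f p.1 p.2)).
Qed.

Lemma measurable_int2 (f : T1 -> T2 -> \bar R) :
  measurable_fun setT (fun p : T1 * T2 => f p.1 p.2) ->
  (forall x y, 0 <= f x y) ->
  measurable_fun setT (fun x => \int[m2]_y f x y).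
Proof.
move=> mf f0.
exact: (measurable_fun_fubini_tonelli_F (fun p : T1 * T2 => f p.1 p.2)).
Qed.

Lemma schur_le (a : T1 -> T2 -> \bar R) (H : T2 -> \bar R) (A : R) :
  measurable_fun setT (fun p : T1 * T2 => a p.1 p.2) ->
  measurable_fun setT H ->
  (forall x y, 0 <= a x y) -> (forall y, 0 <= H y) ->
  (0 <= A)%R ->
  (forall y, \int[m1]_x a x y <= A%:E) ->
  \int[m1]_x \int[m2]_y (a x y * H y) <= A%:E * \int[m2]_y H y.
Proof.
move=> ma mH a0 H0 A0 aA.
rewrite tonelli_swap//; last 2 first.
- apply: emeasurable_funM => //; exact: measurableT_comp.
- by move=> x y; rewrite mule_ge0.
rewrite -ge0_integralZl//.
apply: ge0_le_int => y _; first by apply: int_ge0 => x; rewrite mule_ge0.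
rewrite ge0_integralZr//; first by rewrite lee_wpmul2r.
by have := measurableT_comp ma (pair2_measurable y).
Qed.

End tonelli.

Section power_layers.
Context (R : realType).
Implicit Types (a b c p q r : R).

Lemma powRX (a q : R) k : 0 <= a -> (a ^+ k) `^ q = (a `^ q) ^+ k.
Proof. by move=> a0; rewrite -powR_mulrn// -powRrM mulrC powRrM powR_mulrn// powR_ge0. Qed.

Lemma powR_le q a b : 0 <= q -> 0 <= a -> a <= b -> a `^ q <= b `^ q.
Proof. by move=> q0 a0 ab; rewrite ge0_ler_powR ?nnegrE// (le_trans a0). Qed.

Lemma powRDp a p q : 0 < a -> a `^ (p + q) = a `^ p * a `^ q.
Proof. by move=> a0; rewrite powRD// (gt_eqF a0) implybT. Qed.

Lemma powR_comparable q a r c : 0 < r -> 1 <= c -> r / c <= a -> a <= c * r ->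
  a `^ q <= c `^ `|q| * r `^ q.
Proof.
move=> r0 c1 ra ar; have c0 : 0 < c by lra.
have a0 : 0 < a by apply: lt_le_trans ra; rewrite divr_gt0.
have [q0|q0] := leP 0 q.
  rewrite (ger0_norm q0) -powRM ?(ltW c0) ?(ltW r0)//.
  by rewrite powR_le// ltW.
have inv x : 0 < x -> x `^ q = (x^-1) `^ (- q).
  by move=> x0; rewrite -powR_inv1 ?(ltW x0)// -powRrM mulN1r opprK.
rewrite (ltr0_norm q0) (inv a)// (inv r)// -powRM ?invr_ge0 ?(ltW c0) ?(ltW r0)//.
rewrite powR_le ?oppr_ge0 ?invr_ge0 ?(ltW q0) ?(ltW a0)//.
by rewrite -[c]invrK -invfM lef_pV2 ?posrE ?mulr_gt0 ?invr_gt0// mulrC.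
Qed.

Lemma half_expn_lt (e : R) : 0 < e -> exists k, 2^-1 ^+ k < e.
Proof.
move=> e0; exists (Num.truncn e^-1).+1.
have h := truncnS_gt e^-1.
rewrite exprVn -[ltRHS]invrK ltf_pV2 ?posrE ?exprn_gt0 ?invr_gt0//.
apply: lt_trans h _; by rewrite -natrX ltr_nat ltn_expl.
Qed.

Lemma dyadic_ex (a r : R) : 0 < a -> a < r ->
  exists k, r * 2^-1 ^+ k.+1 <= a /\ a < r * 2^-1 ^+ k.
Proof.
move=> a0 ar; have r0 := lt_trans a0 ar.
have ex : exists k, r * 2^-1 ^+ k <= a.
  have [k hk] := half_expn_lt (divr_gt0 a0 r0).
  by exists k; rewrite mulrC -ler_pdivlMr// ltW.
case: (ex_minnP ex) => -[|k] hk mk; first by move: hk; rewrite expr0 mulr1; lra.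
by exists k; split=> //; rewrite ltNge; apply/negP => /mk; rewrite ltnn.
Qed.

Lemma dyadic_ex_large (a r : R) : 0 < r -> r <= a ->
  exists k, r * 2 ^+ k <= a /\ a < r * 2 ^+ k.+1.
Proof.
move=> r0 ra; have a0 : 0 < a by lra.
have ex : exists k, a < r * 2 ^+ k.
  have [k hk] := half_expn_lt (divr_gt0 r0 a0).
  exists k; rewrite -ltr_pdivrMl// -[ltRHS]invrK -exprVn -[ltLHS]invrK ltf_pV2 ?posrE ?exprn_gt0 ?invr_gt0 ?mulr_gt0 ?invr_gt0//.
  by rewrite invfM invrK.
case: (ex_minnP ex) => -[|k] hk mk; first by move: hk; rewrite expr0 mulr1; lra.
by exists k; split=> //; rewrite leNgt; apply/negP => /mk; rewrite ltnn.
Qed.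

Lemma measurable_ltR d (T : measurableType d) (f g : T -> R) :
  measurable_fun setT f -> measurable_fun setT g ->
  measurable_fun setT (fun x => (f x < g x)%R%:R : R).
Proof.
move=> mf mg; rewrite (_ : (fun _ => _) = fun x => if f x < g x then 1 else 0).
  by apply: measurable_fun_ifT => //; exact: measurable_fun_ltr.
by apply/funext => x; case: ifP.
Qed.

Lemma measurable_leR d (T : measurableType d) (f g : T -> R) :
  measurable_fun setT f -> measurable_fun setT g ->
  measurable_fun setT (fun x => (f x <= g x)%R%:R : R).
Proof.
move=> mf mg; rewrite (_ : (fun _ => _) = fun x => if g x < f x then 0 else 1).
  by apply: measurable_fun_ifT => //; exact: measurable_fun_ltr.
by apply/funext => x; rewrite leNgt; case: ifP.
Qed.

Lemma measurable_sublevel d (T : measurableType d) (f : T -> R) r :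
  measurable_fun setT f -> measurable [set x | f x < r].
Proof.
move=> mf; rewrite -[X in measurable X]setTI.
have -> : [set x | f x < r] = f @^-1` `]-oo, r[%classic.
  by apply/seteqP; split => x /=; rewrite in_itv.
exact: mf.
Qed.

Lemma measurable_funpow d (T : measurableType d) (f : T -> R) p :
  measurable_fun setT f -> measurable_fun setT (fun x => f x `^ p).
Proof. by move=> mf; exact: (measurableT_comp (measurable_powR p) mf). Qed.

Definition layer_const (n p : R) : R := 2 `^ `|p| / (1 - 2 `^ (- `|n - p|)).

Lemma layer_denom_gt0 (n p : R) : n != p -> 0 < 1 - 2 `^ (- `|n - p|).
Proof.
move=> np; rewrite subr_gt0 powRN invf_lt1 ?powR_gt0//.
have h : 0 < `|n - p| by rewrite normr_gt0 subr_eq0.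
have := @gt0_ltr_powR R _ h 1 2; rewrite powR1; apply; rewrite ?nnegrE ?ltr1n//.
Qed.

Lemma layer_const_ge0 (n p : R) : n != p -> 0 <= layer_const n p.
Proof. by move=> np; rewrite divr_ge0 ?powR_ge0// ltW// layer_denom_gt0. Qed.

Section layers.
Context d (T : measurableType d) (m : {measure set T -> \bar R}).
Variables (rho : T -> R) (A n p r0 : R).
Hypotheses (mrho : measurable_fun setT rho) (rho0 : forall x, 0 <= rho x).
Hypotheses (r0_gt0 : 0 < r0) (A0 : 0 <= A).

Let half0 : 0 < 2^-1 :> R. Proof. by rewrite invr_gt0. Qed.

Lemma layer_small : p < n ->
  (forall r, 0 < r -> r <= r0 -> (m [set x | rho x < r]%R <= (A * r `^ n)%:E)%E) ->
  (\int[m]_x ((rho x < r0)%R%:R * rho x `^ (- p))%:E <=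
    (layer_const n p * A * r0 `^ (n - p))%:E)%E.
Proof.
move=> pn mA; pose rk k := r0 * 2^-1 ^+ k.
have rk0 k : 0 < rk k by rewrite mulr_gt0// exprn_gt0.
have rkr k : rk k <= r0 by rewrite ler_piMr ?(ltW r0_gt0)// exprn_ile1 ?(ltW half0)// invf_le1// ler1n.
apply: (@le_trans _ _ (\sum_(k <oo) ((2 `^ `|p| * rk k `^ (- p))%:E * m [set x | rho x < rk k]%R))%E).
  apply: int_le_series_indic.
  - by move=> x; rewrite lee_fin mulr_ge0// powR_ge0.
  - by move=> k; rewrite mulr_ge0// powR_ge0.
  - by move=> k; exact: measurable_sublevel.
  move=> x; have [xr|xr] := ltP (rho x) r0; last by left; rewrite mul0r.
  rewrite mul1r; have [x0|x0] := eqVneq (rho x) 0.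
    have [p0|p0] := eqVneq p 0; last by left; rewrite x0 powR0// oppr_eq0.
    right; exists 0%N; split; first by rewrite /= /rk expr0 mulr1.
    by rewrite p0 normr0 oppr0 !powRr0 mulr1.
  have xp : 0 < rho x by rewrite lt_neqAle eq_sym x0/= rho0.
  have [k [k1 k2]] := dyadic_ex xp xr.
  right; exists k; split => //; rewrite lee_fin -(normrN p).
  apply: powR_comparable => //; first by rewrite ler1n.
    by apply: le_trans k1; rewrite /rk exprSr mulrA.
  by apply: ltW; apply: lt_le_trans k2 _; rewrite -/(rk k) ler_peMl ?(ltW (rk0 k))// ler1n.
pose q : R := 2 `^ (- `|n - p|).
pose a : R := 2 `^ `|p| * A * r0 `^ (n - p).
apply: (@le_trans _ _ (\sum_(k <oo) (a * q ^+ k)%:E)%E).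
  apply: lee_nneseries => k _ => [_|].
    by rewrite mule_ge0// lee_fin mulr_ge0// powR_ge0.
  apply: (@le_trans _ _ ((2 `^ `|p| * rk k `^ (- p))%:E * (A * rk k `^ n)%:E)%E).
    by rewrite lee_wpmul2l ?mA// lee_fin mulr_ge0// powR_ge0.
  rewrite -EFinM lee_fin /a /q.
  have -> : 2 `^ `|p| * rk k `^ (- p) * (A * rk k `^ n) = 2 `^ `|p| * A * (rk k `^ (n - p)).
    by rewrite mulrACA (powRDp n (- p) (rk0 k)) [rk k `^ n * _]mulrC.
  rewrite /rk (powRM (n - p) (ltW r0_gt0) (exprn_ge0 k (ltW half0))) (powRX _ _ (ltW half0)).
  rewrite (@gtr0_norm _ (n - p)) ?subr_gt0// [2^-1 `^ _](_ : _ = 2 `^ (- (n - p))) ?mulrA//.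
  by rewrite -powR_inv1// -powRrM mulN1r.
apply: le_trans (nneseries_geometric_le _ _ _) _.
- by rewrite !mulr_ge0 ?powR_ge0.
- exact: powR_ge0.
- by rewrite -subr_gt0 layer_denom_gt0// gt_eqF.
by rewrite lee_fin /a /layer_const -/q le_eqVlt; apply/orP; left; apply/eqP; ring.
Qed.

Lemma layer_large : n < p ->
  (forall r, r0 <= r -> (m [set x | rho x < r]%R <= (A * r `^ n)%:E)%E) ->
  (\int[m]_x ((r0 <= rho x)%R%:R * rho x `^ (- p))%:E <=
    (2 `^ `|n - p| * layer_const n p * A * r0 `^ (n - p))%:E)%E.
Proof.
move=> pn mA; pose rk k := r0 * 2 ^+ k.+1.
have rk0 k : 0 < rk k by rewrite mulr_gt0// exprn_gt0.
have rkr k : r0 <= rk k by rewrite ler_peMr ?(ltW r0_gt0)// exprn_ege1// ler1n.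
apply: (@le_trans _ _ (\sum_(k <oo) ((2 `^ `|p| * rk k `^ (- p))%:E * m [set x | rho x < rk k]%R))%E).
  apply: int_le_series_indic.
  - by move=> x; rewrite lee_fin mulr_ge0// powR_ge0.
  - by move=> k; rewrite mulr_ge0// powR_ge0.
  - by move=> k; exact: measurable_sublevel.
  move=> x; have [xr|xr] := leP r0 (rho x); last by left; rewrite mul0r.
  rewrite mul1r.
  have [k [k1 k2]] := dyadic_ex_large r0_gt0 xr.
  right; exists k; split => //; rewrite lee_fin -(normrN p).
  apply: powR_comparable => //; first by rewrite ler1n.
    by apply: le_trans k1; rewrite /rk exprSr mulrA mulfK.
  by apply: ltW; apply: lt_le_trans k2 _; rewrite -/(rk k) ler_peMl ?(ltW (rk0 k))// ler1n.
pose q : R := 2 `^ (- `|n - p|).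
pose a : R := 2 `^ `|p| * A * r0 `^ (n - p) * q.
apply: (@le_trans _ _ (\sum_(k <oo) (a * q ^+ k)%:E)%E).
  apply: lee_nneseries => k _ => [_|].
    by rewrite mule_ge0// lee_fin mulr_ge0// powR_ge0.
  apply: (@le_trans _ _ ((2 `^ `|p| * rk k `^ (- p))%:E * (A * rk k `^ n)%:E)%E).
    by rewrite lee_wpmul2l ?mA// lee_fin mulr_ge0// powR_ge0.
  rewrite -EFinM lee_fin /a /q.
  have -> : 2 `^ `|p| * rk k `^ (- p) * (A * rk k `^ n) = 2 `^ `|p| * A * (rk k `^ (n - p)).
    by rewrite mulrACA (powRDp n (- p) (rk0 k)) [rk k `^ n * _]mulrC.
  rewrite /rk (powRM (n - p) (ltW r0_gt0) (exprn_ge0 k.+1 (ler0n R 2))) (powRX _ _ (ler0n R 2)).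
  by rewrite (@ltr0_norm _ (n - p)) ?subr_lt0// opprK exprS !mulrA.
apply: le_trans (nneseries_geometric_le _ _ _) _.
- by rewrite !mulr_ge0 ?powR_ge0.
- exact: powR_ge0.
- by rewrite -subr_gt0 layer_denom_gt0// lt_eqF.
rewrite lee_fin /a /layer_const -/q.
have q1 : q <= 2 `^ `|n - p| by rewrite /q ler_powR ?ler1n// (@le_trans _ _ 0)// oppr_le0.
have h : 0 < 1 - q by rewrite layer_denom_gt0// lt_eqF.
rewrite (_ : _ / _ = q * (2 `^ `|p| / (1 - q) * A * r0 `^ (n - p))); last by ring.
rewrite [leRHS](_ : _ = 2 `^ `|n - p| * (2 `^ `|p| / (1 - q) * A * r0 `^ (n - p))); last by ring.
by rewrite ler_wpM2r// !mulr_ge0 ?powR_ge0// invr_ge0 ltW.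
Qed.

End layers.
End power_layers.

Section lebesgue_balls.
Context (R : realType).
Implicit Types (r p : R).

Lemma measurable_rV_box N (J : 'I_N -> set R) : (forall i, measurable (J i)) ->
  measurable [set y : 'rV[R]_N | forall i, J i (y ord0 i)].
Proof.
move=> mJ; rewrite (_ : [set _ | _] = \bigcap_(i in [set: 'I_N]) [set y : 'rV[R]_N | J i (y ord0 i)]).
  apply: fin_bigcap_measurable => // i _; rewrite -[X in measurable X]setTI.
  exact: (@measurable_coord_rV R N i measurableT _ (mJ i)).
by apply/seteqP; split => y /= h i; [move=> _; exact: h|exact: h].
Qed.

Lemma lebesgue_rV_box N (J : 'I_N -> set R) : (forall i, measurable (J i)) ->
  lebesgue_rV R N [set y | forall i, J i (y ord0 i)] =
  (\prod_(i < N) lebesgue_measure (J i))%E.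
Proof.
elim: N J => [|n IH] J mJ.
  by rewrite big_ord0 /= diracE mem_set//= => -[].
rewrite big_ord_recl /= /lebesgue_cons /pushforward.
rewrite (_ : _ @^-1` _ = J ord0 `*` [set y : 'rV[R]_n | forall i, J (lift ord0 i) (y ord0 i)]).
  rewrite product_measure1E//.
    by congr (_ * _)%E; apply: (IH (fun i => J (lift ord0 i))) => i; exact: mJ.
    exact: mJ.
  by apply: (measurable_rV_box (J := fun i => J (lift ord0 i))) => i; exact: mJ.
apply/seteqP; split => -[a y] /=.
  move=> h; split.
    have := h ord0; rewrite /cons_rV.
    have -> : ord0 = lshift n (ord0 : 'I_1) :> 'I_(1 + n) by exact: val_inj.
    by rewrite (row_mxEl (a%:M : 'M[R]_1) y) !mxE mulr1n.
  move=> i; have := h (lift ord0 i); rewrite /cons_rV.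
  have -> : lift ord0 i = rshift 1 i :> 'I_(1 + n) by exact: val_inj.
  by rewrite (row_mxEr (a%:M : 'M[R]_1) y).
move=> [h0 h1] i; rewrite /cons_rV.
case: (@split_ordP 1 n i) => j -> {i}.
  rewrite (row_mxEl (a%:M : 'M[R]_1) y) (ord1 j) !mxE mulr1n.
  by have -> : lshift n (ord0 : 'I_1) = ord0 :> 'I_(1 + n) by exact: val_inj.
rewrite (row_mxEr (a%:M : 'M[R]_1) y).
by have -> : rshift 1 j = lift ord0 j :> 'I_(1 + n) by exact: val_inj.
Qed.

Variable N : nat.
Local Notation E := 'rV[R]_N.
Local Notation leb := (lebesgue_rV R N).

Lemma open_measurable_rV (U : set E) : open U -> measurable U.
Proof. by move=> oU; apply: sub_sigma_algebra. Qed.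

Lemma closed_measurable_rV (U : set E) : closed U -> measurable U.
Proof. by move=> cU; rewrite -[U]setCK; apply: measurableC; apply: open_measurable_rV; rewrite openC. Qed.

Lemma measurable_eball (x : E) r : measurable (eball x r).
Proof. apply: open_measurable_rV; exact: eball_open. Qed.

Lemma leb_cube (x : E) r : 0 <= r ->
  leb [set y | forall i, `]x ord0 i - r, x ord0 i + r[%classic (y ord0 i)] = ((2 * r) ^+ N)%:E.
Proof.
move=> r0; rewrite (lebesgue_rV_box (J := fun i => `]x ord0 i - r, x ord0 i + r[%classic))//.
rewrite (eq_bigr (fun=> (2 * r)%:E)) => [|i _].
  by rewrite big_const iter_mule mule1 card_ord EFin_expe.
rewrite lebesgue_measure_itv/= lte_fin ltrBlDr -addrA -subr_gt0 addrAC subrr add0r.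
case: ifPn => [_|]; first by rewrite -EFinB; congr EFin; ring.
by rewrite -leNgt -mulr2n pmulrn_lle0// => r1; congr EFin; rewrite (@le_anti _ _ r 0) ?mulr0// r0 r1.
Qed.

Lemma leb_eball_le (x : E) r : 0 <= r -> (leb (eball x r) <= ((2 * r) ^+ N)%:E)%E.
Proof.
move=> r0; rewrite -(leb_cube x r0); apply: le_measure; rewrite ?inE.
- exact: measurable_eball.
- exact: (measurable_rV_box (J := fun i => `]x ord0 i - r, x ord0 i + r[%classic)).
move=> y; rewrite /eball/= => xy i; rewrite in_itv/= -ltr_distl.
by apply: le_lt_trans xy; have := enorm_coord (y - x) i; rewrite !mxE.
Qed.

Lemma leb_eball_ge (x : E) r : 0 < r -> (((2 / N.+1%:R * r) ^+ N)%:E <= leb (eball x r))%E.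
Proof.
move=> r0; have r1 : 0 < r / N.+1%:R by rewrite divr_gt0.
rewrite mulrAC -mulrA -(leb_cube x (ltW r1)); apply: le_measure; rewrite ?inE.
- exact: (measurable_rV_box (J := fun i => `]x ord0 i - r / N.+1%:R, x ord0 i + r / N.+1%:R[%classic)).
- exact: measurable_eball.
move=> y h; rewrite /eball/=.
apply: (@le_lt_trans _ _ (N%:R * (r / N.+1%:R))).
  apply: enorm_le_coord => [|i]; first exact: ltW.
  by have := h i; rewrite /= in_itv/= -ltr_distl !mxE => /ltW.
by rewrite mulrA mulrAC gtr_pMl// ltr_pdivrMr// mul1r ltr_nat.
Qed.

Lemma measurable_enorm d (T : measurableType d) (f : T -> E) :
  (forall i, measurable_fun setT (fun x => f x ord0 i)) ->
  measurable_fun setT (fun x => enorm (f x)).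
Proof.
move=> mf; rewrite /enorm /dotr.
have ms : measurable_fun setT (@Num.sqrt R).
  by apply: continuous_measurable_fun; exact: sqrt_continuous.
apply: (measurableT_comp ms).
by apply: measurable_sum => i; exact: measurable_funM.
Qed.

Lemma measurable_rV_coord d (T : measurableType d) (f : T -> E) i :
  measurable_fun setT f -> measurable_fun setT (fun x => f x ord0 i).
Proof. by move=> mf; exact: (measurableT_comp (@measurable_coord_rV R N i) mf). Qed.

Lemma measurable_dist d (T : measurableType d) (f g : T -> E) :
  measurable_fun setT f -> measurable_fun setT g ->
  measurable_fun setT (fun x => enorm (f x - g x)).
Proof.
move=> mf mg; apply: measurable_enorm => i.
rewrite (_ : (fun _ => _) = fun x => f x ord0 i - g x ord0 i).
  by apply: measurable_funB; exact: measurable_rV_coord.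
by apply/funext => x; rewrite !mxE.
Qed.

Section ball_integrals.
Variables (m : {measure set E -> \bar R}) (A n : R).
Hypothesis A0 : 0 <= A.

Lemma ball_int_small (y : E) p r : p < n -> 0 < r ->
  (forall q, 0 < q -> q <= r -> (m (eball y q) <= (A * q `^ n)%:E)%E) ->
  (\int[m]_x ((enorm (x - y) < r)%R%:R * enorm (x - y) `^ (- p))%:E <=
    (layer_const n p * A * r `^ (n - p))%:E)%E.
Proof.
move=> pn r0 mA; apply: layer_small => //; first exact: measurable_dist.
by move=> x; exact: enorm_ge0.
Qed.

Lemma ball_int_large (y : E) p r : n < p -> 0 < r ->
  (forall q, 0 < q -> (m (eball y q) <= (A * q `^ n)%:E)%E) ->
  (\int[m]_x ((r <= enorm (x - y))%R%:R * enorm (x - y) `^ (- p))%:E <=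
    (2 `^ `|n - p| * layer_const n p * A * r `^ (n - p))%:E)%E.
Proof.
move=> pn r0 mA; apply: layer_large => //.
- exact: measurable_dist.
- by move=> q rq; apply: mA; exact: lt_le_trans rq.
Qed.
End ball_integrals.

Lemma leb_eball_powR (x : E) r : 0 < r -> (leb (eball x r) <= (2 ^+ N * r `^ N%:R)%:E)%E.
Proof.
by move=> r0; apply: le_trans (leb_eball_le x (ltW r0)) _; rewrite exprMn powR_mulrn ?(ltW r0).
Qed.

Lemma leb_int_small (y : E) p r : p < N%:R -> 0 < r ->
  (\int[leb]_x ((enorm (x - y) < r)%R%:R * enorm (x - y) `^ (- p))%:E <=
    (layer_const N%:R p * 2 ^+ N * r `^ (N%:R - p))%:E)%E.
Proof.
by move=> pn r0; apply: ball_int_small => // q q0 _; exact: leb_eball_powR.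
Qed.

Lemma leb_int_large (y : E) p r : N%:R < p -> 0 < r ->
  (\int[leb]_x ((r <= enorm (x - y))%R%:R * enorm (x - y) `^ (- p))%:E <=
    (2 `^ `|N%:R - p| * layer_const N%:R p * 2 ^+ N * r `^ (N%:R - p))%:E)%E.
Proof.
by move=> pn r0; apply: ball_int_large => // q q0; exact: leb_eball_powR.
Qed.

End lebesgue_balls.

Section geometry.
Context (R : realType) (N : nat).
Local Notation E := 'rV[R]_N.
Implicit Types (x y z a b : E) (Om : set E) (r : R).

Lemma continuous_measurable_rV (f : E -> R) :
  continuous f -> measurable_fun setT f.
Proof.
move=> cf; apply: (measurability _ (RGenOInfty.measurableE R)) => _ [_ [a ->] <-].
rewrite setTI; apply: sub_sigma_algebra.
by apply: open_comp; [move=> v _; exact: cf|exact: interval_open].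
Qed.

Lemma bounded_enorm Om : bounded_set Om ->
  exists2 M : R, 0 < M & forall x, Om x -> enorm x < M.
Proof.
move=> [M [_ h]]; pose M1 := Num.max M 0 + 1.
have M1M : M < M1 by rewrite /M1; have : M <= Num.max M 0; [rewrite le_max lexx|lra].
have M10 : 0 < M1 by rewrite /M1; have : 0 <= Num.max M 0; [rewrite le_max lexx orbT|lra].
exists (N.+1%:R * M1); first by rewrite mulr_gt0.
move=> x Ox; apply: le_lt_trans (enorm_le_norm x) _.
apply: (@le_lt_trans _ _ (N%:R * M1)); last by rewrite ltr_pM2r// ltr_nat.
by rewrite ler_wpM2l// (h M1).
Qed.

Lemma nonsurj_bounded Om (M : R) : (0 < N)%N -> (forall x, Om x -> enorm x < M) ->
  (~` Om) !=set0.
Proof.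
case: N Om => // n Om _ h; exists (const_mx `|M|) => /h; apply/negP; rewrite -leNgt.
apply: le_trans (enorm_coord _ ord0); rewrite mxE normr_id; exact: ler_norm.
Qed.

Lemma segment_connected x y : connected [set x + t *: (y - x) | t in `[0%R, 1%R]%classic].
Proof.
apply: connected_continuous_connected.
  by apply/connected_intervalP; exact: interval_is_interval.
apply: continuous_subspaceT => t.
apply: cvgD; first exact: cvg_cst.
by apply: cvgZr_tmp; exact: cvg_id.
Qed.

Lemma boundary_open Om : open Om -> boundary Om = closure Om `\` Om.
Proof. by move=> oO; rewrite /boundary (interior_id _).1. Qed.

Lemma closed_boundary Om : open Om -> closed (boundary Om).
Proof.
move=> oO; rewrite boundary_open// setDE; apply: closedI; first exact: closed_closure.
exact: open_closedC.
Qed.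

Lemma closure_eball (A : set E) y r : closure A y -> 0 < r ->
  exists2 x, A x & enorm (x - y) < r.
Proof.
move=> cy r0; have [|x [Ax yx]] := cy (eball y r); last by exists x.
by apply/nbhs_eball; exists r.
Qed.

Lemma segment_boundary Om x y : open Om -> Om x -> ~ Om y ->
  exists2 z, boundary Om z & enorm (x - z) <= enorm (x - y).
Proof.
move=> oO Ox nOy; apply: contrapT => nF.
pose A := [set x + t *: (y - x) | t in `[0%R, 1%R]%classic].
have nb z : A z -> ~ boundary Om z.
  move=> [t /=]; rewrite in_itv/= => /andP[t0 t1] <- bz; apply: nF.
  exists (x + t *: (y - x)) => //.
  by rewrite opprD addNKr enormN enormZ ger0_norm// enormB ler_piMl// enorm_ge0.
have := segment_connected (x:=x) (y:=y); move=> /(_ (A `&` Om)).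
have Ax : A x by exists 0; rewrite /= ?in_itv/= ?lexx ?ler01// scale0r addr0.
have Ay : A y by exists 1; rewrite /= ?in_itv/= ?lexx ?ler01// scale1r addrC subrK.
move=> /(_ _ _ _) h.
have : A `&` Om = A.
  apply: h; first by exists x.
    by exists Om.
  exists (closure Om); first exact: closed_closure.
  apply/seteqP; split => z [Az Oz]; split => //; first exact: subset_closure.
  by apply: contrapT => nO; apply: (nb z) => //; rewrite boundary_open.
by move=> AO; apply: nOy; move: Ay; rewrite -AO => -[].
Qed.

Section dist.
Variable Om : set E.
Hypotheses (oO : open Om) (nO : (~` Om) !=set0).

Let S x := [set enorm (x - y) | y in ~` Om].
Let S0 x : S x !=set0. Proof. by case: nO => y ny; exists (enorm (x - y)); exists y. Qed.
Let lbS x : has_lbound (S x). Proof. by exists 0 => _ [y _ <-]; exact: enorm_ge0. Qed.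

Lemma dist_compl_le x y : ~ Om y -> dist_compl Om x <= enorm (x - y).
Proof. by move=> nOy; apply: ge_inf; [exact: lbS|exists y]. Qed.

Lemma dist_compl_ge x r : (forall y, ~ Om y -> r <= enorm (x - y)) -> r <= dist_compl Om x.
Proof. by move=> h; apply: lb_le_inf; [exact: S0|move=> _ [y nOy <-]; exact: h]. Qed.

Lemma dist_compl_ge0 x : 0 <= dist_compl Om x.
Proof. by apply: dist_compl_ge => y _; exact: enorm_ge0. Qed.

Lemma dist_compl_lip x z : dist_compl Om x <= dist_compl Om z + enorm (x - z).
Proof.
rewrite -lerBlDr; apply: dist_compl_ge => y nOy.
by rewrite lerBlDr addrC (le_trans (dist_compl_le x nOy))// enorm_triangle.
Qed.

Lemma dist_compl_gt0 x : Om x -> 0 < dist_compl Om x.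
Proof.
move=> Ox; have /nbhs_eball[r r0 xr] : nbhs x Om by exact: open_nbhs_nbhs.
apply: lt_le_trans r0 _; apply: dist_compl_ge => y nOy; rewrite leNgt; apply/negP => h.
by apply: nOy; apply: xr; rewrite /eball/= enormB.
Qed.

Lemma dist_compl_boundary_le x y : boundary Om y -> dist_compl Om x <= enorm (x - y).
Proof. by rewrite boundary_open// => -[_ nOy]; exact: dist_compl_le. Qed.

Lemma dist_compl_boundary x r : Om x -> dist_compl Om x < r ->
  exists2 y, boundary Om y & enorm (x - y) < r.
Proof.
move=> Ox xr; have r0 : 0 < r - dist_compl Om x by rewrite subr_gt0.
have [_ [y nOy <-]] := inf_adherent r0 (conj (S0 x) (lbS x)).
rewrite -[inf _]/(dist_compl Om x) subrKC => xy.
have [z bz xz] := segment_boundary oO Ox nOy.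
by exists z => //; exact: le_lt_trans xy.
Qed.

Lemma dist_compl_eball z y : enorm (y - z) < dist_compl Om z -> Om y.
Proof.
move=> h; apply: contrapT => nOy; move: h; apply/negP.
by rewrite -leNgt enormB dist_compl_le.
Qed.

Lemma measurable_dist_compl : measurable_fun setT (dist_compl Om).
Proof.
apply: continuous_measurable_rV => x.
apply/(@cvgrPdist_lt _ _ _ (nbhs x) (nbhs_filter x)) => e e0; apply/nbhs_eball.
exists e => // y; rewrite /eball/= => xy.
apply: le_lt_trans xy; rewrite ler_norml.
have := dist_compl_lip x y; have := dist_compl_lip y x; rewrite (enormB y x) => h1 h2.
by apply/andP; split; lra.
Qed.

End dist.

Lemma corkscrew Om (eps delta : R) : (0 < N)%N -> bounded_set Om ->
  eps_delta_domain Om eps delta ->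
  exists r0 c : R, [/\ 0 < r0, 0 < c & forall y r, boundary Om y -> 0 < r -> r <= r0 ->
    exists z, [/\ Om z, enorm (z - y) < r & c * r <= dist_compl Om z]].
Proof.
move=> N0 bO [oO cO eps0 delta0 hO].
have [[p Op]|Oe] := pselect (Om !=set0); last first.
  exists 1, 1; split => // y r by0; exfalso; apply: Oe.
  move: by0; rewrite boundary_open// => -[cy _].
  by have [x Ox _] := closure_eball cy ltr01; exists x.
have [q [Oq pq]] : exists q, Om q /\ 0 < enorm (p - q).
  have /nbhs_eball[r r0 pr] : nbhs p Om by exact: open_nbhs_nbhs.
  pose v : E := delta_mx ord0 (Ordinal N0).
  have v0 : 0 < enorm v.
    by apply: lt_le_trans (enorm_coord _ (Ordinal N0)); rewrite mxE !eqxx normr1.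
  exists (p + (r / 2 / enorm v) *: v).
  have nv : enorm ((r / 2 / enorm v) *: v) = r / 2.
    by rewrite enormZ ger0_norm ?divr_ge0 ?ltW// divfK// gt_eqF.
  split.
    by apply: pr; rewrite /eball/= addrAC subrr add0r nv; lra.
  by rewrite opprD addNKr enormN nv; lra.
pose r0 := Num.min delta (enorm (p - q) / 4).
have r00 : 0 < r0 by rewrite lt_min delta0 divr_gt0.
exists r0, (eps / 64); split => //; first by rewrite divr_gt0.
move=> y r by0 r_gt0 rr0.
have rd : r <= delta by apply: le_trans rr0 _; rewrite ge_min lexx.
have rpq : r <= enorm (p - q) / 4 by apply: le_trans rr0 _; rewrite ge_min lexx orbT.
move: (by0); rewrite boundary_open// => -[cy nOy].
have [a Oa ay] := closure_eball cy (divr_gt0 r_gt0 (ltr0n R 8) : 0 < r / 8).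
have cf : continuous (fun x => enorm (x - y)).
  move=> x; apply/(@cvgrPdist_lt _ _ _ (nbhs x) (nbhs_filter x)) => e e0; apply/nbhs_eball.
  exists e => // z; rewrite /eball/= => xz; apply: le_lt_trans (enorm_dist _ _) _.
  by rewrite opprB addrA subrK enormB.
have [b Ob eby] : exists2 b, Om b & enorm (b - y) = r / 2.
  have : connected [set enorm (x - y) | x in Om].
    by apply: connected_continuous_connected => //; exact: continuous_subspaceT.
  move=> /connected_intervalP itv.
  have [u Ou uy] : exists2 u, Om u & r / 2 <= enorm (u - y).
    have := enorm_triangle y p q; rewrite (enormB y q) => tri.
    have [h|h] := leP (r / 2) (enorm (p - y)); first by exists p.
    by exists q => //; lra.
  have [b Ob eb] : [set enorm (x - y) | x in Om] (r / 2); last by exists b.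
  apply: (itv (enorm (a - y)) (enorm (u - y))); [by exists a|by exists u|].
  by rewrite uy andbT; lra.
have ab : enorm (a - b) < r.
  have := enorm_triangle y a b; rewrite (enormB y b); lra.
have ab0 : 0 < enorm (a - b).
  have := enorm_triangle a b y; rewrite (enormB b a); lra.
have [g [[cg gO] g0 g1 _ gd]] := hO a b Oa Ob (lt_le_trans ab rd).
have [z gz ez] : exists2 z, (g @` `[0, 1]) z & enorm (z - y) = r / 4.
  have : connected [set enorm (x - y) | x in g @` `[0, 1]].
    apply: connected_continuous_connected; last exact: continuous_subspaceT.
    apply: connected_continuous_connected cg.
    by apply/connected_intervalP; exact: interval_is_interval.
  move=> /connected_intervalP itv.
  have [z gz ez] : [set enorm (x - y) | x in g @` `[0, 1]] (r / 4); last by exists z.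
  apply: (itv (enorm (a - y)) (enorm (b - y))).
  - by exists a => //; exists 0 => //=; rewrite in_itv/= lexx ler01.
  - by exists b => //; exists 1 => //=; rewrite in_itv/= lexx ler01.
  - by rewrite eby; apply/andP; split; lra.
exists z; split; [exact: gO|by rewrite ez; lra|].
apply: le_trans (gd _ gz).
have h1 : r / 8 <= enorm (a - z).
  have := enorm_triangle a z y; rewrite ez (enormB z a); lra.
have h2 : r / 4 <= enorm (b - z).
  have := enorm_triangle z b y; rewrite ez eby; lra.
rewrite ler_pdivlMr//.
have h3 : r / 8 * (r / 4) <= enorm (a - z) * enorm (b - z).
  by apply: ler_pM => //; lra.
rewrite -[leRHS]mulrA.
apply: (@le_trans _ _ (eps * (r / 8 * (r / 4)))); last by rewrite ler_pM2l.
have : eps / 64 * r * enorm (a - b) <= eps / 64 * r * r.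
  by rewrite ler_wpM2l ?mulr_ge0 ?divr_ge0 ?ltW.
have : 0 <= eps * r * r by rewrite !mulr_ge0 ?ltW.
lra.
Qed.

Lemma corkscrew_volume Om (eps delta : R) : (0 < N)%N -> bounded_set Om ->
  eps_delta_domain Om eps delta ->
  exists r0 c : R, [/\ 0 < r0, 0 < c & forall y r, boundary Om y -> 0 < r -> r <= r0 ->
    ((c * r ^+ N)%:E <= lebesgue_rV R N (eball y r `&` Om))%E].
Proof.
move=> N0 bO hO; have [r0 [c [r00 c0 h]]] := corkscrew N0 bO hO.
have [oO _ _ _ _] := hO.
have [M _ OM] := bounded_enorm bO; have nO := nonsurj_bounded N0 OM.
pose c' := Num.min c 1; have c'0 : 0 < c' by rewrite lt_min c0 ltr01.
exists r0, ((2 / N.+1%:R * (c' / 2)) ^+ N); split => //.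
  by rewrite exprn_gt0// mulr_gt0 ?divr_gt0.
move=> y r by0 r_gt0 rr0.
have [z [Oz zy cz]] := h y (r / 2) by0 (divr_gt0 r_gt0 (ltr0n R 2)) (ltac:(lra)).
rewrite -exprMn -[_ * r]mulrA.
have rz : 0 < c' / 2 * r by rewrite mulr_gt0// divr_gt0.
apply: le_trans (leb_eball_ge z rz) _.
apply: le_measure; rewrite ?inE.
- exact: measurable_eball.
- by apply: measurableI; [exact: measurable_eball|exact: open_measurable_rV].
have c'c : c' <= c by rewrite ge_min lexx.
have c'1 : c' <= 1 by rewrite ge_min lexx orbT.
have cc : c' / 2 * r <= c * (r / 2).
  by rewrite mulrAC [leRHS]mulrA ler_wpM2r// ler_wpM2r// ltW.
have c1 : c' / 2 * r <= r / 2.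
  by rewrite mulrAC ler_wpM2r// ler_piMl// ltW.
move=> x; rewrite /eball/= => xz; split.
  have := enorm_triangle z x y; rewrite /eball/=; lra.
by apply: (dist_compl_eball (z := z)); lra.
Qed.

End geometry.

Section measurability_automation.
Context d1 d2 d3 (T1 : measurableType d1) (T2 : measurableType d2) (T3 : measurableType d3).

Lemma measurable_proj1 (f : T1 -> T2 * T3) :
  measurable_fun setT f -> measurable_fun setT (fun x => (f x).1).
Proof. by move=> mf; exact: (measurableT_comp measurable_fst mf). Qed.

Lemma measurable_proj2 (f : T1 -> T2 * T3) :
  measurable_fun setT f -> measurable_fun setT (fun x => (f x).2).
Proof. by move=> mf; exact: (measurableT_comp measurable_snd mf). Qed.

Lemma measurable_compT (g : T2 -> T3) (f : T1 -> T2) :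
  measurable_fun setT g -> measurable_fun setT f -> measurable_fun setT (fun x => g (f x)).
Proof. by move=> mg mf; exact: (measurableT_comp mg mf). Qed.

End measurability_automation.

Ltac mfun1 := lazymatch goal with
  | H : measurable_fun ?D ?f |- measurable_fun ?D ?f => exact: H
  | |- measurable_fun _ (fun x => ((@?f x)%:E)%E) => apply/measurable_EFinP
  | |- measurable_fun _ (fun x => (@?f x * @?g x)%E) => apply: emeasurable_funM
  | |- measurable_fun _ (fun x => (@?f x * @?g x)%R) => apply: measurable_funM
  | |- measurable_fun _ (fun x => (@?f x - @?g x)%R) => apply: measurable_funB
  | |- measurable_fun _ (fun x => (@?f x + @?g x)%R) =>
      first [apply: measurable_funD | apply: emeasurable_funD]
  | |- measurable_fun _ (fun x => (@?f x ^+ _)%R) => apply: measurable_funX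
  | |- measurable_fun _ (fun x => (@?f x `^ _)%R) => apply: measurable_funpow
  | |- measurable_fun _ (fun x => GRing.natmul _ (nat_of_bool (@Order.lt _ _ (@?f x) (@?g x)))) => apply: measurable_ltR
  | |- measurable_fun _ (fun x => GRing.natmul _ (nat_of_bool (@Order.le _ _ (@?f x) (@?g x)))) => apply: measurable_leR
  | |- measurable_fun _ (fun x => enorm (@?f x - @?g x)) => apply: measurable_dist
  | |- measurable_fun _ (fun x => (@?f x, @?g x)) => apply: measurable_fun_pair
  | H : measurable_fun _ ?v |- measurable_fun _ (fun x => ?v (@?f x)) =>
      apply: (measurable_compT H)
  | |- measurable_fun _ (fun x => (@?f x).1) => apply: measurable_proj1
  | |- measurable_fun _ (fun x => (@?f x).2) => apply: measurable_proj2
  | |- measurable_fun _ fst => exact: measurable_fst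
  | |- measurable_fun _ snd => exact: measurable_snd
  | |- measurable_fun _ (fun x => x) => exact: measurable_id
  | |- measurable_fun _ (fun x => ?c) => exact: measurable_cst
  end.
Ltac mfun := repeat mfun1.

(** * Energies at dyadic scales and traces *)

Section restricted_measure.
Context d (T : measurableType d) (R : realType).
Variables (m : {measure set T -> \bar R}) (D : set T).
Hypothesis mD : measurable D.

Lemma ge0_integral_mrestr (f : T -> \bar R) :
  measurable_fun setT f -> (forall x, (0 <= f x)%E) ->
  (\int[mrestr m mD]_x f x = \int[m]_(x in D) f x)%E.
Proof.
move=> mf f0.
rewrite (@ge0_negligible_integral _ _ _ (mrestr m mD) setT (~` D))//; last 2 first.
- exact: measurableC.
- by have h : m (~` D `&` D) = 0%E; [rewrite setICl measure0|exact: h].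
rewrite setTD setCK; apply: eq_measure_integral => A mA AD.
by have h : m (A `&` D) = m A; [rewrite setIidl|exact: h].
Qed.

End restricted_measure.

Section dyadic_sum.
Context (R : realType).
Implicit Types (p c a : R).

Lemma dyadic_sum_le p c a (r0 : R) : 0 < p -> 0 < c -> 0 < a -> 0 < r0 ->
  (\sum_(k <oo) (((a < c * (r0 * 2^-1 ^+ k))%R%:R * (r0 * 2^-1 ^+ k) `^ (- p)))%:E <=
   (2 `^ p / (2 `^ p - 1) * c `^ p * a `^ (- p))%:E)%E.
Proof.
move=> p0 c0 a0 r00; pose r k := r0 * 2^-1 ^+ k.
have r_gt0 k : 0 < r k by rewrite mulr_gt0// exprn_gt0// invr_gt0.
have q1 : 1 < 2 `^ p :> R.
  by have := @gt0_ltr_powR R _ p0 1 2; rewrite powR1; apply; rewrite ?nnegrE ?ltr1n.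
have rS k : r k.+1 `^ (- p) = 2 `^ p * r k `^ (- p).
  rewrite /r exprSr mulrA powRM ?invr_ge0 ?(ltW (r_gt0 k))// mulrC; congr (_ * _).
  by rewrite -powR_inv1// -powRrM mulrNN mul1r.
pose B := 2 `^ p * c `^ p * a `^ (- p).
pose f n := \sum_(0 <= k < n) ((a < c * r k)%R%:R * r k `^ (- p)).
have key n : f n <= (2 `^ p - 1)^-1 * r n `^ (- p) /\ f n <= (2 `^ p - 1)^-1 * B.
  elim: n => [|n [IH1 IH2]].
    rewrite /f big_nil; split; rewrite !mulr_ge0 ?powR_ge0 ?invr_ge0 ?subr_ge0 ?(ltW q1)//.
  have fS : f n.+1 = f n + (a < c * r n)%R%:R * r n `^ (- p) by rewrite /f big_nat_recr.
  have up : r n `^ (- p) <= r n.+1 `^ (- p).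
    by rewrite rS ler_peMl ?powR_ge0// ltW.
  have [h|h] := ltP a (c * r n); rewrite fS ?h.
    have e : (2 `^ p - 1)^-1 * r n `^ (- p) + r n `^ (- p) = (2 `^ p - 1)^-1 * r n.+1 `^ (- p).
      by rewrite rS; field; rewrite subr_eq0 gt_eqF.
    rewrite mul1r; split; first by rewrite -e lerD2r.
    apply: (@le_trans _ _ ((2 `^ p - 1)^-1 * r n.+1 `^ (- p))); first by rewrite -e lerD2r.
    rewrite ler_wpM2l ?invr_ge0 ?subr_ge0 ?(ltW q1)// rS /B -mulrA ler_wpM2l ?powR_ge0//.
    rewrite !powRN ler_pdivlMr ?powR_gt0// mulrC ler_pdivrMr ?powR_gt0//.
    by rewrite -powRM ?(ltW c0) ?(ltW (r_gt0 n))// powR_le// ltW.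
  rewrite ltNge h mul0r addr0; split=> //; apply: le_trans IH1 _.
  by rewrite ler_wpM2l// invr_ge0 subr_ge0 ltW.
apply: lime_le.
  by apply: is_cvg_nneseries => k _ _; rewrite lee_fin mulr_ge0// powR_ge0.
near=> n; rewrite sumEFin lee_fin; apply: le_trans (key n).2 _.
by rewrite le_eqVlt; apply/orP; left; apply/eqP; rewrite /B; ring.
Unshelve. all: by end_near. Qed.

End dyadic_sum.

Section energies.
Local Open Scope ereal_scope.
Context (R : realType) (N : nat).
Local Notation E := 'rV[R]_N.
Variables (m : {sigma_finite_measure set E -> \bar R}) (u : E -> R).
Hypothesis mu_ : measurable_fun setT u.

Definition near_energy (m : {sigma_finite_measure set E -> \bar R}) (u : E -> R) (r : R) : \bar R :=
  \int[m]_x \int[m]_y ((enorm (x - y) < r)%R%:R * (u x - u y) ^+ 2)%:E.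

Definition power_energy (m : {sigma_finite_measure set E -> \bar R}) (u : E -> R) (p : R) : \bar R :=
  \int[m]_x \int[m]_y ((u x - u y) ^+ 2 * enorm (x - y) `^ (- p))%:E.

Lemma power_energy_ge0 p : 0 <= power_energy m u p.
Proof.
apply: int_ge0 => x; apply: int_ge0 => y.
by rewrite lee_fin mulr_ge0 ?sqr_ge0 ?powR_ge0.
Qed.

Lemma near_energy_ge0 r : 0 <= near_energy m u r.
Proof. by apply: int_ge0 => x; apply: int_ge0 => y; rewrite lee_fin mulr_ge0 ?sqr_ge0. Qed.

Lemma near_energy_le (p r : R) : (0 <= p)%R -> (0 < r)%R ->
  near_energy m u r <= (r `^ p)%:E * power_energy m u p.
Proof.
move=> p0 r0; rewrite -ge0_integralZl//; last 3 first.
- apply: (@measurable_int2 _ _ _ _ _ _ (fun x y => ((u x - u y) ^+ 2 * enorm (x - y) `^ (- p))%:E)).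
    by mfun.
  by move=> x y; rewrite lee_fin mulr_ge0 ?sqr_ge0 ?powR_ge0.
- by move=> x _; apply: int_ge0 => y; rewrite lee_fin mulr_ge0 ?sqr_ge0 ?powR_ge0.
- by rewrite lee_fin powR_ge0.
apply: ge0_le_int => x _; first by apply: int_ge0 => y; rewrite lee_fin mulr_ge0 ?sqr_ge0.
rewrite -ge0_integralZl//; last 3 first.
- by mfun.
- by move=> y _; rewrite lee_fin mulr_ge0 ?sqr_ge0 ?powR_ge0.
- by rewrite lee_fin powR_ge0.
apply: ge0_le_int => y _; first by rewrite lee_fin mulr_ge0 ?sqr_ge0.
rewrite -EFinM lee_fin.
have [->|xy] := eqVneq x y; first by rewrite (subrr (u y)) expr0n !(mul0r, mulr0).
rewrite mulrC [leRHS]mulrCA ler_wpM2l ?sqr_ge0//.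
have [h|h] := ltP (enorm (x - y)) r; last by rewrite mulr_ge0 ?powR_ge0.
have h0 : (0 < enorm (x - y))%R by rewrite lt_neqAle enorm_ge0 eq_sym enorm_eq0 subr_eq0 xy.
by rewrite powRN ler_pdivlMr ?powR_gt0// mul1r powR_le ?enorm_ge0// ltW.
Qed.

(* [near_energy] at the dyadic scales, weighted by the inverse p-th power of the
   scale, resums to [power_energy]. *)
Lemma sum_near_energy_le (p c r0 : R) : (0 < p)%R -> (0 < c)%R -> (0 < r0)%R ->
  \sum_(k <oo) (((r0 * 2^-1 ^+ k) `^ (- p))%:E * near_energy m u (c * (r0 * 2^-1 ^+ k))) <=
  (2 `^ p / (2 `^ p - 1) * c `^ p)%:E * power_energy m u p.
Proof.
move=> p0 c0 r00; pose r k := (r0 * 2^-1 ^+ k)%R.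
pose g k (x y : E) := ((r k `^ (- p)) * ((enorm (x - y) < c * r k)%R%:R * (u x - u y) ^+ 2))%:E.
have g0 k (x y : E) : 0 <= g k x y by rewrite lee_fin mulr_ge0 ?powR_ge0// mulr_ge0 ?sqr_ge0.
have mg k : measurable_fun setT (fun q : E * E => g k q.1 q.2) by rewrite /g; mfun.
have C0 : (0 <= 2 `^ p / (2 `^ p - 1) * c `^ p :> R)%R.
  rewrite mulr_ge0 ?powR_ge0// divr_ge0 ?powR_ge0// subr_ge0.
  by have := @powR_le R p 1 2; rewrite powR1; apply; rewrite ?ltW// ltr1n.
have -> : \sum_(k <oo) ((r k `^ (- p))%:E * near_energy m u (c * r k)) =
    \int[m]_x \int[m]_y \sum_(k <oo) g k x y.
  rewrite [RHS](eq_integral (fun x => \sum_(k <oo) \int[m]_y g k x y)); last first.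
    move=> x _; rewrite integral_nneseries// => k.
    by rewrite /g; mfun.
  rewrite integral_nneseries//; last 2 first.
  - by move=> k; exact: measurable_int2.
  - by move=> k x _; exact: int_ge0.
  apply: eq_eseriesr => k _.
  rewrite -ge0_integralZl//; last 3 first.
  - apply: (@measurable_int2 _ _ _ _ _ _ (fun x y : E => ((enorm (x - y) < c * r k)%R%:R * (u x - u y) ^+ 2)%:E)).
      by mfun.
    by move=> x y; rewrite lee_fin mulr_ge0 ?sqr_ge0.
  - by move=> x _; apply: int_ge0 => y; rewrite lee_fin mulr_ge0 ?sqr_ge0.
  - by rewrite lee_fin powR_ge0.
  apply: eq_integral => x _; rewrite -ge0_integralZl//.
  - by mfun.
  - by move=> y _; rewrite lee_fin mulr_ge0 ?sqr_ge0.
  - by rewrite lee_fin powR_ge0.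
rewrite -ge0_integralZl//; last 2 first.
- apply: (@measurable_int2 _ _ _ _ _ _ (fun x y => ((u x - u y) ^+ 2 * enorm (x - y) `^ (- p))%:E)).
    by mfun.
  by move=> x y; rewrite lee_fin mulr_ge0 ?sqr_ge0 ?powR_ge0.
- by move=> x _; apply: int_ge0 => y; rewrite lee_fin mulr_ge0 ?sqr_ge0 ?powR_ge0.
apply: ge0_le_int => x _; first by apply: int_ge0 => y; exact: nneseries_ge0.
rewrite -ge0_integralZl//; last 2 first.
- by mfun.
- by move=> y _; rewrite lee_fin mulr_ge0 ?sqr_ge0 ?powR_ge0.
apply: ge0_le_int => y _; first exact: nneseries_ge0.
have [->|xy] := eqVneq x y.
  rewrite eseries0; first by rewrite (subrr (u y)) expr0n mul0r mule0.
  by move=> k _ _; rewrite /g (subrr (u y)) expr0n !mulr0.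
have h0 : (0 < enorm (x - y))%R by rewrite lt_neqAle enorm_ge0 eq_sym enorm_eq0 subr_eq0 xy.
rewrite (eq_eseriesr (g := fun k => ((u x - u y) ^+ 2)%:E *
  ((enorm (x - y) < c * r k)%R%:R * r k `^ (- p))%:E)); last first.
  by move=> k _; rewrite /g -EFinM; congr EFin; ring.
rewrite nneseriesZl//; last by move=> k _; rewrite lee_fin mulr_ge0// powR_ge0.
apply: le_trans (lee_wpmul2l _ (dyadic_sum_le p0 c0 h0 r00)) _.
  by rewrite lee_fin sqr_ge0.
by rewrite -!EFinM lee_fin le_eqVlt; apply/orP; left; apply/eqP; ring.
Qed.

End energies.

Section averages.
Context d (T : measurableType d) (R : realType).
Variable m : {measure set T -> \bar R}.

Definition average (A : set T) (v : T -> R) : R := (\int[m]_(x in A) v x) / fine (m A).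

Lemma L2_integrable (A : set T) (v : T -> R) : measurable A -> measurable_fun A v ->
  (m A < +oo)%E -> (\int[m]_(x in A) (v x ^+ 2)%:E < +oo)%E ->
  m.-integrable A (EFin \o v).
Proof.
move=> mA mv Aoo v2.
have -> : EFin \o v = EFin \o (fun x => v x * 1) by apply/funext => x /=; rewrite mulr1.
apply: integrable_mul => //.
rewrite (eq_integral (cst 1%:E)); last by move=> x _; rewrite expr1n.
by rewrite integral_cst// mul1e.
Qed.

Lemma L2_sub_cst (A : set T) (v : T -> R) (c : R) : measurable A -> measurable_fun A v ->
  (m A < +oo)%E -> (\int[m]_(x in A) (v x ^+ 2)%:E < +oo)%E ->
  (\int[m]_(x in A) ((v x - c) ^+ 2)%:E < +oo)%E.
Proof.
move=> mA mv Aoo v2.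
apply: (@le_lt_trans _ _ (\int[m]_(x in A) (2%:E * (v x ^+ 2)%:E + (2 * c ^+ 2)%:E))%E).
  apply: ge0_le_int => x _; first by rewrite lee_fin sqr_ge0.
  rewrite -EFinM -EFinD lee_fin; have := sqr_ge0 (v x + c); nra.
have mv2 : measurable_fun A (fun x => (v x ^+ 2)%:E).
  by apply/measurable_EFinP; exact: measurable_funX.
rewrite ge0_integralD//; last 3 first.
- by move=> x _; rewrite mule_ge0// lee_fin sqr_ge0.
- by apply: emeasurable_funM.
- by move=> x _; rewrite lee_fin mulr_ge0// sqr_ge0.
rewrite ge0_integralZl//; last by move=> x _; rewrite lee_fin sqr_ge0.
rewrite (integral_cst m mA (2 * c ^+ 2)%:E).
by apply: lte_add_pinfty; apply: lte_mul_pinfty => //; rewrite lee_fin mulr_ge0// sqr_ge0.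
Qed.

Lemma average_sq_le (A : set T) (v : T -> R) (c : R) : measurable A -> measurable_fun A v ->
  (m A < +oo)%E -> (0 < m A)%E -> (\int[m]_(x in A) (v x ^+ 2)%:E < +oo)%E ->
  (((average A v - c) ^+ 2 * fine (m A))%:E <= \int[m]_(x in A) ((v x - c) ^+ 2)%:E)%E.
Proof.
move=> mA mv Aoo A0 v2.
have fA : m A \is a fin_num by rewrite ge0_fin_numE.
have V0 : 0 < fine (m A) by rewrite fine_gt0// A0 Aoo.
have mvc : measurable_fun A (fun x => v x - c) by apply: measurable_funB.
have iv := L2_integrable mA mv Aoo v2.
have ic : m.-integrable A (EFin \o cst c).
  apply: L2_integrable => //.
    by rewrite (integral_cst m mA (c ^+ 2)%:E) lte_mul_pinfty// lee_fin sqr_ge0.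
have e : \int[m]_(x in A) ((v x - c) * 1) = fine (m A) * (average A v - c).
  have -> : \int[m]_(x in A) ((v x - c) * 1) = \int[m]_(x in A) (v x - c).
    by apply: eq_Rintegral => x _; rewrite mulr1.
  rewrite RintegralB// Rintegral_cst// /average mulrBr mulrCA divff ?gt_eqF// mulr1.
  by rewrite [c * _]mulrC.
have vc2 := L2_sub_cst c mA mv Aoo v2.
have := @cauchy_bounded _ _ _ m (fun x => v x - c) (cst 1) A 1 (fine (m A)) mA mvc
  (measurable_cst _) vc2.
rewrite fineK// => /(_ (lexx _) ler01 _); rewrite e expr1n mul1r => h.
have {}h := h (fun x _ => ltac:(by rewrite normr1)).
rewrite -(@lee_pmul2l _ (fine (m A))%:E)//.
apply: le_trans h; rewrite -EFinM lee_fin le_eqVlt; apply/orP; left; apply/eqP; ring.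
Qed.

End averages.

Section scales.
Context (R : realType).

Lemma powR_small (C al e r0 : R) : 0 <= C -> 0 < al -> 0 < e -> 0 < r0 ->
  exists r, [/\ 0 < r, r <= r0 & C * r `^ al < e].
Proof.
move=> C0 al0 e0 r00; pose t := (e / (C + 1)) `^ al^-1.
have C1 : 0 < C + 1 by lra.
have t0 : 0 < t by rewrite powR_gt0// divr_gt0.
exists (Num.min r0 t); have m0 : 0 < Num.min r0 t by rewrite lt_min r00.
split=> //; first by rewrite ge_min lexx.
apply: (@le_lt_trans _ _ (C * (e / (C + 1)))).
  rewrite ler_wpM2l//; apply: (@le_trans _ _ (t `^ al)).
    by rewrite powR_le ?(ltW al0) ?(ltW m0)// ge_min lexx orbT.
  by rewrite /t -powRrM mulVf ?gt_eqF// powRr1// ltW// divr_gt0.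
by rewrite mulrCA gtr_pMr// ltr_pdivrMr// mul1r; lra.
Qed.

Definition scale_const (al : R) : R := (1 - 2 `^ (- al))^-1 + 1.

Lemma scale_const_ge0 al : 0 < al -> 0 <= scale_const al.
Proof.
move=> al0; rewrite addr_ge0// invr_ge0 ltW//.
by have := @layer_denom_gt0 R 0 al; rewrite sub0r normrN gtr0_norm//; apply; rewrite lt_eqF.
Qed.

Lemma scale_cauchy (a : R -> R) (B al r0 : R) : 0 <= B -> 0 < al -> 0 < r0 ->
  (forall r r', 0 < r -> r <= r0 -> r / 2 <= r' -> r' <= r -> `|a r - a r'| <= B * r `^ al) ->
  exists2 L, a r @[r --> (0:R)^'+] --> L &
    forall r, 0 < r -> r <= r0 -> `|a r - L| <= scale_const al * B * r `^ al.
Proof.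
move=> B0 al0 r00 ha; set q := 2 `^ (- al).
have q1 : 0 < 1 - q.
  by have := @layer_denom_gt0 R 0 al; rewrite sub0r normrN gtr0_norm//; apply; rewrite lt_eqF.
have half r : 0 <= r -> (r / 2) `^ al = q * r `^ al.
  by move=> r0_; rewrite powRM ?invr_ge0// mulrC /q -powR_inv1// -powRrM mulN1r.
have step j : forall r, 0 < r -> r <= r0 -> `|a r - a (r * 2^-1 ^+ j)| <= (1 - q)^-1 * B * r `^ al.
  elim: j => [|j IH] r r_gt0 rr0.
    by rewrite expr0 mulr1 subrr normr0 !mulr_ge0 ?powR_ge0// invr_ge0 ltW.
  have r2 : 0 < r / 2 by rewrite divr_gt0.
  have {IH} := IH (r / 2) r2 (ltac:(lra)); rewrite -mulrA -exprS half ?(ltW r_gt0)// => h.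
  have := ha r (r / 2) r_gt0 rr0 (lexx _) (ltac:(lra)) => h2.
  apply: le_trans (ler_distD (a (r / 2)) _ _) _.
  apply: le_trans (lerD h2 h) _.
  rewrite le_eqVlt; apply/orP; left; apply/eqP; field.
  by rewrite gt_eqF.
have main r r' : 0 < r' -> r' <= r -> r <= r0 -> `|a r - a r'| <= scale_const al * B * r `^ al.
  move=> r'0; rewrite le_eqVlt => /orP[/eqP <- rr0|r'r rr0].
    by rewrite subrr normr0 mulr_ge0 ?powR_ge0// mulr_ge0// scale_const_ge0.
  have r_gt0 := lt_trans r'0 r'r.
  have [k [k1 k2]] := dyadic_ex r'0 r'r.
  have rk0 : 0 < r * 2^-1 ^+ k by rewrite mulr_gt0// exprn_gt0// invr_gt0.
  have rkr : r * 2^-1 ^+ k <= r by rewrite ler_piMr ?(ltW r_gt0)// exprn_ile1// ?invr_ge0// invf_le1// ler1n.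
  have h1 := step k r r_gt0 rr0.
  have h2 := ha (r * 2^-1 ^+ k) r' rk0 (le_trans rkr rr0).
  have {}h2 := h2 (ltac:(by rewrite -mulrA -exprSr)) (ltW k2).
  apply: le_trans (ler_distD (a (r * 2^-1 ^+ k)) _ _) _.
  apply: le_trans (lerD h1 h2) _.
  rewrite /scale_const -/q mulrDl mul1r mulrDl lerD2l ler_wpM2l// powR_le ?(ltW al0)// ltW//.
have C0 : 0 <= scale_const al * B by rewrite mulr_ge0 ?scale_const_ge0.
have cv : cvg (a r @[r --> (0:R)^'+]).
  apply/cauchy_cvgP; apply: cauchy_exP => e e0.
  have [r [r_gt0 rr0 re]] := powR_small C0 al0 e0 r00.
  exists (a r).
  have : \forall r' \near (0:R)^'+, ball (a r) e (a r'); last by [].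
  near=> r'; apply: le_lt_trans re; apply: main => //.
  by near: r'; apply: nbhs_right_le.
exists (lim (a r @[r --> (0:R)^'+])); first exact: cv.
move=> r r_gt0 rr0; apply/ler_addgt0Pr => e e0.
have /cvgrPdist_lt/(_ e e0) near_l : a r @[r --> (0:R)^'+] --> lim (a r @[r --> (0:R)^'+]) by exact: cv.
near (0:R)^'+ => r'.
have h : `|lim (a r @[r --> (0:R)^'+]) - a r'| < e by near: r'.
apply: le_trans (ler_distD (a r') _ _) _.
apply: lerD; last by rewrite distrC ltW.
apply: main => //; near: r'; exact: nbhs_right_le.
Unshelve. all: by end_near. Qed.

End scales.

Section trace_of_finite_energy.
Local Open Scope ereal_scope.
Context (R : realType) (N : nat).
Local Notation E := 'rV[R]_N.
Variables la nu : {sigma_finite_measure set E -> \bar R}.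
Variables (d al c Cu Cl r0 : R).
Let p : R := (2 * al + 2 * N%:R - d)%R.
Hypotheses (al0 : (0 < al)%R) (p0 : (0 < p)%R) (c0 : (0 < c)%R).
Hypotheses (Cu0 : (0 <= Cu)%R) (Cl0 : (0 <= Cl)%R) (r00 : (0 < r0)%R).
Hypothesis nu_up : forall (x : E) (r : R), (0 < r)%R -> nu (eball x r) <= (Cu * r `^ d)%:E.
Hypothesis la_up : forall (x : E) (r : R), (0 < r)%R -> la (eball x r) <= (Cl * r `^ N%:R)%:E.

Definition thick (la : {measure set E -> \bar R}) (c r0 : R) (y : E) : Prop :=
  forall r, (0 < r)%R -> (r <= r0)%R -> (c * r `^ N%:R)%:E <= la (eball y r).

Variable v : E -> R.
Hypotheses (mv : measurable_fun setT v) (v2 : \int[la]_x (v x ^+ 2)%:E < +oo).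

Definition osc (la : {measure set E -> \bar R}) (v : E -> R) (y : E) (r : R) : \bar R :=
  \int[la]_z \int[la]_w
    ((enorm (z - y) < r)%R%:R * ((enorm (w - y) < r)%R%:R * (v z - v w) ^+ 2))%:E.

Let sq0 (z w : E) : (0 <= (v z - v w) ^+ 2)%R. Proof. exact: sqr_ge0. Qed.

Lemma osc_ge0 y r : 0 <= osc la v y r.
Proof. by apply: int_ge0 => z; apply: int_ge0 => w; rewrite lee_fin mulr_ge0// mulr_ge0. Qed.

Lemma measurable_osc r : measurable_fun setT (fun y => osc la v y r).
Proof.
apply: (@measurable_int2 _ _ _ _ _ _ (fun y z : E => \int[la]_w
    ((enorm (z - y) < r)%R%:R * ((enorm (w - y) < r)%R%:R * (v z - v w) ^+ 2))%:E)); last first.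
  by move=> y z; apply: int_ge0 => w; rewrite lee_fin mulr_ge0// mulr_ge0.
apply: (@measurable_int2 _ _ _ _ _ _ (fun (q : E * E) (w : E) =>
    ((enorm (q.2 - q.1) < r)%R%:R * ((enorm (w - q.1) < r)%R%:R * (v q.2 - v w) ^+ 2))%:E)).
  by mfun.
by move=> q w; rewrite lee_fin mulr_ge0// mulr_ge0.
Qed.

Lemma osc_le_mono y r r' : (r <= r')%R -> osc la v y r <= osc la v y r'.
Proof.
move=> rr; apply: ge0_le_int => z _.
  by apply: int_ge0 => w; rewrite lee_fin mulr_ge0// mulr_ge0.
apply: ge0_le_int => w _; rewrite lee_fin; first by rewrite mulr_ge0// mulr_ge0.
have mono (t : R) : (((t < r)%R%:R : R) <= (t < r')%R%:R)%R.
  by have [h|//] := ltP t r; rewrite (lt_le_trans h rr).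
by apply: ler_pM => //; [rewrite mulr_ge0|apply: ler_pM].
Qed.

Lemma int_osc_le r : (0 < r)%R ->
  \int[nu]_y osc la v y r <= (Cu * r `^ d)%:E * near_energy la v (2 * r).
Proof.
move=> r_gt0.
pose H (z : E) := \int[la]_w ((enorm (z - w) < 2 * r)%R%:R * (v z - v w) ^+ 2)%:E.
have mH : measurable_fun setT H.
  apply: (@measurable_int2 _ _ _ _ _ _ (fun z w : E => ((enorm (z - w) < 2 * r)%R%:R * (v z - v w) ^+ 2)%:E)).
    by mfun.
  by move=> z w; rewrite lee_fin mulr_ge0.
apply: (@le_trans _ _ (\int[nu]_y \int[la]_z (((enorm (z - y) < r)%R%:R)%:E * H z))).
  apply: ge0_le_int => y _; first exact: osc_ge0.
  apply: ge0_le_int => z _; first by apply: int_ge0 => w; rewrite lee_fin mulr_ge0// mulr_ge0.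
  rewrite -ge0_integralZl//; last 2 first.
  - by mfun.
  - by move=> w _; rewrite lee_fin mulr_ge0.
  apply: ge0_le_int => w _; first by rewrite lee_fin mulr_ge0// mulr_ge0.
  rewrite -EFinM lee_fin.
  have [h1|_] := ltP (enorm (z - y)) r; last by rewrite !mul0r.
  have [h2|_] := ltP (enorm (w - y)) r; last by rewrite mul0r mulr0 mulr_ge0// mulr_ge0.
  rewrite (_ : (enorm (z - w) < 2 * r)%R = true)//.
  have := enorm_triangle y z w; rewrite (enormB y w); lra.
apply: schur_le => //.
- by mfun.
- by move=> z; apply: int_ge0 => w; rewrite lee_fin mulr_ge0.
- by rewrite mulr_ge0// powR_ge0.
move=> z; apply: le_trans (nu_up z r_gt0).
rewrite -[leRHS]mul1e -(integral_cst nu (measurable_eball z r) 1).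
rewrite [leRHS]integral_mkcond; apply: ge0_le_int => y _; first by rewrite lee_fin.
rewrite patchE; have [h|h] := ltP (enorm (z - y)) r; last by case: ifP => _; rewrite ?lee_fin.
by rewrite mem_set// /eball/= enormB.
Qed.

Let rk k : R := (2 * r0 * 2^-1 ^+ k)%R.
Let rk0 k : (0 < rk k)%R.
Proof. by rewrite mulr_gt0 ?mulr_gt0// exprn_gt0// invr_gt0. Qed.

Definition osc_sum (la : {measure set E -> \bar R}) (al r0 : R) (v : E -> R) (y : E) : \bar R :=
  \sum_(k <oo) (((2 * r0 * 2^-1 ^+ k) `^ (- (2 * al + 2 * N%:R)))%:E * osc la v y (2 * r0 * 2^-1 ^+ k)).
Let S := osc_sum la al r0 v.

Let term0 k y : 0 <= ((rk k `^ (- (2 * al + 2 * N%:R)))%:E * osc la v y (rk k)).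
Proof. by rewrite mule_ge0 ?osc_ge0// lee_fin powR_ge0. Qed.

Lemma osc_sum_ge0 y : 0 <= S y.
Proof. by apply: nneseries_ge0 => k _ _; exact: term0. Qed.

Let mterm k : measurable_fun setT (fun y => (rk k `^ (- (2 * al + 2 * N%:R)))%:E * osc la v y (rk k)).
Proof. by apply: emeasurable_funM => //; exact: measurable_osc. Qed.

Lemma measurable_osc_sum : measurable_fun setT S.
Proof.
apply: ge0_emeasurable_sum => k.
  by move=> y _ _; exact: term0.
by move=> _; exact: mterm.
Qed.

Definition osc_const (Cu p : R) : R := (Cu * (2 `^ p / (2 `^ p - 1) * 2 `^ p))%R.

Lemma int_osc_sum_le : \int[nu]_y S y <= (osc_const Cu p)%:E * power_energy la v p.
Proof.
rewrite integral_nneseries//; last by move=> k y _; exact: term0.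
apply: (@le_trans _ _ (\sum_(k <oo) (Cu%:E * ((rk k `^ (- p))%:E * near_energy la v (2 * rk k))))).
  apply: lee_nneseries => k _ => [_|].
    by apply: integral_ge0 => y _; exact: term0.
  rewrite ge0_integralZl//; last 3 first.
  - exact: measurable_osc.
  - by move=> y _; exact: osc_ge0.
  - by rewrite lee_fin powR_ge0.
  apply: le_trans (lee_wpmul2l _ (int_osc_le (rk0 k))) _; first by rewrite lee_fin powR_ge0.
  rewrite !muleA lee_wpmul2r ?near_energy_ge0// -!EFinM lee_fin.
  by rewrite mulrCA -(powRDp _ _ (rk0 k)) le_eqVlt; apply/orP; left; apply/eqP; congr (_ * _ `^ _)%R; rewrite /p; ring.
rewrite nneseriesZl; last first.
  by move=> k _; rewrite mule_ge0 ?near_energy_ge0// lee_fin powR_ge0.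
rewrite /osc_const EFinM -muleA lee_wpmul2l//.
apply: sum_near_energy_le => //; by rewrite mulr_gt0.
Qed.

Let v2A (A : set E) : measurable A -> \int[la]_(x in A) (v x ^+ 2)%:E < +oo.
Proof.
move=> mA; apply: le_lt_trans v2; apply: ge0_subset_integral => //; first by mfun.
by move=> x _; rewrite lee_fin sqr_ge0.
Qed.

Let la_oo y r : (0 < r)%R -> la (eball y r) < +oo.
Proof. by move=> r_gt0; apply: le_lt_trans (la_up y r_gt0) _; rewrite ltry. Qed.

Let la_gt0 y r : thick la c r0 y -> (0 < r)%R -> (r <= r0)%R -> 0 < la (eball y r).
Proof.
move=> ty r_gt0 rr0; apply: lt_le_trans (ty _ r_gt0 rr0).
by rewrite lte_fin mulr_gt0// powR_gt0.
Qed.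

Let fine_la y r : thick la c r0 y -> (0 < r)%R -> (r <= r0)%R ->
  (c * r `^ N%:R <= fine (la (eball y r)))%R.
Proof.
move=> ty r_gt0 rr0; rewrite -lee_fin fineK; first exact: ty.
by rewrite ge0_fin_numE// la_oo.
Qed.

Lemma int_eball (m : {measure set E -> \bar R}) (y : E) r (f : E -> \bar R) :
  (forall x, 0 <= f x) ->
  \int[m]_(x in eball y r) f x = \int[m]_x (((enorm (x - y) < r)%R%:R)%:E * f x).
Proof.
move=> f0; rewrite integral_mkcond; apply: eq_integral => x _; rewrite patchE.
have [h|h] := ltP (enorm (x - y)) r; first by rewrite mem_set// mul1e.
by rewrite memNset ?mul0e// /eball/=; apply/negP; rewrite -leNgt.
Qed.

Lemma average_near_le x y r : thick la c r0 y -> (0 < r)%R -> (r <= r0)%R ->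
  ((average la (eball y r) v - v x) ^+ 2 * (c * r `^ N%:R))%:E <=
  \int[la]_z ((enorm (z - y) < r)%R%:R * (v z - v x) ^+ 2)%:E.
Proof.
move=> ty r_gt0 rr0.
have h := @average_sq_le _ _ _ la (eball y r) v (v x) (measurable_eball y r)
  (measurable_funTS mv) (la_oo y r_gt0) (la_gt0 ty r_gt0 rr0) (v2A (measurable_eball y r)).
rewrite int_eball in h; last by move=> z; rewrite lee_fin sqr_ge0.
apply: le_trans h; rewrite lee_fin ler_wpM2l ?sqr_ge0//; exact: fine_la.
Qed.

Lemma average_diff_le y r r' : thick la c r0 y -> (0 < r)%R -> (r <= r0)%R ->
  (0 < r')%R -> (r' <= r)%R ->
  ((average la (eball y r) v - average la (eball y r') v) ^+ 2 *
    (c * r `^ N%:R) * (c * r' `^ N%:R))%:E <= osc la v y r.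
Proof.
move=> ty r_gt0 rr0 r'_gt0 r'r; set b := average la (eball y r') v.
have h := @average_sq_le _ _ _ la (eball y r) v b (measurable_eball y r)
  (measurable_funTS mv) (la_oo y r_gt0) (la_gt0 ty r_gt0 rr0) (v2A (measurable_eball y r)).
rewrite int_eball in h; last by move=> z; rewrite lee_fin sqr_ge0.
have cr0 : (0 <= c * r' `^ N%:R)%R by rewrite mulr_ge0 ?powR_ge0// ltW.
apply: (@le_trans _ _ ((c * r' `^ N%:R)%:E * \int[la]_z (((enorm (z - y) < r)%R%:R)%:E * ((v z - b) ^+ 2)%:E))).
  rewrite mulrC EFinM; apply: lee_wpmul2l; first by rewrite lee_fin.
  apply: le_trans h; rewrite lee_fin ler_wpM2l ?sqr_ge0//; exact: fine_la.
rewrite -ge0_integralZl//; last 2 first.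
- by mfun.
- by move=> z _; rewrite mule_ge0// lee_fin ?sqr_ge0.
apply: ge0_le_int => z _.
  by rewrite -!EFinM lee_fin mulr_ge0// mulr_ge0// sqr_ge0.
have h2 := average_near_le z ty r'_gt0 (le_trans r'r rr0).
have [zr|zr] := ltP (enorm (z - y)) r; last first.
  by rewrite mul0e mule0; apply: int_ge0 => w; rewrite mul0r.
rewrite mul1e -EFinM mulrC.
have -> : ((v z - b) ^+ 2 = (b - v z) ^+ 2)%R by ring.
apply: le_trans h2 _; apply: ge0_le_int => w _; first by rewrite lee_fin mulr_ge0// sqr_ge0.
rewrite lee_fin mul1r.
have -> : ((v w - v z) ^+ 2 = (v z - v w) ^+ 2)%R by ring.
rewrite ler_wpM2r//.
by have [wr|//] := ltP (enorm (w - y)) r'; rewrite (lt_le_trans wr r'r).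
Qed.

Lemma osc_le_sum y r : (0 < r)%R -> (r <= r0)%R ->
  osc la v y r <= ((2 * r) `^ (2 * al + 2 * N%:R))%:E * S y.
Proof.
move=> r_gt0 rr0; have r2 : (r < 2 * r0)%R by lra.
have [k [k1 k2]] := dyadic_ex r_gt0 r2.
apply: le_trans (osc_le_mono y (ltW k2)) _.
have h : (rk k `^ (- (2 * al + 2 * N%:R)))%:E * osc la v y (rk k) <= S y.
  apply: le_trans (nneseries_lim_ge k.+1 _); last by move=> n ? _; exact: term0.
  by rewrite big_nat_recr//= leeDr// sume_ge0// => i _; exact: term0.
apply: (@le_trans _ _ ((rk k `^ (2 * al + 2 * N%:R))%:E * S y)).
  apply: le_trans (lee_wpmul2l _ h); last by rewrite lee_fin powR_ge0.
  by rewrite muleA -EFinM -powRDp// subrr powRr0 mul1e.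
rewrite lee_wpmul2r ?osc_sum_ge0// lee_fin powR_le ?(ltW (rk0 k))//.
  by rewrite addr_ge0// mulr_ge0// ltW.
by rewrite /rk; move: k1; rewrite exprSr mulrA; lra.
Qed.

Definition trace_const (c al : R) : R :=
  (scale_const al * Num.sqrt (c ^- 2 * 2 `^ N%:R * 2 `^ (2 * al + 2 * N%:R)))%R.

Lemma trace_cvg y : thick la c r0 y -> S y < +oo ->
  exists2 L, average la (eball y r) v @[r --> (0:R)%R^'+] --> L &
    forall r, (0 < r)%R -> (r <= r0)%R ->
      (`|average la (eball y r) v - L| <= trace_const c al * Num.sqrt (fine (S y)) * r `^ al)%R.
Proof.
move=> ty Sy.
have fS : S y \is a fin_num by rewrite ge0_fin_numE// osc_sum_ge0.
have S0 : (0 <= fine (S y))%R by rewrite fine_ge0// osc_sum_ge0.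
pose K := (c ^- 2 * 2 `^ N%:R * 2 `^ (2 * al + 2 * N%:R))%R.
have K0 : (0 <= K)%R by rewrite !mulr_ge0 ?powR_ge0// invr_ge0 exprn_ge0// ltW.
pose B := (Num.sqrt K * Num.sqrt (fine (S y)))%R.
have B0 : (0 <= B)%R by rewrite mulr_ge0// sqrtr_ge0.
have [|L hL1 hL2] := @scale_cauchy R (fun r => average la (eball y r) v) B al r0 B0 al0 r00; last first.
  by exists L => // r r_gt0 rr0; have := hL2 r r_gt0 rr0; rewrite /trace_const /B !mulrA.
move=> r r' r_gt0 rr0 r'1 r'2; have r'0 : (0 < r')%R by apply: lt_le_trans r'1; rewrite divr_gt0.
have h := le_trans (average_diff_le ty r_gt0 rr0 r'0 r'2) (osc_le_sum y r_gt0 rr0).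
rewrite -[S y]fineK// -EFinM lee_fin in h.
rewrite -ler_sqr ?nnegrE ?mulr_ge0 ?powR_ge0// real_normK ?num_real// /B !exprMn !sqr_sqrtr//.
set D := (_ ^+ 2)%R in h *.
have D0 : (0 <= D)%R by rewrite sqr_ge0.
have rN : (0 < r `^ N%:R)%R by rewrite powR_gt0.
have rN' : ((r / 2) `^ N%:R <= r' `^ N%:R)%R by rewrite powR_le// divr_ge0// ltW.
have e1 : (r `^ al ^+ 2 * (r `^ N%:R * r `^ N%:R) = r `^ (2 * al + 2 * N%:R))%R.
  by rewrite -expr2 -!powR_mulrn ?powR_ge0// -!powRrM -powRDp//; congr (_ `^ _)%R; ring.
have e2 : ((r / 2) `^ N%:R = r `^ N%:R / 2 `^ N%:R)%R.
  rewrite powRM ?(ltW r_gt0)//; congr (_ * _)%R.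
  by rewrite -[in LHS](powR_inv1 (ler0n R 2)) -powRrM mulN1r powRN.
have e3 : ((2 * r) `^ (2 * al + 2 * N%:R) = 2 `^ (2 * al + 2 * N%:R) * r `^ (2 * al + 2 * N%:R))%R.
  by rewrite powRM// ltW.
have two0 : (0 < 2 `^ N%:R :> R)%R by rewrite powR_gt0.
have h' : (D * (c * r `^ N%:R) * (c * (r `^ N%:R / 2 `^ N%:R)) <= 2 `^ (2 * al + 2 * N%:R) * (r `^ al ^+ 2 * (r `^ N%:R * r `^ N%:R)) * fine (S y))%R.
  rewrite e1 -e3; apply: le_trans h; rewrite -e2 ler_wpM2l ?ler_wpM2l ?(ltW c0)//.
  by rewrite mulr_ge0// mulr_ge0 ?powR_ge0 ?(ltW c0).
have cc : (0 < c ^+ 2 * (r `^ N%:R * r `^ N%:R) / 2 `^ N%:R)%R.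
  by rewrite divr_gt0// mulr_gt0 ?exprn_gt0// mulr_gt0.
rewrite -(ler_pM2r cc).
apply: le_trans (le_trans _ h') _; rewrite le_eqVlt; apply/orP; left; apply/eqP.
  by field; rewrite gt_eqF.
by rewrite /K; field; rewrite !gt_eqF.
Qed.

Lemma value_le_trace0 (x y : E) r : thick la c r0 y -> S y < +oo ->
  lim (average la (eball y r) v @[r --> (0:R)%R^'+]) = 0%R ->
  (0 < r)%R -> (r <= r0)%R -> (enorm (x - y) < r)%R ->
  (v x ^+ 2)%:E <=
    (2 / (c * r `^ N%:R))%:E * \int[la]_w ((enorm (x - w) < 2 * r)%R%:R * (v x - v w) ^+ 2)%:E +
    (2 * trace_const c al ^+ 2 * r `^ (2 * al))%:E * S y.
Proof.
move=> ty Sy L0 r_gt0 rr0 xy.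
have [L cL hL] := trace_cvg ty Sy.
have {L0}L0 : L = 0%R by rewrite -L0; apply/esym/cvg_lim.
have cr : (0 < c * r `^ N%:R)%R by rewrite mulr_gt0// powR_gt0.
have h1 := average_near_le x ty r_gt0 rr0.
have h2 := hL r r_gt0 rr0; rewrite L0 subr0 in h2.
have fS : S y \is a fin_num by rewrite ge0_fin_numE// osc_sum_ge0.
have S0 : (0 <= fine (S y))%R by rewrite fine_ge0// osc_sum_ge0.
set a := average _ _ _ in h1 h2.
have a2 : (a ^+ 2 <= trace_const c al ^+ 2 * r `^ (2 * al) * fine (S y))%R.
  rewrite -[X in (X <= _)%R]real_normK ?num_real//.
  have t0 : (0 <= trace_const c al)%R by rewrite mulr_ge0 ?sqrtr_ge0// scale_const_ge0.
  have T0 : (0 <= trace_const c al * Num.sqrt (fine (S y)) * r `^ al)%R.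
    by rewrite mulr_ge0 ?powR_ge0// mulr_ge0 ?sqrtr_ge0.
  have := @lerXn2r R 2%N `|a|%R (trace_const c al * Num.sqrt (fine (S y)) * r `^ al)%R.
  rewrite !nnegrE normr_ge0 T0 => /(_ isT isT h2).
  have e : (r `^ al ^+ 2 = r `^ (2 * al))%R.
    by rewrite -powR_mulrn ?powR_ge0// -powRrM mulrC.
  by move: (trace_const c al) => tc; rewrite !exprMn sqr_sqrtr// e mulrAC.
apply: (@le_trans _ _ ((2 * (a - v x) ^+ 2 + 2 * a ^+ 2)%:E)).
  by rewrite lee_fin; have := sqr_ge0 (v x - 2 * a)%R; nra.
rewrite EFinD; apply: leeD.
  apply: (@le_trans _ _ ((2 / (c * r `^ N%:R))%:E * ((a - v x) ^+ 2 * (c * r `^ N%:R))%:E)).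
    rewrite -EFinM lee_fin le_eqVlt; apply/orP; left; apply/eqP; field.
    by rewrite !gt_eqF ?powR_gt0.
  apply: lee_wpmul2l; first by rewrite lee_fin divr_ge0// ltW.
  apply: le_trans h1 _; apply: ge0_le_int => w _; rewrite lee_fin.
    by rewrite mulr_ge0// sqr_ge0.
  have [wy|wy] := ltP (enorm (w - y)) r; last by rewrite mul0r mulr_ge0.
  rewrite (_ : (enorm (x - w) < 2 * r)%R = true).
    by rewrite !mul1r le_eqVlt; apply/orP; left; apply/eqP; ring.
  have := enorm_triangle y x w; rewrite (enormB y w); lra.
rewrite -[S y]fineK// -EFinM lee_fin; move: a2; lra.
Qed.

Definition layer_bound (c cl Cu Cl al p : R) : R :=
  ((2 * Cu / c * 2 `^ p + 2 * trace_const c al ^+ 2 * Cl * osc_const Cu p) / cl)%R.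

Lemma trace0_layer_le (W : set E) cl r : measurable W -> (0 < cl)%R -> (0 < r)%R -> (r <= r0)%R ->
  (forall x, W x -> (cl * r `^ d)%:E <= nu (eball x r)) ->
  {ae nu, forall y, thick la c r0 y} ->
  {ae nu, forall y, lim (average la (eball y r) v @[r --> (0:R)%R^'+]) = 0%R} ->
  power_energy la v p < +oo ->
  \int[la]_(x in W) (v x ^+ 2)%:E <=
    (layer_bound c cl Cu Cl al p * r `^ (p - N%:R))%:E * power_energy la v p.
Proof.
move=> mW cl0 r_gt0 rr0 hW aeT aeL Eoo.
have cr : (0 < c * r `^ N%:R)%R by rewrite mulr_gt0// powR_gt0.
have C10 : (0 <= osc_const Cu p)%R.
  rewrite mulr_ge0// mulr_ge0 ?powR_ge0// divr_ge0 ?powR_ge0// subr_ge0.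
  by have := @powR_le R p 1 2; rewrite powR1; apply; rewrite ?(ltW p0)// ler1n.
pose G (x : E) := \int[la]_w ((enorm (x - w) < 2 * r)%R%:R * (v x - v w) ^+ 2)%:E.
have G0 x : 0 <= G x by apply: int_ge0 => w; rewrite lee_fin mulr_ge0.
have mG : measurable_fun setT G.
  apply: (@measurable_int2 _ _ _ _ _ _ (fun x w : E => ((enorm (x - w) < 2 * r)%R%:R * (v x - v w) ^+ 2)%:E)).
    by mfun.
  by move=> x w; rewrite lee_fin mulr_ge0.
have Soo : {ae nu, forall y, S y < +oo}.
  have iS : nu.-integrable setT S.
    apply/integrableP; split; first exact: measurable_osc_sum.
    rewrite (eq_integral S); last by move=> y _; rewrite gee0_abs// osc_sum_ge0.
    apply: le_lt_trans int_osc_sum_le _; apply: lte_mul_pinfty => //.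
  have := integrable_ae measurableT iS; apply: filterS => y /(_ I).
  by rewrite ge0_fin_numE// osc_sum_ge0.
pose A : R := (2 / (c * r `^ N%:R))%R.
pose B : R := (2 * trace_const c al ^+ 2 * r `^ (2 * al))%R.
have A0 : (0 <= A)%R by rewrite divr_ge0// ltW.
have B0 : (0 <= B)%R by rewrite mulr_ge0 ?powR_ge0// mulr_ge0// sqr_ge0.
have mS := measurable_osc_sum.
have sum_le x : W x -> (cl * r `^ d)%:E * (v x ^+ 2)%:E <=
    (A * (Cu * r `^ d))%:E * G x + B%:E * \int[nu]_y (((enorm (x - y) < r)%R%:R)%:E * S y).
  move=> Wx.
  apply: (@le_trans _ _ (nu (eball x r) * (v x ^+ 2)%:E)).
    by rewrite lee_wpmul2r ?hW// lee_fin sqr_ge0.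
  rewrite muleC -(integral_cst nu (measurable_eball x r) (v x ^+ 2)%:E).
  rewrite int_eball; last by move=> y; rewrite lee_fin sqr_ge0.
  apply: (@le_trans _ _ (\int[nu]_y (((enorm (y - x) < r)%R%:R)%:E * (A%:E * G x + B%:E * S y)))).
    apply: ae_ge0_le_integral => //.
    - by move=> y _; rewrite mule_ge0// lee_fin sqr_ge0.
    - by mfun.
    - by move=> y _; rewrite mule_ge0// adde_ge0// mule_ge0// osc_sum_ge0.
    - by mfun.
    near=> y => _; rewrite /=.
    have [yx|yx] := ltP (enorm (y - x)) r; last by rewrite !mul0e.
    rewrite !mul1e; apply: value_le_trace0 => //.
    - by near: y.
    - by near: y.
    - by near: y.
    - by rewrite enormB.
  under eq_integral do rewrite ge0_muleDr ?mule_ge0 ?osc_sum_ge0//.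
  rewrite ge0_integralD//; last 4 first.
  - by move=> y _; rewrite mule_ge0// mule_ge0.
  - by mfun.
  - by move=> y _; rewrite mule_ge0// mule_ge0// osc_sum_ge0.
  - by mfun.
  apply: leeD.
    rewrite ge0_integralZr//; last 2 first.
    - by mfun.
    - by rewrite mule_ge0.
    rewrite muleC [X in _ <= X](_ : _ = (A%:E * G x) * (Cu * r `^ d)%:E); last first.
      by rewrite EFinM muleAC.
    apply: lee_wpmul2l; first by rewrite mule_ge0.
    apply: le_trans (nu_up x r_gt0).
    rewrite -[leRHS]mul1e -(integral_cst nu (measurable_eball x r) 1).
    by rewrite int_eball//; under [leRHS]eq_integral do rewrite mule1.
  under eq_integral do rewrite muleCA enormB.
  rewrite ge0_integralZl//.
  - by mfun.
  - by move=> y _; rewrite mule_ge0// osc_sum_ge0.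
have cld : (0 < cl * r `^ d)%R by rewrite mulr_gt0// powR_gt0.
rewrite -(@lee_pmul2l _ (cl * r `^ d)%:E)//.
rewrite -ge0_integralZl//; last 3 first.
- by apply: measurable_funTS; mfun.
- by move=> x _; rewrite lee_fin sqr_ge0.
- by rewrite lee_fin ltW.
pose H x := \int[nu]_y (((enorm (x - y) < r)%R%:R)%:E * S y).
have H0 x : 0 <= H x by apply: int_ge0 => y; rewrite mule_ge0// osc_sum_ge0.
have mH : measurable_fun setT H.
  apply: (@measurable_int2 _ _ _ _ _ _ (fun x y : E => (((enorm (x - y) < r)%R%:R)%:E * S y))).
    apply: emeasurable_funM; first by mfun.
    exact: (measurableT_comp mS measurable_snd).
  by move=> x y; rewrite mule_ge0// osc_sum_ge0.
apply: (@le_trans _ _ (\int[la]_x ((A * (Cu * r `^ d))%:E * G x + B%:E * H x))).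
  apply: (@le_trans _ _ (\int[la]_(x in W) ((A * (Cu * r `^ d))%:E * G x + B%:E * H x))).
    apply: ge0_le_int => x Wx; last exact: sum_le.
    by rewrite mule_ge0// lee_fin ?sqr_ge0// ltW.
  apply: ge0_subset_integral => //.
  - by mfun.
  - move=> x _; rewrite adde_ge0// mule_ge0// lee_fin mulr_ge0// mulr_ge0 ?powR_ge0//.
have AC0 : (0 <= A * (Cu * r `^ d))%R by rewrite mulr_ge0// mulr_ge0// powR_ge0.
rewrite ge0_integralD//; last 4 first.
- by move=> x _; rewrite mule_ge0// lee_fin.
- by mfun.
- by move=> x _; rewrite mule_ge0.
- by mfun.
rewrite !ge0_integralZl//.
have hG : \int[la]_x G x <= ((2 * r) `^ p)%:E * power_energy la v p.
  by apply: near_energy_le => //; rewrite ?(ltW p0)// mulr_gt0.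
have hH : \int[la]_x H x <= (Cl * r `^ N%:R)%:E * ((osc_const Cu p)%:E * power_energy la v p).
  apply: (@le_trans _ _ ((Cl * r `^ N%:R)%:E * \int[nu]_y S y)); last first.
    by apply: lee_wpmul2l; [rewrite lee_fin mulr_ge0// powR_ge0|exact: int_osc_sum_le].
  apply: schur_le => //.
  - by mfun.
  - exact: osc_sum_ge0.
  - by rewrite mulr_ge0// powR_ge0.
  move=> y; apply: le_trans (la_up y r_gt0).
  rewrite -[leRHS]mul1e -(integral_cst la (measurable_eball y r) 1).
  by rewrite int_eball//; under [leRHS]eq_integral do rewrite mule1.
apply: le_trans (leeD (lee_wpmul2l _ hG) (lee_wpmul2l _ hH)) _; rewrite ?lee_fin//.
have PE : power_energy la v p \is a fin_num by rewrite ge0_fin_numE// power_energy_ge0.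
rewrite -(fineK PE) -!EFinM -EFinD lee_fin.
rewrite le_eqVlt; apply/orP; left; apply/eqP.
rewrite /A /B /layer_bound powRM ?(ltW r_gt0)//.
move: (osc_const Cu p) (trace_const c al) (fine _) => oc tc pe.
have rN : (0 < r `^ N%:R)%R by rewrite powR_gt0.
have e1 : (r `^ p = r `^ (p - N%:R) * r `^ N%:R)%R by rewrite -powRDp// subrK.
have e2 : (r `^ (2 * al) * r `^ N%:R = r `^ d * r `^ (p - N%:R))%R.
  by rewrite -!powRDp//; congr (_ `^ _)%R; rewrite /p; ring.
have e3 : (r `^ (2 * al) = r `^ d * r `^ (p - N%:R) / r `^ N%:R)%R.
  by rewrite -e2 mulfK// gt_eqF.
by rewrite e1 e3; field; rewrite !gt_eqF// powR_gt0.
Unshelve. all: by end_near. Qed.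

End trace_of_finite_energy.

(** * The averaging extension *)

Section concentrated.
Local Open Scope ereal_scope.
Context d (T : measurableType d) (R : realType).
Variable m : {measure set T -> \bar R}.

Lemma le_int_on (D : set T) (F G : T -> \bar R) : measurable D -> m (~` D) = 0 ->
  measurable_fun setT F -> (forall x, 0 <= F x) -> (forall x, 0 <= G x) ->
  (forall x, D x -> F x <= G x) -> \int[m]_x F x <= \int[m]_x G x.
Proof.
move=> mD D0 mF F0 G0 FG.
rewrite (@ge0_negligible_integral _ _ _ m setT (~` D))//; last exact: measurableC.
rewrite setTD setCK; apply: (@le_trans _ _ (\int[m]_(x in D) G x)).
  by apply: ge0_le_int => x Dx; [exact: F0|exact: FG].
rewrite integral_mkcond; apply: ge0_le_int => x _; rewrite patchE; case: ifP => //.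
Qed.

End concentrated.

Section tonelli_more.
Local Open Scope ereal_scope.
Context d1 d2 (T1 : measurableType d1) (T2 : measurableType d2) (R : realType).
Variables (m1 : {sigma_finite_measure set T1 -> \bar R})
  (m2 : {sigma_finite_measure set T2 -> \bar R}).

Lemma measurable_Rint2 (g : T1 -> T2 -> R) :
  measurable_fun setT (fun p : T1 * T2 => g p.1 p.2) ->
  measurable_fun setT (fun x => Rintegral m2 setT (g x)).
Proof.
move=> mg; apply: (measurableT_comp (@fine_measurable _ setT measurableT)).
rewrite [X in measurable_fun _ X](_ : _ = (fun x =>
    \int[m2]_y (fun y => (g x y)%:E)^\+ y - \int[m2]_y (fun y => (g x y)%:E)^\- y)); last first.
  by apply/funext => x; rewrite integralE.
have mE : measurable_fun setT (fun p : T1 * T2 => (g p.1 p.2)%:E) by apply/measurable_EFinP.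
apply: emeasurable_funB.
  apply: (@measurable_int2 _ _ _ _ _ m2 (fun x y => (fun y => (g x y)%:E)^\+ y)).
    rewrite (_ : (fun _ => _) = (fun p : T1 * T2 => (g p.1 p.2)%:E)^\+); last by apply/funext => p; rewrite !funeposE.
    exact: measurable_funepos.
  by move=> x y; rewrite funepos_ge0.
apply: (@measurable_int2 _ _ _ _ _ m2 (fun x y => (fun y => (g x y)%:E)^\- y)).
  rewrite (_ : (fun _ => _) = (fun p : T1 * T2 => (g p.1 p.2)%:E)^\-); last by apply/funext => p; rewrite !funenegE.
  exact: measurable_funeneg.
by move=> x y; rewrite funeneg_ge0.
Qed.

Lemma schur_le_on (F : set T2) (a : T1 -> T2 -> \bar R) (H : T2 -> \bar R) (A : R) :
  measurable F -> m2 (~` F) = 0 ->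
  measurable_fun setT (fun p : T1 * T2 => a p.1 p.2) ->
  measurable_fun setT H ->
  (forall x y, 0 <= a x y) -> (forall y, 0 <= H y) ->
  (0 <= A)%R ->
  (forall y, F y -> \int[m1]_x a x y <= A%:E) ->
  \int[m1]_x \int[m2]_y (a x y * H y) <= A%:E * \int[m2]_y H y.
Proof.
move=> mF F0 ma mH a0 H0 A0 aA.
have maH : measurable_fun setT (fun p : T1 * T2 => a p.1 p.2 * H p.2).
  by apply: emeasurable_funM => //; exact: measurableT_comp.
rewrite tonelli_swap//; last by move=> x y; rewrite mule_ge0.
rewrite -ge0_integralZl//.
apply: (le_int_on mF F0).
- apply: (@measurable_int2 _ _ _ _ _ m1 (fun y x => a x y * H y)).
    exact: (measurableT_comp maH (measurable_fun_pair measurable_snd measurable_fst)).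
  by move=> y x; rewrite mule_ge0.
- by move=> y; apply: int_ge0 => x; rewrite mule_ge0.
- by move=> y; rewrite mule_ge0.
move=> y Fy; rewrite ge0_integralZr//; first by rewrite lee_wpmul2r// aA.
by have := measurableT_comp ma (pair2_measurable y).
Qed.

(* Schur's test for the tensor square of the kernel [a]. *)
Lemma schur2_le_on (F : set T2) (a : T1 -> T2 -> \bar R) (g : T2 -> T2 -> \bar R) (A : R) :
  measurable F -> m2 (~` F) = 0 ->
  measurable_fun setT (fun p : T1 * T2 => a p.1 p.2) ->
  measurable_fun setT (fun p : T2 * T2 => g p.1 p.2) ->
  (forall x y, 0 <= a x y) -> (forall y z, 0 <= g y z) ->
  (0 <= A)%R ->
  (forall y, F y -> \int[m1]_x a x y <= A%:E) ->
  \int[m1]_x \int[m1]_w \int[m2]_y (a x y * \int[m2]_z (a w z * g y z)) <=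
    (A ^+ 2)%:E * \int[m2]_y \int[m2]_z g y z.
Proof.
move=> mF F0 ma mg a0 g0 A0 aA.
pose H y := \int[m2]_z g y z.
have H0 y : 0 <= H y by exact: int_ge0.
have mH : measurable_fun setT H by exact: measurable_int2.
have AH0 y : 0 <= A%:E * H y by rewrite mule_ge0.
pose K w y := \int[m2]_z (a w z * g y z).
have K0 w y : 0 <= K w y by apply: int_ge0 => z; rewrite mule_ge0.
have mK : measurable_fun setT (fun p : T1 * T2 => K p.1 p.2).
  apply: (@measurable_int2 _ _ _ _ _ m2 (fun (p : T1 * T2) z => a p.1 z * g p.2 z)); last first.
    by move=> p z; rewrite mule_ge0.
  apply: emeasurable_funM.
    exact: (measurableT_comp ma (measurable_fun_pair
      (measurableT_comp measurable_fst measurable_fst) measurable_snd)).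
  exact: (measurableT_comp mg (measurable_fun_pair
    (measurableT_comp measurable_snd measurable_fst) measurable_snd)).
apply: (@le_trans _ _ (\int[m1]_x \int[m2]_y (a x y * (A%:E * H y)))).
  apply: ge0_le_int => x _; first by apply: int_ge0 => w; apply: int_ge0 => y; apply: mule_ge0 => //; exact: K0.
  have max : measurable_fun setT (a x) by have := measurableT_comp ma (pair1_measurable x).
  rewrite (@tonelli_swap _ _ _ _ _ m1 m2 (fun w y => a x y * K w y)); last 2 first.
  - by apply: emeasurable_funM => //; exact: (measurableT_comp max measurable_snd).
  - by move=> w y; rewrite mule_ge0.
  apply: ge0_le_int => y _; first by apply: int_ge0 => w; rewrite mule_ge0.
  rewrite ge0_integralZl//; last by have := measurableT_comp mK (pair2_measurable y).
  apply: lee_wpmul2l => //; apply: (schur_le_on mF F0) => //.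
  by have := measurableT_comp mg (pair1_measurable y).
apply: le_trans (schur_le_on mF F0 ma _ a0 AH0 A0 aA) _.
  by apply: emeasurable_funM.
by rewrite ge0_integralZl// muleA -EFinM -expr2.
Qed.

End tonelli_more.

Lemma sqrD_le (R : realType) (a b x y : R) : a ^+ 2 <= x -> b ^+ 2 <= y ->
  (a + b) ^+ 2 <= 2 * x + 2 * y.
Proof. by move=> ax yb; have := sqr_ge0 (a - b); rewrite sqrrB sqrrD; lra. Qed.

Section extension.
Local Open Scope ereal_scope.
Context (R : realType) (N : nat).
Local Notation E := 'rV[R]_N.
Variables la nu : {sigma_finite_measure set E -> \bar R}.
Variables (d Cu Cl cl : R).
Hypotheses (d0 : (0 < d)%R) (dN : (d < N%:R)%R).
Hypotheses (Cu0 : (0 <= Cu)%R) (Cl0 : (0 <= Cl)%R) (cl0 : (0 < cl)%R).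
Hypothesis nu_up : forall (x : E) (r : R), (0 < r)%R -> nu (eball x r) <= (Cu * r `^ d)%:E.
Hypothesis la_up : forall (x : E) (r : R), (0 < r)%R -> la (eball x r) <= (Cl * r `^ N%:R)%:E.
Variables (D : E -> R) (Om F : set E).
Hypotheses (mD : measurable_fun setT D) (D0 : forall x, (0 <= D x)%R).
Hypothesis Dlip : forall x z, (D x <= D z + enorm (x - z))%R.
Hypotheses (mOm : measurable Om) (mF : measurable F).
Hypotheses (laOm : la (~` Om) = 0) (nuF : nu (~` F) = 0).
Hypothesis DOm : forall x, Om x -> (0 < D x)%R.
Hypothesis DF : forall y x, F y -> (D x <= enorm (x - y))%R.
Hypothesis nu_lo : forall x, Om x -> (cl * D x `^ d)%:E <= nu (eball x (2 * D x)).

Definition bump (D : E -> R) (x y : E) : R :=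
  ((enorm (x - y) < 3 * D x)%R%:R * (3 * D x - enorm (x - y)))%R.

Lemma bump_ge0 x y : (0 <= bump D x y)%R.
Proof. by rewrite /bump; have [h|h] := ltP (enorm (x - y)) (3 * D x)%R; rewrite ?mul0r ?mul1r; lra. Qed.

Lemma bump_le x y : (bump D x y <= 3 * D x)%R.
Proof.
have := enorm_ge0 (x - y); have := D0 x.
by rewrite /bump; have [h|h] := ltP (enorm (x - y)) (3 * D x)%R; rewrite ?mul0r ?mul1r; lra.
Qed.

Lemma bump_lip x z y : (`|bump D x y - bump D z y| <= 4 * enorm (x - z))%R.
Proof.
have h1 := Dlip x z; have h2 := Dlip z x.
have h3 := enorm_triangle z x y; have h4 := enorm_triangle x z y.
rewrite (enormB z x) in h2 h4; have h5 := enorm_ge0 (x - z).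
rewrite /bump ler_norml; apply/andP.
by have [h|h] := ltP (enorm (x - y)) (3 * D x)%R;
  have [h'|h'] := ltP (enorm (z - y)) (3 * D z)%R; rewrite ?mul0r ?mul1r; split; lra.
Qed.

Lemma measurable_bump : measurable_fun setT (fun q : E * E => bump D q.1 q.2).
Proof. by rewrite /bump; mfun. Qed.

Lemma measurable_bump1 x : measurable_fun setT (bump D x).
Proof. by rewrite /bump; mfun. Qed.

Lemma weighted_sq_le (g lam : E -> R) (x : E) (r M k : R) : (0 < r)%R -> (0 <= M)%R ->
  measurable_fun setT g -> \int[nu]_y (g y ^+ 2)%:E < +oo ->
  measurable_fun setT lam -> (forall y, `|lam y| <= M)%R ->
  (forall y, (r <= enorm (x - y))%R -> lam y = 0%R) ->
  (((\int[nu]_y (g y * lam y) - k * \int[nu]_y lam y) ^+ 2)%R)%:E <=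
    (M ^+ 2 * (Cu * r `^ d))%:E *
    \int[nu]_y ((enorm (x - y) < r)%R%:R * (g y - k) ^+ 2)%:E.
Proof.
move=> r_gt0 M0 mg g2 ml lM lsupp; pose A := eball x r.
have mA : measurable A by exact: measurable_eball.
have Aoo : nu A < +oo by apply: le_lt_trans (nu_up x r_gt0) _; rewrite ltry.
have supp (h : E -> R) : (\int[nu]_y (h y * lam y) = \int[nu]_(y in A) (h y * lam y))%R.
  rewrite [RHS]Rintegral_mkcond; apply: eq_Rintegral => y _; rewrite patchE.
  case: ifPn => //; rewrite notin_setE /A /eball/= => /negP; rewrite -leNgt enormB => /lsupp ->.
  by rewrite mulr0.
have g2A : \int[nu]_(y in A) (g y ^+ 2)%:E < +oo.
  apply: le_lt_trans g2; apply: ge0_subset_integral => //; first by mfun.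
  by move=> y _; rewrite lee_fin sqr_ge0.
have l2A : \int[nu]_(y in A) (lam y ^+ 2)%:E < +oo.
  apply: (@le_lt_trans _ _ (\int[nu]_(y in A) (M ^+ 2)%:E)).
    apply: ge0_le_int => y _; rewrite lee_fin ?sqr_ge0//.
    by rewrite -real_normK ?num_real// lerXn2r ?nnegrE// lM.
  by rewrite (integral_cst nu mA (M ^+ 2)%:E) lte_mul_pinfty// lee_fin sqr_ge0.
have e : (\int[nu]_y (g y * lam y) - k * \int[nu]_y lam y)%R =
    (\int[nu]_(y in A) ((g y - k) * lam y))%R.
  have il := L2_integrable mA (measurable_funTS ml) Aoo l2A.
  rewrite supp [X in (_ - k * X)%R](_ : _ = \int[nu]_y (1 * lam y))%R; last first.
    by apply: eq_Rintegral => y _; rewrite mul1r.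
  rewrite (supp (cst 1%R)) [X in (_ - k * X)%R](_ : _ = \int[nu]_(y in A) lam y)%R; last first.
    by apply: eq_Rintegral => y _; rewrite mul1r.
  rewrite -RintegralZl// -RintegralB//.
  - by apply: eq_Rintegral => y _; rewrite mulrBl.
  - by apply: integrable_mul => //; exact: measurable_funTS.
  - exact: (integrableZl mA k il).
rewrite e.
have gk2 := L2_sub_cst k mA (measurable_funTS mg) Aoo g2A.
have := @cauchy_bounded _ _ _ nu (fun y => g y - k)%R lam A M (Cu * r `^ d) mA
  (measurable_funTS (measurable_funB mg (measurable_cst k))) (measurable_funTS ml) gk2
  (nu_up x r_gt0) M0 (fun y _ => lM y).
move=> /le_trans; apply; apply: lee_wpmul2l.
  by rewrite lee_fin mulr_ge0 ?sqr_ge0// mulr_ge0// powR_ge0.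
rewrite int_eball; last by move=> y; rewrite lee_fin sqr_ge0.
by apply: ge0_le_int => y _; rewrite -?EFinM enormB ?lee_fin// mulr_ge0// sqr_ge0.
Qed.

Definition mass (nu : {measure set E -> \bar R}) (D : E -> R) (x : E) : R :=
  (\int[nu]_y bump D x y)%R.

Let Z := mass nu D.

Lemma bump_supp x y r : (3 * D x <= r)%R -> (r <= enorm (x - y))%R -> bump D x y = 0%R.
Proof. by move=> h1 h2; rewrite /bump ltNge (le_trans h1 h2) mul0r. Qed.

Let bump_int x : Om x -> \int[nu]_y (bump D x y)%:E < +oo.
Proof.
move=> Ox; have r0 : (0 < 3 * D x)%R by rewrite mulr_gt0// DOm.
apply: (@le_lt_trans _ _ (\int[nu]_(y in eball x (3 * D x)) (3 * D x)%:E)).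
  rewrite int_eball; last by move=> y; rewrite lee_fin ltW.
  apply: ge0_le_int => y _; first by rewrite lee_fin bump_ge0.
  rewrite -EFinM lee_fin; have [h|h] := ltP (enorm (y - x)) (3 * D x)%R.
    by rewrite mul1r bump_le.
  by rewrite mul0r (bump_supp (lexx _))// enormB.
rewrite (integral_cst nu (measurable_eball x _) (3 * D x)%:E).
by apply: lte_mul_pinfty; rewrite ?lee_fin ?(ltW r0)// (le_lt_trans (nu_up x r0))// ltry.
Qed.

Lemma mass_ge x : Om x -> (cl * D x `^ (d + 1) <= Z x)%R.
Proof.
move=> Ox; have Dx := DOm Ox.
rewrite -lee_fin /Z /mass /Rintegral fineK; last first.
  by rewrite ge0_fin_numE ?bump_int// int_ge0// => y; rewrite lee_fin bump_ge0.
apply: (@le_trans _ _ (\int[nu]_(y in eball x (2 * D x)) (D x)%:E)).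
  rewrite (integral_cst nu (measurable_eball x _) (D x)%:E) powRDp// powRr1 ?(ltW Dx)//.
  by rewrite mulrA mulrC EFinM; apply: lee_wpmul2l; [rewrite lee_fin ltW|exact: nu_lo].
rewrite int_eball; last by move=> y; rewrite lee_fin ltW.
apply: ge0_le_int => y _; first by rewrite -EFinM lee_fin mulr_ge0// ltW.
rewrite -EFinM lee_fin /bump enormB.
have [h|h] := ltP (enorm (x - y)) (2 * D x)%R; last by rewrite mul0r -/(bump D x y) bump_ge0.
by rewrite (_ : (enorm (x - y) < 3 * D x)%R = true) ?mul1r; lra.
Qed.

Let Z_gt0 x : Om x -> (0 < Z x)%R.
Proof. by move=> Ox; apply: lt_le_trans (mass_ge Ox); rewrite mulr_gt0// powR_gt0// DOm. Qed.

Definition ext (nu : {measure set E -> \bar R}) (D : E -> R) (f : E -> R) (x : E) : R :=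
  ((\int[nu]_y (f y * bump D x y)) / mass nu D x)%R.

Lemma measurable_ext f : measurable_fun setT f -> measurable_fun setT (ext nu D f).
Proof.
move=> mf; have mb := measurable_bump.
apply: measurable_funM.
  by apply: (@measurable_Rint2 _ _ _ _ _ nu (fun x y => f y * bump D x y)%R); rewrite /bump; mfun.
rewrite (_ : (fun _ => _) = fun x => mass nu D x `^ (- 1))%R; last first.
  apply/funext => x; rewrite powR_inv1//; apply: Rintegral_ge0 => y _; exact: bump_ge0.
apply: measurable_funpow.
by apply: (@measurable_Rint2 _ _ _ _ _ nu (fun x y => bump D x y)).
Qed.

Variable f : E -> R.
Hypotheses (mf : measurable_fun setT f) (f2 : \int[nu]_y (f y ^+ 2)%:E < +oo).
Let T := ext nu D f.

Definition ext_c1 (Cu cl d : R) : R := (9 * 3 `^ d * Cu / cl ^+ 2)%R.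

Lemma ext_c1_ge0 : (0 <= ext_c1 Cu cl d)%R.
Proof. by rewrite divr_ge0 ?exprn_ge0 ?(ltW cl0)// mulr_ge0// mulr_ge0// powR_ge0. Qed.

Lemma ext_sq_le x k : Om x ->
  ((T x - k) ^+ 2)%:E <= (ext_c1 Cu cl d * D x `^ (- d))%:E *
    \int[nu]_y ((enorm (x - y) < 3 * D x)%R%:R * (f y - k) ^+ 2)%:E.
Proof.
move=> Ox; have Dx := DOm Ox; have Zx := Z_gt0 Ox.
have r0 : (0 < 3 * D x)%R by rewrite mulr_gt0.
have h := @weighted_sq_le f (bump D x) x (3 * D x) (3 * D x) k r0 (ltW r0) mf f2
  (measurable_bump1 x) (fun y => ltac:(by rewrite ger0_norm ?bump_ge0 ?bump_le))
  (fun y => bump_supp (lexx _)).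
have e : ((\int[nu]_y (f y * bump D x y)) - k * (\int[nu]_y bump D x y) = Z x * (T x - k))%R.
  have -> : T x = ((\int[nu]_y (f y * bump D x y)) / Z x)%R by [].
  by rewrite -/(mass nu D x) -/(Z x); field; rewrite gt_eqF.
rewrite e {e} in h.
set Q := \int[nu]_y _ in h *.
have Q0 : 0 <= Q by apply: int_ge0 => y; rewrite lee_fin mulr_ge0// sqr_ge0.
rewrite -(@lee_pmul2l _ ((cl * D x `^ (d + 1)) ^+ 2)%:E)//; last first.
  by rewrite lte_fin exprn_gt0// mulr_gt0// powR_gt0.
apply: (@le_trans _ _ ((Z x * (T x - k)) ^+ 2)%:E).
  rewrite -EFinM lee_fin [leRHS]exprMn ler_wpM2r ?sqr_ge0// lerXn2r ?nnegrE ?mass_ge//.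
    by rewrite mulr_ge0 ?powR_ge0// ltW.
  exact: ltW.
apply: le_trans h _; rewrite muleA lee_wpmul2r// -EFinM lee_fin.
rewrite le_eqVlt; apply/orP; left; apply/eqP.
have dd : (0 < D x `^ d)%R by rewrite powR_gt0.
rewrite /ext_c1 powRM ?(ltW Dx)// powRDp// powRr1 ?(ltW Dx)// powRN.
by field; rewrite !gt_eqF.
Qed.

Definition ext_c2 (Cu cl d : R) : R :=
  (2 * 4 ^+ 2 * Cu * 4 `^ d / cl ^+ 2 +
   2 * 4 ^+ 2 * 4 ^+ 2 * Cu ^+ 3 * (4 `^ d) ^+ 3 * (2 `^ (d + 1)) ^+ 2 / cl ^+ 4)%R.

Lemma ext_c2_ge0 : (0 <= ext_c2 Cu cl d)%R.
Proof.
have cl2 := exprn_ge0 2 (ltW cl0); have cl4 := exprn_ge0 4 (ltW cl0).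
have p4 : (0 <= 4 `^ d :> R)%R by exact: powR_ge0.
have p2 : (0 <= 2 `^ (d + 1) :> R)%R by exact: powR_ge0.
have s4 : (0 <= 4 ^+ 2 :> R)%R by exact: sqr_ge0.
have c3 := exprn_ge0 3 Cu0; have p43 := exprn_ge0 3 p4; have p22 := exprn_ge0 2 p2.
apply: addr_ge0; apply: divr_ge0 => //; apply: mulr_ge0 => //; apply: mulr_ge0 => //.
  by apply: mulr_ge0.
Qed.

Lemma ext_lip_le x z k : Om x -> Om z -> (enorm (x - z) <= D x / 4)%R ->
  ((T x - T z) ^+ 2)%:E <= (ext_c2 Cu cl d * enorm (x - z) ^+ 2 * D x `^ (- (d + 2)))%:E *
    \int[nu]_y ((enorm (x - y) < 4 * D x)%R%:R * (f y - k) ^+ 2)%:E.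
Proof.
move=> Ox Oz xz; have Dx := DOm Ox; have Dz := DOm Oz.
have Zx := Z_gt0 Ox; have Zz := Z_gt0 Oz.
have h1 := Dlip x z; have h2 := Dlip z x; rewrite (enormB z x) in h2.
have r0 : (0 < 4 * D x)%R by rewrite mulr_gt0.
have rho0 := enorm_ge0 (x - z); set rho := enorm (x - z) in rho0 xz h1 h2 *.
have hz : (D x / 2 <= D z)%R by lra.
have mb := measurable_bump1 x; have mbz := measurable_bump1 z.
have ml : measurable_fun setT (fun y => bump D x y - bump D z y)%R by exact: measurable_funB.
have supz y : (4 * D x <= enorm (x - y))%R -> bump D z y = 0%R.
  move=> h; apply: (bump_supp (lexx _)).
  have := enorm_triangle z x y; rewrite -/rho; lra.
have supl y : (4 * D x <= enorm (x - y))%R -> (bump D x y - bump D z y = 0)%R.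
  by move=> h; rewrite supz// (bump_supp (lexx _)) ?subrr//; lra.
have M0 : (0 <= 4 * rho)%R by rewrite mulr_ge0.
have w1 := @weighted_sq_le f _ x (4 * D x) (4 * rho) k r0 M0 mf f2 ml
  (fun y => bump_lip x z y) supl.
have bz y : (`|bump D z y| <= 4 * D x)%R.
  by rewrite ger0_norm ?bump_ge0// (le_trans (bump_le z y))//; lra.
have w2 := @weighted_sq_le f _ x (4 * D x) (4 * D x) k r0 (ltW r0) mf f2 mbz bz supz.
pose A := eball x (4 * D x).
have mA : measurable A by exact: measurable_eball.
set Q := \int[nu]_y _ in w1 w2 *.
have Q0 : 0 <= Q by apply: int_ge0 => y; rewrite lee_fin mulr_ge0// sqr_ge0.
pose I := (\int[nu]_y (f y * bump D x y))%R; pose J := (\int[nu]_y (f y * bump D z y))%R.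
have f2A : \int[nu]_(y in A) (f y ^+ 2)%:E < +oo.
  apply: le_lt_trans f2; apply: ge0_subset_integral => //; first by mfun.
  by move=> y _; rewrite lee_fin sqr_ge0.
have Aoo : nu A < +oo by apply: le_lt_trans (nu_up x r0) _; rewrite ltry.
have supp (h l : E -> R) : (forall y, (4 * D x <= enorm (x - y))%R -> l y = 0%R) ->
    (\int[nu]_y (h y * l y) = \int[nu]_(y in A) (h y * l y))%R.
  move=> hl; rewrite [RHS]Rintegral_mkcond; apply: eq_Rintegral => y _; rewrite patchE.
  case: ifPn => //; rewrite notin_setE /A /eball/= => /negP; rewrite -leNgt enormB => /hl ->.
  by rewrite mulr0.
have supx y : (4 * D x <= enorm (x - y))%R -> bump D x y = 0%R.
  by move=> h; rewrite (bump_supp (lexx _))//; lra.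
have b2A (l : E -> R) M : (0 <= M)%R -> (forall y, `|l y| <= M)%R ->
    \int[nu]_(y in A) (l y ^+ 2)%:E < +oo.
  move=> M0' lM; apply: (@le_lt_trans _ _ (\int[nu]_(y in A) (M ^+ 2)%:E)).
    apply: ge0_le_int => y _; rewrite lee_fin ?sqr_ge0//.
    by rewrite -real_normK ?num_real// lerXn2r ?nnegrE// lM.
  by rewrite (integral_cst nu mA (M ^+ 2)%:E) lte_mul_pinfty// lee_fin sqr_ge0.
have bx y : (`|bump D x y| <= 4 * D x)%R.
  by rewrite ger0_norm ?bump_ge0// (le_trans (bump_le x y))//; lra.
have lin (h : E -> R) : measurable_fun setT h -> \int[nu]_(y in A) (h y ^+ 2)%:E < +oo ->
    (\int[nu]_y (h y * (bump D x y - bump D z y)) =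
     \int[nu]_y (h y * bump D x y) - \int[nu]_y (h y * bump D z y))%R.
  move=> mh h2A; rewrite !supp// -RintegralB//.
  - by apply: eq_Rintegral => y _; rewrite mulrBr.
  - apply: integrable_mul => //; try exact: measurable_funTS.
    exact: b2A (ltW r0) bx.
  - apply: integrable_mul => //; try exact: measurable_funTS.
    exact: b2A (ltW r0) bz.
have one2 : \int[nu]_(y in A) ((cst 1%R : E -> R) y ^+ 2)%:E < +oo.
  by apply: (b2A (cst 1%R) 1%R) => // y; rewrite normr1.
have linZ : (\int[nu]_y (bump D x y - bump D z y) = Z x - Z z)%R.
  have := lin (cst 1%R) (measurable_cst _) one2.
  by under eq_Rintegral do rewrite mul1r;
    under [X in (X - _)%R]eq_Rintegral do rewrite mul1r;
    under [X in (_ - X)%R]eq_Rintegral do rewrite mul1r.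
rewrite (lin f mf f2A) -/I -/J linZ in w1; rewrite -/J -/(mass nu D z) -/(Z z) in w2.
have w3 : ((Z x - Z z) ^+ 2 <= (4 * rho) ^+ 2 * (Cu * (4 * D x) `^ d) ^+ 2)%R.
  rewrite -lee_fin -linZ.
  have -> : (\int[nu]_y (bump D x y - bump D z y) = \int[nu]_(y in A) (1 * (bump D x y - bump D z y)))%R.
    by rewrite -(supp (cst 1%R) _ supl); apply: eq_Rintegral => y _; rewrite mul1r.
  have := @cauchy_bounded _ _ _ nu (cst 1%R) (fun y => bump D x y - bump D z y)%R A (4 * rho) (Cu * (4 * D x) `^ d) mA
    (measurable_cst _) (measurable_funTS ml) one2 (nu_up x r0) M0 (fun y _ => bump_lip x z y).
  move=> /le_trans; apply.
  rewrite [X in _ <= X%:E](_ : _ =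
    (4 * rho) ^+ 2 * (Cu * (4 * D x) `^ d) * (Cu * (4 * D x) `^ d))%R; last by ring.
  rewrite [leRHS]EFinM.
  apply: lee_wpmul2l; first by rewrite lee_fin mulr_ge0 ?sqr_ge0// mulr_ge0// powR_ge0.
  under eq_integral do rewrite expr1n.
  by rewrite (integral_cst nu mA 1%:E) mul1e nu_up.
have zx : (cl * D x `^ (d + 1) <= Z x)%R by exact: mass_ge.
have zz : (cl * (D x / 2) `^ (d + 1) <= Z z)%R.
  apply: le_trans (mass_ge Oz); rewrite ler_wpM2l ?(ltW cl0)// powR_le// ?divr_ge0//.
  by rewrite addr_ge0// ltW.
have Qoo : Q \is a fin_num.
  rewrite ge0_fin_numE// /Q.
  have := L2_sub_cst k mA (measurable_funTS mf) Aoo f2A.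
  rewrite int_eball; last by move=> y; rewrite lee_fin sqr_ge0.
  apply: le_lt_trans; apply: ge0_le_int => y _.
    by rewrite lee_fin mulr_ge0// sqr_ge0.
  by rewrite -EFinM enormB.
move: w1 w2; rewrite -(fineK Qoo); set q := fine Q.
have q0 : (0 <= q)%R by rewrite fine_ge0.
rewrite -!EFinM !lee_fin => w1 w2.
have -> : (T x - T z = ((I - J - k * (Z x - Z z)) + (J - k * Z z) * ((Z z - Z x) / Z z)) / Z x)%R.
  have -> : T x = (I / Z x)%R by [].
  have -> : T z = (J / Z z)%R by [].
  move: (I) (J) (Z x) (Z z) Zx Zz => i j zx' zz' zx0 zz0.
  by field; rewrite !gt_eqF.
have dd : (0 < D x `^ d)%R by rewrite powR_gt0.
set a := (I - J - _)%R in w1 *; set b := (J - _)%R in w2 *.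
set t := (4 `^ d * D x `^ d)%R.
have e4 : ((4 * D x) `^ d = t)%R by rewrite powRM// ltW.
rewrite e4 in w1 w2 w3.
have t0 : (0 <= t)%R by rewrite mulr_ge0 ?powR_ge0.
pose X := (cl * (D x `^ d * D x))%R; pose Y := (X / 2 `^ (d + 1))%R.
have X0 : (0 < X)%R by rewrite mulr_gt0// mulr_gt0.
have two0 : (0 < 2 `^ (d + 1) :> R)%R by rewrite powR_gt0.
have Y0 : (0 < Y)%R by rewrite divr_gt0.
have e1 : (D x `^ (d + 1) = D x `^ d * D x)%R by rewrite (powRDp d 1 Dx) powRr1 ?(ltW Dx).
have XZ : (X <= Z x)%R by rewrite /X -e1.
have YZ : (Y <= Z z)%R.
  apply: le_trans zz; rewrite (powRM (d + 1)%R (ltW Dx)); last by rewrite invr_ge0.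
  have -> : (2^-1 `^ (d + 1) = (2 `^ (d + 1))^-1 :> R)%R.
    by rewrite -[in LHS](powR_inv1 (ler0n R 2)) -powRrM mulN1r powRN.
  by rewrite e1 /Y /X [leRHS]mulrA.
have sq_inv (u w W : R) : (0 < w)%R -> (w <= W)%R -> ((u / W) ^+ 2 <= u ^+ 2 / w ^+ 2)%R.
  move=> w0 wW; rewrite expr_div_n ler_wpM2l ?sqr_ge0// lef_pV2 ?posrE ?exprn_gt0//.
    by rewrite lerXn2r ?nnegrE ?(ltW w0)// (le_trans (ltW w0)).
  exact: lt_le_trans wW.
apply: le_trans (sq_inv _ _ _ X0 XZ) _.
have w4 : (((Z z - Z x) / Z z) ^+ 2 <= (4 * rho) ^+ 2 * (Cu * t) ^+ 2 / Y ^+ 2)%R.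
  apply: le_trans (sq_inv _ _ _ Y0 YZ) _.
  by apply: ler_wpM2r; [rewrite invr_ge0 sqr_ge0|rewrite -sqrrN opprB].
have w5 : ((b * ((Z z - Z x) / Z z)) ^+ 2 <=
   ((4 * D x) ^+ 2 * (Cu * t) * q) * ((4 * rho) ^+ 2 * (Cu * t) ^+ 2 / Y ^+ 2))%R.
  by rewrite exprMn; apply: ler_pM => //; exact: sqr_ge0.
apply: (@le_trans _ _ ((2 * ((4 * rho) ^+ 2 * (Cu * t) * q) +
   2 * (((4 * D x) ^+ 2 * (Cu * t) * q) * ((4 * rho) ^+ 2 * (Cu * t) ^+ 2 / Y ^+ 2))) / X ^+ 2)%R).
  rewrite ler_wpM2r ?invr_ge0 ?sqr_ge0//.
  exact: sqrD_le w1 w5.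
rewrite le_eqVlt; apply/orP; left; apply/eqP.
rewrite /ext_c2 /Y /X /t powRN (powRDp d 2 Dx) (powR_mulrn 2) ?(ltW Dx)//.
by field; rewrite !gt_eqF.
Qed.

End extension.

(* Mapping properties shared by every operator [T] that averages, at the scale
   [D x], the values of [f] on the set carrying [nu]. *)
Section averaging_operator.
Local Open Scope ereal_scope.
Context (R : realType) (N : nat).
Local Notation E := 'rV[R]_N.
Variables la nu : {sigma_finite_measure set E -> \bar R}.
Variables (d al Cl cl C1 C2 : R).
Hypotheses (d0 : (0 < d)%R) (dN : (d < N%:R)%R) (al0 : (0 < al)%R).
Let p : R := (2 * al + 2 * N%:R - d)%R.
Hypothesis pN : (p - 2 < N%:R)%R.
Hypotheses (Cl0 : (0 <= Cl)%R) (cl0 : (0 < cl)%R) (C10 : (0 <= C1)%R) (C20 : (0 <= C2)%R).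
Hypothesis la_up : forall (x : E) (r : R), (0 < r)%R -> la (eball x r) <= (Cl * r `^ N%:R)%:E.
Variables (D : E -> R) (Om F : set E) (M : R).
Hypotheses (mD : measurable_fun setT D) (D0 : forall x, (0 <= D x)%R).
Hypothesis Dlip : forall x z, (D x <= D z + enorm (x - z))%R.
Hypotheses (mOm : measurable Om) (mF : measurable F).
Hypotheses (laOm : la (~` Om) = 0) (nuF : nu (~` F) = 0).
Hypothesis DOm : forall x, Om x -> (0 < D x)%R.
Hypothesis DF : forall y x, F y -> (D x <= enorm (x - y))%R.
Hypotheses (M0 : (0 < M)%R) (DM : forall x, Om x -> (D x < M)%R).
Hypothesis OmM : forall x z, Om x -> Om z -> (enorm (x - z) < M)%R.
Hypothesis nu_lo : forall x, Om x -> (cl * D x `^ d)%:E <= nu (eball x (2 * D x)).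
Variables (f T : E -> R).
Hypotheses (mf : measurable_fun setT f) (f2 : \int[nu]_y (f y ^+ 2)%:E < +oo).
Hypothesis mT : measurable_fun setT T.
Hypothesis T_sq : forall x k, Om x ->
  ((T x - k) ^+ 2)%:E <= (C1 * D x `^ (- d))%:E *
    \int[nu]_y ((enorm (x - y) < 3 * D x)%R%:R * (f y - k) ^+ 2)%:E.
Hypothesis T_lip : forall x z k, Om x -> Om z -> (enorm (x - z) <= D x / 4)%R ->
  ((T x - T z) ^+ 2)%:E <= (C2 * enorm (x - z) ^+ 2 * D x `^ (- (d + 2)))%:E *
    \int[nu]_y ((enorm (x - y) < 4 * D x)%R%:R * (f y - k) ^+ 2)%:E.

Let chi : E -> R := \1_Om.
Let mchi : measurable_fun setT chi. Proof. exact: measurable_indic. Qed.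
Let chi0 x : (0 <= chi x)%R. Proof. by rewrite /chi indicE. Qed.
Let chi1 x : Om x -> chi x = 1%R. Proof. by move=> Ox; rewrite /chi indicE mem_set. Qed.
Let chiN x : ~ Om x -> chi x = 0%R. Proof. by move=> Ox; rewrite /chi indicE memNset. Qed.

Definition ak (r : R) (x y : E) : R :=
  (chi x * (enorm (x - y) < 3 * D x)%R%:R * (D x < r)%R%:R * D x `^ (- d))%R.

Let ak0 r x y : (0 <= ak r x y)%R.
Proof. by rewrite /ak !mulr_ge0 ?powR_ge0. Qed.

Let mak r : measurable_fun setT (fun q : E * E => (ak r q.1 q.2)%:E).
Proof. by rewrite /ak; mfun. Qed.

Definition ak_const : R := (3 `^ d * (layer_const N%:R d * Cl * 3 `^ (N%:R - d)))%R.

Lemma ak_const_ge0 : (0 <= ak_const)%R.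
Proof.
have l0 : (0 <= layer_const N%:R d)%R by apply: layer_const_ge0; rewrite gt_eqF.
apply: mulr_ge0; first exact: powR_ge0.
by apply: mulr_ge0; [exact: mulr_ge0|exact: powR_ge0].
Qed.

Lemma int_ak_le r y : F y -> (0 < r)%R ->
  \int[la]_x (ak r x y)%:E <= (ak_const * r `^ (N%:R - d))%:E.
Proof.
move=> Fy r0; have r3 : (0 < 3 * r)%R by rewrite mulr_gt0.
apply: (@le_trans _ _ (\int[la]_x ((3 `^ d)%:E * ((enorm (x - y) < 3 * r)%R%:R * enorm (x - y) `^ (- d))%:E))).
  apply: ge0_le_int => x _; first by rewrite lee_fin.
  rewrite -EFinM lee_fin /ak.
  have [Ox|nOx] := pselect (Om x); last first.
    by rewrite chiN// !mul0r; apply: mulr_ge0; [exact: powR_ge0|apply: mulr_ge0; [by []|exact: powR_ge0]].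
  rewrite chi1// mul1r; have Dx := DOm Ox; have Dxy := DF x Fy.
  have RHS0 : (0 <= 3 `^ d * ((enorm (x - y) < 3 * r)%R%:R * enorm (x - y) `^ (- d)) :> R)%R.
    by apply: mulr_ge0; [exact: powR_ge0|apply: mulr_ge0; [by []|exact: powR_ge0]].
  have [h1|h1] := ltP (enorm (x - y)) (3 * D x)%R; last by rewrite !mul0r.
  have [h2|h2] := ltP (D x) r; last by rewrite mulr0 mul0r.
  rewrite (_ : (enorm (x - y) < 3 * r)%R = true); last by lra.
  rewrite !mul1r; have := @powR_comparable R (- d) (D x) (enorm (x - y)) 3.
  by rewrite normrN gtr0_norm//; apply; lra.
rewrite ge0_integralZl//; last 2 first.
- by mfun.
- by move=> x _; rewrite lee_fin mulr_ge0// powR_ge0.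
apply: le_trans (lee_wpmul2l _ (ball_int_small Cl0 dN r3 (fun q q0 _ => la_up y q0))) _.
  by rewrite lee_fin powR_ge0.
rewrite -EFinM lee_fin /ak_const powRM ?(ltW r0)//.
by rewrite le_eqVlt; apply/orP; left; apply/eqP; ring.
Qed.

Lemma T_sq_ak r x k : Om x -> (D x < r)%R ->
  ((T x - k) ^+ 2)%:E <= C1%:E * \int[nu]_y (ak r x y * (f y - k) ^+ 2)%:E.
Proof.
move=> Ox Dr; apply: le_trans (T_sq k Ox) _.
rewrite EFinM -muleA; apply: lee_wpmul2l; first by rewrite lee_fin.
rewrite -ge0_integralZl//; last 3 first.
- by mfun.
- by move=> y _; rewrite lee_fin mulr_ge0// sqr_ge0.
- by rewrite lee_fin powR_ge0.
apply: ge0_le_int => y _.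
  by rewrite -EFinM lee_fin mulr_ge0 ?powR_ge0// mulr_ge0// sqr_ge0.
have Dr1 : ((D x < r)%R%:R = 1 :> R)%R by rewrite Dr.
rewrite -EFinM lee_fin /ak chi1// Dr1 le_eqVlt; apply/orP; left; apply/eqP; ring.
Qed.

Lemma int_T_sq_le : \int[la]_x (T x ^+ 2)%:E <=
  (C1 * (ak_const * M `^ (N%:R - d)))%:E * \int[nu]_y (f y ^+ 2)%:E.
Proof.
have f0 y : 0 <= (f y ^+ 2)%:E by rewrite lee_fin sqr_ge0.
apply: (@le_trans _ _ (\int[la]_x (C1%:E * \int[nu]_y ((ak M x y)%:E * (f y ^+ 2)%:E)))).
  apply: (le_int_on mOm laOm) => [|x|x|x Ox].
  - by mfun.
  - by rewrite lee_fin sqr_ge0.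
  - by rewrite mule_ge0// int_ge0// => y; rewrite mule_ge0// lee_fin.
  have := T_sq_ak 0 Ox (DM Ox); rewrite subr0 => /le_trans; apply.
  by under eq_integral do rewrite subr0 EFinM.
have mak' := mak M.
rewrite ge0_integralZl//; last 2 first.
- apply: (@measurable_int2 _ _ _ _ _ nu (fun x y => (ak M x y)%:E * (f y ^+ 2)%:E)).
    by apply: emeasurable_funM => //; mfun.
  by move=> x y; rewrite mule_ge0// lee_fin.
- by move=> x _; apply: int_ge0 => y; rewrite mule_ge0// lee_fin.
rewrite EFinM -muleA; apply: lee_wpmul2l; first by rewrite lee_fin.
apply: (schur_le_on mF nuF) => //.
- by mfun.
- by move=> x y; rewrite lee_fin.
- by rewrite mulr_ge0 ?powR_ge0// ak_const_ge0.
- by move=> y Fy; exact: int_ak_le.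
Qed.

Lemma average_T_le (c r : R) y0 : (0 < c)%R -> (0 < r)%R -> F y0 ->
  (c * r `^ N%:R)%:E <= la (eball y0 r) ->
  ((average la (eball y0 r) T - f y0) ^+ 2 * (c * r `^ N%:R))%:E <=
  (C1 * (ak_const * r `^ (N%:R - d)) * (4 * r) `^ (d + 2 * al))%:E *
    \int[nu]_y ((f y - f y0) ^+ 2 * enorm (y - y0) `^ (- (d + 2 * al)))%:E.
Proof.
move=> c0 r0 Fy0 la_lo.
have laoo : la (eball y0 r) < +oo by apply: le_lt_trans (la_up y0 r0) _; rewrite ltry.
have la0 : 0 < la (eball y0 r).
  by apply: lt_le_trans la_lo; rewrite lte_fin mulr_gt0// powR_gt0.
have T2 : \int[la]_(x in eball y0 r) (T x ^+ 2)%:E < +oo.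
  apply: (@le_lt_trans _ _ (\int[la]_x (T x ^+ 2)%:E)).
    apply: ge0_subset_integral => //; [exact: measurable_eball|by mfun|].
    by move=> x _; rewrite lee_fin sqr_ge0.
  apply: le_lt_trans int_T_sq_le _; apply: lte_mul_pinfty => //.
  by rewrite lee_fin mulr_ge0// mulr_ge0 ?powR_ge0// ak_const_ge0.
have h := average_sq_le (f y0) (measurable_eball y0 r) (measurable_funTS mT) laoo la0 T2.
apply: (@le_trans _ _ ((average la (eball y0 r) T - f y0) ^+ 2 * fine (la (eball y0 r)))%:E).
  rewrite lee_fin ler_wpM2l ?sqr_ge0// -lee_fin fineK//.
  by rewrite ge0_fin_numE.
apply: le_trans h _; rewrite int_eball; last by move=> x; rewrite lee_fin sqr_ge0.
pose g y : \bar R := ((enorm (y - y0) < 4 * r)%R%:R * (f y - f y0) ^+ 2)%:E.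
have g0 y : 0 <= g y by rewrite lee_fin mulr_ge0// sqr_ge0.
have mg : measurable_fun setT g by rewrite /g; mfun.
apply: (@le_trans _ _ (\int[la]_x (C1%:E * \int[nu]_y ((ak r x y)%:E * g y)))).
  apply: (le_int_on mOm laOm) => [|x|x|x Ox].
  - by mfun.
  - by rewrite -EFinM lee_fin mulr_ge0// sqr_ge0.
  - by rewrite mule_ge0// int_ge0// => y; rewrite mule_ge0// lee_fin.
  have [xy|xy] := ltP (enorm (x - y0)) r; last first.
    by rewrite mul0e mule_ge0// int_ge0// => y; rewrite mule_ge0// lee_fin.
  have Dr : (D x < r)%R by apply: le_lt_trans xy; exact: DF.
  rewrite mul1e; apply: le_trans (T_sq_ak (f y0) Ox Dr) _.
  apply: lee_wpmul2l; first by rewrite lee_fin.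
  apply: ge0_le_int => y _; first by rewrite lee_fin mulr_ge0// sqr_ge0.
  rewrite -EFinM lee_fin.
  have [h3|h3] := ltP (enorm (x - y)) (3 * D x)%R; last first.
    by rewrite {1}/ak ltNge h3 mulr0 !mul0r mulr_ge0// mulr_ge0// sqr_ge0.
  rewrite (_ : (enorm (y - y0) < 4 * r)%R = true) ?mul1r//.
  have := enorm_triangle x y y0; rewrite (enormB y x); lra.
have mak' := mak r.
rewrite ge0_integralZl//; last 2 first.
- apply: (@measurable_int2 _ _ _ _ _ nu (fun x y => (ak r x y)%:E * g y)).
    by apply: emeasurable_funM => //; mfun.
  by move=> x y; rewrite mule_ge0// lee_fin.
- by move=> x _; apply: int_ge0 => y; rewrite mule_ge0// lee_fin.
have A0 : (0 <= ak_const * r `^ (N%:R - d))%R by rewrite mulr_ge0 ?powR_ge0// ak_const_ge0.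
rewrite 2!EFinM -!muleA; apply: lee_wpmul2l; first by rewrite lee_fin.
apply: (@le_trans _ _ ((ak_const * r `^ (N%:R - d))%:E * \int[nu]_y g y)).
  apply: (schur_le_on mF nuF) => //.
  - by move=> x y; rewrite lee_fin.
  - by move=> y Fy; exact: int_ak_le.
apply: lee_wpmul2l; first by rewrite lee_fin.
have q0 : (0 < d + 2 * al)%R by rewrite addr_gt0// mulr_gt0.
rewrite -ge0_integralZl//; last 3 first.
- by mfun.
- by move=> y _; rewrite lee_fin mulr_ge0 ?sqr_ge0// powR_ge0.
- by rewrite lee_fin powR_ge0.
apply: ge0_le_int => y _ //; rewrite -EFinM lee_fin.
have [->|yy] := eqVneq y y0; first by rewrite (subrr (f y0)) expr0n !(mul0r, mulr0).
rewrite mulrC [leRHS]mulrCA ler_wpM2l ?sqr_ge0//.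
have [h|h] := ltP (enorm (y - y0)) (4 * r)%R; last by rewrite mulr_ge0 ?powR_ge0.
have h0 : (0 < enorm (y - y0))%R by rewrite lt_neqAle enorm_ge0 eq_sym enorm_eq0 subr_eq0 yy.
by rewrite powRN ler_pdivlMr ?powR_gt0// mul1r powR_le ?enorm_ge0// ltW.
Qed.

Let q1 : R := (d + 2 * al)%R.
Let q1_gt0 : (0 < q1)%R. Proof. by rewrite addr_gt0// mulr_gt0. Qed.
Let p_gt0 : (0 < p)%R.
Proof.
rewrite /p -addrA addr_gt0 ?mulr_gt0// subr_gt0.
by apply: lt_le_trans dN _; rewrite ler_peMl// ler1n.
Qed.

Let w (x y z : E) : \bar R :=
  ((enorm (x - y) < 4 * D x)%R%:R * ((enorm (x - z) < 4 * D x)%R%:R * (f z - f y) ^+ 2))%:E.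
Let w0 x y z : 0 <= w x y z.
Proof. by rewrite lee_fin mulr_ge0// mulr_ge0// sqr_ge0. Qed.
Let W x := \int[nu]_y \int[nu]_z w x y z.
Let W0 x : 0 <= W x. Proof. by apply: int_ge0 => y; exact: int_ge0. Qed.
Let mw2 : measurable_fun setT (fun s : E * E => \int[nu]_z w s.1 s.2 z).
Proof.
apply: (@measurable_int2 _ _ _ _ _ nu (fun (s : E * E) (z : E) => w s.1 s.2 z)).
  by rewrite /w; mfun.
by move=> s z; exact: w0.
Qed.
Let mW : measurable_fun setT W.
Proof.
apply: (@measurable_int2 _ _ _ _ _ nu (fun x y => \int[nu]_z w x y z)) => //.
by move=> x y; exact: int_ge0.
Qed.

Lemma T_near_le x z : Om x -> Om z -> (enorm (x - z) <= D x / 4)%R ->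
  ((T x - T z) ^+ 2)%:E <=
  (C2 / cl * enorm (x - z) ^+ 2 * D x `^ (- (2 * d + 2)))%:E * W x.
Proof.
move=> Ox Oz xz; have Dx := DOm Ox; have Dd : (0 < D x `^ d)%R by rewrite powR_gt0.
rewrite -(@lee_pmul2l _ (cl * D x `^ d)%:E)//; last by rewrite lte_fin mulr_gt0.
pose C : R := (C2 * enorm (x - z) ^+ 2 * D x `^ (- (d + 2)))%R.
have Cge0 : (0 <= C)%R by rewrite mulr_ge0 ?powR_ge0// mulr_ge0// sqr_ge0.
apply: (@le_trans _ _ (C%:E * W x)); last first.
  rewrite muleA -EFinM lee_wpmul2r// lee_fin /C.
  rewrite le_eqVlt; apply/orP; left; apply/eqP.
  rewrite (_ : (- (2 * d + 2) = - (d + 2) + - d)%R); last by ring.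
  by rewrite (powRDp _ _ Dx) (powRN _ d); field; rewrite !gt_eqF.
apply: (@le_trans _ _ (nu (eball x (2 * D x)) * ((T x - T z) ^+ 2)%:E)).
  by rewrite lee_wpmul2r ?nu_lo// lee_fin sqr_ge0.
rewrite muleC -(integral_cst nu (measurable_eball x _) ((T x - T z) ^+ 2)%:E).
rewrite int_eball; last by move=> y; rewrite lee_fin sqr_ge0.
have mwx : measurable_fun setT (fun y => \int[nu]_z w x y z).
  by have := measurableT_comp mw2 (pair1_measurable x).
rewrite -ge0_integralZl//; last by move=> y _; exact: int_ge0.
apply: ge0_le_int => y _; first by rewrite mule_ge0// lee_fin sqr_ge0.
have [xy|xy] := ltP (enorm (y - x)) (2 * D x)%R; last first.
  by rewrite mul0e mule_ge0 ?int_ge0.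
rewrite mul1e; apply: le_trans (T_lip (f y) Ox Oz xz) _.
apply: lee_wpmul2l; first by rewrite lee_fin.
apply: ge0_le_int => u _; first by rewrite lee_fin mulr_ge0// sqr_ge0.
by rewrite /w (_ : (enorm (x - y) < 4 * D x)%R = true) ?mul1r//; rewrite enormB; lra.
Qed.

Let near_ker (x z : E) : R :=
  (chi x * D x `^ (- (2 * d + 2)) * ((enorm (z - x) < D x)%R%:R * enorm (z - x) `^ (- (p - 2))))%R.
Let near_ker0 x z : (0 <= near_ker x z)%R.
Proof.
by rewrite /near_ker mulr_ge0//; [rewrite mulr_ge0// powR_ge0|rewrite mulr_ge0// powR_ge0].
Qed.

Definition near_const : R :=
  (C2 / cl * (layer_const N%:R (p - 2) * Cl) *
   (4 `^ `|N%:R - 2 * d - p| * (2 `^ `|N%:R - (d + 2 * al + N%:R)| *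
     layer_const N%:R (d + 2 * al + N%:R) * Cl) * 8 `^ (d + 2 * al)))%R.

Let q : R := (N%:R - 2 * d - p)%R.
Let qE : (- (q1 + N%:R) = q)%R. Proof. by rewrite /q /q1 /p; ring. Qed.

Let int_w_le y z : F y ->
  \int[la]_x ((chi x * D x `^ q)%:E * w x y z) <=
  (4 `^ `|q| * (2 `^ `|N%:R - (q1 + N%:R)| * layer_const N%:R (q1 + N%:R) * Cl) * 8 `^ q1)%:E *
    ((f y - f z) ^+ 2 * enorm (y - z) `^ (- q1))%:E.
Proof.
move=> Fy; have [<-|yz] := eqVneq y z.
  rewrite (_ : (fun _ => _) = cst 0) ?integral0; last first.
    by apply/funext => x; rewrite /w subrr expr0n !mulr0 mule0.
  by rewrite (subrr (f y)) expr0n mul0r mule0.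
have h0 : (0 < enorm (y - z))%R by rewrite lt_neqAle enorm_ge0 eq_sym enorm_eq0 subr_eq0 yz.
set rho := enorm (y - z) in h0 *; have r8 : (0 < rho / 8)%R by rewrite divr_gt0.
apply: (@le_trans _ _ (\int[la]_x ((4 `^ `|q| * (f y - f z) ^+ 2)%:E *
    ((rho / 8 <= enorm (x - y))%R%:R * enorm (x - y) `^ (- (q1 + N%:R)))%:E))).
  apply: ge0_le_int => x _; first by rewrite mule_ge0// lee_fin mulr_ge0 ?powR_ge0.
  rewrite -!EFinM lee_fin.
  have R0 : (0 <= 4 `^ `|q| * (f y - f z) ^+ 2 *
    ((rho / 8 <= enorm (x - y))%R%:R * enorm (x - y) `^ (- (q1 + N%:R))))%R.
    apply: mulr_ge0; first by rewrite mulr_ge0 ?powR_ge0// sqr_ge0.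
    by rewrite mulr_ge0// powR_ge0.
  have [Ox|nOx] := pselect (Om x); last by rewrite chiN// !mul0r.
  have Dx := DOm Ox; have Dxy := DF x Fy.
  have [h1|h1] := ltP (enorm (x - y)) (4 * D x)%R; last by rewrite mul0r mulr0.
  have [h2|h2] := ltP (enorm (x - z)) (4 * D x)%R; last by rewrite mul0r !mulr0.
  have h3 : (rho / 8 <= enorm (x - y))%R.
    have := enorm_triangle x y z; rewrite -/rho (enormB y x); lra.
  rewrite h3 chi1// !mul1r qE.
  have -> : ((f z - f y) ^+ 2 = (f y - f z) ^+ 2)%R by ring.
  rewrite mulrAC ler_wpM2r ?sqr_ge0//.
  by apply: powR_comparable; lra.
rewrite ge0_integralZl//; last 3 first.
- by mfun.
- by move=> x _; rewrite lee_fin mulr_ge0// powR_ge0.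
- by rewrite lee_fin mulr_ge0 ?powR_ge0// sqr_ge0.
have Nq : (N%:R < q1 + N%:R)%R by rewrite ltrDr.
apply: le_trans (lee_wpmul2l _ (ball_int_large Cl0 Nq r8 (fun r r0 => la_up y r0))) _.
  by rewrite lee_fin mulr_ge0 ?powR_ge0// sqr_ge0.
rewrite -!EFinM lee_fin.
rewrite (_ : (N%:R - (q1 + N%:R) = - q1)%R); last by ring.
rewrite (powRM (- q1) (ltW h0)) ?invr_ge0//.
have -> : (8^-1 `^ (- q1) = 8 `^ q1 :> R)%R.
  by rewrite -(powR_inv1 (ler0n R 8)) -powRrM mulrNN mul1r.
by rewrite le_eqVlt; apply/orP; left; apply/eqP; ring.
Qed.

Let w_const : R := (4 `^ `|q| * (2 `^ `|N%:R - (q1 + N%:R)| * layer_const N%:R (q1 + N%:R) * Cl) * 8 `^ q1)%R.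
Let w_const0 : (0 <= w_const)%R.
Proof.
have l0 : (0 <= layer_const N%:R (q1 + N%:R) :> R)%R by apply: layer_const_ge0; rewrite lt_eqF// ltrDr.
apply: mulr_ge0; last exact: powR_ge0.
apply: mulr_ge0; first exact: powR_ge0.
by apply: mulr_ge0 => //; apply: mulr_ge0 => //; exact: powR_ge0.
Qed.

Let int_W_le : \int[la]_x ((chi x * D x `^ q)%:E * W x) <= w_const%:E * power_energy nu f q1.
Proof.
pose v x y z := (chi x * D x `^ q)%:E * w x y z.
have v0 x y z : 0 <= v x y z by rewrite mule_ge0// lee_fin mulr_ge0 ?powR_ge0.
have mv3 : measurable_fun setT (fun s : (E * E) * E => v s.1.1 s.1.2 s.2).
  by rewrite /v /w; mfun.
have mv3' : measurable_fun setT (fun s : (E * E) * E => v s.1.2 s.1.1 s.2).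
  by rewrite /v /w; mfun.
have mv3'' : measurable_fun setT (fun s : (E * E) * E => v s.2 s.1.1 s.1.2).
  by rewrite /v /w; mfun.
have mv2 : measurable_fun setT (fun s : E * E => \int[nu]_z v s.1 s.2 z).
  exact: (@measurable_int2 _ _ _ _ _ nu (fun (s : E * E) (z : E) => v s.1 s.2 z)).
have mv2'' : measurable_fun setT (fun s : E * E => \int[la]_x v x s.1 s.2).
  exact: (@measurable_int2 _ _ _ _ _ la (fun (s : E * E) (x : E) => v x s.1 s.2)).
rewrite [X in X <= _](_ : _ = \int[la]_x \int[nu]_y \int[nu]_z v x y z); last first.
  apply: eq_integral => x _.
  have mwx : measurable_fun setT (fun y => \int[nu]_z w x y z).
    by have := measurableT_comp mw2 (pair1_measurable x).
  have c0 : 0 <= (chi x * D x `^ q)%:E by rewrite lee_fin mulr_ge0 ?powR_ge0.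
  rewrite -ge0_integralZl//; last by move=> y _; exact: int_ge0.
  apply: eq_integral => y _; rewrite -ge0_integralZl//.
  by rewrite /w; mfun.
rewrite (@tonelli_swap _ _ _ _ _ la nu (fun x y => \int[nu]_z v x y z))//; last first.
  by move=> x y; exact: int_ge0.
have swap2 y : \int[la]_x \int[nu]_z v x y z = \int[nu]_z \int[la]_x v x y z.
  apply: (@tonelli_swap _ _ _ _ _ la nu (fun x z => v x y z)) => //.
  by rewrite /v /w; mfun.
under eq_integral do rewrite swap2.
have me z : measurable_fun setT (fun y => ((f z - f y) ^+ 2 * enorm (z - y) `^ (- q1))%:E).
  by mfun.
rewrite /power_energy -ge0_integralZl//; last 2 first.
- apply: (@measurable_int2 _ _ _ _ _ nu (fun x y : E => ((f x - f y) ^+ 2 * enorm (x - y) `^ (- q1))%:E)).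
    by mfun.
  by move=> x y; rewrite lee_fin mulr_ge0 ?sqr_ge0// powR_ge0.
- by move=> x _; apply: int_ge0 => y; rewrite lee_fin mulr_ge0 ?sqr_ge0// powR_ge0.
apply: (le_int_on mF nuF) => [|y|y|y Fy].
- apply: (@measurable_int2 _ _ _ _ _ nu (fun y z => \int[la]_x v x y z)) => //.
  by move=> y z; exact: int_ge0.
- by apply: int_ge0 => z; exact: int_ge0.
- by rewrite mule_ge0// int_ge0// => z; rewrite lee_fin mulr_ge0 ?sqr_ge0// powR_ge0.
rewrite -ge0_integralZl//; last by move=> z _; rewrite lee_fin mulr_ge0 ?sqr_ge0// powR_ge0.
apply: ge0_le_int => z _; first exact: int_ge0.
exact: int_w_le.
Qed.

Let mnear : measurable_fun setT (fun s : E * E => (C2 / cl * near_ker s.1 s.2)%:E * W s.1).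
Proof.
apply: emeasurable_funM; last exact: (measurableT_comp mW measurable_fst).
by rewrite /near_ker; mfun.
Qed.

Lemma int_near_le :
  \int[la]_x \int[la]_z ((C2 / cl * near_ker x z)%:E * W x) <= near_const%:E * power_energy nu f q1.
Proof.
have C2cl : (0 <= C2 / cl)%R by rewrite divr_ge0// ltW.
have l0 : (0 <= layer_const N%:R (p - 2) :> R)%R by apply: layer_const_ge0; rewrite gt_eqF.
pose c : R := (C2 / cl * (layer_const N%:R (p - 2) * Cl))%R.
have c0 : (0 <= c)%R by rewrite mulr_ge0// mulr_ge0.
apply: (@le_trans _ _ (\int[la]_x (c%:E * ((chi x * D x `^ q)%:E * W x)))).
  apply: ge0_le_int => x _.
    by apply: int_ge0 => z; rewrite mule_ge0// lee_fin mulr_ge0.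
  have mnx : measurable_fun setT (fun z => (C2 / cl * near_ker x z)%:E).
    by rewrite /near_ker; mfun.
  rewrite ge0_integralZr//; last by move=> z _; rewrite lee_fin mulr_ge0.
  rewrite muleA lee_wpmul2r//.
  have [Ox|nOx] := pselect (Om x); last first.
    rewrite (eq_integral (cst 0)); last by move=> z _; rewrite /near_ker chiN// !mul0r mulr0.
    by rewrite integral0 mule_ge0// lee_fin mulr_ge0 ?powR_ge0.
  have Dx := DOm Ox.
  rewrite (eq_integral (fun z : E => (C2 / cl * D x `^ (- (2 * d + 2)))%:E *
      ((enorm (z - x) < D x)%R%:R * enorm (z - x) `^ (- (p - 2)))%:E)); last first.
    by move=> z _; rewrite /near_ker chi1// mul1r -EFinM mulrA.
  have k0 : 0 <= (C2 / cl * D x `^ (- (2 * d + 2)))%:E by rewrite lee_fin mulr_ge0 ?powR_ge0.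
  rewrite ge0_integralZl//; last 2 first.
  - by mfun.
  - by move=> z _; rewrite lee_fin mulr_ge0// powR_ge0.
  apply: le_trans (lee_wpmul2l k0 (ball_int_small Cl0 pN Dx (fun r r0 _ => la_up x r0))) _.
  rewrite -!EFinM lee_fin chi1// mul1r /c.
  rewrite (_ : q = - (2 * d + 2) + (N%:R - (p - 2)))%R; last by rewrite /q; ring.
  rewrite (powRDp (- (2 * d + 2)) (N%:R - (p - 2)) Dx).
  by rewrite le_eqVlt; apply/orP; left; apply/eqP; ring.
rewrite ge0_integralZl//; last 2 first.
- by apply: emeasurable_funM => //; mfun.
- by move=> x _; rewrite mule_ge0// lee_fin mulr_ge0 ?powR_ge0.
apply: le_trans (lee_wpmul2l _ int_W_le) _; first by rewrite lee_fin.
by rewrite muleA -EFinM /near_const.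
Qed.

Let rk k : R := (M * 2^-1 ^+ k)%R.
Let rk0 k : (0 < rk k)%R. Proof. by rewrite mulr_gt0// exprn_gt0// invr_gt0. Qed.
Let g k (y u : E) : \bar R := ((enorm (y - u) < 28 * rk k)%R%:R * (f y - f u) ^+ 2)%:E.
Let g0 k y u : 0 <= g k y u. Proof. by rewrite lee_fin mulr_ge0// sqr_ge0. Qed.
Let X k (x z : E) : \bar R :=
  \int[nu]_y ((ak (5 * rk k) x y)%:E * \int[nu]_u ((ak (5 * rk k) z u)%:E * g k y u)).
Let X0 k x z : 0 <= X k x z.
Proof.
apply: int_ge0 => y; apply: mule_ge0; first by rewrite lee_fin.
by apply: int_ge0 => u; rewrite mule_ge0// lee_fin.
Qed.
Let mX k : measurable_fun setT (fun s : E * E => X k s.1 s.2).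
Proof.
have mg : measurable_fun setT (fun s : (E * E) * E * E => (ak (5 * rk k) s.1.1.2 s.2)%:E * g k s.1.2 s.2).
  by rewrite /ak /g; mfun.
have h : measurable_fun setT (fun s : (E * E) * E =>
    \int[nu]_u ((ak (5 * rk k) s.1.2 u)%:E * g k s.2 u)).
  apply: (@measurable_int2 _ _ _ _ _ nu (fun (s : (E * E) * E) (u : E) =>
    (ak (5 * rk k) s.1.2 u)%:E * g k s.2 u)) => //.
  by move=> s u; rewrite mule_ge0// lee_fin.
apply: (@measurable_int2 _ _ _ _ _ nu (fun (s : E * E) (y : E) => (ak (5 * rk k) s.1 y)%:E *
  \int[nu]_u ((ak (5 * rk k) s.2 u)%:E * g k y u))).
  by apply: emeasurable_funM => //; rewrite /ak; mfun.
move=> s y; rewrite mule_ge0//; first by rewrite lee_fin.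
by apply: int_ge0 => u; rewrite mule_ge0// lee_fin.
Qed.
Let ck k : R := (2 `^ p * rk k `^ (- p) * C1 ^+ 2)%R.
Let ck0 k : (0 <= ck k)%R.
Proof. by rewrite /ck mulr_ge0 ?sqr_ge0// mulr_ge0 ?powR_ge0. Qed.
Let far (x z : E) : \bar R := \sum_(k <oo) ((ck k)%:E * X k x z).
Let cX0 k x z : 0 <= (ck k)%:E * X k x z. Proof. by rewrite mule_ge0// lee_fin. Qed.
Let far0 x z : 0 <= far x z. Proof. by apply: nneseries_ge0 => k _ _. Qed.
Let mcX k : measurable_fun setT (fun s : E * E => (ck k)%:E * X k s.1 s.2).
Proof. by apply: emeasurable_funM. Qed.
Let mfar : measurable_fun setT (fun s : E * E => far s.1 s.2).
Proof. by apply: ge0_emeasurable_sum => k; [move=> s _ _|move=> _]. Qed.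

Lemma T_far_le x z : Om x -> Om z -> x != z -> (D x / 4 < enorm (x - z))%R ->
  ((T x - T z) ^+ 2 * enorm (x - z) `^ (- p))%:E <= far x z.
Proof.
move=> Ox Oz xz Dxz; set rho := enorm (x - z) in Dxz *.
have rho0 : (0 < rho)%R by rewrite lt_neqAle enorm_ge0 eq_sym enorm_eq0 subr_eq0 xz.
have [k [k1 k2]] := dyadic_ex rho0 (OmM Ox Oz); rewrite -/(rk k) in k2.
rewrite exprSr mulrA -/(rk k) in k1.
have Dz : (D z < 5 * rk k)%R.
  have := Dlip z x; rewrite (enormB z x) -/rho; lra.
have Dx5 : (D x < 5 * rk k)%R by lra.
have h : ((T x - T z) ^+ 2)%:E <= (C1 ^+ 2)%:E * X k x z.
  apply: le_trans (T_sq_ak (T z) Ox Dx5) _.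
  rewrite expr2 EFinM -muleA; apply: lee_wpmul2l; first by rewrite lee_fin.
  have mh : measurable_fun setT (fun y : E => \int[nu]_u ((ak (5 * rk k) z u)%:E * g k y u)).
    apply: (@measurable_int2 _ _ _ _ _ nu (fun (y u : E) => (ak (5 * rk k) z u)%:E * g k y u)).
      by rewrite /ak /g; mfun.
    by move=> y u; rewrite mule_ge0// lee_fin.
  rewrite /X -ge0_integralZl//; last 2 first.
  - by apply: emeasurable_funM => //; rewrite /ak; mfun.
  - move=> y _; rewrite mule_ge0//; first by rewrite lee_fin.
    by apply: int_ge0 => u; rewrite mule_ge0// lee_fin.
  apply: ge0_le_int => y _; first by rewrite lee_fin mulr_ge0// sqr_ge0.
  have [xy|xy] := ltP (enorm (x - y)) (3 * D x)%R; last first.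
    have -> : ak (5 * rk k) x y = 0%R by rewrite /ak ltNge xy mulr0 !mul0r.
    by rewrite mul0r mul0e mule0.
  rewrite EFinM muleCA; apply: lee_wpmul2l; first by rewrite lee_fin.
  have -> : ((f y - T z) ^+ 2 = (T z - f y) ^+ 2)%R by ring.
  apply: le_trans (T_sq_ak (f y) Oz Dz) _; apply: lee_wpmul2l; first by rewrite lee_fin.
  apply: ge0_le_int => u _; first by rewrite lee_fin mulr_ge0// sqr_ge0.
  rewrite /g -EFinM lee_fin.
  have [zu|zu] := ltP (enorm (z - u)) (3 * D z)%R; last first.
    have -> : ak (5 * rk k) z u = 0%R by rewrite /ak ltNge zu mulr0 !mul0r.
    by rewrite !mul0r.
  rewrite (_ : (enorm (y - u) < 28 * rk k)%R = true).
    by rewrite mul1r; have -> : ((f u - f y) ^+ 2 = (f y - f u) ^+ 2)%R by ring.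
  have t1 := enorm_triangle x y u; have t2 := enorm_triangle z x u.
  rewrite (enormB y x) in t1; rewrite -/rho in t2.
  have := Dlip z x; rewrite (enormB z x) -/rho; lra.
apply: (@le_trans _ _ ((ck k)%:E * X k x z)); last first.
  apply: le_trans (nneseries_lim_ge k.+1 _); last by move=> j ? _; exact: cX0.
  by rewrite big_nat_recr//= leeDr// sume_ge0// => i _; exact: (cX0 i x z).
rewrite mulrC EFinM; apply: le_trans (lee_wpmul2l _ h) _; first by rewrite lee_fin powR_ge0.
rewrite muleA -EFinM; apply: lee_wpmul2r => //; rewrite lee_fin /ck ler_wpM2r ?sqr_ge0//.
have := @powR_comparable R (- p) rho (rk k) 2; rewrite normrN gtr0_norm//; apply => //.
- exact: ler1n.
- by lra.
Qed.

Definition far_const : R :=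
  (2 `^ p * C1 ^+ 2 * (ak_const * 5 `^ (N%:R - d)) ^+ 2 * (2 `^ q1 / (2 `^ q1 - 1) * 28 `^ q1))%R.

Lemma int_far_le : \int[la]_x \int[la]_z far x z <= far_const%:E * power_energy nu f q1.
Proof.
rewrite (eq_integral (fun x => \sum_(k <oo) \int[la]_z ((ck k)%:E * X k x z))); last first.
  move=> x _; rewrite integral_nneseries// => k.
  by have := measurableT_comp (mcX k) (pair1_measurable x).
rewrite integral_nneseries//; last 2 first.
- move=> k; apply: (@measurable_int2 _ _ _ _ _ la (fun x z => (ck k)%:E * X k x z)) => //.
- by move=> k x _; exact: int_ge0.
pose c : R := (2 `^ p * C1 ^+ 2 * (ak_const * 5 `^ (N%:R - d)) ^+ 2)%R.
have c0 : (0 <= c)%R by rewrite mulr_ge0 ?sqr_ge0// mulr_ge0 ?sqr_ge0// powR_ge0.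
apply: (@le_trans _ _ (\sum_(k <oo) (c%:E * ((rk k `^ (- q1))%:E * near_energy nu f (28 * rk k))))).
  apply: lee_nneseries => k _ => [_|]; first by apply: integral_ge0 => x _; exact: int_ge0.
  have r5 : (0 < 5 * rk k)%R by rewrite mulr_gt0.
  have A0 : (0 <= ak_const * (5 * rk k) `^ (N%:R - d))%R by rewrite mulr_ge0 ?powR_ge0// ak_const_ge0.
  have mg : measurable_fun setT (fun s : E * E => g k s.1 s.2) by rewrite /g; mfun.
  have hX : \int[la]_x \int[la]_z X k x z <=
      ((ak_const * (5 * rk k) `^ (N%:R - d)) ^+ 2)%:E * near_energy nu f (28 * rk k).
    apply: (schur2_le_on mF nuF (mak (5 * rk k)) mg) => // [x y|y Fy]; first by rewrite lee_fin.
    exact: int_ak_le.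
  have mXx x : measurable_fun setT (X k x).
    by have := measurableT_comp (mX k) (pair1_measurable x).
  under eq_integral => x _ do rewrite ge0_integralZl ?lee_fin//.
  rewrite ge0_integralZl//; last 3 first.
  - by apply: (@measurable_int2 _ _ _ _ _ la (X k)).
  - by move=> x _; exact: int_ge0.
  - by rewrite lee_fin.
  apply: le_trans (lee_wpmul2l _ hX) _; first by rewrite lee_fin.
  rewrite !muleA lee_wpmul2r ?near_energy_ge0// -!EFinM lee_fin /ck /c.
  rewrite (_ : - q1 = - p + ((N%:R - d) + (N%:R - d)))%R; last by rewrite /q1 /p; ring.
  rewrite !(powRDp _ _ (rk0 k)) (powRM (N%:R - d) (ler0n R 5) (ltW (rk0 k))).
  by rewrite (powRDp _ (- d) (rk0 k)) le_eqVlt; apply/orP; left; apply/eqP; ring.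
rewrite nneseriesZl; last first.
  by move=> k _; rewrite mule_ge0 ?near_energy_ge0// lee_fin powR_ge0.
have -> : far_const%:E * power_energy nu f q1 =
    c%:E * ((2 `^ q1 / (2 `^ q1 - 1) * 28 `^ q1)%:E * power_energy nu f q1).
  by rewrite muleA -EFinM.
apply: lee_wpmul2l; first by rewrite lee_fin.
by apply: sum_near_energy_le.
Qed.

Lemma power_energy_T_le :
  power_energy la T p <= (near_const + far_const)%:E * power_energy nu f q1.
Proof.
have C2cl : (0 <= C2 / cl)%R by rewrite divr_ge0// ltW.
pose nr x z := (C2 / cl * near_ker x z)%:E * W x.
have nr0 x z : 0 <= nr x z by rewrite mule_ge0// lee_fin mulr_ge0.
have mnrx x : measurable_fun setT (nr x).
  by have := measurableT_comp mnear (pair1_measurable x).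
have mfarx x : measurable_fun setT (far x).
  by have := measurableT_comp mfar (pair1_measurable x).
have mE : measurable_fun setT (fun s : E * E => ((T s.1 - T s.2) ^+ 2 * enorm (s.1 - s.2) `^ (- p))%:E).
  by mfun.
have E0 (x z : E) : 0 <= ((T x - T z) ^+ 2 * enorm (x - z) `^ (- p))%:E.
  by rewrite lee_fin mulr_ge0 ?sqr_ge0// powR_ge0.
apply: (@le_trans _ _ (\int[la]_x \int[la]_z (nr x z + far x z))).
  apply: (le_int_on mOm laOm) => [|x|x|x Ox].
  - by apply: (@measurable_int2 _ _ _ _ _ la (fun x z : E => ((T x - T z) ^+ 2 * enorm (x - z) `^ (- p))%:E)).
  - exact: int_ge0.
  - by apply: int_ge0 => z; rewrite adde_ge0.
  apply: (le_int_on mOm laOm) => [|z|z|z Oz] //.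
  - by mfun.
  - by rewrite adde_ge0.
  have [->|xz] := eqVneq x z; first by rewrite (subrr (T z)) expr0n mul0r adde_ge0.
  have rho0 : (0 < enorm (x - z))%R by rewrite lt_neqAle enorm_ge0 eq_sym enorm_eq0 subr_eq0 xz.
  have [h|h] := leP (enorm (x - z)) (D x / 4)%R; last first.
    by apply: le_trans (T_far_le Ox Oz xz h) _; rewrite leeDr.
  apply: (@le_trans _ _ (nr x z)); last by rewrite leeDl.
  have hn := T_near_le Ox Oz h.
  rewrite mulrC EFinM; apply: le_trans (lee_wpmul2l _ hn) _; first by rewrite lee_fin powR_ge0.
  rewrite muleA -EFinM lee_wpmul2r// lee_fin /near_ker chi1// mul1r (enormB z x).
  have Dx := DOm Ox.
  rewrite (_ : (enorm (x - z) < D x)%R = true) ?mul1r; last by lra.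
  rewrite (_ : - (p - 2) = - p + 2)%R; last by ring.
  rewrite (powRDp _ _ rho0) (powR_mulrn 2 (enorm_ge0 _)).
  by rewrite le_eqVlt; apply/orP; left; apply/eqP; ring.
have int_nr0 x : 0 <= \int[la]_z nr x z by exact: int_ge0.
have int_far0 x : 0 <= \int[la]_z far x z by exact: int_ge0.
rewrite (eq_integral (fun x => \int[la]_z nr x z + \int[la]_z far x z)); last first.
  move=> x _; exact: (ge0_integralD la measurableT (fun z _ => nr0 x z) (mnrx x)
    (fun z _ => far0 x z) (mfarx x)).
have mnr := @measurable_int2 _ _ _ _ _ la nr mnear nr0.
have mfr := @measurable_int2 _ _ _ _ _ la far mfar far0.
rewrite (ge0_integralD la measurableT (fun x _ => int_nr0 x) mnr (fun x _ => int_far0 x) mfr).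
rewrite EFinD ge0_muleDl; first by apply: leeD; [exact: int_near_le|exact: int_far_le].
  rewrite lee_fin mulr_ge0//; apply: mulr_ge0 => //; apply: mulr_ge0 => //.
  by apply: layer_const_ge0; rewrite gt_eqF.
rewrite lee_fin; apply: mulr_ge0; first by rewrite mulr_ge0 ?sqr_ge0// mulr_ge0 ?powR_ge0// sqr_ge0.
apply: mulr_ge0; last exact: powR_ge0.
rewrite divr_ge0 ?powR_ge0// subr_ge0.
by have := @powR_le R q1 1 2; rewrite powR1; apply; rewrite ?(ltW q1_gt0)// ler1n.
Qed.

End averaging_operator.

(** * Positivity of the constant in the Green formula *)

Section real_line_integrals.
Context (R : realType).
Local Notation leb1 := (@lebesgue_measure R).

Lemma leb1_ball (c r : R) : 0 < r -> (leb1 [set x | `|x - c| < r]%R <= (2 * r `^ 1)%:E)%E.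
Proof.
move=> r0; have -> : [set x | `|x - c| < r]%R = `]c - r, c + r[%classic.
  by apply/seteqP; split => x /=; rewrite in_itv/= ltr_distl.
rewrite lebesgue_measure_itv/= lte_fin ifT; last by lra.
by rewrite -EFinB lee_fin powRr1 ?(ltW r0)//; lra.
Qed.

Lemma measurable_dist1 (c : R) : measurable_fun setT (fun x : measurableTypeR R => `|x - c| : R).
Proof. by apply: measurableT_comp => //; apply: measurable_funB. Qed.

Lemma leb1_small (c p : R) : p < 1 ->
  (\int[leb1]_x ((`|x - c| < 1)%R%:R * `|x - c| `^ (- p))%:E < +oo)%E.
Proof.
move=> p1; have := @layer_small R _ _ leb1 (fun x => `|x - c|) 2 1 p 1 (measurable_dist1 c)
  (fun x => normr_ge0 _) ltr01 (ler0n R 2) p1 (fun r r0 _ => leb1_ball c r0).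
by move=> /le_lt_trans; apply; rewrite ltry.
Qed.

Lemma leb1_large (p : R) : 1 < p ->
  (\int[leb1]_x ((1 <= `|x - 0|)%R%:R * `|x - 0| `^ (- p))%:E < +oo)%E.
Proof.
move=> p1; have := @layer_large R _ _ leb1 (fun x => `|x - 0|) 2 1 p 1 (measurable_dist1 0)
  ltr01 (ler0n R 2) p1 (fun r r1 => leb1_ball 0 (lt_le_trans ltr01 r1)).
by move=> /le_lt_trans; apply; rewrite ltry.
Qed.

(* A power envelope that is integrable on the half-line and dominates all the
   integrands below. *)
Definition envelope (k1 k2 k3 p b x : R) : R :=
  k1 * ((`|x - 0| < 1)%R%:R * `|x - 0| `^ (- p)) +
  k2 * ((`|x - 1| < 1)%R%:R * `|x - 1| `^ (- b)) +
  k3 * ((1 <= `|x - 0|)%R%:R * `|x - 0| `^ (- 2)).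

Lemma le_envelope (k1 k2 k3 p b x : R) : 0 <= k1 -> 0 <= k2 -> 0 <= k3 ->
  [/\ k1 * ((`|x - 0| < 1)%R%:R * `|x - 0| `^ (- p)) <= envelope k1 k2 k3 p b x,
      k2 * ((`|x - 1| < 1)%R%:R * `|x - 1| `^ (- b)) <= envelope k1 k2 k3 p b x &
      k3 * ((1 <= `|x - 0|)%R%:R * `|x - 0| `^ (- 2)) <= envelope k1 k2 k3 p b x].
Proof.
move=> k10 k20 k30; rewrite /envelope.
have h (k : R) (c : bool) (y : R) : 0 <= k -> 0 <= y -> 0 <= k * (c%:R * y).
  by move=> ? ?; rewrite mulr_ge0// mulr_ge0.
have h1 := h _ (`|x - 0| < 1)%R _ k10 (powR_ge0 `|x - 0| (- p)).
have h2 := h _ (`|x - 1| < 1)%R _ k20 (powR_ge0 `|x - 1| (- b)).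
have h3 := h _ (1 <= `|x - 0|)%R _ k30 (powR_ge0 `|x - 0| (- 2)).
by split; [rewrite -addrA lerDl addr_ge0|rewrite addrAC lerDr addr_ge0|rewrite lerDr addr_ge0].
Qed.

Lemma envelope_integrable (k1 k2 k3 p b : R) : 0 <= k1 -> 0 <= k2 -> 0 <= k3 -> p < 1 -> b < 1 ->
  leb1.-integrable `]0, +oo[ (EFin \o envelope k1 k2 k3 p b).
Proof.
move=> k10 k20 k30 p1 b1.
have m0 := measurable_dist1 0; have m1 := measurable_dist1 1.
have int (f : measurableTypeR R -> R) : measurable_fun setT f -> (forall x, 0 <= f x) ->
    (\int[leb1]_x (f x)%:E < +oo)%E -> leb1.-integrable `]0, +oo[ (EFin \o f).
  move=> mf f0 foo; apply: (@integrableS _ _ _ _ setT) => //.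
  apply/integrableP; split; first exact/measurable_EFinP.
  by under eq_integral do rewrite /= ger0_norm//.
have i1 : leb1.-integrable `]0, +oo[ (EFin \o (fun x => (`|x - 0| < 1)%R%:R * `|x - 0| `^ (- p))).
  apply: int; [|by move=> x; rewrite mulr_ge0 ?powR_ge0|exact: leb1_small].
  by apply: measurable_funM; [exact: measurable_ltR|exact: measurable_funpow].
have i2 : leb1.-integrable `]0, +oo[ (EFin \o (fun x => (`|x - 1| < 1)%R%:R * `|x - 1| `^ (- b))).
  apply: int; [|by move=> x; rewrite mulr_ge0 ?powR_ge0|exact: leb1_small].
  by apply: measurable_funM; [exact: measurable_ltR|exact: measurable_funpow].
have i3 : leb1.-integrable `]0, +oo[ (EFin \o (fun x => (1 <= `|x - 0|)%R%:R * `|x - 0| `^ (- 2))).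
  apply: int; [|by move=> x; rewrite mulr_ge0 ?powR_ge0|by apply: leb1_large; lra].
  by apply: measurable_funM; [exact: measurable_leR|exact: measurable_funpow].
have mI : measurable (`]0, +oo[%classic : set (measurableTypeR R)) by [].
have := integrableD mI (integrableD mI (integrableZl mI k1 i1) (integrableZl mI k2 i2)) (integrableZl mI k3 i3).
by apply: eq_integrable.
Qed.

End real_line_integrals.

Section half_line.
Context (R : realType).
Local Notation leb1 := (@lebesgue_measure R).
Implicit Types (a b x y z : R).

Lemma powR_anti x a b : 0 < x -> x <= 1 -> a <= b -> x `^ b <= x `^ a.
Proof.
move=> x0 x1 ab; rewrite /powR (gt_eqF x0) ler_expR.
by rewrite ler_wnM2r// ln_le0.
Qed.

Lemma half_line_Rint_gt0 (f : R -> R) :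
  leb1.-integrable `]0, +oo[ (EFin \o f) ->
  (forall z, 0 < z -> z != 1 -> 0 < f z) ->
  0 < (\int[leb1]_(z in `]0, +oo[) f z)%R.
Proof.
move=> fi f0; have mI : measurable (`]0, +oo[%classic : set R) by [].
have mf := measurable_int _ fi.
have fabs : (\int[leb1]_(z in `]0%R, +oo[) (f z)%:E = \int[leb1]_(z in `]0%R, +oo[) `|(f z)%:E|)%E.
  apply: ae_eq_integral => //; first exact: measurableT_comp.
  exists [set 1]; split; [exact: measurable_set1|exact: lebesgue_measure_set1|].
  move=> z /= /not_implyP[]; rewrite in_itv/= andbT => z0 ne; apply: contrapT => /eqP z1.
  by apply: ne; rewrite ger0_norm// ltW// f0.
rewrite /Rintegral fine_gt0//; apply/andP; split; last first.
  by rewrite fabs; have [_] := integrableP _ _ _ fi.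
rewrite lt_neqAle; apply/andP; split; last by rewrite fabs integral_ge0.
apply/negP => /eqP/esym; rewrite fabs => /(proj1 (ae_eq_integral_abs leb1 mI mf))[Z [mZ Z0 sZ]].
have : (leb1 `]0%R, 1%R[%classic <= leb1 Z)%E.
  apply: le_measure; rewrite ?inE//; apply: subset_trans sZ => z /=.
  rewrite in_itv/= => /andP[z0 z1]; apply/not_implyP; rewrite in_itv/= z0; split => //.
  by case=> fz; have := f0 z z0; rewrite fz ltxx lt_eqF// => /(_ isT).
by rewrite Z0 lebesgue_measure_itv/= lte_fin ltr01 -EFinB subr0 lee_fin leNgt ltr01.
Qed.

Lemma continuous_powRr z : 0 < z -> continuous (fun x : R => z `^ x).
Proof.
move=> z0 x; rewrite /powR (gt_eqF z0).
apply: continuous_comp; last exact: continuous_expR.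
by apply: cvgM; [exact: cvg_id|exact: cvg_cst].
Qed.

Lemma expR_ge_pow (k : nat) (x : R) : 0 <= x -> (x / k.+1%:R) ^+ k.+1 <= expR x.
Proof.
move=> x0; have -> : expR x = expR (x / k.+1%:R) ^+ k.+1 by rewrite -expRM_natl mulrC divfK.
rewrite lerXn2r ?nnegrE ?divr_ge0 ?expR_ge0//; apply: le_trans (expR_ge1Dx _).
by rewrite lerDr.
Qed.

Definition gamma_fun x z : R := z `^ (x - 1) * expR (- z).

Lemma gamma_fun_ge0 x z : 0 <= gamma_fun x z.
Proof. by rewrite mulr_ge0 ?powR_ge0 ?expR_ge0. Qed.

Lemma gamma_fun_le (v : R) : exists2 k : R, 0 <= k & forall u x z : R, 0 < z ->
  u <= x -> x <= v -> gamma_fun x z <= envelope 1 0 k (1 - u) 0 z.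
Proof.
have [m vm] : exists m : nat, v + 1 <= m.+1%:R.
  by exists (Num.truncn (v + 1)); rewrite ltW// truncnS_gt.
exists (m.+1%:R ^+ m.+1); first by rewrite exprn_ge0.
move=> u x z z0 ux xv; rewrite /envelope !subr0 mul0r addr0 mul1r (gtr0_norm z0) /gamma_fun.
have e0 := expR_gt0 (- z).
have [z1|z1] := ltP z 1; rewrite ?z1 ?(lt_geF z1) ?(le_gtF z1) ?mul1r ?mul0r ?mulr0 ?addr0 ?add0r.
  rewrite -[leRHS]mulr1 ler_pM ?powR_ge0 ?(ltW e0)//.
    by apply: powR_anti => //; [exact: ltW|lra].
  by rewrite expR_le1; lra.
have h1 : z `^ (x - 1) <= z `^ (m.+1%:R + (- 2)) by apply: ler_powR => //; lra.
apply: (le_trans (ler_wpM2r (ltW e0) h1)); rewrite (powRDp _ _ z0) powR_mulrn ?(ltW z0)//.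
have := expR_ge_pow m (ltW z0); rewrite expr_div_n ler_pdivrMr ?exprn_gt0// => h.
have h2 : z ^+ m.+1 * expR (- z) <= m.+1%:R ^+ m.+1.
  by rewrite expRN ler_pdivrMr ?expR_gt0// mulrC.
by rewrite mulrAC ler_wpM2r ?powR_ge0.
Qed.

Lemma measurable_powRl (q : R) : measurable_fun setT (fun z : measurableTypeR R => z `^ q : R).
Proof. exact: (measurable_funpow (f := fun z => z)). Qed.

Lemma gamma_integrable x : 0 < x -> leb1.-integrable `]0, +oo[ (EFin \o gamma_fun x).
Proof.
move=> x0; have [k k0 le] := gamma_fun_le x.
apply: (le_integrable _ _ _ (envelope_integrable ler01 (lexx 0) k0 (_ : 1 - x < 1) ltr01)) => //; last by lra.
  apply/measurable_EFinP/measurable_funTS; apply: measurable_funM; first exact: measurable_powRl.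
  apply: measurableT_comp => //; exact: measurable_funN.
move=> z; rewrite /= in_itv/= andbT => z0.
rewrite lee_fin ger0_norm ?gamma_fun_ge0// (le_trans _ (ler_norm _))//.
exact: le.
Qed.

Lemma Gamma_gt0 x : 0 < x -> 0 < Gamma x.
Proof.
move=> x0; apply: (half_line_Rint_gt0 (gamma_integrable x0)) => z z0 _.
by rewrite /gamma_fun mulr_gt0 ?powR_gt0 ?expR_gt0.
Qed.

Lemma Gamma_continuous x : 0 < x -> {for x, continuous (@Gamma R)}.
Proof.
move=> x0; have [k k0 le] := gamma_fun_le (x + 1).
apply: (@continuity_under_integral R _ _ leb1 gamma_fun `]0, +oo[ _ (x / 2) (x + 1)
  _ _ (envelope 1 0 k (1 - x / 2) 0)) => //.
- by move=> y; rewrite /= in_itv/= => /andP[? ?]; apply: gamma_integrable; lra.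
- apply: aeW => z /=; rewrite in_itv/= andbT => z0 y _.
  apply: cvgM; last exact: cvg_cst.
  apply: (@cvg_comp _ _ _ (fun t : R => t - 1) (fun t => z `^ t) _ (nbhs (y - 1))); last exact: continuous_powRr.
  by apply: cvgB; [exact: cvg_id|exact: cvg_cst].
- apply: envelope_integrable => //; lra.
- move=> y; rewrite /= in_itv/= => /andP[? ?]; apply: aeW => z /=; rewrite in_itv/= andbT => z0.
  by rewrite ger0_norm ?gamma_fun_ge0//; apply: le => //; lra.
- by rewrite inE/= in_itv/=; apply/andP; split; lra.
Qed.

End half_line.

Section green_kernel.
Context (R : realType).
Local Notation leb1 := (@lebesgue_measure R).
Implicit Types (a b x y z : R).

Definition exp_slope (al be a : R) : R :=
  if a == 0 then be - al else (expR (a * be) - expR (a * al)) / a.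

Lemma exp_slope_bounds (al be a : R) : al < be ->
  0 < exp_slope al be a <= (be - al) * (expR (a * be) + expR (a * al)).
Proof.
move=> ab; rewrite /exp_slope; have [->|a0] := eqVneq a 0.
  by rewrite !mul0r expR0 subr_gt0 ab/=; lra.
have ea := expR_gt0 (a * al); have eb := expR_gt0 (a * be).
have h1 : expR (a * al) * (1 + a * (be - al)) <= expR (a * be).
  rewrite (_ : a * be = a * al + a * (be - al)); last by ring.
  by rewrite expRD ler_wpM2l ?(ltW ea)// expR_ge1Dx.
have h2 : expR (a * be) * (1 - a * (be - al)) <= expR (a * al).
  rewrite (_ : expR (a * al) = expR (a * be) * expR (- (a * (be - al)))).
    by rewrite ler_wpM2l ?(ltW eb)// expR_ge1Dx.
  by rewrite -expRD; congr expR; ring.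
have d0 : 0 < be - al by rewrite subr_gt0.
have [an|ap] := ltP a 0.
  have i0 : a^-1 < 0 by rewrite invr_lt0.
  have p1 : 0 < (- a) * (be - al) by rewrite mulr_gt0 ?oppr_gt0.
  apply/andP; split.
    rewrite nmulr_lgt0// subr_lt0 ltr_expR ltr_nM2l//.
  rewrite ler_ndivrMr//; nra.
have {}ap : 0 < a by rewrite lt_neqAle eq_sym a0.
have p1 : 0 < a * (be - al) by rewrite mulr_gt0.
apply/andP; split.
  by rewrite divr_gt0// subr_gt0 ltr_expR ltr_pM2l.
rewrite ler_pdivrMr//; nra.
Qed.

Lemma exp_slope_continuous (al be : R) : continuous (exp_slope al be).
Proof.
pose h a := expR (a * be) - expR (a * al).
have ch : continuous h.
  move=> a; apply: cvgB.
  - apply: (@cvg_comp _ _ _ (fun t : R => t * be) expR _ (nbhs (a * be))); last exact: continuous_expR.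
    by apply: cvgM; [exact: cvg_id|exact: cvg_cst].
  - apply: (@cvg_comp _ _ _ (fun t : R => t * al) expR _ (nbhs (a * al))); last exact: continuous_expR.
    by apply: cvgM; [exact: cvg_id|exact: cvg_cst].
move=> a; have [->|a0] := eqVneq a 0; last first.
  rewrite /continuous_at (_ : exp_slope al be a = h a / a); last by rewrite /exp_slope (negbTE a0).
  have near0 : \forall t \near a, t != 0.
    by apply: open_nbhs_nbhs; split => //; exact: open_neq.
  apply: (@cvg_trans _ ((fun t => h t / t) @ nbhs a)).
    apply: near_eq_cvg; near=> t; rewrite /exp_slope ifF//; apply/negbTE.
    by near: t.
  by apply: cvgM; [exact: ch|apply: cvgV => //; exact: cvg_id].
have dh : is_derive (0 : R) (1 : R) h (be - al).
  rewrite /h; apply: is_derive_eq.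
  by rewrite !mul0r expR0 /GRing.scale/= !mul1r ?mulr1 ?mulr0 ?addr0 ?add0r; ring.
have := @ex_derive _ _ _ _ _ _ _ dh; have := @derive_val _ _ _ _ _ _ _ dh; rewrite /derive => dv dd.
apply/cvgrPdist_lt => e e0.
have : (fun t : R => t^-1 *: (h (t *: 1 + 0) - h 0)) @ 0^' --> be - al.
  by rewrite -dv; exact: dd.
move/cvgrPdist_lt => /(_ e e0); rewrite near_withinE.
apply: filterS => t; rewrite /exp_slope eqxx.
have [->|tn /(_ isT)] := eqVneq t 0; first by rewrite subrr normr0.
by rewrite /h /GRing.scale/= addr0 mulr1 !mul0r expR0 subrr subr0 mulrC.
Unshelve. all: by end_near.
Qed.

Definition lo z : R := `|z - 1|.
Definition hi z : R := Num.max z 1.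

Lemma lo_hi z : 0 < z -> z != 1 -> [/\ 0 < lo z, 0 < hi z & lo z < hi z].
Proof.
move=> z0 z1; rewrite /lo /hi; split.
- by rewrite normr_gt0 subr_eq0.
- by rewrite lt_max z0.
- by rewrite lt_max !ltr_norml; have [/ltW|] := ltP z 1 => h; apply/orP; [right|left]; lra.
Qed.

Definition green_kernel a z : R :=
  (if a == 0 then ln (hi z) - ln (lo z) else (hi z `^ a - lo z `^ a) / a) * z `^ (- 1 - a).

Lemma green_kernelE a z : 0 < z -> z != 1 ->
  green_kernel a z = exp_slope (ln (lo z)) (ln (hi z)) a * z `^ (- 1 - a).
Proof.
move=> z0 z1; have [l0 h0 _] := lo_hi z0 z1.
by rewrite /green_kernel /exp_slope /powR (gt_eqF l0) (gt_eqF h0).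
Qed.

Lemma green_kernel_bounds a z : 0 < z -> z != 1 ->
  0 < green_kernel a z <=
    (ln (hi z) - ln (lo z)) * (hi z `^ a + lo z `^ a) * z `^ (- 1 - a).
Proof.
move=> z0 z1; have [l0 h0 lh] := lo_hi z0 z1; rewrite green_kernelE//.
have /andP[p q] : 0 < exp_slope (ln (lo z)) (ln (hi z)) a <=
   (ln (hi z) - ln (lo z)) * (hi z `^ a + lo z `^ a).
  have -> : hi z `^ a = expR (a * ln (hi z)) by rewrite /powR (gt_eqF h0).
  have -> : lo z `^ a = expR (a * ln (lo z)) by rewrite /powR (gt_eqF l0).
  by apply: exp_slope_bounds; rewrite ltr_ln ?posrE.
by rewrite mulr_gt0 ?powR_gt0//= ler_wpM2r ?powR_ge0.
Qed.

Lemma ln_ratio_le (x y : R) : 0 < x -> 0 < y -> ln y - ln x <= y / x - 1.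
Proof.
move=> x0 y0; rewrite -ln_div ?posrE//.
have := @le_ln1Dx _ (y / x - 1); rewrite [1 + _]addrC subrK; apply.
by rewrite ltrBrDr addNr divr_gt0.
Qed.

Lemma powR_le_inv (x a : R) : 0 < x -> x <= 1 -> - 1 <= a -> x `^ a <= x^-1.
Proof. by move=> x0 x1 a1; rewrite -powR_inv1 ?(ltW x0)//; exact: powR_anti. Qed.

Lemma green_kernel_le (a0 eta : R) : 0 < a0 < 1 -> 0 < eta <= 1 -> forall a z : R, `|a| <= a0 ->
  0 < z -> z != 1 ->
  `|green_kernel a z| <= envelope 6 (24 / eta) 12 a0 (a0 + eta) z.
Proof.
move=> /andP[a00 a01] /andP[eta0 eta1] a z aa z0 z1.
have [l0 h0 lh] := lo_hi z0 z1; have /andP[K0 K1] := green_kernel_bounds a z0 z1.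
rewrite gtr0_norm//; apply: (le_trans K1).
have /andP[aL aU] : - a0 <= a <= a0 by rewrite -ler_norml.
have lnge : 0 <= ln (hi z) - ln (lo z) by rewrite subr_ge0 ler_ln ?posrE// ltW.
have ph := powR_ge0 (hi z) a; have pl := powR_ge0 (lo z) a.
have pz := powR_gt0 (- 1 - a) z0.
have [E1 E2 E3] := @le_envelope R 6 (24 / eta) 12 a0 (a0 + eta) z (ler0n R 6) (divr_ge0 (ler0n R 24) (ltW eta0)) (ler0n R 12).
clear K1 K0 aa.
have [z2|z2] := leP z 2^-1.
  have hz : hi z = 1 by rewrite /hi max_r//; lra.
  have lz : lo z = 1 - z by rewrite /lo distrC gtr0_norm//; lra.
  apply: (le_trans _ E1); clear E1 E2 E3.
  rewrite subr0 (gtr0_norm z0) (_ : (z < 1)%R = true) ?mul1r; last by apply/idP; lra.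
  have h1 : ln (hi z) - ln (lo z) <= 2 * z.
    apply: (le_trans (ln_ratio_le l0 h0)); rewrite hz lz lerBlDr ler_pdivrMr; nra.
  have h2 : hi z `^ a + lo z `^ a <= 3.
    rewrite hz powR1; suff : lo z `^ a <= 2 by lra.
    apply: (le_trans (powR_le_inv l0 _ _)); rewrite ?lz; [lra|lra|].
    by rewrite invf_ple ?posrE; lra.
  have h3 : z * z `^ (- 1 - a) <= z `^ (- a0).
    rewrite -{1}(powRr1 (ltW z0)) -(powRDp _ _ z0); apply: powR_anti => //; lra.
  apply: (@le_trans _ _ (2 * z * 3 * z `^ (-1 - a))).
    by rewrite ler_pM2r//; apply: ler_pM => //; exact: addr_ge0.
  by rewrite (_ : _ * _ = 6 * (z * z `^ (-1 - a))); [rewrite ler_pM2l|ring].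
have [z3|z3] := leP (3 / 2) z.
  have hz : hi z = z by rewrite /hi max_l//; lra.
  have lz : lo z = z - 1 by rewrite /lo gtr0_norm//; lra.
  apply: (le_trans _ E3); clear E1 E2 E3.
  rewrite subr0 (gtr0_norm z0) (_ : (1 <= z)%R = true) ?mul1r; last by apply/idP; lra.
  have h1 : ln (hi z) - ln (lo z) <= 3 / z.
    apply: (le_trans (ln_ratio_le l0 h0)); rewrite hz lz.
    have -> : z / (z - 1) - 1 = (z - 1)^-1 by field; apply/negP => /eqP; lra.
    by rewrite ler_pdivlMr// ler_pdivrMl; lra.
  have h2 : (hi z `^ a + lo z `^ a) * z `^ (- a) <= 4.
    rewrite hz mulrDl -(powRDp _ _ z0) subrr powRr0.
    have -> : lo z `^ a * z `^ (- a) = (lo z / z) `^ a.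
      rewrite powRM ?(ltW l0) ?invr_ge0 ?(ltW z0)//; congr (_ * _).
      by rewrite -(powR_inv1 (ltW z0)) -powRrM mulN1r.
    suff : (lo z / z) `^ a <= 3 by lra.
    apply: (le_trans (powR_le_inv _ _ _)); [by rewrite divr_gt0| |lra|].
      by rewrite ler_pdivrMr// lz; lra.
    by rewrite invf_div ler_pdivrMr// lz; lra.
  apply: (@le_trans _ _ (3 / z * ((hi z `^ a + lo z `^ a) * z `^ (- a)) * z^-1)).
    rewrite (_ : - 1 - a = - a + - 1); last by ring.
    rewrite (powRDp _ _ z0) powR_inv1 ?(ltW z0)// !mulrA ler_pM2r ?invr_gt0// ler_pM2r ?powR_gt0//.
    by rewrite ler_wpM2r ?addr_ge0.
  have -> : z `^ (- 2) = z^-1 * z^-1.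
    by rewrite (_ : - 2 = - 1 + - 1 :> R); [rewrite (powRDp _ _ z0) powR_inv1 ?(ltW z0)|ring].
  have zi : 0 < z^-1 by rewrite invr_gt0.
  rewrite (_ : 3 / z * _ * z^-1 = ((hi z `^ a + lo z `^ a) * z `^ (- a)) * (3 * (z^-1 * z^-1))); last by ring.
  rewrite (_ : 12 * _ = 4 * (3 * (z^-1 * z^-1))); last by ring.
  by rewrite ler_pM2r// mulr_gt0// mulr_gt0.
apply: (le_trans _ E2); clear E1 E2 E3.
have l1 : lo z <= 2^-1 by rewrite /lo ler_norml; lra.
rewrite -/(lo z) (_ : (lo z < 1)%R = true) ?mul1r; last by apply/idP; lra.
have hge : 1 <= hi z by rewrite /hi le_max lexx orbT.
have hle : hi z <= 3 / 2 by rewrite /hi ge_max; apply/andP; split; lra.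
have q0 : 0 < hi z / lo z by rewrite divr_gt0.
have h1 : ln (hi z) - ln (lo z) <= 2 / eta * lo z `^ (- eta).
  rewrite -ln_div ?posrE//.
  apply: (@le_trans _ _ ((hi z / lo z) `^ eta / eta)).
    rewrite ler_pdivlMr// mulrC -ln_powR; apply: ltW; apply: ln_sublinear; exact: powR_gt0.
  rewrite powRM ?invr_ge0 ?(ltW l0) ?(ltW h0)//.
  have -> : (lo z)^-1 `^ eta = lo z `^ (- eta).
    by rewrite -(powR_inv1 (ltW l0)) -powRrM mulN1r.
  rewrite mulrAC ler_wpM2r ?powR_ge0// ler_pM2r ?invr_gt0//.
  apply: (@le_trans _ _ (hi z `^ 1)); first exact: ler_powR.
  rewrite powRr1 ?(ltW h0)//; lra.
have l2 : lo z `^ a <= lo z `^ (- a0) by apply: powR_anti => //; lra.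
have l3 : 1 <= lo z `^ (- a0).
  by rewrite -(powRr0 (lo z)); apply: powR_anti => //; lra.
have h2 : hi z `^ a + lo z `^ a <= 3 * lo z `^ (- a0).
  suff : hi z `^ a <= 2 by lra.
  apply: (@le_trans _ _ (hi z `^ 1)); first by apply: ler_powR => //; lra.
  rewrite powRr1 ?(ltW h0)//; lra.
have h3 : z `^ (- 1 - a) <= 4.
  have [zl|zg] := leP z 1.
    apply: (@le_trans _ _ (z `^ (- 2))); first by apply: powR_anti => //; lra.
    rewrite powRN powR_mulrn ?(ltW z0)// -[leRHS]invrK lef_pV2 ?posrE ?exprn_gt0//; nra.
  apply: (@le_trans _ _ (z `^ 0)); first by apply: ler_powR; lra.
  by rewrite powRr0; lra.
rewrite opprD (powRDp _ _ l0).
apply: (@le_trans _ _ (2 / eta * lo z `^ (- eta) * (3 * lo z `^ (- a0)) * 4)).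
  apply: ler_pM; rewrite ?(ltW pz)//; first by rewrite mulr_ge0// addr_ge0.
  by apply: ler_pM => //; rewrite addr_ge0.
by rewrite le_eqVlt; apply/orP; left; apply/eqP; ring.
Qed.

Lemma measurable_green_kernel a : measurable_fun setT (green_kernel a : measurableTypeR R -> R).
Proof.
have mlo : measurable_fun setT (lo : measurableTypeR R -> R) by exact: measurable_dist1.
have mhi : measurable_fun setT (hi : measurableTypeR R -> R) by apply: measurable_maxr.
apply: measurable_funM; last exact: measurable_powRl.
case: eqP => _; first by apply: measurable_funB; apply: measurableT_comp => //; exact: measurable_ln.
by apply: measurable_funM => //; apply: measurable_funB; exact: measurable_funpow.
Qed.

Definition green_int a : R := \int[leb1]_(z in `]0, +oo[) green_kernel a z.

Let ae_ne1 (P : R -> Prop) : (forall z, 0 < z -> z != 1 -> P z) ->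
  {ae leb1, forall z, `]0, +oo[%classic z -> P z}.
Proof.
move=> h; exists [set 1]; split; [exact: measurable_set1|exact: lebesgue_measure_set1|].
move=> z /= /not_implyP[]; rewrite in_itv/= andbT => z0 ne; apply: contrapT => /eqP z1.
by apply: ne; exact: h.
Qed.

Lemma green_kernel_integrable a : `|a| < 1 -> leb1.-integrable `]0, +oo[ (EFin \o green_kernel a).
Proof.
move=> a1; pose a0 := (1 + `|a|) / 2; have an := normr_ge0 a.
have a01 : 0 < a0 < 1 by rewrite /a0; lra.
pose eta := (1 - a0) / 2; have eta1 : 0 < eta <= 1 by rewrite /eta; lra.
have env : leb1.-integrable `]0, +oo[ (EFin \o envelope 6 (24 / eta) 12 a0 (a0 + eta)).
  apply: envelope_integrable => //; rewrite ?divr_ge0//; rewrite /eta; lra.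
have mk : measurable_fun (`]0, +oo[%classic : set (measurableTypeR R)) (EFin \o green_kernel a).
  by apply/measurable_EFinP/measurable_funTS; exact: measurable_green_kernel.
apply/integrableP; split => //; have [me fe] := integrableP _ _ _ env.
apply: le_lt_trans fe; apply: ae_ge0_le_integral => //; try exact: measurableT_comp.
apply: ae_ne1 => z z0 z1; rewrite /= lee_fin (le_trans _ (ler_norm _))//.
by apply: green_kernel_le => //; rewrite /a0; lra.
Qed.

Lemma green_int_gt0 a : `|a| < 1 -> 0 < green_int a.
Proof.
move=> a1; apply: half_line_Rint_gt0; first exact: green_kernel_integrable.
by move=> z z0 z1; have /andP[] := green_kernel_bounds a z0 z1.
Qed.

Lemma green_int_continuous : {for 0, continuous green_int}.
Proof.
apply: (@continuity_under_integral R _ _ leb1 green_kernel `]0, +oo[ _ (- 2^-1) 2^-1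
  _ _ (envelope 6 (24 / 4^-1) 12 2^-1 (2^-1 + 4^-1))) => //.
- move=> a; rewrite /= in_itv/= => /andP[? ?]; apply: green_kernel_integrable.
  by rewrite ltr_norml; lra.
- apply: ae_ne1 => z z0 z1 a _; rewrite /continuous_at green_kernelE//.
  under eq_fun do rewrite green_kernelE//.
  apply: cvgM; first exact: exp_slope_continuous.
  apply: (@cvg_comp _ _ _ (fun t : R => - 1 - t) (fun t => z `^ t) _ (nbhs (- 1 - a))); last exact: continuous_powRr.
  by apply: cvgB; [exact: cvg_cst|exact: cvg_id].
- apply: envelope_integrable => //; rewrite ?divr_ge0//; lra.
- move=> a; rewrite /= in_itv/= => /andP[? ?]; apply: ae_ne1 => z z0 z1.
  by apply: green_kernel_le => //; rewrite ?ler_norml; lra.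
- by rewrite inE/= in_itv/=; apply/andP; split; lra.
Qed.

Lemma C_frac_gt0 (N : nat) (s : R) : 0 < s -> s < 1 -> 0 < C_frac N s.
Proof.
move=> s0 s1; have N0 : 0 <= N%:R :> R by [].
rewrite /C_frac divr_gt0// mulr_gt0 ?powR_gt0 ?pi_gt0//.
- by rewrite mulr_gt0 ?powR_gt0.
- by apply: Gamma_gt0; lra.
- by apply: Gamma_gt0; lra.
Qed.

Lemma C_frac_continuous (N : nat) (s : R) : 0 < s -> s < 1 -> {for s, continuous (@C_frac R N)}.
Proof.
move=> s0 s1; have N0 : 0 <= N%:R :> R by [].
have c2 : (2 * t) @[t --> s] --> 2 * s by apply: cvgM; [exact: cvg_cst|exact: cvg_id].
apply: cvgM; first apply: cvgM; first apply: cvgM; first exact: cvg_id.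
- apply: (@cvg_comp _ _ _ (fun t : R => 2 * t) (fun t => 2 `^ t) _ (nbhs (2 * s))) => //.
  exact: continuous_powRr.
- apply: (@cvg_comp _ _ _ (fun t : R => (N%:R + 2 * t) / 2) (@Gamma R) _ (nbhs ((N%:R + 2 * s) / 2))).
    by apply: cvgM; [apply: cvgD => //; exact: cvg_cst|exact: cvg_cst].
  by apply: Gamma_continuous; lra.
- apply: cvgV; first by rewrite gt_eqF// mulr_gt0 ?powR_gt0 ?pi_gt0//; apply: Gamma_gt0; lra.
  apply: cvgM; first exact: cvg_cst.
  apply: (@cvg_comp _ _ _ (fun t : R => 1 - t) (@Gamma R) _ (nbhs (1 - s))).
    by apply: cvgB; [exact: cvg_cst|exact: cvg_id].
  by apply: Gamma_continuous; lra.
Qed.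

Lemma C_green_genericE (s : R) : 0 < s -> s < 1 -> s != 2^-1 ->
  C_green_generic s = C_frac 1 s / (2 * s) * green_int (1 - 2 * s).
Proof.
move=> s0 s1 sh; pose a := 1 - 2 * s.
have a0 : a != 0 by apply: contraNneq sh; rewrite /a => h; apply/eqP; lra.
have a1 : `|a| < 1 by rewrite /a ltr_norml; lra.
have -> : C_green_generic s = C_frac 1 s / (2 * s * (2 * s - 1)) * (- a * green_int a).
  rewrite /C_green_generic; congr (_ * _).
  rewrite /green_int -RintegralZl//; last exact: green_kernel_integrable.
  apply: eq_Rintegral => z _; rewrite /green_kernel (negbTE a0) -/a /lo /hi.
  rewrite (_ : 2 - 2 * s = - (- 1 - a)); last by rewrite /a; ring.
  by rewrite powRN invrK; field.
by rewrite /a; field; rewrite gt_eqF//=; apply: contraNneq sh => h; apply/eqP; lra.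
Qed.

Lemma C_green_gt0 (s : R) : 0 < s -> s < 1 -> 0 < C_green s.
Proof.
move=> s0 s1; rewrite /C_green; case: ifP => [_|/negbT sh]; last first.
  rewrite C_green_genericE//; apply: mulr_gt0; last by apply: green_int_gt0; rewrite ltr_norml; lra.
  by apply: divr_gt0; [exact: C_frac_gt0|exact: mulr_gt0].
have h0 : 0 < 2^-1 :> R by []. have h1 : 2^-1 < 1 :> R by lra.
rewrite (_ : lim _ = C_frac 1 2^-1 / (2 * 2^-1) * green_int (1 - 2 * 2^-1)).
  apply: mulr_gt0; last by apply: green_int_gt0; rewrite divff// subrr normr0.
  by apply: divr_gt0; [exact: C_frac_gt0|exact: mulr_gt0].
apply/cvg_lim => //.
have near01 : \forall t \near (2^-1 : R), 0 < t < 1.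
  by near=> t; apply/andP; split; near: t; [exact: lt_nbhsr|exact: lt_nbhsl].
apply: (@cvg_trans _ ((fun t => C_frac 1 t / (2 * t) * green_int (1 - 2 * t)) @ (2^-1 : R)^')).
  apply: near_eq_cvg; rewrite near_withinE; apply: filterS near01 => t /andP[t0 t1] tn.
  by rewrite C_green_genericE.
apply: cvg_within_filter.
have c2 : (2 * t) @[t --> (2^-1 : R)] --> (2 * 2^-1 : R) by apply: cvgM; [exact: cvg_cst|exact: cvg_id].
apply: cvgM.
  apply: cvgM; first exact: C_frac_continuous.
  by apply: cvgV => //; rewrite divff.
apply: (@cvg_comp _ _ _ (fun t : R => 1 - 2 * t) green_int _ (nbhs (1 - 2 * 2^-1 : R))).
  by apply: cvgB => //; exact: cvg_cst.
by rewrite divff// subrr; exact: green_int_continuous.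
Unshelve. all: by end_near.
Qed.

End green_kernel.

(** * Smooth functions and approximation by test functions *)

Section flat_function.
Context (R : realType).
Implicit Types (t : R) (k : nat).

Definition flat k t : R := if 0 < t then t^-1 ^+ k * expR (- t^-1) else 0.

Lemma flat_ge0 k t : 0 <= flat k t.
Proof.
rewrite /flat; case: ifPn => // t0.
by rewrite mulr_ge0 ?expR_ge0// exprn_ge0// invr_ge0 ltW.
Qed.

Lemma flat_gt0 k t : 0 < t -> 0 < flat k t.
Proof. by move=> t0; rewrite /flat t0 mulr_gt0 ?expR_gt0// exprn_gt0// invr_gt0. Qed.

Lemma flat_eq0 k t : t <= 0 -> flat k t = 0.
Proof. by move=> t0; rewrite /flat ltNge t0. Qed.

Lemma flat_le k t : flat k t <= k.+1%:R ^+ k.+1 * `|t|.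
Proof.
have c0 : 0 <= k.+1%:R ^+ k.+1 :> R by rewrite exprn_ge0.
have [t0|t0] := leP t 0; first by rewrite flat_eq0// mulr_ge0.
rewrite /flat t0 (gtr0_norm t0).
have ti : 0 < t^-1 by rewrite invr_gt0.
have := expR_ge_pow k (ltW ti); rewrite expr_div_n ler_pdivrMr ?exprn_gt0// => h.
rewrite expRN ler_pdivrMr ?expR_gt0// -[leRHS]mulrA [t * _]mulrC mulrA.
by rewrite -ler_pdivrMr// -exprSr [leRHS]mulrC.
Qed.

Let is_derive_pow_exp k (y : R) :
  is_derive y (1 : R) (fun y : R => y ^+ k * expR (- y)) ((k%:R * y ^+ k.-1 - y ^+ k) * expR (- y)).
Proof.
have de : is_derive y (1 : R) (fun y : R => expR (- y)) (expR (- y) * - 1).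
  exact: (is_derive1_comp (is_derive_expR (- y))).
have dk : is_derive y (1 : R) (fun y : R => y ^+ k) (k%:R * y ^+ k.-1).
  elim: k => [|k IH]; first by rewrite mul0r; exact: (is_derive_cst (1 : R) y 1).
  rewrite (_ : (fun _ => _) = (id : R -> R) * (fun y => y ^+ k)); last first.
    by apply/funext => z; rewrite exprS.
  have := is_deriveM (is_derive_id y (1 : R)) IH => /is_derive_eq; apply.
  rewrite /GRing.scale/= mulr1 -natr1; case: k {IH} => [|k]; first by rewrite expr0; ring.
  by rewrite /= exprS; ring.
have := is_deriveM dk de => /is_derive_eq; apply; rewrite /GRing.scale/=; ring.
Qed.

Lemma is_derive_flat k t :
  is_derive t 1 (flat k) (flat k.+2 t - k%:R * flat k.+1 t).
Proof.
have [t0|t0|->] := ltgtP t 0.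
- rewrite !flat_eq0 ?(ltW t0)// mulr0 subr0.
  apply: (@near_eq_is_derive R R R (cst 0) (flat k) t 1 0).
  have : \forall u \near t, u < 0 by exact: lt_nbhsl.
  by apply: filterS => u u0; rewrite flat_eq0// ltW.
- apply: (@near_eq_is_derive _ _ _ ((fun y : R => y ^+ k * expR (- y)) \o (fun u => u^-1))).
    have : \forall u \near t, 0 < u by exact: lt_nbhsr.
    by apply: filterS => u u0; rewrite /flat u0.
  have dv : is_derive t 1 (fun u : R => u^-1) (- t ^- 2 *: 1) by apply: is_deriveV; rewrite gt_eqF.
  have := is_derive1_comp (is_derive_pow_exp k t^-1) dv => /is_derive_eq; apply.
  rewrite /flat t0 /GRing.scale/= mulr1 -exprVn !exprS; case: k => [|k]; first by rewrite !expr0; ring.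
  by rewrite /= exprS; ring.
- rewrite !flat_eq0// mulr0 subr0.
  have c : (h^-1 *: ((flat k \o shift 0) (h *: (1 : R)) - flat k 0)) @[h --> 0^'] --> (0 : R).
    apply/cvgrPdist_lt => e e0.
    have C0 : 0 < k.+2%:R ^+ k.+2 :> R by rewrite exprn_gt0.
    have near0 : \forall h \near (0 : R), `|h| < e / k.+2%:R ^+ k.+2.
      by apply: nbhs0_lt; rewrite divr_gt0.
    rewrite near_withinE; apply: filterS near0 => h he hn.
    rewrite /= /GRing.scale/= mulr1 addr0 (flat_eq0 k (lexx 0)) subr0 sub0r normrN.
    have -> : h^-1 * flat k h = flat k.+1 h.
      by rewrite /flat; case: ifPn => _; [rewrite exprS mulrA|rewrite mulr0].
    rewrite ger0_norm ?flat_ge0//; apply: le_lt_trans (flat_le _ _) _.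
    by rewrite mulrC -ltr_pdivlMr.
  apply: DeriveDef; first by apply/cvg_ex; exists 0.
  exact/cvg_lim.
Qed.

End flat_function.

Section smooth_functions.
Context (R : realType) (N : nat).
Local Notation E := 'rV[R]_N.
Implicit Types (f g : E -> R) (v x : E).

(* A class of explicit functions that is closed under directional derivatives,
   so that its members are smooth. *)
Inductive elementary : (E -> R) -> Prop :=
| elementary_flat k (a b : R) (i : 'I_N) : elementary (fun x => flat k (a * x ord0 i + b))
| elementary_cst (c : R) : elementary (fun _ => c)
| elementaryD f g : elementary f -> elementary g -> elementary (fun x => f x + g x)
| elementaryM f g : elementary f -> elementary g -> elementary (fun x => f x * g x)
| elementaryV f : elementary f -> (forall x, f x != 0) -> elementary (fun x => (f x)^-1).

Lemma is_derive_flat_coord k (a b : R) (i : 'I_N) x :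
  differentiable (fun x : E => flat k (a * x ord0 i + b)) x /\
  forall v, 'D_v (fun x : E => flat k (a * x ord0 i + b)) x =
    (a * v ord0 i) * (flat k.+2 (a * x ord0 i + b) - k%:R * flat k.+1 (a * x ord0 i + b)).
Proof.
pose l (x : E) : R := a * x ord0 i + b.
have dl : is_diff x l (fun v : E => a * v ord0 i).
  have h : differentiable (fun x : E => x ord0 i) x by exact: differentiable_coord.
  have dc : is_diff x (fun x : E => x ord0 i) (fun v : E => v ord0 i).
    apply: DiffDef => //; apply/funext => v; rewrite -deriveE//.
    rewrite /derive; apply/cvg_lim => //; apply: cvg_near_cst.
    rewrite near_withinE; apply: filterE => h0 hn; rewrite /= !mxE addrK.
    by rewrite /GRing.scale/= mulrA mulVf// mul1r.
  have := is_diffD (is_diffZ a dc) (is_diff_cst b x).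
  move=> [h1 h2]; apply: DiffDef; first exact: h1.
  by rewrite -[LHS]/('d ((a \*: (fun x : E => x ord0 i)) + cst b) x : E -> R) h2; apply/funext => v; rewrite /= addr0.
have [dd dv] := is_derive_flat k (l x).
have df : differentiable (flat k) (l x) by apply/derivable1_diffP.
have [dlx dlv] := dl.
split; first exact: (differentiable_comp dlx df).
move=> v; rewrite deriveE; last exact: (differentiable_comp dlx df).
have -> : 'd (fun x : E => flat k (a * x ord0 i + b)) x v = 'd (flat k \o l) x v by [].
rewrite diff_comp// /= dlv diff1E// derive1E dv.
by rewrite /GRing.scale.
Qed.

Lemma elementary_derive f : elementary f ->
  (forall x, differentiable f x) /\ forall v, elementary ('D_v f).
Proof.
elim=> [k a b i|c|{}f g _ [df Df] _ [dg Dg]|{}f g ef [df Df] eg [dg Dg]|{}f ef [df Df] f0].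
- split=> [x|v]; first by have [] := is_derive_flat_coord k a b i x.
  rewrite (_ : 'D_v _ = fun x : E => (a * v ord0 i) *
      (flat k.+2 (a * x ord0 i + b) + (- k%:R) * flat k.+1 (a * x ord0 i + b))); last first.
    by apply/funext => x; have [_ ->] := is_derive_flat_coord k a b i x; rewrite mulNr.
  apply: (elementaryM (f := fun=> _)); first exact: elementary_cst.
  apply: elementaryD; first exact: elementary_flat.
  by apply: (elementaryM (f := fun=> _)); [exact: elementary_cst|exact: elementary_flat].
- split=> [x|v]; first exact: differentiable_cst.
  rewrite (_ : 'D_v _ = fun=> 0); first exact: elementary_cst.
  by apply/funext => x; exact: derive_cst.
- split=> [x|v]; first exact: (differentiableD (df x) (dg x)).
  rewrite (_ : 'D_v _ = fun x => 'D_v f x + 'D_v g x); first exact: elementaryD.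
  by apply/funext => x; apply: (@deriveD _ _ _ f g); exact: diff_derivable.
- split=> [x|v]; first exact: (differentiableM (df x) (dg x)).
  rewrite (_ : 'D_v _ = fun x => f x * 'D_v g x + g x * 'D_v f x).
    by apply: elementaryD; apply: elementaryM.
  by apply/funext => x; apply: (@deriveM _ _ f g); exact: diff_derivable.
- split=> [x|v]; first exact: (differentiableV (df x) (f0 x)).
  rewrite (_ : 'D_v _ = fun x => (-1) * ((f x)^-1 * (f x)^-1) * 'D_v f x).
    apply: elementaryM => //; apply: (elementaryM (f := fun=> _)); first exact: elementary_cst.
    by apply: elementaryM; exact: elementaryV.
  apply/funext => x; rewrite deriveV//; last exact: diff_derivable.
  by rewrite /GRing.scale/= mulN1r -expr2 exprVn.
Qed.

Lemma elementary_smooth f : elementary f -> smooth f.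
Proof.
move=> ef vs; suff : elementary (foldr (fun v (f : E -> R) => 'D_v f) f vs).
  by move=> /elementary_derive[].
by elim: vs => //= v vs /elementary_derive[_]; exact.
Qed.

Lemma elementary_sum (I : Type) (r : seq I) (F : I -> E -> R) :
  (forall i, elementary (F i)) -> elementary (fun x => \sum_(i <- r) F i x).
Proof.
move=> eF; elim: r => [|i r IH].
  by rewrite (_ : (fun _ => _) = fun=> 0); [exact: elementary_cst|apply/funext => x; rewrite big_nil].
rewrite (_ : (fun _ => _) = fun x => F i x + \sum_(j <- r) F j x); first exact: elementaryD.
by apply/funext => x; rewrite big_cons.
Qed.

Lemma elementary_prod (I : Type) (r : seq I) (F : I -> E -> R) :
  (forall i, elementary (F i)) -> elementary (fun x => \prod_(i <- r) F i x).
Proof.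
move=> eF; elim: r => [|i r IH].
  by rewrite (_ : (fun _ => _) = fun=> 1); [exact: elementary_cst|apply/funext => x; rewrite big_nil].
rewrite (_ : (fun _ => _) = fun x => F i x * \prod_(j <- r) F j x); first exact: elementaryM.
by apply/funext => x; rewrite big_cons.
Qed.

End smooth_functions.

Section smooth_step.
Context (R : realType).
Implicit Types (t : R).

Definition step t : R := flat 0 t / (flat 0 t + flat 0 (1 - t)).

Lemma step_den_gt0 t : 0 < flat 0 t + flat 0 (1 - t).
Proof.
have [t0|t0] := leP t 0; first by rewrite ltr_wpDl ?flat_ge0// flat_gt0//; lra.
by rewrite ltr_pwDl ?flat_ge0// flat_gt0.
Qed.

Lemma step_ge0 t : 0 <= step t.
Proof. by rewrite divr_ge0 ?flat_ge0// ltW// step_den_gt0. Qed.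

Lemma step_le1 t : step t <= 1.
Proof. by rewrite ler_pdivrMr ?step_den_gt0// mul1r lerDl flat_ge0. Qed.

Lemma step0 t : t <= 0 -> step t = 0.
Proof. by move=> t0; rewrite /step flat_eq0// mul0r. Qed.

Lemma step1 t : 1 <= t -> step t = 1.
Proof.
move=> t1; rewrite /step (flat_eq0 0 (_ : 1 - t <= 0)); last by lra.
by rewrite addr0 divff// gt_eqF// flat_gt0; lra.
Qed.

Definition hat t : R := step t - step (t - 1).

Lemma hat_le1 t : `|hat t| <= 1.
Proof.
rewrite /hat; have := step_ge0 t; have := step_le1 t; have := step_ge0 (t - 1); have := step_le1 (t - 1).
by rewrite ler_norml; lra.
Qed.

Lemma hat_supp t : hat t != 0 -> 0 < t < 2.
Proof.
apply: contraNT; rewrite negb_and -!leNgt => /orP[t0|t2]; rewrite /hat.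
  by rewrite !step0 ?subrr//; lra.
by rewrite !step1 ?subrr//; lra.
Qed.

Lemma sum_hat (m : nat) t : 1 <= t -> t <= m%:R -> \sum_(k < m) hat (t - k%:R) = 1.
Proof.
move=> t1 tm; rewrite -(big_mkord xpredT (fun k => hat (t - k%:R))).
rewrite (eq_bigr (fun k => step (t - k%:R) - step (t - k.+1%:R))); last first.
  by move=> k _; rewrite /hat -natr1 opprD addrA.
rewrite (telescope_sumr_eq (fun k => - step (t - k%:R)))//; last by move=> k _; rewrite opprK addrC.
by rewrite subr0 opprK (step1 t1) (step0 (_ : t - m%:R <= 0)) ?oppr0 ?add0r//; lra.
Qed.

Lemma elementary_hat (N : nat) (a b : R) (i : 'I_N) : elementary (fun x : 'rV[R]_N => hat (a * x ord0 i + b)).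
Proof.
have es (b' : R) : elementary (fun x : 'rV[R]_N => step (a * x ord0 i + b')).
  rewrite /step; apply: elementaryM; first exact: elementary_flat.
  apply: elementaryV; last by move=> x; rewrite gt_eqF// step_den_gt0.
  apply: elementaryD; first exact: elementary_flat.
  rewrite (_ : (fun _ => _) = fun x : 'rV[R]_N => flat 0 (- a * x ord0 i + (1 - b'))).
    exact: elementary_flat.
  by apply/funext => x; congr flat; ring.
rewrite /hat (_ : (fun _ => _) = fun x : 'rV[R]_N => step (a * x ord0 i + b) + (-1) * step (a * x ord0 i + (b - 1))).
  apply: elementaryD => //; apply: (elementaryM (f := fun=> _)) => //; exact: elementary_cst.
by apply/funext => x; rewrite mulN1r addrA.
Qed.

End smooth_step.

Section lipschitz_test.
Context (R : realType) (N : nat).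
Local Notation E := 'rV[R]_N.
Implicit Types (phi : E -> R) (x y : E).

Lemma smooth_continuous phi : smooth phi -> continuous phi.
Proof. by move=> s x; exact: (differentiable_continuous (s [::] x)). Qed.

Lemma smooth_derive phi (v : E) : smooth phi -> smooth ('D_v phi).
Proof. by move=> s vs x; have := s (rcons vs v) x; rewrite -cats1 foldr_cat. Qed.

Lemma derive_supp phi (v : E) x : smooth phi ->
  'D_v phi x != 0 -> closure [set x | phi x != 0] x.
Proof.
move=> s; apply: contraPP => nc; apply/negP; rewrite negbK; apply/eqP.
rewrite (@near_eq_derive _ _ _ _ (cst 0)) ?derive_cst//.
have : nbhs x (~` closure [set x | phi x != 0]).
  by apply: open_nbhs_nbhs; split => //; apply: closed_openC; exact: closed_closure.
apply: filterS => y ny; apply/eqP/negPn/negP => py; apply: ny.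
exact: subset_closure.
Qed.

Lemma smooth_bounded phi : smooth phi -> compact (closure [set x | phi x != 0]) ->
  exists2 M : R, 0 <= M & forall x, `|phi x| <= M.
Proof.
move=> s c; have := compact_bounded (continuous_compact (continuous_subspaceT (smooth_continuous s)) c).
move=> [M0 [_ /(_ (`|M0| + 1))]]; rewrite (le_lt_trans (ler_norm _)) ?ltrDl// => /(_ isT) h.
exists (`|M0| + 1); first by rewrite addr_ge0.
move=> x; have [->|x0] := eqVneq (phi x) 0; first by rewrite normr0 addr_ge0.
by apply: h; exists x => //; exact: subset_closure.
Qed.

Lemma smooth_lipschitz phi : smooth phi -> compact (closure [set x | phi x != 0]) ->
  exists2 M : R, 0 <= M & forall x y, `|phi x - phi y| <= M * enorm (x - y).
Proof.
move=> s c.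
have h (i : 'I_N) : exists M : R, 0 <= M /\ forall x, `|'D_(delta_mx ord0 i : E) phi x| <= M.
  have sd := smooth_derive (delta_mx ord0 i : E) s.
  have [|M M0 hM] := smooth_bounded sd; last by exists M.
  apply: subclosed_compact c _; first exact: closed_closure.
  rewrite [X in _ `<=` X](closure_id _).1; last exact: closed_closure.
  by apply: closure_subset => x /= dx; exact: derive_supp dx.
have [M hM] := choice h.
exists (\sum_i M i); first by apply: sumr_ge0 => i _; have [] := hM i.
move=> x y; pose g (t : R) : R := phi (y + t *: (x - y)).
have dg (t : R) : is_derive t 1 g ('D_(x - y) phi (y + t *: (x - y))).
  have df := s [::] (y + t *: (x - y)).
  have e : (fun u : R => u^-1 *: ((g \o shift t) (u *: (1 : R)) - g t)) =
      (fun u : R => u^-1 *: ((phi \o shift (y + t *: (x - y))) (u *: (x - y)) - phi (y + t *: (x - y)))).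
    apply/funext => u; rewrite /g /=; congr (_ *: (phi _ - _)).
    by rewrite [u%:A]mulr1 scalerDl addrCA.
  by apply: DeriveDef; [have := diff_derivable (v := x - y) df; rewrite /derivable e|rewrite /derive e].
have cg : {within `[0, 1], continuous g}.
  apply: continuous_subspaceT => t; apply: differentiable_continuous; apply/derivable1_diffP.
  by have [] := dg t.
have [t _] := MVT ltr01 (fun t _ => dg t) cg.
rewrite /g (_ : y + 1 *: (x - y) = x); last by rewrite scale1r addrC subrK.
rewrite scale0r addr0 subr0 mulr1 => ->.
set z := y + _; rewrite deriveE; last exact: (s [::] z).
rewrite {1}(row_sum_delta (x - y)) linear_sum mulr_suml.
apply: le_trans (ler_norm_sum _ _ _) _; apply: ler_sum => i _.
rewrite linearZ/= /GRing.scale/= normrM mulrC ler_pM//; last exact: enorm_coord.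
by rewrite -deriveE; [have [_] := hM i; exact|exact: (s [::] z)].
Qed.

End lipschitz_test.

Section linear_combinations.
Context d (T : measurableType d) (R : realType) (m : {measure set T -> \bar R}).

Lemma integrable_lincomb (I : Type) (s : seq I) (c : I -> R) (g : I -> T -> R) :
  (forall i, m.-integrable setT (EFin \o g i)) ->
  m.-integrable setT (EFin \o (fun y => \sum_(i <- s) c i * g i y)).
Proof.
move=> gi; rewrite (_ : EFin \o _ = fun y => (\sum_(i <- s) (c i)%:E * (g i y)%:E)%E).
  by apply: integrable_sum => // i _; apply: integrableZl => //; exact: gi.
by apply/funext => y /=; rewrite -sumEFin; apply: eq_bigr => i _; rewrite EFinM.
Qed.

Lemma Rintegral_lincomb (I : Type) (s : seq I) (c : I -> R) (g : I -> T -> R) :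
  (forall i, m.-integrable setT (EFin \o g i)) ->
  \int[m]_y (\sum_(i <- s) c i * g i y) = \sum_(i <- s) c i * \int[m]_y g i y.
Proof.
move=> gi; elim: s => [|i s IH].
  by rewrite big_nil /Rintegral integral0_eq// => y _; rewrite big_nil.
rewrite big_cons -IH -RintegralZl// -RintegralD//.
- by apply: eq_Rintegral => y _; rewrite big_cons.
- have := @integrable_lincomb _ [:: i] c g gi; apply: eq_integrable => // y _ /=.
  by rewrite big_seq1.
- exact: integrable_lincomb.
Qed.

End linear_combinations.

Section grid.
Context (R : realType) (N : nat).
Local Notation E := 'rV[R]_N.
Local Notation leb := (lebesgue_rV R N).
Implicit Types (x y : E).

Definition hats x : R := \prod_(i < N) hat (x ord0 i).

Lemma prod_norm_le1 (F : 'I_N -> R) : (forall i, `|F i| <= 1) -> `|\prod_i F i| <= 1.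
Proof.
move=> F1; rewrite normr_prod.
apply: (@le_trans _ _ (\prod_(i < N) 1)); last by rewrite big1.
by apply: ler_prod => i _; rewrite normr_ge0 F1.
Qed.

Lemma hats_lipschitz : exists2 L : R, 0 <= L &
  forall x y, `|hats x - hats y| <= L * enorm (x - y).
Proof.
have eh : elementary hats.
  rewrite /hats; apply: elementary_prod => i.
  rewrite (_ : (fun _ => _) = fun x : E => hat (1 * x ord0 i + 0)); first exact: elementary_hat.
  by apply/funext => x; rewrite mul1r addr0.
apply: smooth_lipschitz; first exact: elementary_smooth.
have cb : compact [set x : E | forall i, `[(0:R), 2]%classic (x ord0 i)].
  exact: (@rV_compact R N (fun=> `[(0:R), 2]%classic) (fun=> @segment_compact _ _ _)).
have cl : closed [set x : E | forall i, `[(0:R), 2]%classic (x ord0 i)].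
  by apply: compact_closed cb; exact: norm_hausdorff.
apply: subclosed_compact cb _; first exact: closed_closure.
rewrite [X in _ `<=` X](closure_id _).1//; apply: closure_subset => x /= h i.
have : hat (x ord0 i) != 0 by apply: contraNneq h => h; rewrite /hats (bigD1 i)//= h mul0r.
by move=> /hat_supp; rewrite in_itv/= => /andP[/ltW -> /ltW ->].
Qed.

Section fixed_scale.
Variables (h : R) (m : nat).
Hypothesis h0 : 0 < h.
Local Notation J := {ffun 'I_N -> 'I_(2 * m)}.
Implicit Types (j : J).

Definition off j (i : 'I_N) : R := (j i)%:R - m%:R.

Definition grid_hat j x : R := \prod_(i < N) hat (h^-1 * x ord0 i + - off j i).

Definition cell j : set E :=
  [set y | forall i, `[h * off j i, h * off j i + h[%classic (y ord0 i)].

Definition grid_kernel x y : R := h^-1 ^+ N * \sum_j grid_hat j x * \1_(cell j) y.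

Lemma elementary_grid_hat j : elementary (grid_hat j).
Proof. by apply: elementary_prod => i; exact: elementary_hat. Qed.

Lemma grid_hat_le1 j x : `|grid_hat j x| <= 1.
Proof. by apply: prod_norm_le1 => i; exact: hat_le1. Qed.

Lemma grid_hatE j x : grid_hat j x = hats (h^-1 *: x - \row_i off j i).
Proof. by rewrite /grid_hat /hats; apply: eq_bigr => i _; rewrite !mxE. Qed.

Lemma measurable_cell j : measurable (cell j).
Proof. exact: (measurable_rV_box (J := fun i => `[h * off j i, h * off j i + h[%classic)). Qed.

Lemma leb_cell j : leb (cell j) = (h ^+ N)%:E.
Proof.
rewrite (lebesgue_rV_box (J := fun i => `[h * off j i, h * off j i + h[%classic))//.
rewrite (eq_bigr (fun=> h%:E)) => [|i _].
  by rewrite big_const iter_mule mule1 card_ord EFin_expe.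
by rewrite lebesgue_measure_itv/= lte_fin ltrDl h0 -EFinB addrAC subrr add0r.
Qed.

Lemma int_cell j : (\int[leb]_y (\1_(cell j) y)%:E = (h ^+ N)%:E)%E.
Proof.
rewrite integral_indic//; last exact: measurable_cell.
by rewrite setIT; exact: leb_cell.
Qed.

Lemma cell_uniq j j' y : cell j y -> cell j' y -> j = j'.
Proof.
move=> cj cj'; apply/ffunP => i; apply/val_inj.
have := cj i; have := cj' i; rewrite /= !in_itv/= /off.
move=> /andP[a1 a2] /andP[b1 b2].
have lt (p q : nat) : h * (p%:R - m%:R) < h * (q%:R - m%:R) + h -> (p <= q)%N.
  have -> : h * (q%:R - m%:R) + h = h * (q%:R - m%:R + 1) by ring.
  rewrite ltr_pM2l// => pq.
  have : (p%:R : R) < q.+1%:R by rewrite -natr1; lra.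
  by rewrite ltr_nat.
by apply/eqP; rewrite eqn_leq; apply/andP; split; apply: lt; [exact: le_lt_trans b1 a2|exact: le_lt_trans a1 b2].
Qed.

Lemma grid_kernel_cell j x y : cell j y -> grid_kernel x y = h^-1 ^+ N * grid_hat j x.
Proof.
move=> cj; rewrite /grid_kernel (bigD1 j)//= indicE mem_set// mulr1 big1 ?addr0// => j' j'j.
rewrite indicE memNset ?mulr0// => cj'.
by move/eqP: j'j; apply; exact: cell_uniq cj' cj.
Qed.

Lemma grid_kernel_notin x y : (forall j, ~ cell j y) -> grid_kernel x y = 0.
Proof.
by move=> nc; rewrite /grid_kernel big1 ?mulr0// => j _; rewrite indicE memNset ?mulr0.
Qed.

Let hN0 : 0 <= h^-1 ^+ N. Proof. by rewrite exprn_ge0// invr_ge0 ltW. Qed.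

Lemma grid_kernel_le x y : `|grid_kernel x y| <= h^-1 ^+ N.
Proof.
have [[j cj]|nc] := pselect (exists j, cell j y); last first.
  by rewrite grid_kernel_notin ?normr0// => j cj; apply: nc; exists j.
by rewrite (grid_kernel_cell _ cj) normrM (ger0_norm hN0) ler_piMr// grid_hat_le1.
Qed.

Lemma grid_kernel_lip (L : R) x x' y : 0 <= L ->
  (forall x y, `|hats x - hats y| <= L * enorm (x - y)) ->
  `|grid_kernel x y - grid_kernel x' y| <= h^-1 ^+ N * (L * h^-1 * enorm (x - x')).
Proof.
move=> L0 hL; have b0 : 0 <= L * h^-1 * enorm (x - x').
  by rewrite mulr_ge0 ?enorm_ge0// mulr_ge0// invr_ge0 ltW.
have [[j cj]|nc] := pselect (exists j, cell j y); last first.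
  by rewrite !grid_kernel_notin ?subrr ?normr0 ?(mulr_ge0 hN0 b0)// => j cj; apply: nc; exists j.
rewrite !(grid_kernel_cell _ cj) -mulrBr normrM (ger0_norm hN0) ler_wpM2l// !grid_hatE.
apply: le_trans (hL _ _) _.
have -> : h^-1 *: x - \row_i off j i - (h^-1 *: x' - \row_i off j i) = h^-1 *: (x - x').
  by rewrite scalerBr opprB addrA subrK.
by rewrite enormZ ger0_norm ?invr_ge0 ?(ltW h0)// mulrA.
Qed.

Lemma grid_kernel_supp x y : grid_kernel x y != 0 -> enorm (x - y) < (2 * N%:R + 1) * h.
Proof.
move=> k0; have [[j cj]|nc] := pselect (exists j, cell j y); last first.
  by move: k0; rewrite grid_kernel_notin ?eqxx// => j cj; apply: nc; exists j.
move: k0; rewrite (grid_kernel_cell _ cj) mulf_eq0 negb_or => /andP[_ g0].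
apply: (@le_lt_trans _ _ (N%:R * (2 * h))); last first.
  by rewrite (_ : (2 * N%:R + 1) * h = N%:R * (2 * h) + h); [rewrite ltrDl|ring].
apply: enorm_le_coord => [|i]; first by rewrite mulr_ge0// ltW.
have : hat (h^-1 * x ord0 i + - off j i) != 0.
  by apply: contraNneq g0 => z; rewrite /grid_hat (bigD1 i)//= z mul0r.
move=> /hat_supp; set u := h^-1 * _ => /andP[u1 u2].
have xu : x ord0 i = h * u by rewrite mulVKf// gt_eqF.
have p1 : 0 < h * (u - off j i) by exact: mulr_gt0.
have p2 : h * (u - off j i) < h * 2 by rewrite ltr_pM2l.
have := cj i; rewrite /= in_itv/= !mxE xu => /andP[y1 y2].
rewrite mulrBr in p1 p2; rewrite ler_norml; apply/andP; split; lra.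
Qed.

Lemma measurable_grid_kernel : measurable_fun setT (fun p : E * E => grid_kernel p.1 p.2).
Proof.
apply: measurable_funM => //; apply: measurable_sum => j; apply: measurable_funM.
  have mg : measurable_fun setT (grid_hat j).
    apply: continuous_measurable_rV; apply: smooth_continuous; apply: elementary_smooth.
    exact: elementary_grid_hat.
  exact: (measurableT_comp mg measurable_fst).
have mi : measurable_fun setT (\1_(cell j) : E -> R) by apply: measurable_indic; exact: measurable_cell.
exact: (measurableT_comp mi measurable_snd).
Qed.

Lemma sum_grid_hat x : (forall i, 1 - m%:R <= h^-1 * x ord0 i <= m%:R) -> \sum_j grid_hat j x = 1.
Proof.
move=> xm; rewrite /grid_hat.
rewrite -(bigA_distr_bigA (fun i (k : 'I_(2 * m)) => hat (h^-1 * x ord0 i + - (k%:R - m%:R)))) big1// => i _.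
have /andP[x1 x2] := xm i.
rewrite -[RHS](@sum_hat R (2 * m) (h^-1 * x ord0 i + m%:R)); last by rewrite natrM; lra.
  by apply: eq_bigr => k _; congr hat; rewrite opprB addrA.
lra.
Qed.

Lemma cell_integrable j : leb.-integrable setT (EFin \o (\1_(cell j) : E -> R)).
Proof.
apply/integrableP; split.
  by apply/measurable_EFinP; apply: measurable_indic; exact: measurable_cell.
rewrite (eq_integral (fun y => (\1_(cell j) y)%:E)) => [|y _]; last by rewrite /= ger0_norm.
by rewrite int_cell ltry.
Qed.

Lemma grid_kernel_int x : (forall i, 1 - m%:R <= h^-1 * x ord0 i <= m%:R) ->
  \int[leb]_y grid_kernel x y = 1.
Proof.
move=> xm; rewrite /grid_kernel RintegralZl//; last exact: (integrable_lincomb _ _ cell_integrable).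
rewrite (Rintegral_lincomb _ _ cell_integrable).
rewrite (eq_bigr (fun j => grid_hat j x * h ^+ N)) => [|j _].
  by rewrite -mulr_suml sum_grid_hat// mul1r -exprMn mulVf ?gt_eqF// expr1n.
by congr (_ * _); rewrite /Rintegral int_cell.
Qed.

Lemma grid_kernel_integrable x : leb.-integrable setT (EFin \o grid_kernel x).
Proof.
have := integrableZl measurableT (h^-1 ^+ N) (integrable_lincomb (index_enum _) (fun j => grid_hat j x) cell_integrable).
by apply: eq_integrable.
Qed.

Lemma grid_average_smooth (w : E -> R) : measurable_fun setT w ->
  (\int[leb]_y (w y ^+ 2)%:E < +oo)%E ->
  smooth (fun x => \int[leb]_y (grid_kernel x y * w y)).
Proof.
move=> mw w2; apply: elementary_smooth.
have ci j : leb.-integrable setT (EFin \o (fun y => \1_(cell j) y * w y)).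
  apply: integrable_mul => //; first by apply: measurable_indic; exact: measurable_cell.
  rewrite (eq_integral (fun y => (\1_(cell j) y)%:E)) => [|y _].
    by rewrite int_cell ltry.
  by rewrite indicE expr2 -natrM mulnb andbb.
rewrite (_ : (fun _ => _) = fun x => \sum_j grid_hat j x * (h^-1 ^+ N * \int[leb]_y (\1_(cell j) y * w y))).
  apply: elementary_sum => j; apply: (elementaryM (g := fun=> _)); first exact: elementary_grid_hat.
  exact: elementary_cst.
apply/funext => x.
rewrite (eq_bigr (fun j => (h^-1 ^+ N * grid_hat j x) * \int[leb]_y (\1_(cell j) y * w y))) => [|j _]; last first.
  by rewrite mulrCA mulrA.
rewrite -(Rintegral_lincomb _ _ ci); apply: eq_Rintegral => y _.
rewrite /grid_kernel mulr_sumr mulr_suml; apply: eq_bigr => j _; rewrite !mulrA//.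
Qed.

End fixed_scale.

Definition smoothing_kernel (L h B : R) (k : E -> E -> R) : Prop :=
  [/\ measurable_fun setT (fun p : E * E => k p.1 p.2),
      (forall x y, `|k x y| <= h^-1 ^+ N) /\
      (forall x x' y, `|k x y - k x' y| <= h^-1 ^+ N * (L * h^-1 * enorm (x - x'))),
      forall x y, k x y != 0 -> enorm (x - y) < (2 * N%:R + 1) * h,
      forall x, leb.-integrable setT (EFin \o k x) /\ (enorm x < B -> \int[leb]_y k x y = 1) &
      forall w : E -> R, measurable_fun setT w -> (\int[leb]_y (w y ^+ 2)%:E < +oo)%E ->
        smooth (fun x => \int[leb]_y (k x y * w y))].

Lemma smoothing_kernel_exists : exists2 L : R, 0 <= L &
  forall h B, 0 < h -> 0 < B -> exists k, smoothing_kernel L h B k.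
Proof.
have [L L0 hL] := hats_lipschitz; exists L => // h B h0 B0.
pose m := (Num.truncn (h^-1 * B + 1)).+1; exists (grid_kernel h m).
split.
- exact: measurable_grid_kernel.
- by split=> [x y|x x' y]; [exact: grid_kernel_le|exact: grid_kernel_lip].
- exact: grid_kernel_supp.
- move=> x; split; first exact: grid_kernel_integrable.
  move=> xB; apply: grid_kernel_int => // i.
  have hm : h^-1 * B + 1 < m%:R by rewrite truncnS_gt.
  have : `|h^-1 * x ord0 i| <= h^-1 * B.
    rewrite normrM gtr0_norm ?invr_gt0// ler_pM2l ?invr_gt0//.
    by apply: le_trans (ltW xB); exact: enorm_coord.
  by rewrite ler_norml => /andP[? ?]; apply/andP; split; lra.
- exact: grid_average_smooth.
Qed.

End grid.

Section real_integrands.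
Context d (T : measurableType d) (R : realType) (m : {measure set T -> \bar R}).
Implicit Types (f g : T -> R).

Lemma ge0_intD f g : measurable_fun setT f -> measurable_fun setT g ->
  (forall x, 0 <= f x) -> (forall x, 0 <= g x) ->
  (\int[m]_x (f x + g x)%:E = \int[m]_x (f x)%:E + \int[m]_x (g x)%:E)%E.
Proof.
move=> mf mg f0 g0; rewrite -ge0_integralD//.
- by move=> x _; rewrite lee_fin.
- exact/measurable_EFinP.
- by move=> x _; rewrite lee_fin.
- exact/measurable_EFinP.
Qed.

Lemma ge0_intZl (c : R) f : measurable_fun setT f -> (forall x, 0 <= f x) -> 0 <= c ->
  (\int[m]_x (c * f x)%:E = c%:E * \int[m]_x (f x)%:E)%E.
Proof.
move=> mf f0 c0; rewrite -ge0_integralZl//; first exact/measurable_EFinP.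
by move=> x _; rewrite lee_fin.
Qed.

End real_integrands.

Section smoothing.
Local Open Scope ereal_scope.
Context (R : realType) (N : nat).
Local Notation E := 'rV[R]_N.
Local Notation leb := (lebesgue_rV R N).
Variables (la : {sigma_finite_measure set E -> \bar R}) (Om : set E) (D v : E -> R) (B p L pe vv h : R).
Variable k : E -> E -> R.
Hypothesis mOm : measurable Om.
Hypothesis laOm : la (~` Om) = 0.
Hypothesis la_leb : forall f : E -> \bar R, measurable_fun setT f -> (forall x, 0 <= f x) ->
  \int[la]_x f x <= \int[leb]_x f x.
Hypothesis leb_la : forall f : E -> \bar R, measurable_fun setT f -> (forall x, 0 <= f x) ->
  (forall x, ~ Om x -> f x = 0) -> \int[leb]_x f x <= \int[la]_x f x.
Hypothesis mD : measurable_fun setT D.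
Hypothesis D0 : forall x, (0 <= D x)%R.
Hypothesis Dlip : forall x y, (D x <= D y + enorm (x - y))%R.
Hypothesis DOm : forall x, (0 < D x)%R -> Om x.
Hypothesis OmB : forall x, Om x -> (enorm x < B)%R.
Hypothesis mv : measurable_fun setT v.
Hypothesis vOm : forall x, ~ Om x -> v x = 0%R.
Hypothesis v2 : \int[la]_x (v x ^+ 2)%:E < +oo.
Hypothesis Np : (N%:R < p)%R.
Hypothesis pN : (p - 2 < N%:R)%R.
Hypothesis L0 : (0 <= L)%R.
Hypothesis h0 : (0 < h)%R.
Hypothesis kP : smoothing_kernel L h B k.
Hypothesis pe0 : (0 <= pe)%R.
Hypothesis vv0 : (0 <= vv)%R.

Let c1 : R := (2 * N%:R + 2)%R.
Let r : R := (c1 * h)%R.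
Let c1_gt0 : (0 < c1)%R. Proof. by rewrite /c1 ltr_wpDl. Qed.
Let r_gt0 : (0 < r)%R. Proof. exact: mulr_gt0. Qed.
Let kN : R := (2 ^+ N * c1 `^ N%:R)%R.
Let kN0 : (0 <= kN)%R. Proof. by rewrite mulr_ge0 ?powR_ge0// exprn_ge0. Qed.
Let b : R := (2 ^+ N * r `^ N%:R)%R.
Let b0 : (0 <= b)%R. Proof. by rewrite mulr_ge0 ?powR_ge0// exprn_ge0. Qed.

Definition deep_part (r : R) x : R := ((r < D x)%R%:R * v x)%R.
Definition shallow (r : R) x : R := ((D x < 2 * r)%R%:R * v x ^+ 2)%R.
Local Notation w := (deep_part r).
Local Notation sh := (shallow r).

Hypothesis PEle : power_energy la v p <= pe%:E.
Hypothesis Vle : \int[la]_x (sh x)%:E <= vv%:E.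

Let sh0 x : (0 <= sh x)%R. Proof. by rewrite mulr_ge0// sqr_ge0. Qed.
Let msh : measurable_fun setT sh. Proof. by rewrite /shallow; mfun. Qed.
Let mw : measurable_fun setT w. Proof. by rewrite /deep_part; mfun. Qed.

Let near_ge0 (x y : E) (s : R) : (0 <= s)%R -> (0 <= (enorm (x - y) < r)%R%:R * s)%R.
Proof. by move=> s0; rewrite mulr_ge0. Qed.

Definition osc_deep x : \bar R := \int[leb]_y ((enorm (x - y) < r)%R%:R * (w y - w x) ^+ 2)%:E.

Let osc_deep_ge0 x : 0 <= osc_deep x.
Proof. by apply: int_ge0 => y; rewrite lee_fin near_ge0// sqr_ge0. Qed.

Let mosc : measurable_fun setT osc_deep.
Proof.
apply: (@measurable_int2 _ _ _ _ _ leb (fun x y : E => ((enorm (x - y) < r)%R%:R * (w y - w x) ^+ 2)%:E)).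
  by mfun.
by move=> x y; rewrite lee_fin near_ge0// sqr_ge0.
Qed.

Let leb_ball x : \int[leb]_y ((enorm (x - y) < r)%R%:R)%:E <= b%:E.
Proof.
apply: le_trans (leb_eball_powR x r_gt0).
rewrite -[X in _ <= leb X](setIT (eball x r)) -integral_indic//; last exact: measurable_eball.
apply: ge0_le_int => y _; rewrite lee_fin// indicE.
have [xy|] := ltP (enorm (x - y)) r => //; rewrite mem_set//.
by rewrite /eball/= enormB.
Qed.

Let osc_deep_le x : Om x -> osc_deep x <=
  \int[la]_y ((enorm (x - y) < r)%R%:R * (v x - v y) ^+ 2)%:E +
  (b%:E * (sh x)%:E + \int[la]_y ((enorm (x - y) < r)%R%:R * sh y)%:E).
Proof.
move=> Ox.
pose F1 y := ((enorm (x - y) < r)%R%:R * ((r < D y)%R%:R * (v x - v y) ^+ 2))%R.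
pose F2 y := (sh x * (enorm (x - y) < r)%R%:R)%R.
pose F3 y := ((enorm (x - y) < r)%R%:R * sh y)%R.
have F10 y : (0 <= F1 y)%R by rewrite near_ge0// mulr_ge0// sqr_ge0.
have F20 y : (0 <= F2 y)%R by rewrite mulr_ge0.
have F30 y : (0 <= F3 y)%R by rewrite near_ge0.
have m1 : measurable_fun setT F1 by rewrite /F1; mfun.
have m2 : measurable_fun setT F2 by rewrite /F2; mfun.
have m3 : measurable_fun setT F3 by rewrite /F3; mfun.
apply: (@le_trans _ _ (\int[leb]_y (F1 y + (F2 y + F3 y))%:E)).
  apply: ge0_le_int => y _; first by rewrite lee_fin near_ge0// sqr_ge0.
  rewrite lee_fin /F1 /F2 /F3 /shallow /deep_part.
  have [xy|xy] := ltP (enorm (x - y)) r; last by rewrite !mul0r !mulr0 !addr0.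
  have dx := Dlip x y; have dy := Dlip y x; rewrite (enormB y x) in dy.
  have sx := sqr_ge0 (v x); have sy := sqr_ge0 (v y); have sxy := sqr_ge0 (v x - v y).
  have tx : (D x < 2 * r)%R -> ((D x < 2 * r)%R%:R * v x ^+ 2 = v x ^+ 2)%R by move=> ->; rewrite mul1r.
  have ty : (D y < 2 * r)%R -> ((D y < 2 * r)%R%:R * v y ^+ 2 = v y ^+ 2)%R by move=> ->; rewrite mul1r.
  have tx0 : (0 <= (D x < 2 * r)%R%:R * v x ^+ 2)%R by exact: mulr_ge0.
  have ty0 : (0 <= (D y < 2 * r)%R%:R * v y ^+ 2)%R by exact: mulr_ge0.
  rewrite !mul1r mulr1.
  have [rx|rx] := ltP r (D x); have [ry|ry] := ltP r (D y); rewrite ?mul1r ?mul0r ?subr0 ?sub0r ?sqrrN.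
  - by rewrite -(sqrrN (v y - v x)) opprB; lra.
  - by have := tx ltac:(lra); lra.
  - by have := ty ltac:(lra); lra.
  - by rewrite expr0n/=; lra.
rewrite ge0_intD//; last 2 first.
- exact: measurable_funD.
- by move=> y; rewrite addr_ge0.
apply: leeD.
  apply: le_trans (leb_la _ _ _) _.
  - exact/measurable_EFinP.
  - by move=> y; rewrite lee_fin.
  - move=> y Oy; rewrite /F1; have [ry|] := ltP r (D y); last by rewrite mul0r mulr0.
    by exfalso; apply: Oy; apply: DOm; exact: lt_trans ry.
  apply: ge0_le_int => y _; first by rewrite lee_fin.
  rewrite lee_fin /F1 ler_wpM2l//; case: (r < D y)%R; rewrite ?mul1r ?mul0r//; exact: sqr_ge0.
rewrite ge0_intD//; apply: leeD.
  rewrite ge0_intZl//; last by mfun.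
  by rewrite muleC; apply: lee_wpmul2r; rewrite ?lee_fin//; exact: leb_ball.
apply: leb_la; first exact/measurable_EFinP.
  by move=> y; rewrite lee_fin.
by move=> y Oy; rewrite /F3 /shallow (vOm Oy) expr0n/= !mulr0.
Qed.

Let int_osc_deep_le : \int[la]_x osc_deep x <= (r `^ p * pe + 2 * b * vv)%:E.
Proof.
pose I1 x := \int[la]_y ((enorm (x - y) < r)%R%:R * (v x - v y) ^+ 2)%:E.
pose I3 x := \int[la]_y (((enorm (x - y) < r)%R%:R)%:E * (sh y)%:E).
have i10 x : 0 <= I1 x by apply: int_ge0 => y; rewrite lee_fin near_ge0// sqr_ge0.
have i30 x : 0 <= I3 x by apply: int_ge0 => y; rewrite -EFinM lee_fin near_ge0.
have m1 : measurable_fun setT I1.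
  apply: (@measurable_int2 _ _ _ _ _ la (fun x y : E => ((enorm (x - y) < r)%R%:R * (v x - v y) ^+ 2)%:E)).
    by mfun.
  by move=> x y; rewrite lee_fin near_ge0// sqr_ge0.
have m3 : measurable_fun setT I3.
  apply: (@measurable_int2 _ _ _ _ _ la (fun x y : E => ((enorm (x - y) < r)%R%:R)%:E * (sh y)%:E)).
    by mfun.
  by move=> x y; rewrite -EFinM lee_fin near_ge0.
have m2 : measurable_fun setT (fun x => b%:E * (sh x)%:E) by mfun.
have i20 x : 0 <= b%:E * (sh x)%:E by rewrite -EFinM lee_fin mulr_ge0.
apply: (@le_trans _ _ (\int[la]_x (I1 x + (b%:E * (sh x)%:E + I3 x)))).
  apply: (le_int_on mOm laOm) => //.
  - by move=> x; apply: adde_ge0 => //; exact: adde_ge0.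
rewrite ge0_integralD//; last 2 first.
- by move=> x _; rewrite adde_ge0.
- exact: emeasurable_funD.
rewrite EFinD; apply: leeD.
  apply: le_trans (near_energy_le la mv (ltW (le_lt_trans (ler0n R N) Np)) r_gt0) _.
  by rewrite EFinM; apply: lee_wpmul2l => //; rewrite lee_fin powR_ge0.
rewrite ge0_integralD// (_ : (2 * b * vv)%R = (b * vv + b * vv)%R); last by ring.
rewrite EFinD; apply: leeD.
  rewrite ge0_integralZl//; last 2 first.
  - exact/measurable_EFinP.
  - by move=> x _; rewrite lee_fin.
  by rewrite [X in _ <= X]EFinM; apply: lee_wpmul2l; rewrite ?lee_fin.
apply: (@le_trans _ _ (b%:E * \int[la]_y (sh y)%:E)).
  apply: schur_le => //.
  - by mfun.
  - exact/measurable_EFinP.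
  - move=> y; apply: le_trans (la_leb _ _) _.
    + by mfun.
    + by move=> x; rewrite lee_fin.
    + by apply: le_trans (leb_ball y); rewrite le_eqVlt; apply/orP; left; apply/eqP; apply: eq_integral => x _; rewrite enormB.
by rewrite [X in _ <= X]EFinM; apply: lee_wpmul2l; rewrite ?lee_fin.
Qed.

Definition smoothed (r : R) x : R := (\int[leb]_y (k x y * deep_part r y))%R.
Local Notation vh := (smoothed r).

Let w2 : \int[leb]_y (w y ^+ 2)%:E < +oo.
Proof.
apply: le_lt_trans v2.
apply: (@le_trans _ _ (\int[la]_x (w x ^+ 2)%:E)).
  apply: leb_la; first by mfun.
    by move=> x; rewrite lee_fin sqr_ge0.
  by move=> x Ox; rewrite /deep_part (vOm Ox) mulr0 expr0n.
apply: ge0_le_int => x _; rewrite lee_fin ?sqr_ge0// /deep_part.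
by case: (r < D x)%R; rewrite ?mul1r// mul0r expr0n/= sqr_ge0.
Qed.

Lemma smoothed_smooth : smooth vh.
Proof. by have [_ _ _ _] := kP; apply. Qed.

Let mvh : measurable_fun setT vh.
Proof. by apply: continuous_measurable_rV; apply: smooth_continuous; exact: smoothed_smooth. Qed.

Let mk1 x : measurable_fun setT (k x).
Proof. by have [mk _ _ _ _] := kP; exact: (measurableT_comp mk (pair1_measurable x)). Qed.

Let Mh : R := (h^-1 ^+ N)%R.
Let Mh0 : (0 <= Mh)%R. Proof. by rewrite exprn_ge0// invr_ge0 ltW. Qed.
Let A : R := (kN * h `^ (- N%:R))%R.
Let A0 : (0 <= A)%R. Proof. by rewrite mulr_ge0 ?powR_ge0. Qed.

Let Mh_b : (Mh ^+ 2 * b = A)%R.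
Proof.
have hq : (h `^ (- N%:R) = Mh)%R by rewrite powRN powR_mulrn ?(ltW h0)// /Mh exprVn.
have hh : (h `^ (- N%:R) * h `^ N%:R = 1)%R by rewrite -(powRDp _ _ h0) addNr powRr0.
rewrite /b /A /kN /r powRM ?(ltW h0) ?(ltW c1_gt0)// -hq.
transitivity (2 ^+ N * c1 `^ N%:R * h `^ (- N%:R) * (h `^ (- N%:R) * h `^ N%:R))%R; first by ring.
by rewrite hh mulr1.
Qed.

Let int_kE x (g : E -> R) : (\int[leb]_y (k x y * g y) = \int[leb]_y (g y * k x y))%R.
Proof. by apply: eq_Rintegral => y _; rewrite mulrC. Qed.

Let smoothed_sub_le x : Om x -> ((vh x - w x) ^+ 2)%:E <= A%:E * osc_deep x.
Proof.
move=> Ox; have [_ [kM _] ks ki _] := kP; have [kix k1] := ki x.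
have := @weighted_sq_le R N leb N%:R (2 ^+ N)%R (exprn_ge0 _ (ler0n R 2)) (@leb_eball_powR R N)
  w (k x) x r Mh (w x) r_gt0 Mh0 mw w2 (mk1 x) (kM x).
rewrite k1 ?mulr1 -?int_kE; last exact: OmB.
rewrite -/b Mh_b; apply => y ry; apply/eqP/negPn/negP => /ks; apply/negP; rewrite -leNgt.
by apply: le_trans ry; rewrite /r /c1 ler_pM2r// lerD2l; lra.
Qed.

Let smoothed_lip_le x x' : Om x -> Om x' -> (enorm (x - x') < h)%R ->
  ((vh x - vh x') ^+ 2)%:E <= (A * (L * h^-1 * enorm (x - x')) ^+ 2)%:E * osc_deep x.
Proof.
move=> Ox Ox' xx'; have [_ [_ kL] ks ki _] := kP; have [kix k1] := ki x; have [kix' k1'] := ki x'.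
have s0 : (0 <= L * h^-1 * enorm (x - x'))%R.
  by rewrite mulr_ge0 ?enorm_ge0// mulr_ge0// invr_ge0 ltW.
have := @weighted_sq_le R N leb N%:R (2 ^+ N)%R (exprn_ge0 _ (ler0n R 2)) (@leb_eball_powR R N)
  w (fun y => k x y - k x' y)%R x r (Mh * (L * h^-1 * enorm (x - x'))) (w x) r_gt0 (mulr_ge0 Mh0 s0) mw w2
  (measurable_funB (mk1 x) (mk1 x')) (kL x x').
set q := (L * h^-1 * _)%R.
rewrite (_ : (Mh * q) ^+ 2 * (2 ^+ N * r `^ N%:R) = A * q ^+ 2)%R; last first.
  by rewrite -Mh_b /b; ring.
have fki z : leb.-integrable setT (EFin \o (fun y => w y * k z y)%R).
  have [_ [kM _] _ kiz _] := kP; apply: integrable_mul => //.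
  apply: (@le_lt_trans _ _ (\int[leb]_y (Mh%:E * `|(k z y)%:E|))).
    apply: ge0_le_int => y _; rewrite ?lee_fin ?sqr_ge0//.
    by rewrite -real_normK ?num_real// expr2 ler_wpM2r.
  have [_ fin] := integrableP _ _ _ (kiz z).1.
  rewrite ge0_integralZl//; first exact: lte_mul_pinfty.
  by apply: measurableT_comp => //; exact/measurable_EFinP.
rewrite (_ : (\int[leb]_y (w y * (k x y - k x' y)))%R = (vh x - vh x')%R); last first.
  rewrite /smoothed !int_kE -RintegralB//; apply: eq_Rintegral => y _; by rewrite mulrBr.
rewrite RintegralB// k1 ?k1' ?subrr ?mulr0 ?subr0; [|exact: OmB|exact: OmB].
apply => y ry.
have z (u : E) : (enorm (x - u) < h)%R -> k u y = 0%R.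
  move=> xu; apply/eqP/negPn/negP => /ks uy.
  have := enorm_triangle u x y; move: ry uy; rewrite /r /c1 => ry uy tr.
  by nra.
by rewrite (z x) ?subrr ?enorm0// (z x')// subrr.
Qed.

Let QG : R := (kN * c1 `^ p * h `^ (p - N%:R) * pe + 2 * kN ^+ 2 * vv)%R.
Let QG0 : (0 <= QG)%R.
Proof. by rewrite addr_ge0// mulr_ge0// ?mulr_ge0 ?powR_ge0// exprn_ge0. Qed.

Let A_osc_le : A%:E * \int[la]_x osc_deep x <= QG%:E.
Proof.
apply: le_trans (lee_wpmul2l _ int_osc_deep_le) _; first by rewrite lee_fin.
rewrite -EFinM lee_fin le_eqVlt; apply/orP; left; apply/eqP.
have hh : (h `^ (- N%:R) * h `^ N%:R = 1)%R by rewrite -(powRDp _ _ h0) addNr powRr0.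
rewrite /QG /A /b /r !powRM ?(ltW h0) ?(ltW c1_gt0)// -/kN (_ : p - N%:R = - N%:R + p)%R; last by ring.
rewrite (powRDp _ _ h0) mulrDr; congr (_ + _)%R; first by ring.
transitivity (2 * kN * (2 ^+ N * c1 `^ N%:R) * vv * (h `^ (- N%:R) * h `^ N%:R))%R; first by ring.
by rewrite hh -/kN; ring.
Qed.

Let L2c : R := (2 * QG + 2 * vv)%R.

Lemma smoothed_L2 : \int[la]_x ((vh x - v x) ^+ 2)%:E <= L2c%:E.
Proof.
apply: (@le_trans _ _ (\int[la]_x ((2 * A)%:E * osc_deep x + (2 * sh x)%:E))).
  apply: (le_int_on mOm laOm) => [|x|x|x Ox].
  - by mfun.
  - by rewrite lee_fin sqr_ge0.
  - by rewrite adde_ge0// ?mule_ge0// lee_fin mulr_ge0.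
  rewrite [((2 * A)%R)%:E]EFinM -muleA [((2 * sh x)%R)%:E]EFinM.
  apply: (@le_trans _ _ (2%:E * ((vh x - w x) ^+ 2)%:E + 2%:E * (sh x)%:E)); last first.
    by apply: leeD => //; apply: lee_wpmul2l => //; exact: smoothed_sub_le.
  rewrite -!EFinM -EFinD lee_fin (_ : vh x - v x = (vh x - w x) + (w x - v x))%R; last by ring.
  apply: sqrD_le => //; rewrite /deep_part /shallow.
  have [rx|rx] := ltP r (D x); rewrite ?mul1r ?mul0r.
    by rewrite subrr expr0n/=; exact: (mulr_ge0 _ (sqr_ge0 _)).
  rewrite sub0r sqrrN.
  have r2 : (r < 2 * r)%R by rewrite ltr_pMl// ltr1n.
  by rewrite (le_lt_trans rx r2) mul1r.
rewrite ge0_integralD//; last 4 first.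
- by move=> x _; rewrite mule_ge0// lee_fin mulr_ge0.
- by apply: emeasurable_funM => //; exact: measurable_cst.
- by move=> x _; rewrite lee_fin mulr_ge0.
- by mfun.
rewrite /L2c EFinD; apply: leeD.
  rewrite ge0_integralZl//; last by rewrite lee_fin mulr_ge0.
  rewrite [X in X * _ <= _]EFinM -muleA [X in _ <= X]EFinM.
  by apply: lee_wpmul2l => //; rewrite lee_fin.
by rewrite ge0_intZl// EFinM; apply: lee_wpmul2l.
Qed.

Let cs : R := (layer_const N%:R (p - 2) * 2 ^+ N)%R.
Let cl : R := (2 `^ `|N%:R - p| * layer_const N%:R p * 2 ^+ N)%R.
Let cs0 : (0 <= cs)%R.
Proof. by rewrite mulr_ge0 ?exprn_ge0// layer_const_ge0// gt_eqF. Qed.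
Let cl0 : (0 <= cl)%R.
Proof. by rewrite mulr_ge0 ?exprn_ge0// mulr_ge0 ?powR_ge0// layer_const_ge0// lt_eqF. Qed.

Definition smoothed_energy_const : R :=
  (L ^+ 2 * cs * h `^ (N%:R - p) * QG + (3 * pe + 6 * (cl * h `^ (N%:R - p) * L2c)))%R.

Let ediff (u : E -> R) (x y : E) : R := ((u x - u y) ^+ 2 * enorm (x - y) `^ (- p))%R.
Let ediff_ge0 u x y : (0 <= ediff u x y)%R. Proof. by rewrite mulr_ge0 ?sqr_ge0 ?powR_ge0. Qed.
Let mediff (u : E -> R) : measurable_fun setT u -> measurable_fun setT (fun q : E * E => ediff u q.1 q.2).
Proof. by move=> mu_; rewrite /ediff; mfun. Qed.

Let err x : R := ((vh x - v x) ^+ 2)%R.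
Let err0 x : (0 <= err x)%R. Proof. exact: sqr_ge0. Qed.
Let merr : measurable_fun setT err. Proof. by rewrite /err; mfun. Qed.

Let fr (x y : E) : R := ((h <= enorm (x - y))%R%:R * enorm (x - y) `^ (- p))%R.
Let fr0 x y : (0 <= fr x y)%R. Proof. by rewrite mulr_ge0 ?powR_ge0. Qed.
Let mfr : measurable_fun setT (fun q : E * E => fr q.1 q.2).
Proof. by rewrite /fr; mfun. Qed.

Let nker (x y : E) : R := ((enorm (x - y) < h)%R%:R * enorm (x - y) `^ (- (p - 2)))%R.
Let nker0 x y : (0 <= nker x y)%R. Proof. by rewrite mulr_ge0 ?powR_ge0. Qed.
Let mnker : measurable_fun setT (fun q : E * E => nker q.1 q.2).
Proof. by rewrite /nker; mfun. Qed.

Let clh : (0 <= cl * h `^ (N%:R - p))%R. Proof. by rewrite mulr_ge0 ?powR_ge0. Qed.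

Let int_fr_le y : \int[la]_x (fr x y)%:E <= (cl * h `^ (N%:R - p))%:E.
Proof.
apply: le_trans (la_leb _ _) (leb_int_large y Np h0); first by rewrite /fr; mfun.
by move=> x; rewrite lee_fin; exact: fr0.
Qed.

Let int_nker_le x : \int[la]_y (nker x y)%:E <= (cs * h `^ (N%:R - (p - 2)))%:E.
Proof.
rewrite (eq_integral (fun y => (nker y x)%:E)); last by move=> y _; rewrite /nker enormB.
apply: le_trans (la_leb _ _) (leb_int_small x pN h0); first by rewrite /nker; mfun.
by move=> y; rewrite lee_fin; exact: nker0.
Qed.

Let Lh2 : R := ((L * h^-1) ^+ 2)%R.
Let Lh20 : (0 <= Lh2)%R. Proof. exact: sqr_ge0. Qed.
Let nr (x y : E) : \bar R := (A * Lh2 * nker x y)%:E * osc_deep x.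
Let nr0 x y : 0 <= nr x y.
Proof. by rewrite mule_ge0// lee_fin mulr_ge0// mulr_ge0. Qed.
Let mnr : measurable_fun setT (fun q : E * E => nr q.1 q.2).
Proof.
apply: emeasurable_funM; last exact: (measurableT_comp mosc measurable_fst).
by apply/measurable_EFinP; apply: measurable_funM.
Qed.

Let int_nr_le : \int[la]_x \int[la]_y nr x y <= (L ^+ 2 * cs * h `^ (N%:R - p) * QG)%:E.
Proof.
have C0 : (0 <= cs * h `^ (N%:R - (p - 2)))%R by rewrite mulr_ge0 ?powR_ge0.
have AL0 : (0 <= A * Lh2)%R by exact: mulr_ge0.
apply: (@le_trans _ _ (\int[la]_x ((Lh2 * (cs * h `^ (N%:R - (p - 2))))%:E * (A%:E * osc_deep x)))).
  apply: ge0_le_int => x _; first exact: int_ge0.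
  have mnx : measurable_fun setT (nker x) := measurableT_comp mnker (pair1_measurable x).
  have ALn y : (0 <= A * Lh2 * nker x y)%R by exact: mulr_ge0.
  rewrite ge0_integralZr//; last 2 first.
  - by apply/measurable_EFinP; exact: (measurable_funM (measurable_cst (A * Lh2)%R) mnx).
  - by move=> y _; rewrite lee_fin.
  rewrite (ge0_intZl la mnx (nker0 x) AL0).
  rewrite muleA -EFinM; apply: lee_wpmul2r => //.
  apply: le_trans (lee_wpmul2l _ (int_nker_le x)) _; first by rewrite lee_fin mulr_ge0.
  by rewrite -EFinM lee_fin le_eqVlt; apply/orP; left; apply/eqP; ring.
have mAo : measurable_fun setT (fun x => A%:E * osc_deep x).
  by apply: emeasurable_funM => //; exact: measurable_cst.
have C1 : (0 <= Lh2 * (cs * h `^ (N%:R - (p - 2))))%R by rewrite mulr_ge0.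
rewrite ge0_integralZl//; last by move=> x _; rewrite mule_ge0.
rewrite ge0_integralZl//.
apply: le_trans (lee_wpmul2l _ A_osc_le) _; first by rewrite lee_fin.
rewrite -EFinM lee_fin le_eqVlt; apply/orP; left; apply/eqP; congr (_ * _)%R.
rewrite (_ : N%:R - (p - 2) = N%:R - p + 2)%R; last by ring.
rewrite (powRDp _ _ h0) powR_mulrn ?(ltW h0)// /Lh2; field.
by rewrite gt_eqF.
Qed.

Let FF (x y : E) : R := (3 * ediff v x y + (3 * (err x * fr x y) + 3 * (err y * fr x y)))%R.

Let ediff_smoothed_le x y : Om x -> Om y -> (ediff vh x y)%:E <= nr x y + (FF x y)%:E.
Proof.
have FF0 : (0 <= FF x y)%R by rewrite /FF !addr_ge0// mulr_ge0// mulr_ge0.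
move=> Ox Oy; have [xy|xy] := ltP (enorm (x - y)) h.
  apply: (@le_trans _ _ (nr x y)); last by rewrite leeDl// lee_fin.
  have [xy0|xyn] := eqVneq (enorm (x - y)) 0%R.
    have /eqP := xy0; rewrite enorm_eq0 subr_eq0 => /eqP xye.
    by rewrite /ediff {1}xye subrr expr0n mul0r.
  have xyp : (0 < enorm (x - y))%R by rewrite lt_neqAle eq_sym xyn enorm_ge0.
  rewrite /ediff EFinM; apply: (le_trans (lee_wpmul2r _ (smoothed_lip_le Ox Oy xy))).
    by rewrite lee_fin powR_ge0.
  rewrite muleAC -EFinM /nr le_eqVlt; apply/orP; left; apply/eqP; congr (_%:E * _).
  rewrite /nker xy mul1r (_ : - (p - 2) = 2 + - p)%R; last by ring.
  by rewrite (powRDp _ _ xyp) powR_mulrn ?(ltW xyp)// /Lh2; ring.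
apply: (@le_trans _ _ (FF x y)%:E); last by rewrite leeDr.
rewrite lee_fin /FF /ediff /fr xy mul1r !mulrA -!mulrDl ler_wpM2r ?powR_ge0// /err.
have := sqr_ge0 ((vh x - v x) + (vh y - v y)); have := sqr_ge0 ((vh x - v x) - (v x - v y)).
by have := sqr_ge0 ((v x - v y) + (vh y - v y)); nra.
Qed.

Let mFF1 : measurable_fun setT (fun q : E * E => 3 * ediff v q.1 q.2)%R.
Proof. by apply: measurable_funM => //; exact: mediff. Qed.
Let mFF2 : measurable_fun setT (fun q : E * E => 3 * (err q.1 * fr q.1 q.2))%R.
Proof.
by apply: measurable_funM => //; apply: measurable_funM => //; exact: (measurableT_comp merr measurable_fst).
Qed.
Let mFF3 : measurable_fun setT (fun q : E * E => 3 * (err q.2 * fr q.1 q.2))%R.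
Proof.
by apply: measurable_funM => //; apply: measurable_funM => //; exact: (measurableT_comp merr measurable_snd).
Qed.
Let FF20 x y : (0 <= 3 * (err x * fr x y))%R. Proof. by rewrite mulr_ge0// mulr_ge0. Qed.
Let FF30 x y : (0 <= 3 * (err y * fr x y))%R. Proof. by rewrite mulr_ge0// mulr_ge0. Qed.
Let FF10 x y : (0 <= 3 * ediff v x y)%R. Proof. by rewrite mulr_ge0. Qed.

Let int_FF2 : \int[la]_x \int[la]_y (3 * (err x * fr x y))%:E <= (3 * (cl * h `^ (N%:R - p) * L2c))%:E.
Proof.
apply: (@le_trans _ _ (\int[la]_x ((3 * (cl * h `^ (N%:R - p)))%:E * (err x)%:E))).
  apply: ge0_le_int => x _; first by apply: int_ge0 => y; rewrite lee_fin.
  have mx : measurable_fun setT (fr x) by exact: (measurableT_comp mfr (pair1_measurable x)).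
  have m3 : measurable_fun setT (fun y => err x * fr x y)%R by exact: (measurable_funM (measurable_cst (err x)) mx).
  have f3 y : (0 <= err x * fr x y)%R by exact: mulr_ge0.
  rewrite (ge0_intZl la m3 f3 (ler0n R 3)) (ge0_intZl la mx (fr0 x) (err0 x)).
  rewrite [X in _ <= X * _]EFinM -muleA; apply: lee_wpmul2l => //.
  rewrite muleC; apply: lee_wpmul2r; first by rewrite lee_fin.
  rewrite (eq_integral (fun y => (fr y x)%:E)); first exact: int_fr_le.
  by move=> y _; rewrite /fr enormB.
rewrite ge0_integralZl//; last 3 first.
- exact/measurable_EFinP.
- by move=> x _; rewrite lee_fin.
- by rewrite lee_fin mulr_ge0.
rewrite (_ : 3 * (cl * h `^ (N%:R - p) * L2c) = (3 * (cl * h `^ (N%:R - p))) * L2c)%R; last by ring.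
by rewrite [X in _ <= X]EFinM; apply: lee_wpmul2l; [rewrite lee_fin mulr_ge0|exact: smoothed_L2].
Qed.

Let int_FF3 : \int[la]_x \int[la]_y (3 * (err y * fr x y))%:E <= (3 * (cl * h `^ (N%:R - p) * L2c))%:E.
Proof.
apply: (@le_trans _ _ (\int[la]_x \int[la]_y ((3 * fr x y)%:E * (err y)%:E))).
  apply: ge0_le_int => x _; first by apply: int_ge0 => y; rewrite lee_fin.
  apply: ge0_le_int => y _; first by rewrite lee_fin.
  by rewrite (_ : 3 * (err y * fr x y) = 3 * fr x y * err y)%R; last by ring.
apply: (@le_trans _ _ ((3 * (cl * h `^ (N%:R - p)))%:E * \int[la]_y (err y)%:E)).
  apply: schur_le => //.
  - by apply/measurable_EFinP; exact: measurable_funM.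
  - exact/measurable_EFinP.
  - by move=> x y; rewrite lee_fin mulr_ge0.
  - by rewrite mulr_ge0.
  - move=> y; have my : measurable_fun setT (fr^~ y) by rewrite /fr; mfun.
    rewrite ge0_intZl// EFinM; apply: lee_wpmul2l; first by rewrite lee_fin.
    exact: int_fr_le.
rewrite (_ : 3 * (cl * h `^ (N%:R - p) * L2c) = (3 * (cl * h `^ (N%:R - p))) * L2c)%R; last by ring.
by rewrite [X in _ <= X]EFinM; apply: lee_wpmul2l; [rewrite lee_fin mulr_ge0|exact: smoothed_L2].
Qed.

Let int_FF_le : \int[la]_x \int[la]_y (FF x y)%:E <=
  (3 * pe + 6 * (cl * h `^ (N%:R - p) * L2c))%:E.
Proof.
have m1 x : measurable_fun setT (fun y => 3 * ediff v x y)%R := measurableT_comp mFF1 (pair1_measurable x).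
have m2 x : measurable_fun setT (fun y => 3 * (err x * fr x y))%R := measurableT_comp mFF2 (pair1_measurable x).
have m3 x : measurable_fun setT (fun y => 3 * (err y * fr x y))%R := measurableT_comp mFF3 (pair1_measurable x).
have i1 x : 0 <= \int[la]_y (3 * ediff v x y)%:E by apply: int_ge0 => y; rewrite lee_fin.
have i2 x : 0 <= \int[la]_y (3 * (err x * fr x y))%:E by apply: int_ge0 => y; rewrite lee_fin.
have i3 x : 0 <= \int[la]_y (3 * (err y * fr x y))%:E by apply: int_ge0 => y; rewrite lee_fin.
have M1 : measurable_fun setT (fun x => \int[la]_y (3 * ediff v x y)%:E).
  apply: (@measurable_int2 _ _ _ _ _ la (fun x y : E => (3 * ediff v x y)%:E)); first exact/measurable_EFinP.
  by move=> x y; rewrite lee_fin.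
have M2 : measurable_fun setT (fun x => \int[la]_y (3 * (err x * fr x y))%:E).
  apply: (@measurable_int2 _ _ _ _ _ la (fun x y : E => (3 * (err x * fr x y))%:E)); first exact/measurable_EFinP.
  by move=> x y; rewrite lee_fin.
have M3 : measurable_fun setT (fun x => \int[la]_y (3 * (err y * fr x y))%:E).
  apply: (@measurable_int2 _ _ _ _ _ la (fun x y : E => (3 * (err y * fr x y))%:E)); first exact/measurable_EFinP.
  by move=> x y; rewrite lee_fin.
rewrite (eq_integral (fun x => \int[la]_y (3 * ediff v x y)%:E + (\int[la]_y (3 * (err x * fr x y))%:E + \int[la]_y (3 * (err y * fr x y))%:E))).
  rewrite (ge0_integralD la measurableT (fun x _ => i1 x) M1 (fun x _ => adde_ge0 (i2 x) (i3 x)) (emeasurable_funD M2 M3)).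
  rewrite (ge0_integralD la measurableT (fun x _ => i2 x) M2 (fun x _ => i3 x) M3).
  rewrite [X in _ <= X]EFinD; apply: leeD.
    rewrite (eq_integral (fun x => 3%:E * \int[la]_y (ediff v x y)%:E)); last first.
      by move=> x _; rewrite (ge0_intZl la (measurableT_comp (mediff mv) (pair1_measurable x)) (ediff_ge0 v x) (ler0n R 3)).
    rewrite ge0_integralZl//; last 2 first.
    - apply: (@measurable_int2 _ _ _ _ _ la (fun x y : E => (ediff v x y)%:E)); first by apply/measurable_EFinP; exact: mediff.
      by move=> x y; rewrite lee_fin.
    - by move=> x _; apply: int_ge0 => y; rewrite lee_fin.
    by rewrite [X in _ <= X]EFinM; apply: lee_wpmul2l.
  rewrite (_ : 6 * _ = 3 * (cl * h `^ (N%:R - p) * L2c) + 3 * (cl * h `^ (N%:R - p) * L2c))%R; last by ring.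
  by rewrite [X in _ <= X]EFinD; exact: (leeD int_FF2 int_FF3).
move=> x _; rewrite -(ge0_intD la (m2 x) (m3 x) (FF20 x) (fun y => FF30 x y)).
by rewrite -(ge0_intD la (m1 x) (measurable_funD (m2 x) (m3 x)) (FF10 x) (fun y => addr_ge0 (FF20 x y) (FF30 x y))).
Qed.

Lemma smoothed_energy : power_energy la vh p <= smoothed_energy_const%:E.
Proof.
have mF : measurable_fun setT (fun q : E * E => (FF q.1 q.2)%:E).
  by apply/measurable_EFinP; apply: measurable_funD => //; exact: measurable_funD.
have F0 x y : 0 <= (FF x y)%:E by rewrite lee_fin !addr_ge0.
apply: (@le_trans _ _ (\int[la]_x (\int[la]_y nr x y + \int[la]_y (FF x y)%:E))).
  apply: (le_int_on mOm laOm) => [|x|x|x Ox].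
  - apply: (@measurable_int2 _ _ _ _ _ la (fun x y : E => (ediff vh x y)%:E)).
      by apply/measurable_EFinP; exact: mediff.
    by move=> x y; rewrite lee_fin.
  - by apply: int_ge0 => y; rewrite lee_fin ediff_ge0.
  - by rewrite adde_ge0// int_ge0.
  rewrite -(ge0_integralD la measurableT (fun y _ => nr0 x y) (measurableT_comp mnr (pair1_measurable x))
    (fun y _ => F0 x y) (measurableT_comp mF (pair1_measurable x))).
  apply: (le_int_on mOm laOm) => [|y|y|y Oy].
  - by apply/measurable_EFinP; exact: (measurableT_comp (mediff mvh) (pair1_measurable x)).
  - by rewrite lee_fin ediff_ge0.
  - by rewrite adde_ge0.
  - exact: ediff_smoothed_le.
rewrite (ge0_integralD la measurableT (fun x _ => int_ge0 la setT (nr0 x)) (measurable_int2 la mnr nr0)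
  (fun x _ => int_ge0 la setT (F0 x)) (measurable_int2 la mF F0)).
by rewrite /smoothed_energy_const [X in _ <= X]EFinD; exact: (leeD int_nr_le int_FF_le).
Qed.

Lemma smoothed_neq0 x : vh x != 0%R -> exists2 y, (r < D y)%R & (enorm (x - y) < r - h)%R.
Proof.
move=> vx; apply: contrapT => ny; move/eqP: vx; apply.
rewrite /smoothed /Rintegral integral0_eq// => y _.
have [ry|ry] := ltP r (D y); last by rewrite /deep_part ltNge ry mul0r mulr0.
have [->|kn] := eqVneq (k x y) 0%R; first by rewrite mul0r.
exfalso; apply: ny; exists y => //; have [_ _ ks _ _] := kP; apply: lt_le_trans (ks _ _ kn) _.
by rewrite le_eqVlt; apply/orP; left; apply/eqP; rewrite /r /c1; ring.
Qed.

End smoothing.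

(** * Regular domains *)

Section small_sublevels.
Context d (T : measurableType d) (R : realType) (m : {measure set T -> \bar R}).

Lemma int_sublevel_small (f g : T -> R) : measurable_fun setT f -> measurable_fun setT g ->
  (forall x, 0 <= f x) -> (\int[m]_x (f x)%:E < +oo)%E -> (forall x, f x != 0 -> 0 < g x) ->
  forall e : R, 0 < e -> exists2 eta : R, 0 < eta & forall q, 0 < q -> q <= eta ->
    (\int[m]_x ((g x < q)%R%:R * f x)%:E <= e%:E)%E.
Proof.
move=> mf mg f0 foo fg e e0.
pose F n x := ((g x < n.+1%:R^-1)%R%:R * f x)%:E.
have mF n : measurable_fun setT (F n).
  by apply/measurable_EFinP; apply: measurable_funM => //; exact: measurable_ltR.
have fi : m.-integrable setT (EFin \o f).
  apply/integrableP; split; first exact/measurable_EFinP.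
  by under eq_integral do rewrite /= ger0_norm//.
have F0 : {ae m, forall x, setT x -> F ^~ x @ \oo --> (cst 0%E : T -> \bar R) x}.
  apply: aeW => x _; have [fx|fx] := eqVneq (f x) 0.
    by rewrite /F fx; under eq_fun do rewrite mulr0; exact: cvg_cst.
  apply: cvg_near_cst; near=> n; rewrite /F.
  have -> : (g x < n.+1%:R^-1)%R = false; last by rewrite mul0r.
  apply/negbTE; rewrite -leNgt; near: n.
  by have [n _ hn] := near_infty_natSinv_lt (PosNum (fg x fx)); exists n => // k nk; exact/ltW/hn.
have dom : {ae m, forall x n, setT x -> (`|F n x| <= (EFin \o f) x)%E}.
  apply: aeW => x n _; rewrite /F /= lee_fin ger0_norm ?mulr_ge0//.
  by case: (_ < _); rewrite ?mul1r// mul0r.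
have [_ _] := dominated_convergence measurableT mF (measurable_cst _) F0 fi dom.
rewrite integral0 => /fine_cvgP[_ /cvgrPdist_lt/(_ e e0)[n _ /(_ n (leqnn n))]].
rewrite /= sub0r normrN ger0_norm ?fine_ge0 ?int_ge0//; last first.
  by move=> x; rewrite lee_fin mulr_ge0.
have Foo : (\int[m]_x F n x < +oo)%E.
  apply: le_lt_trans foo; apply: ge0_le_int => x _; first by rewrite lee_fin mulr_ge0.
  by rewrite lee_fin; case: (_ < _); rewrite ?mul1r// mul0r.
move=> Fe; exists n.+1%:R^-1 => // q q0 qn.
apply: (@le_trans _ _ (\int[m]_x F n x)%E).
  apply: ge0_le_int => x _; first by rewrite lee_fin mulr_ge0.
  rewrite lee_fin ler_wpM2r//; have [gq|] := ltP (g x) q => //.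
  by rewrite (lt_le_trans gq qn).
by rewrite -[leLHS]fineK ?lee_fin ?ltW// ge0_fin_numE// int_ge0// => x; rewrite lee_fin mulr_ge0.
Unshelve. all: by end_near.
Qed.

End small_sublevels.

Section regular_domains.
Context (R : realType) (N : nat).
Local Notation E := 'rV[R]_N.
Local Notation leb := (lebesgue_rV R N).

(* [la] and [nu] stand for the restrictions of Lebesgue measure to [Om] and of
   [mu] to [F]; [D] is the distance to the complement of [Om]. *)
Record regular_domain (Om F : set E) (mu : {measure set E -> \bar R}) (d : R) (D : E -> R)
    (la nu : {sigma_finite_measure set E -> \bar R}) (M cl Cu c r0 Cnu : R) : Prop := RegularDomain {
  rd_mOm : measurable Om;
  rd_mF : measurable F;
  rd_la_int : forall f : E -> \bar R, measurable_fun setT f -> (forall x, (0 <= f x)%E) ->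
    (\int[la]_x f x = \int[leb]_(x in Om) f x)%E;
  rd_nu_int : forall f : E -> \bar R, measurable_fun setT f -> (forall x, (0 <= f x)%E) ->
    (\int[nu]_x f x = \int[mu]_(x in F) f x)%E;
  rd_la0 : la (~` Om) = 0%E;
  rd_nu0 : nu (~` F) = 0%E;
  rd_la : forall A, la A = leb (A `&` Om);
  rd_cst : [/\ 0 < d, d < N%:R & 0 < M] /\ [/\ 0 < cl, 0 <= Cu, 0 < c & 0 < r0];
  rd_nu_fin : (nu setT <= Cnu%:E)%E;
  rd_la_up : forall (x : E) (r : R), 0 < r -> (la (eball x r) <= (2 ^+ N * r `^ N%:R)%:E)%E;
  rd_nu_up : forall (x : E) (r : R), 0 < r -> (nu (eball x r) <= (Cu * r `^ d)%:E)%E;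
  rd_mD : measurable_fun setT D;
  rd_D0 : forall x, 0 <= D x;
  rd_Dlip : forall x z, D x <= D z + enorm (x - z);
  rd_DOm : forall x, Om x -> 0 < D x;
  rd_OmD : forall x, 0 < D x -> Om x;
  rd_DF : forall y x, F y -> D x <= enorm (x - y);
  rd_DM : forall x, Om x -> D x < M;
  rd_OmM : forall x z, Om x -> Om z -> enorm (x - z) < M;
  rd_OmB : forall x, Om x -> enorm x < M;
  rd_nu_lo : forall x, Om x -> ((cl * D x `^ d)%:E <= nu (eball x (2 * D x)))%E;
  rd_nu_layer : forall x (q : R), Om x -> D x < q -> q <= M -> ((cl * q `^ d)%:E <= nu (eball x (2 * q)))%E;
  rd_thick : forall y, F y -> thick la c r0 y }.

Lemma compact_measure_lty (mu : {measure set E -> \bar R}) (F : set E) : compact F ->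
  measurable F -> (forall x, F x -> (mu (eball x 1 `&` F) < +oo)%E) -> (mu F < +oo)%E.
Proof.
move=> cF mF loc; have := cF; rewrite compact_cover => cc.
have [||D' sD FD] := cc E F (fun x => eball x 1).
- by move=> x _; exact: eball_open.
- by move=> x Fx; exists x => //; rewrite /eball/= subrr enorm0.
pose l := finmap.enum_fset D'.
pose A i := eball (nth 0 l i) 1 `&` F.
have mA i : measurable (A i) by apply: measurableI => //; exact: measurable_eball.
apply: (@le_lt_trans _ _ (mu (\big[setU/set0]_(i < size l) A i))).
  apply: le_measure; rewrite ?inE//; first exact: bigsetU_measurable.
  move=> x Fx; have [z zD xz] := FD x Fx.
  rewrite -(bigcup_mkord _ A); exists (index z l); rewrite /= ?index_mem//.
  by split => //; rewrite nth_index.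
apply: le_lt_trans (Boole_inequality mu _) _ => [i _|]; first exact: mA.
apply: lte_sum_pinfty => i _; apply: loc.
have il : nth 0 l i \in l by exact: mem_nth.
by have := sD _ il; rewrite inE.
Qed.

Lemma regular_domain_exists (Om : set E) (eps delta d : R) (mu : {measure set E -> \bar R}) :
  eps_delta_domain Om eps delta -> bounded_set Om -> Om !=set0 -> d_set_measure (boundary Om) d mu ->
  exists (la nu : {sigma_finite_measure set E -> \bar R}) (M cl Cu c r0 Cnu : R),
    regular_domain Om (boundary Om) mu d (dist_compl Om) la nu M cl Cu c r0 Cnu.
Proof.
move=> dom bOm [x0 Ox0] [d0 dN suppF [c1 [c2 [c1_gt0 c2_gt0 muB]]]].
have [oOm _ _ _ _] := dom; set F := boundary Om.
have N0 : (0 < N)%N by rewrite -(ltr_nat R); exact: lt_le_trans dN.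
have [B B0 OmB] := bounded_enorm bOm.
have nOm := nonsurj_bounded N0 OmB.
have [r1 [c [r10 c0 vol]]] := corkscrew_volume N0 bOm dom.
have mOm : measurable Om by exact: open_measurable_rV.
have cF : closed F by exact: closed_boundary.
have mF : measurable F by exact: closed_measurable_rV.
have FB x : F x -> enorm x <= B.
  rewrite /F boundary_open// => -[+ _].
  have cl : closed [set x : E | enorm x <= B].
    apply: (@closed_comp _ _ (@enorm R N) [set x | x <= B]); last exact: closed_le.
    by move=> z _; exact: enorm_continuous.
  have sub : closure Om `<=` [set x : E | enorm x <= B].
    by rewrite [X in _ `<=` X](closure_id _).1//; apply: closure_subset => z /OmB /ltW.
  exact: sub.
have compF : compact F.
  apply: bounded_closed_compact => //; exists B; split; first exact: num_real.
  by move=> q Bq x Fx; apply: le_trans (norm_le_enorm x) _; apply: le_trans (FB x Fx) (ltW Bq).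
have muF : (mu F < +oo)%E.
  apply: compact_measure_lty => // x Fx; apply: le_lt_trans (muB x 1 Fx ltr01 (lexx 1)).2 _.
  by rewrite ltry.
have Omoo : (leb Om < +oo)%E.
  apply: (@le_lt_trans _ _ (leb (eball 0 B))); last first.
    by apply: le_lt_trans (leb_eball_le 0 (ltW B0)) _; rewrite ltry.
  apply: le_measure; rewrite ?inE//; first exact: measurable_eball.
  by move=> x Ox; rewrite /eball/= subr0; exact: OmB.
pose la : {sigma_finite_measure set E -> \bar R} := mfrestr mOm Omoo.
pose nu : {sigma_finite_measure set E -> \bar R} := mfrestr mF muF.
have laE A : la A = leb (A `&` Om) by [].
have nuE A : nu A = mu (A `&` F) by [].
have la_up (x : E) (r : R) : 0 < r -> (la (eball x r) <= (2 ^+ N * r `^ N%:R)%:E)%E.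
  move=> r0; rewrite laE; apply: le_trans (leb_eball_powR x r0).
  by apply: le_measure; rewrite ?inE//; [apply: measurableI => //|]; exact: measurable_eball.
pose fF := fine (mu F).
have fFE : mu F = fF%:E by rewrite fineK// ge0_fin_numE.
have fF0 : 0 <= fF by exact: fine_ge0.
pose Cu := (c2 + fF) * 2 `^ d.
have Cu0 : 0 <= Cu by rewrite mulr_ge0 ?powR_ge0// addr_ge0// ltW.
have nu_up (x : E) (r : R) : 0 < r -> (nu (eball x r) <= (Cu * r `^ d)%:E)%E.
  move=> r0; rewrite nuE; have mb : measurable (eball x r `&` F) by apply: measurableI => //; exact: measurable_eball.
  have rd0 : 0 <= (2 * r) `^ d by exact: powR_ge0.
  have CuE : Cu * r `^ d = (c2 + fF) * (2 * r) `^ d by rewrite powRM ?(ltW r0)// mulrA.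
  have [[y [xy Fy]]|ne] := pselect ((eball x r `&` F) !=set0); last first.
    have -> : eball x r `&` F = set0 by apply/seteqP; split=> // y h; apply: ne; exists y.
    by rewrite measure0 lee_fin; apply: mulr_ge0 => //; exact: powR_ge0.
  rewrite CuE; have [r2|r2] := leP (2 * r) 1.
    apply: (@le_trans _ _ (mu (eball y (2 * r) `&` F))).
      apply: le_measure; rewrite ?inE//; first by apply: measurableI => //; exact: measurable_eball.
      move=> z [xz Fz]; split => //; move: xy xz; rewrite /eball/= => xy xz.
      have := enorm_triangle x z y; rewrite (enormB x y); lra.
    apply: le_trans (muB y (2 * r) Fy _ r2).2 _; first by rewrite mulr_gt0.
    by rewrite lee_fin ler_wpM2r// lerDl.
  apply: (@le_trans _ _ (mu F)); first by apply: le_measure; rewrite ?inE// => z [].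
  rewrite fFE lee_fin (@le_trans _ _ (fF * (2 * r) `^ d))//; last by rewrite ler_wpM2r// lerDr ltW.
  have h1 : 1 <= (2 * r) `^ d by have := ler_powR (ltW r2) (ltW d0); rewrite powRr0.
  by rewrite ler_peMr.
have F_ne : F !=set0.
  have [y ny] := nOm; have [z Fz _] := segment_boundary oOm Ox0 ny; by exists z.
have muF0 : 0 < fF.
  have [y Fy] := F_ne; have := (muB y 1 Fy ltr01 (lexx 1)).1.
  rewrite powR1 mulr1 => h; rewrite -lte_fin -fFE; apply: lt_le_trans (le_trans h _); first by rewrite lte_fin.
  by apply: le_measure; rewrite ?inE//; apply: measurableI => //; exact: measurable_eball.
pose D := dist_compl Om.
have mD : measurable_fun setT D by exact: measurable_dist_compl.
have Dgt0 := dist_compl_gt0 oOm nOm.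
have D0 : forall x, 0 <= D x by exact: dist_compl_ge0.
have la_int (f : E -> \bar R) : measurable_fun setT f -> (forall x, (0 <= f x)%E) ->
    (\int[la]_x f x = \int[leb]_(x in Om) f x)%E by exact: ge0_integral_mrestr.
have nu_int (f : E -> \bar R) : measurable_fun setT f -> (forall x, (0 <= f x)%E) ->
    (\int[nu]_x f x = \int[mu]_(x in F) f x)%E by exact: ge0_integral_mrestr.
have vol' (y : E) (r : R) : F y -> 0 < r -> r <= r1 -> ((c * r `^ N%:R)%:E <= la (eball y r))%E.
  by move=> Fy r0 rr; rewrite laE powR_mulrn ?(ltW r0)//; exact: vol.
(* If [d = N] then Tonelli bounds [c r^N nu(F)] by [Cu r^N la(D < r)], although
   the last factor tends to 0. *)
have dltN : d < N%:R.
  rewrite lt_neqAle dN andbT; apply/eqP => dNe.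
  have la_one : (\int[la]_x (\1_Om x)%:E < +oo)%E.
    by rewrite integral_indic//; change (leb ((Om `&` setT) `&` Om) < +oo)%E; rewrite setIT setIid.
  have mO : measurable_fun setT (\1_Om : E -> R) by exact: measurable_indic.
  have e0 : 0 < c * fF / (2 * (Cu + 1)).
    by rewrite divr_gt0 ?mulr_gt0// ltr_wpDl.
  have pos x : (\1_Om x : R) != 0 -> 0 < D x.
    by rewrite indicE; case: (pselect (Om x)) => [/Dgt0//|nx]; rewrite memNset// eqxx.
  have [eta eta0 small] := int_sublevel_small mO mD (fun x => ltac:(by rewrite indicE))
    la_one pos e0.
  pose r := Num.min eta r1; have r0 : 0 < r by rewrite lt_min eta0.
  have := small r r0 ltac:(by rewrite ge_min lexx); move=> {}small.
  pose a (y x : E) : \bar R := (((enorm (x - y) < r)%R%:R * ((D x < r)%R%:R * \1_Om x)))%:E.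
  have a0 y x : (0 <= a y x)%E by rewrite lee_fin !mulr_ge0// indicE.
  have ma : measurable_fun setT (fun q : E * E => a q.1 q.2).
    apply/measurable_EFinP; apply: measurable_funM; first by mfun.
    apply: measurable_funM; first by mfun.
    exact: (measurableT_comp mO measurable_snd).
  have lo : ((c * r `^ N%:R * fF)%:E <= \int[nu]_y \int[la]_x a y x)%E.
    apply: (@le_trans _ _ (\int[mu]_(y in F) (c * r `^ N%:R)%:E)%E).
      by rewrite integral_cst// fFE EFinM.
    rewrite nu_int; [|exact: measurable_int2|by move=> y; exact: int_ge0].
    apply: ge0_le_int => y Fy; first by rewrite lee_fin mulr_ge0 ?powR_ge0// ltW.
    apply: le_trans (vol' y r Fy r0 _) _; first by rewrite ge_min lexx orbT.
    rewrite -[X in la X](setIT (eball y r)) -integral_indic//; last exact: measurable_eball.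
    apply: (le_int_on mOm) => [|||x|x Ox].
    - by change (leb (~` Om `&` Om) = 0%E); rewrite setICl measure0.
    - by apply/measurable_EFinP; apply: measurable_indic; exact: measurable_eball.
    - by move=> x; rewrite lee_fin indicE.
    - exact: a0.
    - rewrite /a lee_fin !indicE (mem_set Ox) mulr1.
      have [yx|yx] := pselect (eball y r x); last by rewrite memNset// mulr_ge0.
      have xy : enorm (x - y) < r by [].
      by rewrite mem_set// xy (le_lt_trans (dist_compl_boundary_le oOm x Fy) xy) mulr1.
  have up : (\int[nu]_y \int[la]_x a y x <= (Cu * r `^ N%:R * (c * fF / (2 * (Cu + 1))))%:E)%E.
    apply: (@le_trans _ _ (\int[nu]_y \int[la]_x ((((enorm (x - y) < r)%R%:R))%:E * (((D x < r)%R%:R * \1_Om x))%:E))%E).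
      by apply: ge0_le_int => y _; [exact: int_ge0|apply: ge0_le_int => x _ //; rewrite -EFinM].
    apply: le_trans (@schur_le _ _ _ _ _ nu la _ _ (Cu * r `^ N%:R) _ _ _ _ _ _) _.
    - by mfun.
    - by apply/measurable_EFinP; apply: measurable_funM => //; mfun.
    - by move=> y x; rewrite lee_fin.
    - by move=> x; rewrite lee_fin mulr_ge0// indicE.
    - by rewrite mulr_ge0 ?powR_ge0.
    - move=> x; rewrite -dNe; apply: le_trans (nu_up x r r0).
      rewrite -[X in nu X](setIT (eball x r)) -integral_indic//; last exact: measurable_eball.
      apply: ge0_le_int => y _; rewrite lee_fin// indicE.
      have [xy|] := ltP (enorm (x - y)) r => //; rewrite mem_set//.
      by rewrite /eball/= enormB.
    rewrite [X in (_ <= X)%E]EFinM; apply: lee_wpmul2l => //.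
    by rewrite lee_fin mulr_ge0 ?powR_ge0.
  have := le_trans lo up; rewrite lee_fin.
  have rN : 0 < r `^ N%:R by rewrite powR_gt0.
  have cf : 0 < c * fF by rewrite mulr_gt0.
  have -> : Cu * r `^ N%:R * (c * fF / (2 * (Cu + 1))) = r `^ N%:R * ((c * fF) * (Cu / (2 * (Cu + 1)))).
    by ring.
  rewrite (_ : c * r `^ N%:R * fF = r `^ N%:R * (c * fF)) ?ler_pM2l//; last by ring.
  have k : Cu / (2 * (Cu + 1)) < 1 by rewrite ltr_pdivrMr; lra.
  by rewrite -[leLHS]mulr1 ler_pM2l// leNgt k.
pose M := 2 * B + 1.
have M0 : 0 < M by rewrite /M; lra.
have M1 : 1 <= M by rewrite /M; lra.
pose cl := c1 * M `^ (- d).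
have cl0 : 0 < cl by rewrite mulr_gt0// powR_gt0.
have loF (y : E) (r : R) : F y -> 0 < r -> r <= M -> ((cl * r `^ d)%:E <= nu (eball y r))%E.
  move=> Fy r0 rM; have q0 : 0 < r / M by rewrite divr_gt0.
  have q1 : r / M <= 1 by rewrite ler_pdivrMr// mul1r.
  apply: (@le_trans _ _ (mu (eball y (r / M) `&` F))).
    apply: le_trans (muB y _ Fy q0 q1).1; rewrite lee_fin /cl powRM ?(ltW r0) ?invr_ge0 ?(ltW M0)//.
    by rewrite -(powR_inv1 (ltW M0)) -powRrM mulN1r; lra.
  rewrite nuE; apply: le_measure; rewrite ?inE; [by apply: measurableI => //; exact: measurable_eball| |].
    by apply: measurableI => //; exact: measurable_eball.
  move=> z [yz Fz]; split=> //; apply: lt_le_trans yz _.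
  by rewrite ler_pdivrMr// ler_peMr// ltW.
have layer x (q : R) : Om x -> D x < q -> q <= M -> ((cl * q `^ d)%:E <= nu (eball x (2 * q)))%E.
  move=> Ox Dq qM; have [y Fy xy] := dist_compl_boundary oOm nOm Ox Dq.
  have q0 : 0 < q by exact: le_lt_trans (enorm_ge0 _) xy.
  apply: le_trans (loF y q Fy q0 qM) _; apply: le_measure; rewrite ?inE; [exact: measurable_eball|exact: measurable_eball|].
  move=> z; rewrite /eball/= => zy; have := enorm_triangle y z x; rewrite (enormB y x); lra.
exists la, nu, M, (cl * 2 `^ (- d)), Cu, c, r1, fF; split => //.
- by rewrite laE setICl measure0.
- by rewrite nuE setICl measure0.
- by split; split => //; rewrite mulr_gt0// powR_gt0.
- by rewrite nuE setTI fFE.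
- exact: dist_compl_lip.
- move=> x Dx; apply: contrapT => nx; have := dist_compl_le x nx.
  by rewrite subrr enorm0 leNgt Dx.
- by move=> y x Fy; exact: dist_compl_boundary_le.
- move=> x Ox; have [y Fy] := F_ne; apply: le_lt_trans (dist_compl_boundary_le oOm x Fy) _.
  have := enorm_triangle 0 x y; rewrite subr0 sub0r enormN; have := FB y Fy; have := OmB x Ox; rewrite /M; lra.
- move=> x z Ox Oz; have := enorm_triangle 0 x z; rewrite subr0 sub0r enormN.
  have := OmB z Oz; have := OmB x Ox; rewrite /M; lra.
- by move=> x Ox; have := OmB x Ox; rewrite /M; lra.
- move=> x Ox; have Dx := Dgt0 _ Ox.
  (* the nearest boundary point may lie at distance slightly more than [D x] *)
  have Dx32 : D x < 3 / 2 * D x by lra.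
  have [y Fy xy] := dist_compl_boundary oOm nOm Ox Dx32.
  have DM2 : D x / 2 <= M.
    have := dist_compl_boundary_le oOm x Fy; have := enorm_triangle 0 x y; rewrite subr0 sub0r enormN.
    have := FB y Fy; have := OmB x Ox; rewrite -/(D x) /M; lra.
  have D2 : 0 < D x / 2 by rewrite divr_gt0.
  apply: (@le_trans _ _ (nu (eball y (D x / 2)))).
    apply: le_trans (loF y _ Fy D2 DM2); rewrite lee_fin powRM ?(ltW Dx)//.
    by rewrite -(powR_inv1 (ler0n R 2)) -powRrM mulN1r; lra.
  apply: le_measure; rewrite ?inE; [exact: measurable_eball|exact: measurable_eball|].
  move=> z; rewrite /eball/= => zy; have := enorm_triangle y z x; rewrite (enormB y x) -/(D x); lra.
- move=> x q Ox Dq qM; apply: le_trans (layer x q Ox Dq qM).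
  have q0 : 0 < q by exact: le_lt_trans Dq.
  rewrite lee_fin ler_wpM2r ?powR_ge0// ler_piMr ?(ltW cl0)//.
  have dn : - d <= 0 by rewrite oppr_le0 ltW.
  by have := ler_powR (ler1n R 2) dn; rewrite powRr0.
- by move=> y Fy r r0 rr; exact: vol'.
Qed.

End regular_domains.

(** * The energy form and the Green functional *)

Section square_integrable.
Context d (T : measurableType d) (R : realType) (m : {measure set T -> \bar R}) (A : set T).
Hypothesis mA : measurable A.
Implicit Types (f g h : T -> R).

Definition sqint f : Prop := measurable_fun A f /\ (\int[m]_(x in A) (f x ^+ 2)%:E < +oo)%E.

Definition ip f g : R := \int[m]_(x in A) (f x * g x).

Lemma ip_integrable f g : sqint f -> sqint g -> m.-integrable A (EFin \o (fun x => f x * g x)).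
Proof. by move=> [mf f2] [mg g2]; exact: integrable_mul. Qed.

Lemma ipC f g : ip f g = ip g f.
Proof. by apply: eq_Rintegral => x _; rewrite mulrC. Qed.

Lemma ip_linr f g h (a : R) : sqint f -> sqint g -> sqint h ->
  ip f (fun x => a * g x + h x) = a * ip f g + ip f h.
Proof.
move=> sf sg sh; rewrite /ip -RintegralZl//; last exact: ip_integrable.
rewrite -RintegralD//; last 2 first.
- by have := integrableZl mA a (ip_integrable sf sg); apply: eq_integrable.
- exact: ip_integrable.
by apply: eq_Rintegral => x _; ring.
Qed.

Lemma ip_linl f g h (a : R) : sqint f -> sqint g -> sqint h ->
  ip (fun x => a * g x + h x) f = a * ip g f + ip h f.
Proof. by move=> sf sg sh; rewrite ipC ip_linr// !(ipC f). Qed.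

Lemma ip_sq_ge0 f : 0 <= ip f f.
Proof. by apply: Rintegral_ge0 => x _; rewrite -expr2 sqr_ge0. Qed.

Lemma ip_sqE f : sqint f -> (\int[m]_(x in A) (f x ^+ 2)%:E = (ip f f)%:E)%E.
Proof.
move=> [mf f2]; rewrite /ip /Rintegral fineK; last first.
  rewrite ge0_fin_numE; last by apply: integral_ge0 => x _; rewrite lee_fin -expr2 sqr_ge0.
  by under eq_integral do rewrite -expr2.
by apply: eq_integral => x _; rewrite expr2.
Qed.

Lemma ip_cauchy f g : sqint f -> sqint g -> ip f g ^+ 2 <= ip f f * ip g g.
Proof.
move=> [mf f2] [mg g2]; have := cauchy_int mA mf mg f2 g2.
have sq h : ip h h = \int[m]_(x in A) (h x ^+ 2) by apply: eq_Rintegral => x _; rewrite expr2.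
by rewrite !sq.
Qed.

Lemma sqint_lin f g (a : R) : sqint f -> sqint g -> sqint (fun x => a * f x + g x).
Proof.
move=> [mf f2] [mg g2]; split.
  by apply: measurable_funD => //; exact: measurable_funM.
apply: (@le_lt_trans _ _ (\int[m]_(x in A) ((2 * a ^+ 2)%:E * (f x ^+ 2)%:E + 2%:E * (g x ^+ 2)%:E))%E).
  apply: ge0_le_int => x _; first by rewrite lee_fin sqr_ge0.
  rewrite -!EFinM -EFinD lee_fin -mulrA -exprMn; apply: sqrD_le => //.
have m2 (F : T -> R) : measurable_fun A F -> measurable_fun A (fun x => (F x ^+ 2)%:E).
  by move=> ?; apply/measurable_EFinP; exact: measurable_funX.
have a0 : (0 <= (2 * a ^+ 2)%:E)%E by rewrite lee_fin mulr_ge0// sqr_ge0.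
have sq0 (F : T -> R) x : (0 <= (F x ^+ 2)%:E)%E by rewrite lee_fin sqr_ge0.
rewrite ge0_integralD//; last 4 first.
- by move=> x _; rewrite mule_ge0.
- by apply: emeasurable_funM; [exact: measurable_cst|exact: m2].
- by move=> x _; rewrite mule_ge0.
- by apply: emeasurable_funM; [exact: measurable_cst|exact: m2].
rewrite !ge0_integralZl//; [|exact: m2|exact: m2].
by rewrite lte_add_pinfty// lte_mul_pinfty.
Qed.

Lemma sqint0 : sqint (fun=> 0).
Proof.
split; first exact: measurable_cst.
by rewrite integral0_eq ?ltry// => x _; rewrite expr0n.
Qed.

Lemma ip_self_lin f g (a : R) : sqint f -> sqint g ->
  ip (fun x => a * f x + g x) (fun x => a * f x + g x) <= 2 * a ^+ 2 * ip f f + 2 * ip g g.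
Proof.
move=> sf sg; have sh := sqint_lin a sf sg.
rewrite ip_linr// !ip_linl// (ipC f g).
have nb : sqint (fun x => - a * f x + g x) by exact: sqint_lin.
have := ip_sq_ge0 (fun x => - a * f x + g x).
rewrite ip_linr// !ip_linl// (ipC f g); nra.
Qed.

End square_integrable.

Lemma int_tensor d1 d2 (T1 : measurableType d1) (T2 : measurableType d2) (R : realType)
    (m1 : {sigma_finite_measure set T1 -> \bar R}) (m2 : {sigma_finite_measure set T2 -> \bar R})
    (F : T1 -> \bar R) (G : T2 -> \bar R) :
  measurable_fun setT F -> (forall x, (0 <= F x)%E) ->
  measurable_fun setT G -> (forall y, (0 <= G y)%E) ->
  (\int[(m1 \x m2)%E]_q (F q.1 * G q.2) = \int[m1]_x F x * \int[m2]_y G y)%E.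
Proof.
move=> mF F0 mG G0; rewrite (fubini_tonelli1 (m1 := m1) (m2 := m2)); last 2 first.
- by apply: emeasurable_funM; [exact: (measurableT_comp mF measurable_fst)|exact: (measurableT_comp mG measurable_snd)].
- by move=> q; exact: mule_ge0.
rewrite /fubini_F (eq_integral (fun x => F x * \int[m2]_y G y)%E) => [|x _].
  by rewrite ge0_integralZr//; exact: integral_ge0.
by rewrite /= ge0_integralZl.
Qed.

Section forms.
Context (R : realType) (N : nat).
Local Notation E := 'rV[R]_N.
Local Notation leb := (lebesgue_rV R N).
Local Notation leb2 := (leb \x leb)%E.
Variables (Om : set E) (s : R).
Hypothesis mOm : measurable Om.
Local Notation p := (N%:R + 2 * s).
Local Notation A := (Om `*` Om).
Implicit Types (u v : E -> R) (k : E -> E -> R) (q : E * E).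

Let mA : measurable A. Proof. exact: measurableX. Qed.

Definition slope u q : R := (u q.1 - u q.2) * enorm (q.1 - q.2) `^ (- (p / 2)).

Lemma slope_sq u q : slope u q ^+ 2 = (u q.1 - u q.2) ^+ 2 / enorm (q.1 - q.2) `^ p.
Proof.
rewrite /slope -powRN [- p](_ : _ = - (p / 2) * 2%:R); last by field.
by rewrite powRrM powR_mulrn ?powR_ge0//; ring.
Qed.

Lemma slope_lin u v (a : R) : slope (fun x => a * u x + v x) = fun q => a * slope u q + slope v q.
Proof. by apply/funext => q; rewrite /slope; ring. Qed.

Lemma measurable_on_fst v : measurable_fun Om v -> measurable_fun A (fun q => v q.1).
Proof.
by move=> mv; apply: (measurable_comp mOm _ mv); [move=> _ [q [? _] <-]|exact: measurable_funTS measurable_fst].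
Qed.

Lemma measurable_on_snd v : measurable_fun Om v -> measurable_fun A (fun q => v q.2).
Proof.
by move=> mv; apply: (measurable_comp mOm _ mv); [move=> _ [q [_ ?] <-]|exact: measurable_funTS measurable_snd].
Qed.

Lemma measurable_slope u : measurable_fun Om u -> measurable_fun A (slope u).
Proof.
move=> mu; apply: measurable_funM.
  by apply: measurable_funB; [exact: measurable_on_fst|exact: measurable_on_snd].
by apply: measurable_funTS; mfun.
Qed.

Lemma Hs_normsqE u : Hs_normsq Om s u =
  (\int[leb]_(x in Om) (u x ^+ 2)%:E + \int[leb2]_(q in A) (slope u q ^+ 2)%:E)%E.
Proof. by congr (_ + _)%E; apply: eq_integral => q _; rewrite slope_sq. Qed.

Lemma HsP u : Hs Om s u <-> sqint leb Om u /\ sqint leb2 A (slope u).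
Proof.
have i1 : (0 <= \int[leb]_(x in Om) (u x ^+ 2)%:E)%E.
  by apply: integral_ge0 => x _; rewrite lee_fin sqr_ge0.
have i2 : (0 <= \int[leb2]_(q in A) (slope u q ^+ 2)%:E)%E.
  by apply: integral_ge0 => x _; rewrite lee_fin sqr_ge0.
rewrite /Hs/= Hs_normsqE; split=> [[mu h]|[[mu h1] [_ h2]]]; last first.
  by split=> //; exact: lte_add_pinfty.
split; split => //; [|exact: measurable_slope|].
- by apply: le_lt_trans h; rewrite leeDl.
- by apply: le_lt_trans h; rewrite leeDr.
Qed.

Lemma Hs_lin u v (a : R) : Hs Om s u -> Hs Om s v -> Hs Om s (fun x => a * u x + v x).
Proof.
move=> /HsP[u1 u2] /HsP[v1 v2]; apply/HsP; split; first exact: sqint_lin.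
by rewrite slope_lin; exact: sqint_lin.
Qed.

Lemma Hs0 : Hs Om s (fun=> 0).
Proof.
apply/HsP; split; first exact: sqint0.
have -> : slope (fun=> 0) = fun=> 0 by apply/funext => q; rewrite /slope subrr mul0r.
exact: sqint0.
Qed.

Definition Hs_sq v : R := ip leb Om v v + ip leb2 A (slope v) (slope v).

Lemma Hs_normsq_fin v : Hs Om s v -> Hs_normsq Om s v = (Hs_sq v)%:E.
Proof. by move=> /HsP[v1 v2]; rewrite Hs_normsqE EFinD !ip_sqE. Qed.

Section kernel.
Variables (k : E -> E -> R) (k1 k2 : R).
Hypothesis mk : measurable_fun A (fun q => k q.1 q.2).
Hypothesis k10 : 0 < k1.
Hypothesis kb : {ae leb2, forall q, Om q.1 -> Om q.2 -> k1 <= k q.1 q.2 <= k2}.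

Definition kslope u q : R := k q.1 q.2 * slope u q.

Lemma kslope_sq_le u : sqint leb2 A (slope u) ->
  (\int[leb2]_(q in A) (kslope u q ^+ 2)%:E <= (k2 ^+ 2)%:E * \int[leb2]_(q in A) (slope u q ^+ 2)%:E)%E.
Proof.
move=> [mu u2].
have m1 : measurable_fun A (fun q => (slope u q ^+ 2)%:E) by apply/measurable_EFinP; exact: measurable_funX.
rewrite -ge0_integralZl//; last 2 first.
- by move=> q _; rewrite lee_fin sqr_ge0.
- by rewrite lee_fin sqr_ge0.
apply: ae_ge0_le_integral => //.
- by move=> q _; rewrite lee_fin sqr_ge0.
- by apply/measurable_EFinP; apply: measurable_funX; exact: measurable_funM.
- by move=> q _; rewrite -EFinM lee_fin mulr_ge0// sqr_ge0.
- by apply: emeasurable_funM => //; exact: measurable_cst.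
apply: filterS kb => q h [q1 q2]; have /andP[h1 h2] := h q1 q2.
rewrite -EFinM lee_fin /kslope exprMn ler_wpM2r ?sqr_ge0//.
have kq0 : 0 <= k q.1 q.2 := le_trans (ltW k10) h1.
have k20 : 0 <= k2 := le_trans kq0 h2.
by rewrite lerXn2r ?nnegrE.
Qed.

Lemma sqint_kslope u : sqint leb2 A (slope u) -> sqint leb2 A (kslope u).
Proof.
move=> su; split; first by apply: measurable_funM => //; have [] := su.
apply: le_lt_trans (kslope_sq_le su) _; apply: lte_mul_pinfty; rewrite ?lee_fin ?sqr_ge0//.
by have [] := su.
Qed.

Lemma ip_kslope_le u : sqint leb2 A (slope u) ->
  ip leb2 A (kslope u) (kslope u) <= k2 ^+ 2 * ip leb2 A (slope u) (slope u).
Proof.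
by move=> su; have := kslope_sq_le su; rewrite !ip_sqE//; exact: sqint_kslope.
Qed.

Lemma energy_formE u v : energy_form Om s k u v = C_frac N s / 2 * ip leb2 A (kslope u) (slope v).
Proof.
congr (_ * _); apply: eq_Rintegral => q _; rewrite /kslope /slope.
rewrite -powRN [- p](_ : _ = - (p / 2) * 2%:R); last by field.
by rewrite powRrM powR_mulrn ?powR_ge0//; ring.
Qed.

Lemma energy_form_linr u v w (a : R) : Hs Om s u -> Hs Om s v -> Hs Om s w ->
  energy_form Om s k u (fun x => a * v x + w x) = a * energy_form Om s k u v + energy_form Om s k u w.
Proof.
move=> /HsP[_ u2] /HsP[_ v2] /HsP[_ w2].
rewrite !energy_formE slope_lin ip_linr//; [ring|exact: sqint_kslope].
Qed.

Lemma energy_form_linl u v w (a : R) : Hs Om s u -> Hs Om s v -> Hs Om s w ->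
  energy_form Om s k (fun x => a * v x + w x) u = a * energy_form Om s k v u + energy_form Om s k w u.
Proof.
move=> /HsP[_ u2] /HsP[_ v2] /HsP[_ w2]; rewrite !energy_formE.
have -> : kslope (fun x => a * v x + w x) = fun q => a * kslope v q + kslope w q.
  by apply/funext => q; rewrite /kslope slope_lin; ring.
rewrite ip_linl//; [ring|exact: sqint_kslope|exact: sqint_kslope].
Qed.

Definition green u g v : R := - ip leb Om g v + energy_form Om s k u v.

Lemma green_linr u g v w (a : R) : Hs Om s u -> sqint leb Om g -> Hs Om s v -> Hs Om s w ->
  green u g (fun x => a * v x + w x) = a * green u g v + green u g w.
Proof.
move=> hu sg hv hw; rewrite /green energy_form_linr// ip_linr//; first ring.
  by have [] := (HsP v).1 hv.
by have [] := (HsP w).1 hw.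
Qed.

Lemma green_sq_le u g v : Hs Om s u -> sqint leb Om g -> Hs Om s v ->
  green u g v ^+ 2 <= (2 + C_frac N s ^+ 2 / 2 * k2 ^+ 2) * (Hs_sq u + ip leb Om g g) * Hs_sq v.
Proof.
move=> /HsP[u1 u2] sg /HsP[v1 v2]; rewrite /green energy_formE /Hs_sq.
have h1 := ip_cauchy mOm sg v1.
have h2 := ip_cauchy mA (sqint_kslope u2) v2.
have h3 := ip_kslope_le u2.
have p1 := ip_sq_ge0 leb Om u; have p2 := ip_sq_ge0 leb2 A (slope u).
have p3 := ip_sq_ge0 leb Om v; have p4 := ip_sq_ge0 leb2 A (slope v).
have p5 := ip_sq_ge0 leb Om g; have p6 := sqr_ge0 (C_frac N s); have p7 := sqr_ge0 k2.
move: (ip leb Om u u) (ip leb2 A (slope u) (slope u)) (ip leb Om v v) (ip leb2 A (slope v) (slope v))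
  (ip leb Om g g) (ip leb Om g v) (ip leb2 A (kslope u) (slope v)) (ip leb2 A (kslope u) (kslope u))
  (C_frac N s) h1 h2 h3 p1 p2 p3 p4 p5 p6 p7 => a b c e g' x y z C h1 h2 h3 p1 p2 p3 p4 p5 p6 p7.
have hy : y ^+ 2 <= k2 ^+ 2 * b * e.
  by apply: le_trans h2 _; rewrite ler_wpM2r.
have h4 : (- x + C / 2 * y) ^+ 2 <= 2 * (g' * c) + 2 * ((C / 2) ^+ 2 * (k2 ^+ 2 * b * e)).
  by apply: sqrD_le; [rewrite sqrrN|rewrite exprMn ler_wpM2l// sqr_ge0].
apply: (le_trans h4).
have q1 : 0 <= a * c by exact: mulr_ge0.
have q2 : 0 <= a * e by exact: mulr_ge0.
have q3 : 0 <= b * c by exact: mulr_ge0.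
have q4 : 0 <= b * e by exact: mulr_ge0.
have q5 : 0 <= g' * c by exact: mulr_ge0.
have q6 : 0 <= g' * e by exact: mulr_ge0.
have C0 : 0 <= C ^+ 2 * k2 ^+ 2 by exact: mulr_ge0.
have r1 := mulr_ge0 C0 q1; have r2 := mulr_ge0 C0 q2; have r3 := mulr_ge0 C0 q3.
have r5 := mulr_ge0 C0 q5; have r6 := mulr_ge0 C0 q6.
rewrite (_ : (2 + C ^+ 2 / 2 * k2 ^+ 2) * (a + b + g') * (c + e) =
  2 * (a * c) + 2 * (a * e) + 2 * (b * c) + 2 * (b * e) + 2 * (g' * c) + 2 * (g' * e) +
  (C ^+ 2 * k2 ^+ 2 * (a * c) + C ^+ 2 * k2 ^+ 2 * (a * e) + C ^+ 2 * k2 ^+ 2 * (b * c) +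
   C ^+ 2 * k2 ^+ 2 * (b * e) + C ^+ 2 * k2 ^+ 2 * (g' * c) + C ^+ 2 * k2 ^+ 2 * (g' * e)) / 2); last by field.
rewrite (_ : 2 * ((C / 2) ^+ 2 * (k2 ^+ 2 * b * e)) = (C ^+ 2 * k2 ^+ 2 * (b * e)) / 2); last by field.
lra.
Qed.

(* The pairs at distance less than [eta] carry little energy of [u], while on
   the remaining pairs [slope z] is controlled by [z] in L2. *)
Lemma energy_form_weak u (G : R) : Hs Om s u -> (leb Om < +oo)%E -> 0 < p -> 0 <= G ->
  forall e : R, 0 < e -> exists2 tau : R, 0 < tau & forall z, Hs Om s z ->
    ip leb2 A (slope z) (slope z) <= G -> ip leb Om z z <= tau ->
    energy_form Om s k u z ^+ 2 <= e.
Proof.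
move=> /HsP[_ u2] Omoo p0 G0 e e0; have [ma a2] := sqint_kslope u2.
pose a := kslope u; pose c := (C_frac N s / 2) ^+ 2.
have c0 : 0 <= c by exact: sqr_ge0.
pose a0 : E * E -> R := (fun q => a q ^+ 2) \_ A.
have ma0 : measurable_fun setT a0.
  by apply/(measurable_restrictT _ mA); apply: measurable_funX.
have a0ge q : 0 <= a0 q by rewrite /a0 patchE; case: ifP => // _; exact: sqr_ge0.
have a0oo : (\int[leb2]_q (a0 q)%:E < +oo)%E.
  rewrite (eq_integral ((fun q => (a q ^+ 2)%:E) \_ A)) -?integral_mkcond// => q _.
  by rewrite /a0 !patchE; case: ifP.
have a0pos q : a0 q != 0 -> 0 < enorm (q.1 - q.2).
  apply: contraNT; rewrite -leNgt => h; have {}h : enorm (q.1 - q.2) = 0 by apply/le_anti; rewrite h enorm_ge0.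
  rewrite /a0 patchE; case: ifP => // _; rewrite /a /kslope /slope h powR0 ?mulr0 ?expr0n//.
  by rewrite oppr_eq0 mulf_neq0// ?gt_eqF ?invr_gt0.
have e1 : 0 < e / (4 * (c + 1) * (G + 1)).
  by rewrite divr_gt0// mulr_gt0 ?mulr_gt0// ltr_wpDl.
have md : measurable_fun setT (fun q : E * E => enorm (q.1 - q.2)) by mfun.
have [eta eta0 small] := int_sublevel_small ma0 md a0ge a0oo a0pos e1.
have {small} := small eta eta0 (lexx eta) => small.
pose l := fine (leb Om).
have lE : leb Om = l%:E by rewrite fineK// ge0_fin_numE.
have l0 : 0 <= l by exact: fine_ge0.
pose a2r := ip leb2 A a a; have a2r0 : 0 <= a2r by exact: ip_sq_ge0.
pose B := a2r * (4 * eta `^ (- p) * l).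
have B0 : 0 <= B by rewrite mulr_ge0// mulr_ge0// mulr_ge0 ?powR_ge0.
exists (e / (4 * (c + 1) * (B + 1))); first by rewrite divr_gt0// mulr_gt0 ?mulr_gt0// ltr_wpDl.
move=> z /HsP[z1 z2] zG zt.
pose near q : R := (enorm (q.1 - q.2) < eta)%R%:R.
pose far q : R := (eta <= enorm (q.1 - q.2))%R%:R.
have nf q : near q + far q = 1 by rewrite /near /far; case: ltP => _; rewrite ?addr0 ?add0r.
have mn : measurable_fun A near by apply: measurable_funTS; exact: measurable_ltR.
have mf : measurable_fun A far by apply: measurable_funTS; exact: measurable_leR.
have sqind (b : E * E -> R) (f : E * E -> R) : measurable_fun A b -> (forall q, 0 <= b q <= 1) ->
    sqint leb2 A f -> sqint leb2 A (fun q => b q * f q).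
  move=> mb b01 [mff f2]; split; first exact: measurable_funM.
  apply: le_lt_trans f2; apply: ge0_le_int => q _; first by rewrite lee_fin sqr_ge0.
  have /andP[b0 b1] := b01 q; rewrite lee_fin exprMn ler_piMl ?sqr_ge0//.
  by rewrite expr_le1.
have near01 q : 0 <= near q <= 1 by rewrite /near; case: (_ < _); rewrite ?lexx ?ler01.
have far01 q : 0 <= far q <= 1 by rewrite /far; case: (eta <= _); rewrite ?lexx ?ler01.
have sa : sqint leb2 A a by split.
have sna := sqind _ _ mn near01 sa; have sfz := sqind _ _ mf far01 z2.
have split_ip : ip leb2 A a (slope z) = ip leb2 A (fun q => near q * a q) (slope z) + ip leb2 A a (fun q => far q * slope z q).
  rewrite /ip -RintegralD//; [|exact: ip_integrable|exact: ip_integrable].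
  apply: eq_Rintegral => q _; rewrite -[LHS]mul1r -(nf q); ring.
have h1 : ip leb2 A (fun q => near q * a q) (fun q => near q * a q) <= e / (4 * (c + 1) * (G + 1)).
  rewrite -lee_fin -ip_sqE//; apply: le_trans small; rewrite integral_mkcond.
  apply: ge0_le_int => q _; first by rewrite patchE; case: ifP => // _; rewrite lee_fin sqr_ge0.
  rewrite /a0 !patchE; case: ifP => _; last by rewrite mulr0.
  rewrite lee_fin exprMn /near; case: (_ < _); rewrite ?expr1n ?expr0n//.
have h2 : ip leb2 A (fun q => far q * slope z q) (fun q => far q * slope z q) <= 4 * eta `^ (- p) * l * ip leb Om z z.
  rewrite -lee_fin -ip_sqE//.
  have mz := z1.1.
  have zz (f : E * E -> E) : measurable_fun A (fun q => z (f q)) -> measurable_fun A (fun q => (z (f q) ^+ 2)%:E).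
    by move=> ?; apply/measurable_EFinP; exact: measurable_funX.
  have m1 := zz _ (measurable_on_fst mz); have m2 := zz _ (measurable_on_snd mz).
  have eta2 : 0 <= 2 * eta `^ (- p) by rewrite mulr_ge0 ?powR_ge0.
  apply: (@le_trans _ _ (\int[leb2]_(q in A) ((2 * eta `^ (- p))%:E * ((z q.1 ^+ 2)%:E + (z q.2 ^+ 2)%:E)))%E).
    apply: ge0_le_int => q _; first by rewrite lee_fin sqr_ge0.
    rewrite -EFinD -EFinM lee_fin exprMn /far.
    have [eq|eq] := leP eta (enorm (q.1 - q.2)); last first.
      by rewrite expr0n mul0r mulr_ge0// addr_ge0 ?sqr_ge0.
    rewrite expr1n mul1r slope_sq -powRN.
    have hE : enorm (q.1 - q.2) `^ (- p) <= eta `^ (- p).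
      by rewrite !powRN lef_pV2 ?posrE ?powR_gt0//; [apply: powR_le => //; exact: ltW|exact: lt_le_trans eq].
    have hz : (z q.1 - z q.2) ^+ 2 <= 2 * (z q.1 ^+ 2 + z q.2 ^+ 2).
      by have := sqr_ge0 (z q.1 + z q.2); nra.
    rewrite (_ : 2 * eta `^ (- p) * (z q.1 ^+ 2 + z q.2 ^+ 2) = 2 * (z q.1 ^+ 2 + z q.2 ^+ 2) * eta `^ (- p)); last by ring.
    by apply: ler_pM => //; [exact: sqr_ge0|exact: powR_ge0].
  have intsq (f : E * E -> \bar R) : (forall q, A q -> f q = (z q.1 ^+ 2)%:E) \/ (forall q, A q -> f q = (z q.2 ^+ 2)%:E) ->
      (\int[leb2]_(q in A) f q = l%:E * (ip leb Om z z)%:E)%E.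
    have z0e : (fun x => (z x ^+ 2)%:E) \_ Om = (fun x => (\1_Om x)%:E * ((fun x => (z x ^+ 2)%:E) \_ Om x))%E.
      by apply/funext => x; rewrite !patchE indicE; case: ifP => _; rewrite ?mul1e ?mul0e.
    have mz0 : measurable_fun setT ((fun x => (z x ^+ 2)%:E) \_ Om).
      by apply/(measurable_restrictT _ mOm); apply/measurable_EFinP; exact: measurable_funX.
    have z00 x : (0 <= ((fun x => (z x ^+ 2)%:E) \_ Om) x)%E.
      by rewrite patchE; case: ifP => // _; rewrite lee_fin sqr_ge0.
    have mi : measurable_fun setT (fun x : E => (\1_Om x : R)%:E) by apply/measurable_EFinP; exact: measurable_indic.
    have i0 (x : E) : (0 <= (\1_Om x : R)%:E)%E by rewrite lee_fin indicE.
    have izz : (\int[leb]_x ((fun x => (z x ^+ 2)%:E) \_ Om) x = (ip leb Om z z)%:E)%E.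
      by rewrite -integral_mkcond ip_sqE.
    have iOm : (\int[leb]_x (\1_Om x : R)%:E = l%:E)%E by rewrite integral_indic// setIT; exact: lE.
    rewrite integral_mkcond => -[fE|fE].
    - rewrite (eq_integral (fun q : E * E => ((fun x => (z x ^+ 2)%:E) \_ Om) q.1 * (\1_Om q.2 : R)%:E)%E); last first.
        move=> q _; rewrite !patchE indicE in_setX; case: (boolP (q.1 \in Om)) => q1; case: (boolP (q.2 \in Om)) => q2; rewrite ?mule1 ?mule0 ?mul0e//=.
        by rewrite fE//; split; exact: set_mem.
      by rewrite (int_tensor leb leb mz0 z00 mi i0) izz iOm muleC.
    - rewrite (eq_integral (fun q : E * E => (\1_Om q.1 : R)%:E * ((fun x => (z x ^+ 2)%:E) \_ Om) q.2)%E); last first.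
        move=> q _; rewrite !patchE indicE in_setX; case: (boolP (q.1 \in Om)) => q1; case: (boolP (q.2 \in Om)) => q2; rewrite ?mul1e ?mule0 ?mul0e//=.
        by rewrite fE//; split; exact: set_mem.
      by rewrite (int_tensor leb leb mi i0 mz0 z00) izz iOm.
  rewrite ge0_integralZl//; last 2 first.
  - exact: emeasurable_funD.
  - by move=> q _; rewrite adde_ge0// lee_fin sqr_ge0.
  rewrite ge0_integralD//; [|by move=> q _; rewrite lee_fin sqr_ge0|by move=> q _; rewrite lee_fin sqr_ge0].
  rewrite (intsq (fun q => (z q.1 ^+ 2)%:E)); last by left.
  rewrite (intsq (fun q => (z q.2 ^+ 2)%:E)); last by right.
  move: (ip leb Om z z) => ww.
  rewrite -[(l%:E * ww%:E)%E]EFinM -EFinD -EFinM lee_fin le_eqVlt; apply/orP; left; apply/eqP; ring.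
have c1 := ip_cauchy mA sna z2; have c2 := ip_cauchy mA sa sfz.
have zz0 := ip_sq_ge0 leb Om z; have sz0 := ip_sq_ge0 leb2 A (slope z).
have nn0 := ip_sq_ge0 leb2 A (fun q => near q * a q).
rewrite energy_formE -/a exprMn -/c split_ip.
have b1 : ip leb2 A (fun q => near q * a q) (slope z) ^+ 2 <= e / (4 * (c + 1) * (G + 1)) * G.
  by apply: le_trans c1 _; apply: ler_pM.
have b2 : ip leb2 A a (fun q => far q * slope z q) ^+ 2 <= B * (e / (4 * (c + 1) * (B + 1))).
  apply: le_trans c2 _; rewrite /B -mulrA ler_wpM2l//; apply: le_trans h2 _.
  by rewrite ler_wpM2l// mulr_ge0// mulr_ge0 ?powR_ge0.
apply: (@le_trans _ _ (c * (2 * (e / (4 * (c + 1) * (G + 1)) * G) + 2 * (B * (e / (4 * (c + 1) * (B + 1))))))).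
  by rewrite ler_wpM2l//; exact: sqrD_le.
have frac (x : R) : 0 <= x -> x / (x + 1) <= 1.
  by move=> x0; rewrite ler_pdivrMr ?ltr_wpDl// mul1r lerDl ler01.
have G1 := frac _ G0.
have B1 := frac _ B0.
have C1 := frac _ c0.
have C0 : 0 <= c / (c + 1) by rewrite divr_ge0// ltW// ltr_wpDl.
have G2 : 0 <= G / (G + 1) by rewrite divr_ge0// ltW// ltr_wpDl.
have B2 : 0 <= B / (B + 1) by rewrite divr_ge0// ltW// ltr_wpDl.
rewrite (_ : c * _ = c / (c + 1) * ((G / (G + 1) + B / (B + 1)) / 2) * e); last first.
  by field; rewrite !gt_eqF ?ltr_wpDl.
rewrite ler_piMl ?(ltW e0)//.
rewrite (@le_trans _ _ (c / (c + 1) * 1))//; last by rewrite mulr1.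
by rewrite ler_wpM2l//; lra.
Qed.

End kernel.
End forms.

Section regular_domain_theory.
Context (R : realType) (N : nat).
Local Notation E := 'rV[R]_N.
Local Notation leb := (lebesgue_rV R N).
Local Notation leb2 := (leb \x leb)%E.
Variables (Om F : set E) (mu : {measure set E -> \bar R}) (d : R) (D : E -> R).
Variables (la nu : {sigma_finite_measure set E -> \bar R}) (M cl Cu c r0 Cnu : R).
Hypothesis RD : regular_domain Om F mu d D la nu M cl Cu c r0 Cnu.
Variables (s : R).
Hypotheses (s0 : 0 < s) (s1 : s < 1).
Local Notation p := (N%:R + 2 * s).
Local Notation A := (Om `*` Om).
Implicit Types (u v w f g : E -> R).

Let mOm : measurable Om. Proof. exact: rd_mOm RD. Qed.
Let mA : measurable A. Proof. exact: measurableX. Qed.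
Let p0 : 0 < p. Proof. by rewrite ltr_wpDl// mulr_gt0. Qed.

Lemma rd_la_le (f : E -> \bar R) : measurable_fun setT f -> (forall x, (0 <= f x)%E) ->
  (\int[la]_x f x <= \int[leb]_x f x)%E.
Proof.
by move=> mf f0; rewrite (rd_la_int RD)//; apply: ge0_subset_integral.
Qed.

Lemma rd_leb_le (f : E -> \bar R) : measurable_fun setT f -> (forall x, (0 <= f x)%E) ->
  (forall x, ~ Om x -> f x = 0%E) -> (\int[leb]_x f x <= \int[la]_x f x)%E.
Proof.
move=> mf f0 fOm; rewrite (rd_la_int RD)// [X in (_ <= X)%E]integral_mkcond.
apply: ge0_le_int => x _ //; rewrite patchE; case: ifPn => // /negP xO.
by rewrite fOm// => Ox; apply: xO; exact: mem_set.
Qed.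

Lemma rd_Omoo : (leb Om < +oo)%E.
Proof.
have [[_ _ M0] _] := rd_cst RD.
apply: (@le_lt_trans _ _ (leb (eball 0 M))); last first.
  by apply: le_lt_trans (leb_eball_le 0 (ltW M0)) _; rewrite ltry.
apply: le_measure; rewrite ?inE//; first exact: measurable_eball.
by move=> x Ox; rewrite /eball/= subr0; exact: (rd_OmB RD).
Qed.

Lemma int_sq_la v u : measurable_fun setT u -> (forall x, Om x -> u x = v x) ->
  (\int[leb]_(x in Om) (v x ^+ 2)%:E = \int[la]_x (u x ^+ 2)%:E)%E.
Proof.
move=> mu_ uv; rewrite (rd_la_int RD).
- by apply: eq_integral => x /set_mem Ox; rewrite uv.
- by apply/measurable_EFinP; exact: measurable_funX.
- by move=> x; rewrite lee_fin sqr_ge0.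
Qed.

Lemma int_slope_sq_la v u : measurable_fun setT u -> (forall x, Om x -> u x = v x) ->
  (\int[leb2]_(q in A) (slope s v q ^+ 2)%:E = power_energy la u p)%E.
Proof.
move=> mu_ uv; pose g (x y : E) : \bar R := ((u x - u y) ^+ 2 * enorm (x - y) `^ (- p))%:E.
have g0 x y : (0 <= g x y)%E by rewrite lee_fin mulr_ge0 ?sqr_ge0 ?powR_ge0.
have mg : measurable_fun setT (fun q : E * E => g q.1 q.2) by rewrite /g; mfun.
rewrite /power_energy -/g integral_mkcond.
have mG : measurable_fun setT ((fun q : E * E => g q.1 q.2) \_ A).
  by apply/(measurable_restrictT _ mA); exact: measurable_funTS.
rewrite (eq_integral ((fun q : E * E => g q.1 q.2) \_ A)); last first.
  move=> q _; rewrite !patchE; case: ifPn => // /set_mem[q1 q2].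
  by rewrite /g !uv// slope_sq -powRN.
rewrite (fubini_tonelli1 (m1 := leb) (m2 := leb))//; last first.
  by move=> q; rewrite patchE; case: ifP.
rewrite (rd_la_int RD); [|exact: (measurable_int2 la mg g0)|by move=> x; apply: int_ge0 => y; exact: g0].
rewrite [RHS]integral_mkcond; apply: eq_integral => x _; rewrite /fubini_F patchE.
case: ifPn => xO.
  have -> : (\int[la]_y ((u x - u y) ^+ 2 * enorm (x - y) `^ (- p))%:E = \int[leb]_(y in Om) g x y)%E.
    by apply: (rd_la_int RD (f := g x)) => [|y]; [exact: (measurableT_comp mg (pair1_measurable x))|exact: g0].
  rewrite [RHS]integral_mkcond; apply: eq_integral => y _.
  by rewrite !patchE in_setX xO.
by rewrite integral0_eq// => y _; rewrite patchE in_setX (negbTE xO).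
Qed.

Definition cut v : E -> R := v \_ Om.

Lemma cutE v x : Om x -> cut v x = v x.
Proof. by move=> Ox; rewrite /cut patchE mem_set. Qed.

Lemma cut0 v x : ~ Om x -> cut v x = 0.
Proof. by move=> Ox; rewrite /cut patchE memNset. Qed.

Lemma measurable_cut v : measurable_fun Om v -> measurable_fun setT (cut v).
Proof. by move=> mv; apply/(measurable_restrictT _ mOm). Qed.

Lemma Hs_la v u : measurable_fun setT u -> (forall x, Om x -> u x = v x) ->
  (\int[la]_x (u x ^+ 2)%:E < +oo)%E -> (power_energy la u p < +oo)%E -> Hs Om s v.
Proof.
move=> mu_ uv u2 uE; have mv : measurable_fun Om v.
  apply: (eq_measurable_fun u); last exact: measurable_funTS.
  by move=> x /set_mem Ox; exact: uv.
apply/(HsP s mOm); split; split => //; [by rewrite (int_sq_la mu_ uv)|exact: measurable_slope|].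
by rewrite (int_slope_sq_la mu_ uv).
Qed.

Lemma Hs_cut v : Hs Om s v -> [/\ measurable_fun setT (cut v),
  (\int[la]_x (cut v x ^+ 2)%:E < +oo)%E & (power_energy la (cut v) p < +oo)%E].
Proof.
move=> /(HsP s mOm)[[mv v2] [_ vE]]; have mc := measurable_cut mv.
by split; rewrite // -?(int_sq_la mc (@cutE v)) -?(int_slope_sq_la mc (@cutE v)).
Qed.

Lemma smooth_approx v : Hs Om s v -> exists2 C : R, 0 <= C & forall h vv, 0 < h -> 0 <= vv ->
  (\int[la]_x (shallow D (cut v) ((2 * N%:R + 2) * h) x)%:E <= vv%:E)%E ->
  exists phi, [/\ test_function Om phi, Hs Om s phi,
    ip leb Om (fun x => phi x - v x) (fun x => phi x - v x) <= C * (h `^ (p - N%:R) + vv) &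
    ip leb2 A (slope s phi) (slope s phi) <= C * (1 + h `^ (N%:R - p) * vv)].
Proof.
move=> hv; have [mc c2 cE] := Hs_cut hv.
have [L L0 exk] := smoothing_kernel_exists R N.
pose pe := fine (power_energy la (cut v) p).
have peE : power_energy la (cut v) p = pe%:E by rewrite fineK// ge0_fin_numE// power_energy_ge0.
have peE' : (power_energy la (cut v) p <= pe%:E)%E by rewrite peE.
have pe0 : 0 <= pe by apply: fine_ge0; exact: power_energy_ge0.
pose c1 : R := 2 * N%:R + 2; pose kN := 2 ^+ N * c1 `^ N%:R.
pose cs := layer_const N%:R (p - 2) * 2 ^+ N; pose cf := 2 `^ `|N%:R - p| * layer_const N%:R p * 2 ^+ N.
have Np : N%:R < p by rewrite ltrDl mulr_gt0.
have pN : p - 2 < N%:R by have := s1; lra.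
have kN0 : 0 <= kN by rewrite mulr_ge0 ?powR_ge0// exprn_ge0.
have cs0 : 0 <= cs by rewrite mulr_ge0 ?exprn_ge0// layer_const_ge0// gt_eqF.
have cf0 : 0 <= cf by rewrite mulr_ge0 ?exprn_ge0// mulr_ge0 ?powR_ge0// layer_const_ge0// lt_eqF.
pose a1 := kN * c1 `^ p * pe; pose a2 := 2 * kN ^+ 2.
have a10 : 0 <= a1 by rewrite mulr_ge0// mulr_ge0 ?powR_ge0.
have a20 : 0 <= a2 by rewrite mulr_ge0// sqr_ge0.
pose b1 := L ^+ 2 * cs * a1 + 3 * pe + 12 * cf * a1.
pose b2 := L ^+ 2 * cs * a2 + 6 * cf * (2 * a2 + 2).
have L20 : 0 <= L ^+ 2 * cs by rewrite mulr_ge0// sqr_ge0.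
have q1 := mulr_ge0 L20 a10; have q2 := mulr_ge0 cf0 a10; have q3 := mulr_ge0 L20 a20; have q4 := mulr_ge0 cf0 a20.
have b10 : 0 <= b1 by rewrite /b1; lra.
have b20 : 0 <= b2 by rewrite /b2; lra.
pose C := 2 * a1 + (2 * a2 + 2) + b1 + b2.
exists C => [|h vv h0 vv0 Vle]; first by rewrite /C; lra.
have [[_ _ M0] _] := rd_cst RD.
have [k kP] := exk h M h0 M0.
pose phi := smoothed D (cut v) k ((2 * N%:R + 2) * h).
have sphi : smooth phi := smoothed_smooth rd_leb_le (rd_mD RD) mc (@cut0 v) c2 kP.
have mphi : measurable_fun setT phi by apply: continuous_measurable_rV; exact: smooth_continuous.
have e2 := @smoothed_L2 R N la Om D (cut v) M p L pe vv h k mOm (rd_la0 RD) rd_la_le rd_leb_le (rd_mD RD)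
  (rd_Dlip RD) (rd_OmD RD) (rd_OmB RD) mc (@cut0 v) c2 Np h0 kP peE' Vle.
have eE := @smoothed_energy R N la Om D (cut v) M p L pe vv h k mOm (rd_la0 RD) rd_la_le rd_leb_le (rd_mD RD)
  (rd_Dlip RD) (rd_OmD RD) (rd_OmB RD) mc (@cut0 v) c2 Np pN L0 h0 kP peE' Vle.
rewrite -/phi in e2 eE.
have hp0 : 0 <= h `^ (p - N%:R) by exact: powR_ge0.
have hn0 : 0 <= h `^ (N%:R - p) by exact: powR_ge0.
have hh : h `^ (N%:R - p) * h `^ (p - N%:R) = 1.
  by rewrite -(powRDp _ _ h0) addrA subrK subrr powRr0.
have mdiff : measurable_fun setT (fun x => phi x - cut v x) by exact: measurable_funB.
have dE x : Om x -> phi x - cut v x = phi x - v x by move=> Ox; rewrite cutE.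
have sdiff : sqint leb Om (fun x => phi x - v x).
  split.
    apply: (eq_measurable_fun (fun x => phi x - cut v x)); last exact: measurable_funTS.
    by move=> x /set_mem; exact: dE.
  by rewrite (int_sq_la mdiff dE); apply: le_lt_trans e2 _; rewrite ltry.
have hphi : Hs Om s phi.
  have [sv _] := (HsP s mOm v).1 hv.
  apply: (Hs_la mphi (fun x _ => erefl)); last by apply: le_lt_trans eE _; rewrite ltry.
  rewrite -(int_sq_la mphi (fun x _ => erefl)).
  have [_] := sqint_lin mOm 1 sdiff sv; congr (_ < _)%E.
  by apply: eq_integral => x _; rewrite mul1r subrK.
have supp : closure [set x | phi x != 0] `<=` Om.
  have cD : closed [set x | h <= D x].
    rewrite -[X in closed X]setCK; apply: open_closedC; rewrite openE => x /negP; rewrite -ltNge => Dx.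
    have hx : 0 < h - D x by rewrite subr_gt0.
    have sub : eball x (h - D x) `<=` ~` [set x0 | h <= D x0].
      move=> y; rewrite /eball/= => yx; apply/negP; rewrite -ltNge; have := rd_Dlip RD y x; lra.
    by apply: (proj2 (nbhs_eball x _)); exists (h - D x).
  have sD : [set x | phi x != 0] `<=` [set x | h <= D x].
    move=> x /= /(smoothed_neq0 kP)[y Dy xy]; have := rd_Dlip RD y x; rewrite (enormB y x); lra.
  have cE' := (closure_id [set x | h <= D x]).1 cD.
  move=> x /(closure_subset sD); rewrite -cE' /= => hx.
  by apply: (rd_OmD RD); exact: lt_le_trans hx.
exists phi; split => //.
- split=> //.
    apply: bounded_closed_compact; last exact: closed_closure.
    exists M; split; first exact: num_real.
    move=> q Mq x /supp /(rd_OmB RD) xM; apply: le_trans (norm_le_enorm x) _.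
    exact: ltW (lt_trans xM Mq).
- rewrite -lee_fin -ip_sqE// (int_sq_la mdiff dE); apply: (le_trans e2).
  rewrite lee_fin -/c1 -/kN.
  rewrite (_ : 2 * (_ + _) + 2 * vv = 2 * a1 * h `^ (p - N%:R) + (2 * a2 + 2) * vv); last by rewrite /a1 /a2; ring.
  by rewrite mulrDr; apply: lerD; rewrite ler_wpM2r// /C; lra.
- have [_ sl] := (HsP s mOm phi).1 hphi.
  rewrite -lee_fin -ip_sqE// (int_slope_sq_la mphi (fun x _ => erefl)); apply: (le_trans eE).
  rewrite lee_fin /smoothed_energy_const -/c1 -/kN -/cs -/cf.
  rewrite (_ : _ + (_ + _) = b1 * (h `^ (N%:R - p) * h `^ (p - N%:R)) + 3 * pe * (1 - h `^ (N%:R - p) * h `^ (p - N%:R)) + b2 * (h `^ (N%:R - p) * vv)); last first.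
    by rewrite /b1 /b2 /a1 /a2; ring.
  rewrite hh subrr mulr0 addr0 mulrDr; apply: lerD; rewrite ?ler_wpM2r ?mulr_ge0// /C; lra.
Qed.

Lemma test_dense v : Hs Om s v -> forall tau : R, 0 < tau -> exists phi,
  [/\ test_function Om phi, Hs Om s phi & ip leb Om (fun x => phi x - v x) (fun x => phi x - v x) <= tau].
Proof.
move=> hv tau tau0; have [mc c2 cE] := Hs_cut hv.
have [C C0 appr] := smooth_approx hv.
have mc2 : measurable_fun setT (fun x => cut v x ^+ 2) by exact: measurable_funX.
have pos x : cut v x ^+ 2 != 0 -> 0 < D x.
  apply: contraNT => Dx; rewrite cut0 ?expr0n// => /(rd_DOm RD) Dx'.
  by rewrite Dx' in Dx.
have e0 : 0 < tau / (2 * (C + 1)) by rewrite divr_gt0// mulr_gt0// ltr_wpDl.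
have [eta eta0 small] := int_sublevel_small mc2 (rd_mD RD) (fun x => sqr_ge0 _) c2 pos e0.
have c10 : 0 < 2 * (2 * N%:R + 2) :> R by rewrite mulr_gt0// ltr_wpDl// mulr_ge0.
have [h [h0 hle hs]] := @powR_small R 1 (p - N%:R) _ (eta / (2 * (2 * N%:R + 2))) ler01
  ltac:(by rewrite addrAC subrr add0r mulr_gt0) e0 (divr_gt0 eta0 c10).
have q0 : 0 < 2 * ((2 * N%:R + 2) * h) by rewrite mulrA mulr_gt0.
have qle : 2 * ((2 * N%:R + 2) * h) <= eta by rewrite mulrA mulrC -ler_pdivlMr.
have [phi [t1 t2 t3 _]] := appr h _ h0 (ltW e0) (small _ q0 qle).
exists phi; split => //; apply: (le_trans t3); rewrite mul1r in hs.
apply: (@le_trans _ _ (C * (2 * (tau / (2 * (C + 1)))))).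
  by rewrite ler_wpM2l//; have := hs; lra.
rewrite (_ : C * _ = C / (C + 1) * tau); last by field; rewrite gt_eqF// ltr_wpDl.
by rewrite ler_piMl ?(ltW tau0)// ler_pdivrMr ?ltr_wpDl// mul1r lerDl.
Qed.

Lemma orthogonal_tests_Hs g : sqint leb Om g ->
  (forall phi, test_function Om phi -> sqint leb Om phi -> ip leb Om g phi = 0) ->
  forall v, Hs Om s v -> ip leb Om g v = 0.
Proof.
move=> sg ort v hv; have [sv _] := (HsP s mOm v).1 hv.
have le0 : forall e : R, 0 < e -> ip leb Om g v ^+ 2 <= e.
  move=> e e0; have g0 := ip_sq_ge0 leb Om g.
  have t0 : 0 < e / (ip leb Om g g + 1) by rewrite divr_gt0// ltr_wpDl.
  have [phi [tp hp small]] := test_dense hv t0.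
  have [sp _] := (HsP s mOm phi).1 hp.
  have zE : (fun x => phi x - v x) = (fun x => -1 * v x + phi x) by apply/funext => x; rewrite mulN1r addrC.
  rewrite zE in small; have sz : sqint leb Om (fun x => -1 * v x + phi x) by exact: sqint_lin.
  have E : ip leb Om g (fun x => -1 * v x + phi x) = - ip leb Om g v.
    by rewrite ip_linr// (ort _ tp sp) addr0 mulN1r.
  have := ip_cauchy mOm sg sz; rewrite E sqrrN => /le_trans; apply.
  apply: (le_trans (ler_wpM2l g0 small)).
  rewrite mulrCA ler_piMr ?(ltW e0)// ler_pdivrMr ?ltr_wpDl// mul1r lerDl//.
apply/eqP; rewrite -sqrf_eq0 eq_le sqr_ge0 andbT leNgt; apply/negP => h.
by have := le0 _ (divr_gt0 h (ltr0Sn R 1)); rewrite leNgt ltr_pdivrMr// ltr_pMr// ltr1n.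
Qed.

Section kernel.
Variables (k : E -> E -> R) (k1 k2 : R).
Hypothesis mk : measurable_fun A (fun q => k q.1 q.2).
Hypothesis k10 : 0 < k1.
Hypothesis kb : {ae leb2, forall q, Om q.1 -> Om q.2 -> k1 <= k q.1 q.2 <= k2}.

(* A function that vanishes at the boundary at the rate [h^(2s)] in L2 is
   approximated by test functions in L2, with bounded energy. *)
Lemma green_vanish u g v (C h1 : R) : Hs Om s u -> sqint leb Om g ->
  (forall phi, test_function Om phi -> energy_form Om s k u phi = ip leb Om g phi) ->
  Hs Om s v -> 0 <= C -> 0 < h1 ->
  (forall h, 0 < h -> h <= h1 ->
    (\int[la]_x (shallow D (cut v) ((2 * N%:R + 2) * h) x)%:E <= (C * h `^ (p - N%:R))%:E)%E) ->
  green Om s k u g v = 0.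
Proof.
move=> hu sg weak hv C0 h10 layer.
have [sv slv] := (HsP s mOm v).1 hv.
have [B B0 appr] := smooth_approx hv.
pose G := 2 * (B * (1 + C)) + 2 * ip leb2 A (slope s v) (slope s v).
have v0 := ip_sq_ge0 leb2 A (slope s v).
have G0 : 0 <= G by rewrite addr_ge0// mulr_ge0// mulr_ge0// addr_ge0.
have le0 : forall e : R, 0 < e -> green Om s k u g v ^+ 2 <= e.
  move=> e e0; have e4 : 0 < e / 4 by rewrite divr_gt0.
  have [tau tau0 weakz] := energy_form_weak mOm mk k10 kb hu rd_Omoo p0 G0 e4.
  have g0 := ip_sq_ge0 leb Om g.
  pose t := Num.min tau (e / 4 / (ip leb Om g g + 1)).
  have t0 : 0 < t by rewrite lt_min tau0 divr_gt0// ltr_wpDl.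
  have BC : 0 <= B * (1 + C) by rewrite mulr_ge0// addr_ge0.
  have [h [h0 hle hs]] := @powR_small R (B * (1 + C)) (p - N%:R) _ h1 BC
    ltac:(by rewrite addrAC subrr add0r mulr_gt0) t0 h10.
  have vv0 : 0 <= C * h `^ (p - N%:R) by rewrite mulr_ge0 ?powR_ge0.
  have [phi [tp hp small en]] := appr h _ h0 vv0 (layer h h0 hle).
  have [sp slp] := (HsP s mOm phi).1 hp.
  have hh : h `^ (N%:R - p) * h `^ (p - N%:R) = 1.
    by rewrite -(powRDp _ _ h0) addrA subrK subrr powRr0.
  rewrite mulrCA hh mulr1 in en.
  pose z x := -1 * v x + phi x.
  have zE : (fun x => phi x - v x) = z by apply/funext => x; rewrite /z mulN1r addrC.
  have hz : Hs Om s z by exact: Hs_lin.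
  have [sz slz] := (HsP s mOm z).1 hz.
  rewrite zE in small.
  have zt : ip leb Om z z <= t.
    by apply: (le_trans small); apply: ltW; move: hs; rewrite -mulrA mulrDl mul1r.
  have zG : ip leb2 A (slope s z) (slope s z) <= G.
    rewrite /z slope_lin; apply: le_trans (ip_self_lin mA (-1) slv slp) _.
    by rewrite /G sqrrN expr1n mulr1 addrC lerD2r ler_wpM2l.
  have gphi : green Om s k u g phi = 0 by rewrite /green weak// addNr.
  have E : green Om s k u g z = - green Om s k u g v.
    by rewrite (green_linr mOm mk k10 kb)// gphi addr0 mulN1r.
  rewrite -sqrrN -E /green.
  have b1 : (- ip leb Om g z) ^+ 2 <= e / 4.
    rewrite sqrrN; apply: le_trans (ip_cauchy mOm sg sz) _.
    apply: (@le_trans _ _ (ip leb Om g g * (e / 4 / (ip leb Om g g + 1)))).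
      by rewrite ler_wpM2l//; apply: (le_trans zt); rewrite /t ge_min lexx orbT.
    rewrite mulrCA ler_piMr ?(ltW e4)// ler_pdivrMr ?ltr_wpDl// mul1r lerDl//.
  have b2 : energy_form Om s k u z ^+ 2 <= e / 4.
    by apply: weakz => //; apply: (le_trans zt); rewrite /t ge_min lexx.
  by apply: le_trans (sqrD_le b1 b2) _; lra.
apply/eqP; rewrite -sqrf_eq0 eq_le sqr_ge0 andbT leNgt; apply/negP => h.
by have := le0 _ (divr_gt0 h (ltr0Sn R 1)); rewrite leNgt ltr_pdivrMr// ltr_pMr// ltr1n.
Qed.

End kernel.

End regular_domain_theory.

Section traces.
Context (R : realType) (N : nat).
Local Notation E := 'rV[R]_N.
Local Notation leb := (lebesgue_rV R N).
Local Notation leb2 := (leb \x leb)%E.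
Variables (Om F : set E) (mu : {measure set E -> \bar R}) (d : R) (D : E -> R).
Variables (la nu : {sigma_finite_measure set E -> \bar R}) (M cl Cu c r0 Cnu : R).
Hypothesis RD : regular_domain Om F mu d D la nu M cl Cu c r0 Cnu.
Variables (s : R).
Hypotheses (s_gt : (N%:R - d) / 2 < s) (s1 : s < 1).
Local Notation al := (s - (N%:R - d) / 2).
Local Notation p := (N%:R + 2 * s).
Local Notation A := (Om `*` Om).
Implicit Types (u v w f g : E -> R).

Let mOm : measurable Om. Proof. exact: rd_mOm RD. Qed.
Let mF : measurable F. Proof. exact: rd_mF RD. Qed.
Let dN : d < N%:R. Proof. by have [[]] := rd_cst RD. Qed.
Let d0 : 0 < d. Proof. by have [[]] := rd_cst RD. Qed.
Let M0 : 0 < M. Proof. by have [[]] := rd_cst RD. Qed.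
Let cl0 : 0 < cl. Proof. by have [_ []] := rd_cst RD. Qed.
Let Cu0 : 0 <= Cu. Proof. by have [_ []] := rd_cst RD. Qed.
Let c0 : 0 < c. Proof. by have [_ []] := rd_cst RD. Qed.
Let r00 : 0 < r0. Proof. by have [_ []] := rd_cst RD. Qed.
Let s0 : 0 < s. Proof. by have := s_gt; have := dN; lra. Qed.
Let al0 : 0 < al. Proof. by rewrite subr_gt0. Qed.
Let pE : 2 * al + 2 * N%:R - d = p. Proof. by field. Qed.
Let p0 : 0 < 2 * al + 2 * N%:R - d. Proof. by rewrite pE ltr_wpDl// mulr_gt0. Qed.
Let pN : 2 * al + 2 * N%:R - d - 2 < N%:R. Proof. by rewrite pE; have := s1; lra. Qed.

Lemma ae_boundary : {ae nu, forall y, F y}.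
Proof. by exists (~` F); split; [exact: measurableC|exact: rd_nu0 RD|move=> y]. Qed.

Lemma Rint_la (B : set E) u : measurable B -> measurable_fun setT u ->
  \int[la]_(x in B) u x = \int[leb]_(x in B `&` Om) u x.
Proof.
move=> mB mu_; have key (h : E -> \bar R) : measurable_fun setT h -> (forall x, (0 <= h x)%E) ->
    (\int[la]_(x in B) h x = \int[leb]_(x in B `&` Om) h x)%E.
  move=> mh h0; rewrite integral_mkcond (rd_la_int RD).
  - rewrite integral_mkcond [RHS]integral_mkcond; apply: eq_integral => x _.
    by rewrite !patchE in_setI; case: (x \in Om); case: (x \in B).
  - by apply/(measurable_restrictT _ mB); exact: measurable_funTS.
  - by move=> x; rewrite patchE; case: ifP.
have mE : measurable_fun setT (fun x => (u x)%:E) by exact/measurable_EFinP.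
rewrite /Rintegral integralE [in RHS]integralE; congr (fine (_ - _)%E); apply: key.
- exact: measurable_funepos.
- by move=> x; exact: funepos_ge0.
- exact: measurable_funeneg.
- by move=> x; exact: funeneg_ge0.
Qed.

Lemma average_la u v y (r : R) : measurable_fun setT u -> (forall x, Om x -> u x = v x) ->
  average la (eball y r) u = (\int[leb]_(x in eball y r `&` Om) v x) / fine (leb (eball y r `&` Om)).
Proof.
move=> mu_ uv; rewrite /average Rint_la//; last exact: measurable_eball.
congr (_ / fine _); last exact: (rd_la RD).
by apply: eq_Rintegral => x /set_mem[_]; exact: uv.
Qed.

Lemma traceE u v y : measurable_fun setT u -> (forall x, Om x -> u x = v x) ->
  trace Om v y = lim (average la (eball y r) u @[r --> (0:R)^'+]).
Proof.
move=> mu_ uv; rewrite /trace.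
rewrite (_ : (fun r => average la (eball y r) u) = fun r =>
  (\int[leb]_(x in eball y r `&` Om) v x) / fine (leb (eball y r `&` Om)))//.
by apply/funext => r; exact: average_la.
Qed.

Lemma trace_cvg_ae v : Hs Om s v ->
  {ae nu, forall y, average la (eball y r) (cut Om v) @[r --> (0:R)^'+] --> trace Om v y}.
Proof.
move=> hv; have [mc c2 cE] := Hs_cut RD hv; rewrite -pE in cE.
have Soo : {ae nu, forall y, (osc_sum la al r0 (cut Om v) y < +oo)%E}.
  have mS : measurable_fun setT (osc_sum la al r0 (cut Om v)) by exact: measurable_osc_sum.
  have S0 y : (0 <= osc_sum la al r0 (cut Om v) y)%E by exact: osc_sum_ge0.
  have iS : nu.-integrable setT (osc_sum la al r0 (cut Om v)).
    apply/integrableP; split => //.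
    rewrite (eq_integral (osc_sum la al r0 (cut Om v))); last by move=> y _; rewrite gee0_abs.
    apply: le_lt_trans (int_osc_sum_le la p0 Cu0 r00 (rd_nu_up RD) mc) _.
    apply: lte_mul_pinfty => //; rewrite lee_fin mulr_ge0// mulr_ge0 ?powR_ge0// divr_ge0 ?powR_ge0// subr_ge0.
    by have := @powR_le R (2 * al + 2 * N%:R - d) 1 2; rewrite powR1; apply; rewrite ?(ltW p0)// ler1n.
  have := integrable_ae measurableT iS; apply: filterS => y /(_ I).
  by rewrite ge0_fin_numE.
near=> y; have Fy : F y by near: y; exact: ae_boundary.
have Sy : (osc_sum la al r0 (cut Om v) y < +oo)%E by near: y.
have [L cL _] := trace_cvg al0 c0 r00 (rd_la_up RD) mc c2 (rd_thick RD Fy) Sy.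
rewrite (traceE y mc (@cutE _ _ Om v)).
have -> : lim (average la (eball y r) (cut Om v) @[r --> (0:R)^'+]) = L by exact: cvg_lim.
exact: cL.
Unshelve. all: by end_near.
Qed.

Lemma average_lin (B : set E) u v (a : R) : measurable B -> (la B < +oo)%E ->
  measurable_fun setT u -> measurable_fun setT v ->
  (\int[la]_x (u x ^+ 2)%:E < +oo)%E -> (\int[la]_x (v x ^+ 2)%:E < +oo)%E ->
  average la B (fun x => a * u x + v x) = a * average la B u + average la B v.
Proof.
move=> mB Boo mu_ mv u2 v2.
have i (w : E -> R) : measurable_fun setT w -> (\int[la]_x (w x ^+ 2)%:E < +oo)%E -> la.-integrable B (EFin \o w).
  move=> mw w2; apply: L2_integrable => //; first exact: measurable_funTS.
  apply: le_lt_trans w2; apply: ge0_subset_integral => //.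
    by apply/measurable_EFinP; exact: measurable_funX.
  by move=> x _; rewrite lee_fin sqr_ge0.
have iu := i _ mu_ u2; have iv := i _ mv v2.
rewrite /average RintegralD//; last by have := integrableZl mB a iu; apply: eq_integrable.
by rewrite RintegralZl// mulrDl mulrA.
Qed.

Lemma trace_lin_ae u v (a : R) : Hs Om s u -> Hs Om s v ->
  {ae nu, forall y, trace Om (fun x => a * u x + v x) y = a * trace Om u y + trace Om v y}.
Proof.
move=> hu hv; have [mu_ u2 _] := Hs_cut RD hu; have [mv v2 _] := Hs_cut RD hv.
have mw : measurable_fun setT (fun x => a * cut Om u x + cut Om v x).
  by apply: measurable_funD => //; exact: measurable_funM.
have wE x : Om x -> a * cut Om u x + cut Om v x = a * u x + v x by move=> Ox; rewrite !cutE.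
apply: filterS2 (trace_cvg_ae hu) (trace_cvg_ae hv) => y cu cv.
rewrite (traceE y mw wE); apply/cvg_lim => //.
apply: (@cvg_trans _ ((fun r => a * average la (eball y r) (cut Om u) + average la (eball y r) (cut Om v)) @ (0:R)^'+)).
  apply: near_eq_cvg; near=> r; rewrite average_lin//; first exact: measurable_eball.
  have r_gt0 : 0 < r by near: r; exact: nbhs_right_gt.
  exact: le_lt_trans (rd_la_up RD y r_gt0) (ltry _).
by apply: cvgD => //; apply: cvgM => //; exact: cvg_cst.
Unshelve. all: by end_near.
Qed.

Lemma trace0_shallow_le v : Hs Om s v -> {ae nu, forall y, trace Om v y = 0} ->
  exists C h1 : R, [/\ 0 <= C, 0 < h1 & forall h, 0 < h -> h <= h1 ->
    (\int[la]_x (shallow D (cut Om v) ((2 * N%:R + 2) * h) x)%:E <= (C * h `^ (p - N%:R))%:E)%E].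
Proof.
move=> hv tr0; have [mc c2 cE] := Hs_cut RD hv; rewrite -pE in cE.
pose c1 : R := 2 * N%:R + 2; have c10 : 0 < c1 by rewrite ltr_wpDl// mulr_ge0.
pose pe := fine (power_energy la (cut Om v) (2 * al + 2 * N%:R - d)).
have peE : power_energy la (cut Om v) (2 * al + 2 * N%:R - d) = pe%:E.
  by rewrite fineK// ge0_fin_numE// power_energy_ge0.
pose c' := cl * 2 `^ (- d).
have c'0 : 0 < c' by rewrite mulr_gt0// powR_gt0.
pose K := layer_bound N c c' Cu (2 ^+ N) al (2 * al + 2 * N%:R - d) * (4 * c1) `^ (2 * al + 2 * N%:R - d - N%:R) * pe.
have h10 : 0 < Num.min (r0 / (4 * c1)) (M / (2 * c1)).
  by rewrite lt_min !divr_gt0// mulr_gt0.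
exists `|K|, (Num.min (r0 / (4 * c1)) (M / (2 * c1))); split => // h h0.
rewrite le_min ler_pdivlMr ?mulr_gt0// ler_pdivlMr ?mulr_gt0// => /andP[hr hM].
pose W : set E := Om `&` [set x | D x < 2 * (c1 * h)].
have mW : measurable W.
  by apply: measurableI => //; apply: measurable_sublevel; exact: rd_mD RD.
have hW x : W x -> ((c' * (h * (4 * c1)) `^ d)%:E <= nu (eball x (h * (4 * c1))))%E.
  move=> [Ox Dx]; have q0 : 0 < 2 * (c1 * h) by rewrite mulr_gt0// mulr_gt0.
  have qM : 2 * (c1 * h) <= M by apply: le_trans hM; lra.
  have := rd_nu_layer RD Ox Dx qM.
  rewrite (_ : 2 * (2 * (c1 * h)) = h * (4 * c1)); last by ring.
  apply: le_trans; rewrite lee_fin (_ : h * (4 * c1) = 2 * (2 * (c1 * h))); last by ring.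
  have e2 : 2 `^ (- d) * 2 `^ d = 1 :> R by rewrite -(powRDp _ _ (ltr0Sn R 1)) addNr powRr0.
  rewrite (powRM d (ler0n R 2) (ltW q0)) /c'.
  rewrite (_ : cl * _ * _ = cl * (2 `^ (- d) * 2 `^ d) * (2 * (c1 * h)) `^ d); last by ring.
  by rewrite e2 mulr1.
have aeT : {ae nu, forall y, thick la c r0 y}.
  by apply: filterS ae_boundary => y Fy; exact: (rd_thick RD Fy).
have aeL : {ae nu, forall y, lim (average la (eball y r) (cut Om v) @[r --> (0:R)^'+]) = 0}.
  by apply: filterS tr0 => y tr; rewrite -(traceE y mc (@cutE _ _ Om v)); exact: tr.
have r'0 : 0 < h * (4 * c1) by rewrite mulr_gt0// mulr_gt0.
have := trace0_layer_le al0 p0 c0 Cu0 (exprn_ge0 N (ler0n R 2)) r00 (rd_nu_up RD) (rd_la_up RD) mc c2 mW c'0 r'0 hr hW aeT aeL cE.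
rewrite peE -EFinM => bnd.
apply: (@le_trans _ _ (\int[la]_(x in W) (cut Om v x ^+ 2)%:E)%E).
  rewrite [X in (_ <= X)%E]integral_mkcond; apply: ge0_le_int => x _.
    by rewrite lee_fin mulr_ge0// sqr_ge0.
  rewrite patchE /shallow; have [Wx|Wx] := pselect (W x).
    by rewrite mem_set// lee_fin; case: (_ < _); rewrite ?mul1r// mul0r sqr_ge0.
  rewrite memNset// lee_fin; have [Ox|Ox] := pselect (Om x); last by rewrite cut0// expr0n mulr0.
  by rewrite -/c1; have [Dx|Dx] := ltP (D x) (2 * (c1 * h)); [exfalso; apply: Wx|rewrite mul0r].
apply: (le_trans bnd); rewrite lee_fin -pE.
apply: (@le_trans _ _ (K * h `^ (2 * al + 2 * N%:R - d - N%:R))).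
  by rewrite /K (powRM _ (ltW h0) (ltW _)) ?mulr_gt0//; lra.
by rewrite ler_wpM2r ?powR_ge0// ler_norm.
Qed.

Lemma besov_extension : exists2 C : R, 0 <= C & forall f, besov mu F d al f ->
  exists v, [/\ Hs Om s v, {ae nu, forall y, trace Om v y = f y} &
    Hs_sq Om s v <= C * fine (besov_normsq mu F d al f)].
Proof.
pose C1 := ext_c1 Cu cl d; pose C2 := ext_c2 Cu cl d.
have C10 : 0 <= C1 by exact: ext_c1_ge0.
have C20 : 0 <= C2 by exact: ext_c2_ge0.
have ClN : 0 <= 2 ^+ N :> R by rewrite exprn_ge0.
have Cnu0 : 0 <= Cnu by have := le_trans (measure_ge0 nu setT) (rd_nu_fin RD); rewrite lee_fin.
pose Ka := C1 * (ak_const N d (2 ^+ N) * M `^ (N%:R - d)).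
pose Kb := near_const N d al (2 ^+ N) cl C2 + far_const N d al (2 ^+ N) C1.
pose K := `|Ka| + `|Kb| * (1 + 4 * Cnu).
have b0 : 0 <= 1 + 4 * Cnu by rewrite addr_ge0// mulr_ge0.
have K0 : 0 <= K by rewrite addr_ge0// mulr_ge0.
exists K => // f [mf]; rewrite /besov_normsq.
set B1 := (\int[mu]_(x in F) (f x ^+ 2)%:E)%E; set B2 := (\int[mu]_(x in F) _)%E => Boo.
have B10 : (0 <= B1)%E by apply: integral_ge0 => x _; rewrite lee_fin sqr_ge0.
have B20 : (0 <= B2)%E.
  by apply: integral_ge0 => x _; apply: integral_ge0 => y _; rewrite lee_fin divr_ge0 ?powR_ge0// exprn_ge0.
have B1oo : (B1 < +oo)%E by apply: le_lt_trans Boo; rewrite leeDl.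
have B2oo : (B2 < +oo)%E by apply: le_lt_trans Boo; rewrite leeDr.
pose f0 := f \_ F.
have f0E x : F x -> f0 x = f x by move=> Fx; rewrite /f0 patchE mem_set.
have mf0 : measurable_fun setT f0 by apply/(measurable_restrictT _ mF).
have sq0 x : (0 <= (f0 x ^+ 2)%:E)%E by rewrite lee_fin sqr_ge0.
have msq : measurable_fun setT (fun x => (f0 x ^+ 2)%:E) by apply/measurable_EFinP; exact: measurable_funX.
have f02 : (\int[nu]_x (f0 x ^+ 2)%:E = B1)%E.
  by rewrite (rd_nu_int RD)//; apply: eq_integral => x /set_mem Fx; rewrite f0E.
pose g (x y : E) : R := (f0 x - f0 y) ^+ 2 * enorm (x - y) `^ (- (d + 2 * al)).
have g0 x y : 0 <= g x y by rewrite mulr_ge0 ?sqr_ge0 ?powR_ge0.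
pose ng (x y : E) : \bar R := ((enorm (x - y) < 1)%R%:R * g x y)%:E.
have ng0 x y : (0 <= ng x y)%E by rewrite lee_fin mulr_ge0.
have mng : measurable_fun setT (fun q : E * E => ng q.1 q.2) by rewrite /ng /g; mfun.
pose fg (x y : E) : \bar R := ((2 * f0 x ^+ 2)%:E + (2 * f0 y ^+ 2)%:E)%E.
have sq20 x : (0 <= (2 * f0 x ^+ 2)%:E)%E by rewrite lee_fin mulr_ge0// sqr_ge0.
have msq2 : measurable_fun setT (fun x => (2 * f0 x ^+ 2)%:E).
  by apply/measurable_EFinP; apply: measurable_funM => //; exact: measurable_funX.
have fg0 x y : (0 <= fg x y)%E by exact: adde_ge0.
have mfg : measurable_fun setT (fun q : E * E => fg q.1 q.2).
  by apply: emeasurable_funD; [exact: (measurableT_comp msq2 measurable_fst)|exact: (measurableT_comp msq2 measurable_snd)].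
have q0 : 0 <= d + 2 * al by rewrite addr_ge0 ?(ltW d0)// mulr_ge0// ltW.
have ngE : (\int[nu]_x \int[nu]_y ng x y = B2)%E.
  rewrite (rd_nu_int RD); [|exact: (measurable_int2 nu mng ng0)|by move=> x; apply: int_ge0 => y; exact: ng0].
  apply: eq_integral => x /set_mem Fx.
  rewrite (rd_nu_int RD (f := ng x)); [|exact: (measurableT_comp mng (pair1_measurable x))|exact: ng0].
  rewrite integral_mkcond [RHS]integral_mkcond; apply: eq_integral => y _.
  rewrite !patchE in_setI; case: ifPn => //= /set_mem Fy.
  rewrite /ng /g !f0E//; have [xy|xy] := ltP (enorm (x - y)) 1.
    rewrite mem_set; last by rewrite /eball/= enormB.
    by rewrite mul1r real_normK ?num_real// powRN.
  rewrite memNset ?mul0r// => yx; move: xy; rewrite leNgt; apply/negP; rewrite negbK.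
  by rewrite enormB.
have fgE : (\int[nu]_x \int[nu]_y fg x y <= (4 * Cnu)%:E * B1)%E.
  have iE : (\int[nu]_x (2 * f0 x ^+ 2)%:E = 2%:E * B1)%E.
    by rewrite -f02 (ge0_intZl nu (measurable_funX 2 mf0) (fun x => sqr_ge0 _) (ler0n R 2)).
  have m1 : measurable_fun setT (fun x => (2 * f0 x ^+ 2)%:E * nu setT)%E.
    by apply: emeasurable_funM => //; exact: measurable_cst.
  rewrite (eq_integral (fun x => (2 * f0 x ^+ 2)%:E * nu setT + 2%:E * B1)%E); last first.
    move=> x _; rewrite /fg (ge0_integralD nu measurableT (fun y _ => sq20 x) (measurable_cst _) (fun y _ => sq20 y) msq2).
    by rewrite iE integral_cst.
  rewrite (ge0_integralD nu measurableT (fun x _ => mule_ge0 (sq20 x) (measure_ge0 nu setT)) m1 (fun x _ => mule_ge0 (ler0n R 2 : (0 <= 2%:E)%E) B10) (measurable_cst _)).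
  rewrite integral_cst// (ge0_integralZr nu measurableT msq2 (fun x _ => sq20 x) (measure_ge0 nu setT)) iE.
  rewrite -{2}(mul1e (2%:E * B1)%E); set X := (2%:E * B1)%E.
  have X0 : (0 <= X)%E by rewrite mule_ge0.
  rewrite mul1e; apply: (@le_trans _ _ (X * Cnu%:E + X * Cnu%:E)%E).
    by apply: leeD; apply: lee_wpmul2l => //; exact: rd_nu_fin RD.
  rewrite /X -(fineK (_ : B1 \is a fin_num)) ?ge0_fin_numE// -!EFinM -EFinD lee_fin.
  by rewrite le_eqVlt; apply/orP; left; apply/eqP; ring.
have PE : (power_energy nu f0 (d + 2 * al) <= B2 + (4 * Cnu)%:E * B1)%E.
  apply: (@le_trans _ _ (\int[nu]_x (\int[nu]_y ng x y + \int[nu]_y fg x y))%E).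
    apply: ge0_le_int => x _; first by apply: int_ge0 => y; rewrite lee_fin; exact: g0.
    rewrite -(ge0_integralD nu measurableT (fun y _ => ng0 x y) (measurableT_comp mng (pair1_measurable x))
      (fun y _ => fg0 x y) (measurableT_comp mfg (pair1_measurable x))).
    apply: ge0_le_int => y _; first by rewrite lee_fin; exact: g0.
    rewrite /ng /fg -!EFinD lee_fin /g; have [xy|xy] := ltP (enorm (x - y)) 1.
      by rewrite mul1r lerDl; apply: addr_ge0; apply: mulr_ge0 => //; exact: sqr_ge0.
    rewrite mul0r add0r; apply: (@le_trans _ _ ((f0 x - f0 y) ^+ 2 * 1)).
      rewrite ler_wpM2l ?sqr_ge0// powRN invf_le1 ?powR_gt0//; last exact: lt_le_trans xy.
      by have := powR_le q0 ler01 xy; rewrite powR1.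
    by have := sqr_ge0 (f0 x + f0 y); nra.
  rewrite (ge0_integralD nu measurableT (fun x _ => int_ge0 nu setT (ng0 x)) (measurable_int2 nu mng ng0)
    (fun x _ => int_ge0 nu setT (fg0 x)) (measurable_int2 nu mfg fg0)).
  by rewrite ngE; apply: leeD.
have PEoo : (power_energy nu f0 (d + 2 * al) < +oo)%E.
  by apply: le_lt_trans PE _; apply: lte_add_pinfty => //; apply: lte_mul_pinfty; rewrite ?lee_fin ?mulr_ge0.
have f02oo : (\int[nu]_y (f0 y ^+ 2)%:E < +oo)%E by rewrite f02.
pose T := ext nu D f0.
have mT : measurable_fun setT T by apply: measurable_ext => //; exact: rd_mD RD.
have Tsq := @ext_sq_le R N nu d Cu cl Cu0 cl0 (rd_nu_up RD) D Om (rd_mD RD) (rd_D0 RD) (rd_DOm RD) (rd_nu_lo RD) f0 mf0 f02oo.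
have Tlip := @ext_lip_le R N nu d Cu cl d0 Cu0 cl0 (rd_nu_up RD) D Om (rd_mD RD) (rd_D0 RD) (rd_Dlip RD) (rd_DOm RD) (rd_nu_lo RD) f0 mf0 f02oo.
have T2 := int_T_sq_le d0 dN ClN C10 (rd_la_up RD) (rd_mD RD) mOm mF (rd_la0 RD) (rd_nu0 RD) (rd_DOm RD) (rd_DF RD) M0 (rd_DM RD) mf0 mT Tsq.
have TE := power_energy_T_le d0 dN al0 pN ClN cl0 C10 C20 (rd_la_up RD) (rd_mD RD) (rd_Dlip RD) mOm mF (rd_la0 RD) (rd_nu0 RD)
  (rd_DOm RD) (rd_DF RD) M0 (rd_OmM RD) (rd_nu_lo RD) mf0 mT Tsq Tlip.
rewrite pE -/Kb in TE; rewrite f02 -/Ka in T2.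
pose b1 := fine B1; pose b2 := fine B2.
have B1E : B1 = b1%:E by rewrite fineK// ge0_fin_numE.
have B2E : B2 = b2%:E by rewrite fineK// ge0_fin_numE.
have b10 : 0 <= b1 by exact: fine_ge0.
have b20 : 0 <= b2 by exact: fine_ge0.
have T2' : (\int[la]_x (T x ^+ 2)%:E <= (`|Ka| * b1)%:E)%E.
  by apply: (le_trans T2); rewrite B1E -EFinM lee_fin ler_wpM2r// ler_norm.
have TE' : (power_energy la T p <= (`|Kb| * (b2 + 4 * Cnu * b1))%:E)%E.
  apply: (le_trans TE); apply: (@le_trans _ _ (`|Kb|%:E * power_energy nu f0 (d + 2 * al))%E).
    by apply: lee_wpmul2r; rewrite ?power_energy_ge0// lee_fin ler_norm.
  rewrite [X in (_ <= X)%E]EFinM; apply: lee_wpmul2l; first by rewrite lee_fin.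
  by apply: (le_trans PE); rewrite B1E B2E -EFinM -EFinD.
have hT : Hs Om s T.
  apply: (Hs_la RD mT (fun x _ => erefl)); first by apply: le_lt_trans T2' _; rewrite ltry.
  by apply: le_lt_trans TE' _; rewrite ltry.
exists T; split => //; last first.
  have [sT slT] := (HsP s mOm T).1 hT.
  have e1 : ip leb Om T T <= `|Ka| * b1.
    by rewrite -lee_fin -ip_sqE// (int_sq_la RD mT (fun x _ => erefl)).
  have e2 : ip leb2 A (slope s T) (slope s T) <= `|Kb| * (b2 + 4 * Cnu * b1).
    by rewrite -lee_fin -ip_sqE// (int_slope_sq_la RD s mT (fun x _ => erefl)).
  rewrite /Hs_sq B1E B2E -EFinD /= /K; apply: (le_trans (lerD e1 e2)).
  have n1 := normr_ge0 Ka; have n2 := normr_ge0 Kb.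
  have p1 := mulr_ge0 n1 b20; have p2 := mulr_ge0 n2 b10; have p3 := mulr_ge0 (mulr_ge0 n2 Cnu0) b20.
  by nra.
have Woo : {ae nu, forall y, (\int[nu]_z (g y z)%:E < +oo)%E}.
  have mg : measurable_fun setT (fun q : E * E => (g q.1 q.2)%:E) by rewrite /g; mfun.
  have W0 y : (0 <= \int[nu]_z (g y z)%:E)%E by apply: int_ge0 => z; rewrite lee_fin.
  have iW : nu.-integrable setT (fun y => \int[nu]_z (g y z)%:E)%E.
    apply/integrableP; split; first by apply: (measurable_int2 nu mg) => x y; rewrite lee_fin.
    by rewrite (eq_integral (fun y => \int[nu]_z (g y z)%:E)%E) => [|y _]; [exact: PEoo|rewrite gee0_abs].
  have := integrable_ae measurableT iW; apply: filterS => y /(_ I).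
  by rewrite ge0_fin_numE.
near=> y; have Fy : F y by near: y; exact: ae_boundary.
have Wy : (\int[nu]_z (g y z)%:E < +oo)%E by near: y.
pose W := fine (\int[nu]_z (g y z)%:E)%E.
have WE : (\int[nu]_z (g y z)%:E = W%:E)%E.
  by rewrite fineK// ge0_fin_numE// int_ge0// => z; rewrite lee_fin.
have W0 : 0 <= W by apply: fine_ge0; apply: int_ge0 => z; rewrite lee_fin.
rewrite (traceE y mT (fun x _ => erefl)) -(f0E y Fy); apply/cvg_lim => //.
pose Kt := C1 * ak_const N d (2 ^+ N) * 4 `^ (d + 2 * al) * W / c.
have bnd (r : R) : 0 < r -> r <= r0 -> (average la (eball y r) T - f0 y) ^+ 2 <= Kt * r `^ (2 * al).
  move=> r_gt0 rr; have th := rd_thick RD Fy r_gt0 rr.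
  have := average_T_le d0 dN al0 ClN C10 (rd_la_up RD) (rd_mD RD) mOm mF (rd_la0 RD) (rd_nu0 RD) (rd_DOm RD) (rd_DF RD) M0 (rd_DM RD) mf0 f02oo mT Tsq c0 r_gt0 Fy th.
  rewrite (eq_integral (fun z => (g y z)%:E)); last first.
    by move=> z _; rewrite /g -sqrrN opprB enormB.
  rewrite WE -EFinM lee_fin => h.
  have rN : 0 < c * r `^ N%:R by rewrite mulr_gt0// powR_gt0.
  rewrite -(ler_pM2r rN); apply: (le_trans h).
  rewrite le_eqVlt; apply/orP; left; apply/eqP.
  rewrite (powRM _ (ler0n R 4) (ltW r_gt0)) /Kt.
  have rr' : r `^ (N%:R - d) * r `^ (d + 2 * al) = r `^ (2 * al) * r `^ N%:R.
    by rewrite -!(powRDp _ _ r_gt0); congr (_ `^ _); ring.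
  transitivity (C1 * ak_const N d (2 ^+ N) * 4 `^ (d + 2 * al) * W * (r `^ (N%:R - d) * r `^ (d + 2 * al))); first by ring.
  by rewrite rr'; field; rewrite gt_eqF.
have Kt0 : 0 <= `|Kt| by [].
apply/cvgrPdist_lt => e e0.
have [r1 [r10 r1le r1s]] := powR_small Kt0 (mulr_gt0 (ltr0Sn R 1) al0) (exprn_gt0 2 e0) r00.
near=> r.
have r_gt0 : 0 < r by near: r; exact: nbhs_right_gt.
have rr1 : r <= r1 by near: r; exact: nbhs_right_le.
rewrite distrC -(ltr_pXn2r (ltn0Sn 1)) ?nnegrE ?normr_ge0 ?(ltW e0)// real_normK ?num_real//.
apply: le_lt_trans (bnd r r_gt0 (le_trans rr1 r1le)) _; apply: le_lt_trans r1s.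
apply: (@le_trans _ _ (`|Kt| * r `^ (2 * al))); first by rewrite ler_wpM2r ?powR_ge0// ler_norm.
by rewrite ler_wpM2l//; apply: powR_le => //; rewrite ?(ltW r_gt0)// mulr_ge0// ltW.
Unshelve. all: by end_near.
Qed.

End traces.

(** * The Neumann trace *)

Section dual_bounds.
Context (R : realType) (E : Type).
Implicit Types (S V : set (E -> R)) (nm : (E -> R) -> R).

Lemma dual_norm_le S nm (l : (E -> R) -> R) (c : R) :
  (forall f, S f -> nm f <= 1 -> `|l f| <= c) -> (dual_norm S nm l <= c%:E)%E.
Proof.
by move=> h; apply: ge_ereal_sup => _ [f [Sf nf] <-]; rewrite lee_fin; exact: h.
Qed.

Lemma bounded_linear_to_dual0 V nmV S nmS :
  bounded_linear_to_dual V nmV S nmS (fun _ _ => 0).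
Proof.
have z : (dual_norm S nmS (fun=> 0%R) <= 0%R%:E)%E by apply: dual_norm_le => f _ _; rewrite normr0.
split=> [u _|a u w f _ _ _|].
- by split=> [a f g _ _|]; [rewrite mulr0 addr0|exact: le_lt_trans z (ltry _)].
- by rewrite mulr0 addr0.
- by exists 0 => u _; rewrite mul0r.
Qed.

End dual_bounds.

Section neumann_trace.
Context (R : realType) (N : nat).
Local Notation E := 'rV[R]_N.
Local Notation leb := (lebesgue_rV R N).
Local Notation leb2 := (leb \x leb)%E.
Variables (Om F : set E) (mu : {measure set E -> \bar R}) (d : R) (D : E -> R).
Variables (la nu : {sigma_finite_measure set E -> \bar R}) (M cl Cu c r0 Cnu : R).
Hypothesis RD : regular_domain Om F mu d D la nu M cl Cu c r0 Cnu.
Variables (s : R).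
Hypotheses (s_gt : (N%:R - d) / 2 < s) (s1 : s < 1).
Local Notation al := (s - (N%:R - d) / 2).
Local Notation p := (N%:R + 2 * s).
Local Notation A := (Om `*` Om).
Variables (k : E -> E -> R) (k1 k2 : R).
Hypothesis mk : measurable_fun A (fun q => k q.1 q.2).
Hypothesis k10 : 0 < k1.
Hypothesis kb : {ae leb2, forall q, Om q.1 -> Om q.2 -> k1 <= k q.1 q.2 <= k2}.
Implicit Types (u v w f g : E -> R).

Let mOm : measurable Om. Proof. exact: rd_mOm RD. Qed.
Let s0 : 0 < s.
Proof. by have [[_ dN _] _] := rd_cst RD; have := s_gt; lra. Qed.

Lemma test_Hs phi : test_function Om phi -> Hs Om s phi.
Proof.
move=> [sm cpt _]; have [B B0 phiB] := smooth_bounded sm cpt.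
have [L L0 phiL] := smooth_lipschitz sm cpt.
have mphi : measurable_fun setT phi by apply: continuous_measurable_rV; exact: smooth_continuous.
have [[_ _ M0] _] := rd_cst RD.
have laoo : (la setT < +oo)%E by have := rd_la RD setT; rewrite setTI => ->; exact: rd_Omoo RD.
apply: (Hs_la RD mphi (fun x _ => erefl)).
  apply: (@le_lt_trans _ _ (\int[la]_x (B ^+ 2)%:E)%E).
    apply: ge0_le_int => x _; rewrite lee_fin ?sqr_ge0// -real_normK ?num_real//.
    by rewrite lerXn2r ?nnegrE.
  by rewrite integral_cst// lte_mul_pinfty// lee_fin sqr_ge0.
pose G (x y : E) : R := (enorm (x - y) < M)%R%:R * enorm (x - y) `^ (- (p - 2)).
have G0 x y : 0 <= G x y by rewrite mulr_ge0 ?powR_ge0.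
have mG x : measurable_fun setT (G x) by rewrite /G; mfun.
pose C := layer_const N%:R (p - 2) * 2 ^+ N * M `^ (N%:R - (p - 2)).
have pN : p - 2 < N%:R by have := s1; lra.
have GC x : (\int[la]_y (G x y)%:E <= C%:E)%E.
  rewrite (eq_integral (fun y => (G y x)%:E)); last by move=> y _; rewrite /G enormB.
  apply: le_trans (rd_la_le RD _ _) (leb_int_small x pN M0).
    by rewrite /G; mfun.
  by move=> y; rewrite lee_fin; exact: G0.
have L20 : 0 <= L ^+ 2 by exact: sqr_ge0.
have C0 : 0 <= C by rewrite mulr_ge0 ?powR_ge0// mulr_ge0 ?exprn_ge0// layer_const_ge0// gt_eqF.
pose e (x y : E) : R := (phi x - phi y) ^+ 2 * enorm (x - y) `^ (- p).
have e0 x y : 0 <= e x y by rewrite mulr_ge0 ?sqr_ge0 ?powR_ge0.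
have me : measurable_fun setT (fun q : E * E => (e q.1 q.2)%:E) by rewrite /e; mfun.
have eG x y : Om x -> Om y -> e x y <= L ^+ 2 * G x y.
  move=> Ox Oy; rewrite /e /G (rd_OmM RD Ox Oy) mul1r.
  have [xy0|xyn] := eqVneq (enorm (x - y)) 0.
    have /eqP := xy0; rewrite enorm_eq0 subr_eq0 => /eqP xye.
    by rewrite {1}xye subrr expr0n mul0r mulr_ge0 ?powR_ge0.
  have xyp : 0 < enorm (x - y) by rewrite lt_neqAle eq_sym xyn enorm_ge0.
  rewrite (_ : - (p - 2) = 2 + - p); last by ring.
  rewrite (powRDp _ _ xyp) powR_mulrn ?(ltW xyp)// mulrA -exprMn ler_wpM2r ?powR_ge0//.
  by rewrite -real_normK ?num_real// lerXn2r ?nnegrE// mulr_ge0// enorm_ge0.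
apply: (@le_lt_trans _ _ (\int[la]_x (L ^+ 2 * C)%:E)%E); last first.
  by rewrite integral_cst// lte_mul_pinfty// lee_fin mulr_ge0.
apply: (le_int_on mOm (rd_la0 RD)) => [|x|x|x Ox].
- apply: (measurable_int2 la me) => x y; rewrite lee_fin; exact: e0.
- by apply: int_ge0 => y; rewrite lee_fin; exact: e0.
- by rewrite lee_fin mulr_ge0.
apply: (@le_trans _ _ (\int[la]_y (L ^+ 2 * G x y)%:E)%E).
  apply: (le_int_on mOm (rd_la0 RD)) => [|y|y|y Oy].
  - exact: (measurableT_comp me (pair1_measurable x)).
  - by rewrite lee_fin; exact: e0.
  - by rewrite lee_fin mulr_ge0.
  - by rewrite lee_fin; exact: eG.
rewrite (ge0_intZl la (mG x) (G0 x) L20) [X in (_ <= X)%E]EFinM.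
by apply: lee_wpmul2l; [rewrite lee_fin|exact: GC].
Qed.

Local Notation B := (B_op Om s k).

Lemma B_op_weak u : V_B Om s k u -> weak_B Om s k u (B u).
Proof. by move=> [_ ex]; exact: xgetPex. Qed.

Lemma sqint_B_op u : V_B Om s k u -> sqint leb Om (B u).
Proof. by move=> /B_op_weak[]. Qed.

Lemma weak_B_lin u w g h (a : R) : Hs Om s u -> Hs Om s w ->
  weak_B Om s k u g -> weak_B Om s k w h ->
  weak_B Om s k (fun x => a * u x + w x) (fun x => a * g x + h x).
Proof.
move=> hu hw [sg wg] [sh wh]; split; first exact: (sqint_lin mOm a sg sh).
move=> phi tp; have hp := test_Hs tp; have [sp _] := (HsP s mOm phi).1 hp.
rewrite (energy_form_linl mOm mk k10 kb a hp hu hw) wg// wh//.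
exact: esym (ip_linl mOm a sp sg sh).
Qed.

Lemma weak_B_unique u g h v : weak_B Om s k u g -> weak_B Om s k u h -> Hs Om s v ->
  ip leb Om g v = ip leb Om h v.
Proof.
move=> [sg wg] [sh wh] hv; have [sv _] := (HsP s mOm v).1 hv.
have sd : sqint leb Om (fun x => -1 * g x + h x) := sqint_lin mOm (-1) sg sh.
have := @orthogonal_tests_Hs _ _ _ _ _ _ _ _ _ _ _ _ _ _ _ RD s s0 s1 _ sd.
have ort phi : test_function Om phi -> sqint leb Om phi -> ip leb Om (fun x => -1 * g x + h x) phi = 0.
  move=> tp sp; rewrite (ip_linl mOm (-1) sp sg sh) /ip -wg// -wh// mulN1r addNr//.
by move=> /(_ ort v hv); rewrite (ip_linl mOm (-1) sv sg sh) mulN1r => /eqP; rewrite addrC subr_eq0 => /eqP.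
Qed.

Definition green_functional u v : R := green Om s k u (B u) v.
Local Notation Phi := green_functional.

Lemma green_functional_linr u v w (a : R) : V_B Om s k u -> Hs Om s v -> Hs Om s w ->
  Phi u (fun x => a * v x + w x) = a * Phi u v + Phi u w.
Proof.
by move=> Vu hv hw; apply: (green_linr mOm mk k10 kb) => //; [case: Vu|exact: sqint_B_op].
Qed.

Lemma green_functional_linl u w v (a : R) : V_B Om s k u -> V_B Om s k w -> Hs Om s v ->
  Phi (fun x => a * u x + w x) v = a * Phi u v + Phi w v.
Proof.
move=> Vu Vw hv; have [hu _] := Vu; have [hw _] := Vw; have [sv _] := (HsP s mOm v).1 hv.
have wk := weak_B_lin a hu hw (B_op_weak Vu) (B_op_weak Vw).
have Vuw : V_B Om s k (fun x => a * u x + w x).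
  by split; [exact: Hs_lin|exists (fun x => a * B u x + B w x)].
rewrite /green_functional /green (weak_B_unique (B_op_weak Vuw) wk hv).
rewrite (ip_linl mOm a sv (sqint_B_op Vu) (sqint_B_op Vw)).
rewrite (energy_form_linl mOm mk k10 kb a hv hu hw).
move: (ip leb Om (B u) v) (ip leb Om (B w) v) => x y.
by move: (energy_form Om s k u v) (energy_form Om s k w v) => z t; ring.
Qed.

Lemma green_functional_trace0 u v : V_B Om s k u -> Hs Om s v ->
  {ae nu, forall y, trace Om v y = 0} -> Phi u v = 0.
Proof.
move=> Vu hv tr0; have [C [h1 [C0 h10 layer]]] := trace0_shallow_le RD s_gt hv tr0.
have [hu _] := Vu; have [sB wB] := B_op_weak Vu.
exact: (green_vanish RD s0 s1 mk k10 kb hu sB wB hv C0 h10 layer).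
Qed.

Definition lifts f v : Prop := Hs Om s v /\ {ae nu, forall y, trace Om v y = f y}.

Lemma lifts_lin f g v w (a : R) : lifts f v -> lifts g w ->
  lifts (fun x => a * f x + g x) (fun x => a * v x + w x).
Proof.
move=> [hv tv] [hw tw]; split; first exact: Hs_lin.
by apply: filterS3 (trace_lin_ae RD s_gt a hv hw) tv tw => y -> -> ->.
Qed.

Lemma green_functional_lifts u f v w : V_B Om s k u -> lifts f v -> lifts f w -> Phi u v = Phi u w.
Proof.
move=> Vu lv lw; have [hz tz] := lifts_lin (-1) lv lw; have [hv _] := lv; have [hw _] := lw.
have := green_functional_trace0 Vu hz.
rewrite green_functional_linr// mulN1r => h; apply/eqP; rewrite eq_sym -subr_eq0 addrC h//.
by apply: filterS tz => y ->; rewrite mulN1r addNr.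
Qed.

Definition lift f : E -> R := xget (fun=> 0) [set v | lifts f v].

Lemma Hs_lift f : Hs Om s (lift f).
Proof.
have [ex|nex] := pselect (exists v, lifts f v).
  by have [] : lifts f (lift f) := xgetPex _ ex.
rewrite /lift xgetPN; first exact: Hs0.
by move=> v lv; apply: nex; exists v.
Qed.

Lemma lift_lifts f v : lifts f v -> lifts f (lift f).
Proof. by move=> lv; apply: (xgetPex (fun=> 0)); exists v. Qed.

Definition neumann_trace u f : R := Phi u (lift f) / C_green s.

Let C_green0 : C_green s != 0. Proof. by rewrite gt_eqF// C_green_gt0. Qed.

Lemma neumann_trace_green u v : V_B Om s k u -> Hs Om s v ->
  C_green s * neumann_trace u (trace Om v) = Phi u v.
Proof.
move=> Vu hv; have lv : lifts (trace Om v) v by split => //; exact: aeW.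
by rewrite mulrC divfK// (green_functional_lifts Vu (lift_lifts lv) lv).
Qed.

Lemma neumann_trace_bounded : bounded_linear_to_dual (V_B Om s k) (V_norm Om s k)
  (besov mu F d al) (besov_norm mu F d al) neumann_trace.
Proof.
have [Ke Ke0 ext] := besov_extension RD s_gt s1.
have lifted f : besov mu F d al f -> lifts f (lift f).
  by move=> /ext[v [hv tv _]]; apply: (@lift_lifts f v).
pose K0 := 2 + C_frac N s ^+ 2 / 2 * k2 ^+ 2.
have K00 : 0 <= K0 by rewrite addr_ge0// mulr_ge0 ?sqr_ge0// divr_ge0// sqr_ge0.
pose C := Num.sqrt (K0 * Ke) / C_green s.
have C0 : 0 <= C by rewrite divr_ge0 ?sqrtr_ge0// ltW// C_green_gt0.
have bnd u f : V_B Om s k u -> besov mu F d al f -> besov_norm mu F d al f <= 1 ->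
    `|neumann_trace u f| <= C * V_norm Om s k u.
  move=> Vu bf nf; have [v [hv tv le]] := ext f bf; have [hu _] := Vu.
  have sB := sqint_B_op Vu.
  have VE : V_norm Om s k u = Num.sqrt (Hs_sq Om s u + ip leb Om (B u) (B u)).
    by rewrite /V_norm (Hs_normsq_fin mOm hu) /L2_normsq ip_sqE.
  have lv : lifts f v by [].
  rewrite /neumann_trace (green_functional_lifts Vu (lifted f bf) lv) normrM.
  rewrite normrV ?unitfE// (gtr0_norm (C_green_gt0 s0 s1)) /C mulrAC ler_pM2r ?invr_gt0 ?C_green_gt0//.
  have X0 : 0 <= Hs_sq Om s u + ip leb Om (B u) (B u).
    by rewrite addr_ge0 ?ip_sq_ge0// addr_ge0 ?ip_sq_ge0.
  rewrite VE -sqrtrM ?mulr_ge0// -sqrtr_sqr ler_wsqrtr//.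
  apply: le_trans (green_sq_le mOm mk k10 kb hu sB hv) _; rewrite -/K0.
  have n1 : fine (besov_normsq mu F d al f) <= 1.
    have [b0|b0] := leP (fine (besov_normsq mu F d al f)) 0; first exact: le_trans b0 ler01.
    by rewrite -(sqr_sqrtr (ltW b0)) -[leRHS](expr1n _ 2) lerXn2r ?nnegrE ?sqrtr_ge0.
  have v1 : Hs_sq Om s v <= Ke by apply: (le_trans le); rewrite ler_piMr.
  rewrite (_ : K0 * Ke * _ = K0 * (Hs_sq Om s u + ip leb Om (B u) (B u)) * Ke); last by ring.
  by rewrite ler_wpM2l// mulr_ge0.
split.
- move=> u Vu; split=> [a f g bf bg|].
    rewrite /neumann_trace mulrA -mulrDl -(green_functional_linr a Vu (Hs_lift f) (Hs_lift g)).
    have l := lifts_lin a (lifted f bf) (lifted g bg).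
    by rewrite (green_functional_lifts Vu (lift_lifts l) l).
  apply: (@le_lt_trans _ _ (C * V_norm Om s k u)%:E); last exact: ltry.
  by apply: dual_norm_le => f bf nf; exact: bnd.
- move=> a u w f Vu Vw _; rewrite /neumann_trace (green_functional_linl a Vu Vw (Hs_lift f)).
  by rewrite mulrDl mulrA.
- by exists C => u Vu; apply: dual_norm_le => f bf nf; exact: bnd.
Qed.

End neumann_trace.

Theorem theorem2p2 (R : realType) (N : nat)
  (Om : set 'rV[R]_N) (eps delta : R)
  (Om_dom : eps_delta_domain Om eps delta)
  (Om_bounded : bounded_set Om)
  (d : R) (mu : {measure set 'rV[R]_N -> \bar R})
  (bd_dset : d_set_measure (boundary Om) d mu)
  (Om_ : nat -> set 'rV[R]_N)
  (Om_lip : forall n, bounded_set (Om_ n) /\ lipschitz_domain (Om_ n))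
  (Om_incr : forall n, Om_ n `<=` Om_ n.+1)
  (Om_cup : Om = \bigcup_n Om_ n)
  (s : R) (s_gt : (N%:R - d) / 2 < s) (s_lt1 : s < 1)
  (T : R) (T_gt0 : 0 < T)
  (K : R -> 'rV[R]_N -> 'rV[R]_N -> R) (k1 k2 : R)
  (K_adm : admissible_kernel Om T k1 k2 K)
  (t : R) (t_in : t \in `[0, T]) :
  let alpha := s - (N%:R - d) / 2 in
  exists NK : ('rV[R]_N -> R) -> ('rV[R]_N -> R) -> R,
    bounded_linear_to_dual
      (V_B Om s (K t)) (V_norm Om s (K t))
      (besov mu (boundary Om) d alpha) (besov_norm mu (boundary Om) d alpha)
      NK /\
    forall u v, V_B Om s (K t) u -> Hs Om s v ->
      C_green s * NK u (trace Om v) =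
      - (\int[lebesgue_rV R N]_(x in Om) (B_op Om s (K t) u x * v x)) +
      energy_form Om s (K t) u v.
Proof.
move=> alpha; have [mK Ksym k10 _ Kb] := K_adm.
have tT : `[0, T]%classic t by rewrite /= .
have [ne|emp] := pselect (Om !=set0); last first.
  have {}emp : Om = set0 by apply/seteqP; split => // x Ox; apply: emp; exists x.
  exists (fun _ _ => 0); split; first exact: bounded_linear_to_dual0.
  move=> u v _ _; rewrite mulr0 emp /energy_form setX0.
  by rewrite /Rintegral !integral_set0 /= mulr0 oppr0 addr0.
have [la [nu [M [cl [Cu [c [r0 [Cnu RD]]]]]]]] := regular_domain_exists Om_dom Om_bounded ne bd_dset.
have mOm := rd_mOm RD.
have mk : measurable_fun (Om `*` Om) (fun q => K t q.1 q.2).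
  apply: (measurable_comp (F := `[0, T] `*` (Om `*` Om)) _ _ mK (g := fun q => (t, q))).
  - by apply: measurableX => //; exact: measurableX.
  - by move=> _ [q Aq <-].
  - exact: measurable_funTS (pair1_measurable t).
exists (neumann_trace Om nu s (K t)); split.
  exact: (neumann_trace_bounded RD s_gt s_lt1 mk k10 (Kb t t_in)).
by move=> u v Vu hv; rewrite (neumann_trace_green RD s_gt s_lt1 mk k10 (Kb t t_in)).
Qed.
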